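(* Let $X$ be an elliptic curve $X=\mathbb{C}/\{\mathbb{Z}e_1+\mathbb{Z}e_2\}$, where $e_1$ and $e_2$ are generators of the period lattice, and let $p_1,\dots,p_N$ be pairwise distinct points on $X$. Consider the linear problem (1) $\bar\partial\psi=0$ (away from the points $p_j$ and their lattice translates), (2) $\psi(z+e_j)=e^{2\pi i\langle k,e_j\rangle}\psi(z)$, $j=1,2$, where $k=(k_1,k_2)\in\mathbb{C}^2$, $\langle k,e_j\rangle=k_1\,\mathrm{Re}\,e_j+k_2\,\mathrm{Im}\,e_j$, and $\psi$ satisfies (3) $\psi(z)=\dfrac{a_j}{z-p_j}+O(|z-p_j|)$ for $j=1,\dots,N$ for some $a_j\in\mathbb{C}$. The solutions to (1)--(3) with $k$ and $a_1,\dots,a_N$ arbitrary are parametrized (up to scale) by a one-dimensional (spectral) curve, given by the equation $$\mu^N+q_1(\alpha)\mu^{N-1}+\dots+q_N(\alpha)=0$$ described in the context, which up to one puncture is an $N$-sheeted covering of $X$.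
   Context: Write $\Lambda=\mathbb{Z}e_1+\mathbb{Z}e_2$. The functions $\psi$ are regarded as functions of the coordinate $z$ on $\mathbb{C}$, and lifts of the $p_j$ to $\mathbb{C}$ are denoted by the same letters. The functions $\sigma$ and $\zeta$ are the Weierstrass functions of $\Lambda$: $$\sigma(z)=z\prod_{(m,n)\in\mathbb{Z}^2\setminus\{0\}}\Bigl(1-\frac{z}{e_{mn}}\Bigr)\exp\Bigl(\frac{z}{e_{mn}}+\frac12\frac{z^2}{e_{mn}^2}\Bigr),\quad e_{mn}=me_1+ne_2,\qquad \zeta(z)=\frac{d}{dz}\log\sigma(z).$$ Put $$\Phi(z,\alpha)=\frac{\sigma(\alpha-z)}{\sigma(\alpha)\sigma(z)}e^{\zeta(\alpha)z},\qquad \alpha\in\mathbb{C}\setminus\Lambda,$$ which is $\Lambda$-periodic in $\alpha$ and so is well defined for $\alpha\in X\setminus\{0\}$. The equation of the curve, in the variables $\mu\in\mathbb{C}$ and $\alpha\in X\setminus\{0\}$, is $\det A(\mu,\alpha)=0$, where $A(\mu,\alpha)$ is the $N\times N$ matrix with entries $$A_{lm}=\delta_{lm}\,\mu+(1-\delta_{lm})\,\Phi(p_m-p_l,\alpha)$$ (diagonal entries $\mu$; the $\Phi$ term occurs only for $l\neq m$). Expanding the determinant gives $\mu^N+q_1(\alpha)\mu^{N-1}+\dots+q_N(\alpha)=0$, which defines the coefficients $q_1(\alpha),\dots,q_N(\alpha)$. The covering is given by the natural projection $(\mu,\alpha)\mapsto\alpha$.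
   Formalization: The solution is shown unique up to scale at all but finitely many curve points, as uniqueness can fail (N=4, p_j the half periods); the parametrizing curve is completed by points over α=0, and ''covering'' means branched covering. *)

(* Defs.v *)
From HB Require Import structures.
From mathcomp Require Import all_boot all_order all_algebra.
From mathcomp Require Import all_classical all_reals all_analysis.
From mathcomp Require Import complex.

Set Implicit Arguments.
Unset Strict Implicit.
Unset Printing Implicit Defensive.

Import Order.TTheory GRing.Theory Num.Theory.
Import numFieldNormedType.Exports.

Local Open Scope ring_scope.
Local Open Scope complex_scope.
Local Open Scope classical_set_scope.
Local Open Scope quotient_scope.

HB.instance Definition _ (R : rcfType) := NormedModule.copy R[i] (R[i])^o.

(* [f] restricts to a homeomorphism from [A] onto [B] (subspace topologies). *)
Definition homeomorphism_on (S T : topologicalType) (A : set S) (B : set T)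
    (f : S -> T) : Prop :=
  [/\ set_bij A B f, {within A, continuous f} &
      exists g : T -> S,
        {within B, continuous g} /\ (forall x, A x -> g (f x) = x)].

Definition evenly_covered (N : nat) (E B : topologicalType) (f : E -> B)
    (U : set B) : Prop :=
  exists V : 'I_N -> set E,
    [/\ forall i, open (V i), trivIset [set: 'I_N] V,
        f @^-1` U = \bigcup_(i in [set: 'I_N]) V i &
        forall i, homeomorphism_on (V i) U f].

(* Finite branched covering of a compact surface [B]: a proper map with finite
   fibres which is an honest [N]-sheeted covering over the complement of a
   finite set [D] of branch points, no sheet lying entirely above [D]. *)
Definition branched_covering (N : nat) (E B : topologicalType) (f : E -> B)
    : Prop :=
  [/\ continuous f,
      forall K : set B, compact K -> compact (f @^-1` K),
      forall b, finite_set (f @^-1` [set b]) &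
      exists D : set B,
        [/\ finite_set D, closure (f @^-1` (~` D)) = [set: E] &
            forall b, ~ D b -> exists2 U, open_nbhs b U & evenly_covered N f U]].

Section Complex.
Variable R : realType.
Local Notation C := R[i].
Implicit Types (z w : C) (f : C -> C).

Definition cexp z : C :=
  (expR (complex.Re z))%:C
  * ((cos (complex.Im z)) +i* (sin (complex.Im z))).

(* [f] is real-differentiable at [z], with df = fx dx + fy dy, and
   2 dbar f = fx + 'i fy vanishes at [z]. *)
Definition dbar_eq0 f z : Prop :=
  exists fx fy : C,
    (fun h : C => f (z + h) - f z
       - ((complex.Re h)%:C * fx + (complex.Im h)%:C * fy))
      =o_ (nbhs (0 : C)) (fun h : C => h)
    /\ fx + 'i * fy = 0.

End Complex.

Section Lattice.
Variables (R : realType) (e1 e2 : R[i]).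
Local Notation C := R[i].
Implicit Types (z alpha mu : C) (k : C * C).

Definition lattice_generators : Prop :=
  forall s t : R, s%:C * e1 + t%:C * e2 = 0 -> s = 0 /\ t = 0.

Definition latt (m n : int) : C := m%:~R * e1 + n%:~R * e2.

Definition lattice : set C := [set z | exists m n, z = latt m n].

Definition lattice_rel : rel C := fun x y => `[< lattice (x - y) >].

Fact lattice_rel_refl : reflexive lattice_rel.
Proof. by move=> x; apply/asboolP; exists 0, 0; rewrite /latt subrr !mul0r addr0. Qed.

Fact lattice_rel_sym : symmetric lattice_rel.
Proof.
suff H x y : lattice_rel x y -> lattice_rel y x by move=> x y; apply/idP/idP; exact: H.
move=> /asboolP[m [n e]]; apply/asboolP; exists (- m), (- n).
by rewrite -opprB e /latt opprD !mulrNz !mulNr.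
Qed.

Fact lattice_rel_trans : transitive lattice_rel.
Proof.
move=> y x z /asboolP[m [n e]] /asboolP[m' [n' e']]; apply/asboolP.
exists (m + m'), (n + n').
by rewrite -(subrK y x) -addrA e e' /latt !mulrzDr !mulrDl addrACA.
Qed.

Definition lattice_equiv : equiv_rel C :=
  EquivRel lattice_rel lattice_rel_refl lattice_rel_sym lattice_rel_trans.

(* The elliptic curve X = C / (Z e1 + Z e2) with its quotient topology. *)
Definition torus := quotient_topology {eq_quot lattice_equiv}.

HB.instance Definition _ := Topological.on torus.
HB.instance Definition _ := Quotient.on torus.

Definition torus_pi z : torus := \pi_torus z.

Lemma torus_piP x y : torus_pi x = torus_pi y <-> lattice (x - y).
Proof.
split=> [/eqmodP/asboolP|/asboolP h] //; exact/eqmodP.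
Qed.

Definition sigma_factor (e z : C) : C :=
  (1 - z / e) * cexp (z / e + 2^-1 * (z ^+ 2 / e ^+ 2)).

(* The product converges absolutely; it is taken here as the limit of the
   partial products over the squares |m|, |n| <= K, with m = i - K and
   n = j - K. *)
Definition weierstrass_sigma z : C :=
  z * lim ((fun K : nat =>
       \prod_(i < K.*2.+1) \prod_(j < K.*2.+1 | ((i : nat), (j : nat)) != (K, K))
         sigma_factor (latt (i%:Z - K%:Z) (j%:Z - K%:Z)) z) @ \oo).

Definition weierstrass_zeta z : C :=
  derive1 weierstrass_sigma z / weierstrass_sigma z.

Definition Phi z alpha : C :=
  weierstrass_sigma (alpha - z) / (weierstrass_sigma alpha * weierstrass_sigma z)
  * cexp (weierstrass_zeta alpha * z).

Definition pairing k (e : C) : C :=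
  k.1 * (complex.Re e)%:C + k.2 * (complex.Im e)%:C.

Definition bloch_factor k (e : C) : C :=
  cexp (2 * (pi : R)%:C * 'i * pairing k e).

Definition bloch_factors k : C * C := (bloch_factor k e1, bloch_factor k e2).

(* [P] is the ([lattice]-invariant) set of poles, where values are junk. *)
Definition quasi_periodic (P : set C) k (f : C -> C) : Prop :=
  forall z, ~ P z ->
    f (z + e1) = bloch_factor k e1 * f z /\
    f (z + e2) = bloch_factor k e2 * f z.

Section Problem.
Variables (N : nat) (p : 'I_N -> C).

Definition poles : set C := [set z | exists j, lattice (z - p j)].

Definition is_solution k (a : 'I_N -> C) (psi : C -> C) : Prop :=
  [/\ forall z, ~ poles z -> dbar_eq0 psi z,
      quasi_periodic poles k psi &
      forall j, (fun z => psi z - a j / (z - p j))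
                  =O_ ((p j)^') (fun z => z - p j)].

(* Solutions are functions on the complement of the poles. *)
Definition nonzero_solution (psi : C -> C) : Prop :=
  exists2 z, ~ poles z & psi z != 0.

(* For a nonzero solution, k is determined only modulo the dual lattice, that
   is, through the pair of multipliers [bloch_factors k]. *)
Definition solution_with (b : C * C) (psi : C -> C) : Prop :=
  exists k a, bloch_factors k = b /\ is_solution k a psi.

Definition solution_factors : set (C * C) :=
  [set b | exists2 psi, solution_with b psi & nonzero_solution psi].

Definition unique_up_to_scale (b : C * C) : Prop :=
  forall psi1 psi2, solution_with b psi1 -> solution_with b psi2 ->
    nonzero_solution psi1 ->
    exists c : C, forall z, ~ poles z -> psi2 z = c * psi1 z.

Definition spectral_mx mu alpha : 'M[C]_N :=
  \matrix_(l, m) (if l == m then mu else Phi (p m - p l) alpha).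

(* det A(mu, alpha) is the characteristic polynomial of - A(0, alpha) at mu. *)
Definition q_coef (i : nat) alpha : C :=
  (char_poly (- spectral_mx 0 alpha))`_(N - i).

Definition spectral_eq mu alpha : C :=
  mu ^+ N + \sum_(1 <= i < N.+1) q_coef i alpha * mu ^+ (N - i).

Lemma spectral_eqE mu alpha : spectral_eq mu alpha = \det (spectral_mx mu alpha).
Proof.
have -> : spectral_mx mu alpha = mu%:M - (- spectral_mx 0 alpha).
  apply/matrixP => l m; rewrite !mxE opprK.
  by case: eqVneq => _; rewrite ?addr0 ?mulr1n ?mulr0n ?add0r.
have -> : \det (mu%:M - (- spectral_mx 0 alpha)) =
    (char_poly (- spectral_mx 0 alpha)).[mu].
  rewrite /char_poly -horner_evalE -det_map_mx; congr (\det _).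
  by apply/matrixP => l m; rewrite !mxE /= /horner_eval !hornerE hornerMn hornerX.
rewrite horner_coef size_char_poly big_ord_recr /=.
have := char_poly_monic (- spectral_mx 0 alpha).
rewrite monicE lead_coefE size_char_poly /= => /eqP ->.
rewrite mul1r addrC; congr (_ + _).
rewrite -(big_mkord xpredT (fun i => (char_poly (- spectral_mx 0 alpha))`_i * mu ^+ i)).
rewrite [RHS]big_nat_rev /= add0n big_add1 /=.
by apply: eq_big_nat => i /andP[_ iN]; rewrite /q_coef.
Qed.

(* The part of the curve in the variables mu and alpha, alpha <> 0 in X; on it
   the coefficients are evaluated at any representative of alpha. *)
Definition spectral_curve : set (C * torus) :=
  [set x | x.2 <> torus_pi 0 /\ spectral_eq x.1 (repr x.2) = 0].

End Problem.
End Lattice.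

Arguments torus_pi {R} e1 e2 z.
Arguments spectral_curve {R} e1 e2 {N} p.

(* Main.v *)
Require Import Defs.
From HB Require Import structures.
From mathcomp Require Import all_boot all_order all_algebra.
From mathcomp Require Import all_classical all_reals all_analysis.
From mathcomp Require Import complex.
From mathcomp Require Import ring lra zify.

(** A solution is determined by its pair of multipliers (its factors under the
    two translations) and its residues, so the problem is to find the set S of
    the pairs of multipliers that admit a nonzero solution. Legendre's relation
    shows that every pair of nonzero multipliers is of the form

      Psi(nu, alpha) = (exp(nu e1 - eta1 alpha), exp(nu e2 - eta2 alpha)),

    with (nu, alpha) unique up to the lattice action
    (nu, alpha) -> (nu + eta(l), alpha + l). When alpha is not a lattice point,
    the function exp(mu z) Phi(z, alpha) with mu = nu - zeta(alpha) has these
    multipliers and a simple pole at 0. By Liouville's theorem every solution is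
    a combination of its translates to the points p_j, and the vanishing of the
    constant terms at the p_j says that the residues lie in the kernel of the
    matrix of the statement ([solution_gen], [gen_kernel]). For alpha = 0 the
    kernel is replaced by exp(nu z) zeta(z), and the two cases are described by
    one equation F(nu, alpha) = 0, with F a bordered determinant that is
    continuous at alpha = 0 ([Fmx], [solution_factorsP]); for other alpha it is
    sigma(alpha) times the equation of the curve ([Fdet_gen]).

    The completed curve is the one-point compactification of S, with the
    subspace topology of C x C, and the projection sends a pair of multipliers
    to the class of alpha. Above alpha near 0 the N roots nu add up to
    N zeta(alpha), which is large, and F has degree N - 1 in nu at alpha = 0:
    exactly one root tends to infinity ([one_large_root]) and the others
    converge to the roots at 0 ([root_near]). So the added point lies above 0
    and has a neighbourhood on which the projection is injective
    ([puncture_chart]). The persistence of roots makes the projection an open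
    map ([prjG_open]); an open continuous injection is a homeomorphism onto its
    image ([open_injective_homeo]), which gives the sheets of the covering.

    It remains to see that the N roots are distinct for generic alpha
    ([discriminant_nonzero]). Let r be the generic number of distinct roots. The
    sum of the roots nu minus the sum of the distinct ones is
    (N - r) zeta(alpha) minus a function periodic in alpha; multiple roots are
    bounded near 0, since only one root is large there. Hence it grows at most
    linearly, is affine by Liouville's theorem, and has the increments
    (N - r) eta_j under translation by e_j. So (eta1, eta2) would be
    proportional to (e1, e2) if r < N, contrary to Legendre's relation. At
    points with N distinct roots the kernel of the matrix is a line, which is
    the uniqueness up to scale off finitely many points.

    Before this comes the complex analysis of entire functions: Goursat's
    theorem, Taylor expansions, Liouville's theorem for quotients of entire
    functions of linear growth ([quotient_liouville]), the product defining
    sigma, its quasi-periodicity, and Legendre's relation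
    ([legendre_relation]). The quasi-periods come from the partial products over
    squares of lattice points, which a translation by e1 changes only by
    exchanging two columns. *)

Set Implicit Arguments.
Unset Strict Implicit.
Unset Printing Implicit Defensive.

Import Order.TTheory GRing.Theory Num.Theory.
Import numFieldNormedType.Exports.

Local Open Scope ring_scope.
Local Open Scope complex_scope.
Local Open Scope classical_set_scope.

(** * Complex numbers: modulus, topology, exponential *)

Section Modulus.
Variable R : realType.
Local Notation C := R[i].
Implicit Types (x y z w : C) (r : R).

(** The modulus as an element of R: the norm of [R[i]] takes its values in
    [R[i]] itself, which is only partially ordered. *)
Definition nm z : R := complex.Re `|z|.

Lemma nmE z : (nm z)%:C = `|z|.
Proof. by rewrite /nm normc_def. Qed.

Lemma nmM z w : nm (z * w) = nm z * nm w.
Proof. by apply: complexI; rewrite rmorphM /= !nmE normrM. Qed.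

Lemma nmV z : nm z^-1 = (nm z)^-1.
Proof. by apply: complexI; rewrite fmorphV /= !nmE normfV. Qed.

Lemma nm_div z w : nm (z / w) = nm z / nm w.
Proof. by rewrite nmM nmV. Qed.

Lemma nm_ge0 z : 0 <= nm z.
Proof. by rewrite -lecR nmE normr_ge0. Qed.

Lemma nmN z : nm (- z) = nm z.
Proof. by rewrite /nm normrN. Qed.

Lemma nmB z w : nm (z - w) = nm (w - z).
Proof. by rewrite /nm distrC. Qed.

Lemma nm0 : nm 0 = 0.
Proof. by rewrite /nm normr0. Qed.

Lemma nm1 : nm 1 = 1.
Proof. by rewrite /nm normr1. Qed.

Lemma nm_eq0 z : (nm z == 0) = (z == 0).
Proof. by rewrite -(inj_eq (@complexI R)) nmE normr_eq0. Qed.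

Lemma nm_gt0 z : (0 < nm z) = (z != 0).
Proof. by rewrite lt0r nm_ge0 andbT nm_eq0. Qed.

Lemma nm0_eq0 z : nm z <= 0 -> z = 0.
Proof. by move=> h; apply/eqP; rewrite -nm_eq0 eq_le h nm_ge0. Qed.

Lemma nmD z w : nm (z + w) <= nm z + nm w.
Proof. by rewrite -lecR rmorphD /= !nmE ler_normD. Qed.

Lemma nmBD z w : nm (z - w) <= nm z + nm w.
Proof. by rewrite -(nmN w) nmD. Qed.

Lemma nm_le_sub z w : nm z - nm w <= nm (z - w).
Proof. by rewrite lerBlDr -{1}(subrK w z) nmD. Qed.

Lemma nmX z n : nm (z ^+ n) = nm z ^+ n.
Proof. by elim: n => [|n IH]; rewrite ?expr0 ?nm1 // !exprS nmM IH. Qed.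

Lemma nm_real r : nm r%:C = `|r|.
Proof.
apply: complexI; rewrite nmE normc_def /= expr0n addr0 sqrtr_sqr //.
Qed.

Lemma nm_nat (n : nat) : nm n%:R = n%:R.
Proof. by rewrite -(rmorph_nat (real_complex R)) nm_real normr_nat. Qed.

Lemma nmi : nm 'i = 1.
Proof. by rewrite /nm normc_def /= expr0n add0r expr1n sqrtr1. Qed.

Lemma nm_sqr z : nm z ^+ 2 = complex.Re z ^+ 2 + complex.Im z ^+ 2.
Proof.
by rewrite /nm normc_def /= sqr_sqrtr // addr_ge0 ?sqr_ge0.
Qed.

Lemma nm_pyth (a b : R) : nm (a +i* b) = Num.sqrt (a ^+ 2 + b ^+ 2).
Proof. by rewrite /nm normc_def. Qed.

Lemma Re_le_nm z : `|complex.Re z| <= nm z.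
Proof.
rewrite -(ler_pXn2r (n:=2)) ?nnegrE ?nm_ge0 ?normr_ge0 //.
by rewrite nm_sqr real_normK ?num_real // lerDl sqr_ge0.
Qed.

Lemma Im_le_nm z : `|complex.Im z| <= nm z.
Proof.
rewrite -(ler_pXn2r (n:=2)) ?nnegrE ?nm_ge0 ?normr_ge0 //.
by rewrite nm_sqr real_normK ?num_real // lerDr sqr_ge0.
Qed.

Lemma complexRI z : z = (complex.Re z)%:C + 'i * (complex.Im z)%:C.
Proof. exact: complexE. Qed.

Lemma nm_le_ReIm z : nm z <= `|complex.Re z| + `|complex.Im z|.
Proof.
rewrite {1}(complexRI z); apply: (le_trans (nmD _ _)).
by rewrite nmM nmi mul1r !nm_real.
Qed.

Lemma nm_sum (I : Type) (s : seq I) (P : pred I) (F : I -> C) :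
  nm (\sum_(i <- s | P i) F i) <= \sum_(i <- s | P i) nm (F i).
Proof.
elim/big_ind2: _ => [|x1 x2 y1 y2 h1 h2|//]; first by rewrite nm0.
by apply: (le_trans (nmD _ _)); apply: lerD.
Qed.

Lemma nm_prod (I : Type) (s : seq I) (P : pred I) (F : I -> C) :
  nm (\prod_(i <- s | P i) F i) = \prod_(i <- s | P i) nm (F i).
Proof. exact: (big_morph nm nmM nm1). Qed.

Lemma ReD z w : complex.Re (z + w) = complex.Re z + complex.Re w.
Proof. by case: z; case: w. Qed.
Lemma ImD z w : complex.Im (z + w) = complex.Im z + complex.Im w.
Proof. by case: z; case: w. Qed.
Lemma ReN z : complex.Re (- z) = - complex.Re z.
Proof. by case: z. Qed.
Lemma ImN z : complex.Im (- z) = - complex.Im z.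
Proof. by case: z. Qed.
Lemma ReM z w : complex.Re (z * w) =
  complex.Re z * complex.Re w - complex.Im z * complex.Im w.
Proof. by case: z; case: w. Qed.
Lemma ImM z w : complex.Im (z * w) =
  complex.Re z * complex.Im w + complex.Im z * complex.Re w.
Proof. by case: z => a b; case: w => c d. Qed.

Lemma eqC z w : complex.Re z = complex.Re w -> complex.Im z = complex.Im w -> z = w.
Proof. by case: z => a b; case: w => c d /= -> ->. Qed.

Lemma nbhsCP z (A : set C) :
  nbhs z A <-> exists2 d : R, 0 < d & forall w, nm (w - z) < d -> A w.
Proof.
split.
  rewrite -nbhs_ballE => -[d /= d0 dA].
  have dr : d = (complex.Re d)%:C by rewrite RRe_real // realE ltW.
  exists (complex.Re d); first by rewrite -ltcR -dr.
  by move=> w wz; apply: dA; rewrite -ball_normE /= -nmE nmB dr ltcR.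
case=> d d0 dA; rewrite -nbhs_ballE; exists d%:C => /=; first by rewrite ltcR.
by move=> w; rewrite -ball_normE /= -nmE nmB ltcR; exact: dA.
Qed.

Lemma cvgCP (T : Type) (F : set_system T) (FF : Filter F) (f : T -> C) (l : C) :
  f @ F --> l <-> forall e : R, 0 < e -> \forall t \near F, nm (f t - l) < e.
Proof.
split=> [h e e0|h].
  have : nbhs l [set w | nm (w - l) < e] by apply/nbhsCP; exists e.
  by move=> /h.
move=> A /nbhsCP[d d0 dA].
apply: (@filterS _ F _ [set t | nm (f t - l) < d]); last exact: h.
by move=> t; exact: dA.
Qed.

Lemma contCP (f : C -> C) z : {for z, continuous f} <->
  forall e : R, 0 < e -> exists2 d : R, 0 < d &
    forall w, nm (w - z) < d -> nm (f w - f z) < e.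
Proof.
split=> h.
  by move=> e e0; have /(@cvgCP _ (nbhs z) (nbhs_filter z))/(_ e e0)/nbhsCP := h.
apply/(@cvgCP _ (nbhs z) (nbhs_filter z)) => e e0.
by apply/nbhsCP; exact: h.
Qed.

Lemma is_deriveCP (f : C -> C) z (c : C) : is_derive z 1 f c <->
  forall e : R, 0 < e -> exists2 d : R, 0 < d &
    forall h, nm h < d -> nm (f (z + h) - f z - c * h) <= e * nm h.
Proof.
split=> [[df dfc] e e0|H].
  have /(@cvgCP _ _ (dnbhs_filter _))/(_ e e0) : (fun h => h^-1 *: ((f \o shift z) (h *: (1:C)) - f z)) @ 0^' --> c.
    by rewrite -dfc.
  rewrite /dnbhs near_withinE => /nbhsCP[d d0 hd]; exists d => // h hlt.
  have [->|h0] := eqVneq h 0.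
    by rewrite addr0 subrr mulr0 subrr nm0 mulr0.
  have := hd h; rewrite subr0 => /(_ hlt h0) /=.
  rewrite -[h%:A]/(h * 1) mulr1 /shift /=.
  have -> : h^-1 *: (f (h + z) - f z) - c = h^-1 * (f (z + h) - f z - c * h).
    by rewrite -[h^-1 *: _]/(h^-1 * _) (addrC h); field.
  by rewrite nmM nmV mulrC ltr_pdivrMr ?nm_gt0 // => /ltW.
suff h : (fun h => h^-1 *: ((f \o shift z) (h *: (1:C)) - f z)) @ 0^' --> c.
  by split; [apply/cvg_ex; exists c|exact: cvg_lim].
apply/(@cvgCP _ _ (dnbhs_filter _)) => e e0; rewrite /dnbhs near_withinE; apply/nbhsCP.
have e20 : 0 < e / 2 by rewrite divr_gt0.
have [d d0 hd] := H _ e20; exists d => // h; rewrite subr0 => hlt h0 /=.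
rewrite -[h%:A]/(h * 1) mulr1 /shift /=.
have -> : h^-1 *: (f (h + z) - f z) - c = h^-1 * (f (z + h) - f z - c * h).
  by rewrite -[h^-1 *: _]/(h^-1 * _) (addrC h); field.
rewrite nmM nmV mulrC ltr_pdivrMr ?nm_gt0 //; apply: (le_lt_trans (hd _ hlt)).
by rewrite ltr_pM2r ?nm_gt0 // ltr_pdivrMr // ltr_pMr // ltrDl.
Qed.

Lemma derivableC_cont (f : C -> C) z : derivable f z 1 -> {for z, continuous f}.
Proof. by move=> /derivable1_diffP/differentiable_continuous. Qed.

End Modulus.

Section ComplexExponential.
Variable R : realType.
Local Notation C := R[i].
Implicit Types (x y z w : C) (r : R).

Lemma is_deriveRP (f : R -> R) (z c : R) : is_derive z 1 f c <->
  forall e : R, 0 < e -> exists2 d : R, 0 < d &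
    forall h, `|h| < d -> `|f (z + h) - f z - c * h| <= e * `|h|.
Proof.
have E h : h != 0 -> h^-1 *: (f (h + z) - f z) - c = h^-1 * (f (z + h) - f z - c * h).
  by move=> h0; rewrite -[h^-1 *: _]/(h^-1 * _) (addrC h); field.
split=> [[df dfc] e e0|H].
  have : (fun h => h^-1 *: ((f \o shift z) (h *: (1:R)) - f z)) @ 0^' --> c.
    by rewrite -dfc.
  move=> /cvgrPdist_lt/(_ e e0); rewrite /dnbhs near_withinE.
  move=> /nbhs_ballP[d /= d0 hd]; exists d => // h hlt.
  have [->|h0] := eqVneq h 0.
    by rewrite addr0 subrr mulr0 subrr normr0 mulr0.
  have /= := hd h; rewrite /ball /= sub0r normrN => /(_ hlt h0) /=.
  rewrite -[h%:A]/(h * 1) mulr1 /shift /= distrC E //.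
  by rewrite normrM normfV mulrC ltr_pdivrMr ?normr_gt0 // => /ltW.
suff h : (fun h => h^-1 *: ((f \o shift z) (h *: (1:R)) - f z)) @ 0^' --> c.
  by split; [apply/cvg_ex; exists c|exact: cvg_lim].
apply/cvgrPdist_lt => e e0; rewrite /dnbhs near_withinE; apply/nbhs_ballP.
have e20 : 0 < e / 2 by rewrite divr_gt0.
have [d d0 hd] := H _ e20; exists d => // h; rewrite /ball /= sub0r normrN => hlt h0 /=.
rewrite -[h%:A]/(h * 1) mulr1 /shift /= distrC E //.
rewrite normrM normfV mulrC ltr_pdivrMr ?normr_gt0 //; apply: (le_lt_trans (hd _ hlt)).
by rewrite ltr_pM2r ?normr_gt0 // ltr_pdivrMr // ltr_pMr // ltrDl.
Qed.

Lemma cexpE z : cexp z =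
  (expR (complex.Re z) * cos (complex.Im z)) +i* (expR (complex.Re z) * sin (complex.Im z)).
Proof. by rewrite /cexp; apply: eqC; rewrite ?ReM ?ImM /= !(mul0r, subr0, addr0). Qed.

Lemma cexpD z w : cexp (z + w) = cexp z * cexp w.
Proof.
rewrite !cexpE; apply: eqC; rewrite ?ReM ?ImM /= ReD ImD expRD.
  by rewrite cosD; ring.
by rewrite sinD; ring.
Qed.

Lemma cexp0 : cexp 0 = 1 :> C.
Proof. by rewrite cexpE /= expR0 cos0 sin0 mulr1 mulr0. Qed.

Lemma nm_cexp z : nm (cexp z) = expR (complex.Re z).
Proof.
rewrite cexpE nm_pyth.
have -> : forall a b c : R, (a * b)^+2 + (a * c)^+2 = a^+2 * (b^+2+c^+2) by move=> *; ring.
by rewrite cos2Dsin2 mulr1 sqrtr_sqr ger0_norm // expR_ge0.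
Qed.

Lemma cexp_neq0 z : cexp z != 0.
Proof. by rewrite -nm_gt0 nm_cexp expR_gt0. Qed.

Lemma cexpN z : cexp (- z) = (cexp z)^-1.
Proof.
by apply: (mulfI (cexp_neq0 z)); rewrite -cexpD subrr cexp0 mulfV // cexp_neq0.
Qed.

Lemma cexpB z w : cexp (z - w) = cexp z / cexp w.
Proof. by rewrite cexpD cexpN. Qed.

Lemma cexp_sum (I : Type) (s : seq I) (P : pred I) (F : I -> C) :
  cexp (\sum_(i <- s | P i) F i) = \prod_(i <- s | P i) cexp (F i).
Proof. exact: (big_morph _ cexpD cexp0). Qed.

Lemma cexpM_nat z (n : nat) : cexp (z *+ n) = cexp z ^+ n.
Proof. by elim: n => [|n IH]; rewrite ?cexp0 // mulrS exprS cexpD IH. Qed.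

(** The real and imaginary increments are estimated by those of exp, cos and
    sin; the addition formula reduces everything to the derivative at 0. *)
Lemma is_derive_cexp z : is_derive z 1 (@cexp R) (cexp z).
Proof.
apply/is_deriveCP => e e0.
set M := nm (cexp z); have M0 : 0 < M by rewrite nm_gt0 cexp_neq0.
pose e' := Num.min 1 (e / (8 * M)).
have e'0 : 0 < e' by rewrite lt_min ltr01 divr_gt0 // mulr_gt0.
have e'1 : e' <= 1 by rewrite ge_min lexx.
have e'M : e' <= e / (8 * M) by rewrite ge_min lexx orbT.
clearbody e'.
have /is_deriveRP/(_ e' e'0)[d1 d10 h1] := is_derive_expR (0:R).
have /is_deriveRP/(_ e' e'0)[d2 d20 h2] := is_derive_cos (0:R).
have /is_deriveRP/(_ e' e'0)[d3 d30 h3] := is_derive_sin (0:R).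
exists (Num.min e' (Num.min d1 (Num.min d2 d3))).
  by rewrite !lt_min e'0 d10 d20 d30.
move=> h; rewrite !lt_min => /and4P[he' hd1 hd2 hd3].
rewrite cexpD.
have -> : cexp z * cexp h - cexp z - cexp z * h = cexp z * (cexp h - 1 - h) by ring.
rewrite nmM -/M.
suff H : nm (cexp h - 1 - h) <= 8 * e' * nm h.
  apply: (le_trans (ler_wpM2l (ltW M0) H)); rewrite mulrA ler_wpM2r ?nm_ge0 //.
  by move: e'M; rewrite ler_pdivlMr ?mulr_gt0 //; lra.
apply: (le_trans (nm_le_ReIm _)).
set a := complex.Re h; set b := complex.Im h.
have ah : `|a| <= nm h := Re_le_nm h.
have bh : `|b| <= nm h := Im_le_nm h.
have := h1 a (le_lt_trans ah hd1); rewrite add0r expR0 mul1r => k1.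
have := h2 b (le_lt_trans bh hd2); rewrite add0r cos0 sin0 oppr0 mul0r subr0 => k2.
have := h3 b (le_lt_trans bh hd3); rewrite add0r sin0 cos0 mul1r subr0 => k3.
have a1 : `|1 + a| <= 2.
  apply: (le_trans (ler_normD _ _)); rewrite normr1.
  have : `|a| <= 1 by lra.
  lra.
have c1 : `|cos b| <= 1 by rewrite ler_norml cos_geN1 cos_le1.
have s1 : `|sin b| <= 1 by rewrite ler_norml sin_geN1 sin_le1.
have -> : complex.Re (cexp h - 1 - h) = (expR a - 1 - a) * cos b + (1 + a) * (cos b - 1).
  by rewrite !(ReD, ReN) cexpE /= -/a -/b; ring.
have -> : complex.Im (cexp h - 1 - h) = (expR a - 1 - a) * sin b + (1 + a) * (sin b - b) + a * b.
  by rewrite !(ImD, ImN) cexpE /= -/a -/b; ring.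
have n0 := nm_ge0 h; have na := normr_ge0 a; have nb := normr_ge0 b.
have k1' : `|expR a - 1 - a| <= e' * nm h by apply: (le_trans k1); rewrite ler_pM2l.
have k2' : `|cos b - 1| <= e' * nm h by apply: (le_trans k2); rewrite ler_pM2l.
have k3' : `|sin b - b| <= e' * nm h by apply: (le_trans k3); rewrite ler_pM2l.
have t1 : `|(expR a - 1 - a) * cos b| <= e' * nm h * 1 by rewrite normrM ler_pM.
have t2 : `|(1 + a) * (cos b - 1)| <= 2 * (e' * nm h) by rewrite normrM ler_pM.
have t3 : `|(expR a - 1 - a) * sin b| <= e' * nm h * 1 by rewrite normrM ler_pM.
have t4 : `|(1 + a) * (sin b - b)| <= 2 * (e' * nm h) by rewrite normrM ler_pM.
have t5 : `|a * b| <= e' * nm h by rewrite normrM ler_pM // (le_trans ah) // ltW.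
have := ler_normD ((expR a - 1 - a) * cos b) ((1 + a) * (cos b - 1)).
have := ler_normD ((expR a - 1 - a) * sin b + (1 + a) * (sin b - b)) (a * b).
have := ler_normD ((expR a - 1 - a) * sin b) ((1 + a) * (sin b - b)).
have : 0 <= e' * nm h by rewrite mulr_ge0 // ltW.
lra.
Qed.

(** The principal branch on the right half-plane, where arctan gives the
    argument. *)
Definition clog z : C := ln (nm z) +i* atan (complex.Im z / complex.Re z).

Lemma clogK z : 0 < complex.Re z -> cexp (clog z) = z.
Proof.
move=> z0; have nz : 0 < nm z by apply: (lt_le_trans z0); apply: (le_trans (ler_norm _)); exact: Re_le_nm.
rewrite cexpE /clog /= lnK ?posrE //.
set a := complex.Re z in z0 *; set b := complex.Im z.
have c : cos (atan (b / a)) = a / nm z.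
  rewrite cos_atan.
  have -> : 1 + (b / a) ^+ 2 = (nm z / a) ^+ 2.
    by rewrite !expr_div_n nm_sqr -/a -/b; field; rewrite lt0r_neq0.
  by rewrite sqrtr_sqr ger0_norm ?invf_div // divr_ge0 ?ltW.
have s : sin (atan (b / a)) = b / nm z.
  have : tan (atan (b / a)) = b / a by rewrite atanK.
  rewrite /tan c => h.
  have cn : a / nm z != 0 by rewrite mulf_neq0 ?invr_eq0 ?lt0r_neq0.
  rewrite -[LHS](divfK cn) h.
  by field; rewrite !lt0r_neq0.
rewrite c s; apply: eqC => /=; rewrite -/a -/b mulrC divfK //; exact: lt0r_neq0.
Qed.

Lemma cexp_ipi2 : cexp ('i * (pi / 2 : R)%:C) = 'i.
Proof. by rewrite cexpE /= !(mul0r, mulr0, mul1r, mulr1, subr0, addr0, add0r, oppr0, subrr) expR0 cos_pihalf sin_pihalf mulr0 mulr1. Qed.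

(** One of w, -w, iw, -iw lies in the open right half-plane, where [clog]
    inverts [cexp]. *)
Lemma cexp_surj w : w != 0 -> exists z, cexp z = w.
Proof.
move=> w0.
have I z : cexp (z + 'i * (pi / 2 : R)%:C) = cexp z * 'i by rewrite cexpD cexp_ipi2.
have stepi : forall v, (exists z, cexp z = v) -> exists z, cexp z = v * 'i.
  by move=> v [z <-]; exists (z + 'i * (pi / 2 : R)%:C).
have ii : ('i : C) * 'i = -1 by rewrite -expr2 sqr_i.
have [h|h|h] := ltgtP (complex.Re w) 0.
- have -> : w = - w * 'i * 'i by rewrite -mulrA ii mulrN1 opprK.
  by do 2 apply: (stepi); exists (clog (- w)); apply: clogK; rewrite ReN oppr_gt0.
- by exists (clog w); exact: clogK.
- have [k|k|k] := ltgtP (complex.Im w) 0.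
  + have -> : w = w * 'i * 'i * 'i * 'i by rewrite -!mulrA ii mulrN1 mulrN ii opprK mulr1.
    do 3 apply: (stepi); exists (clog (w * 'i)); apply: clogK.
    by rewrite ReM /= mulr0 mulr1 sub0r oppr_gt0.
  + have -> : w = w * - 'i * 'i by rewrite -mulrA mulNr ii opprK mulr1.
    apply: (stepi); exists (clog (w * - 'i)); apply: clogK.
    by rewrite ReM /= oppr0 mulr0 mulrN1 sub0r opprK.
  + by case/eqP: w0; apply: eqC.
Qed.

Lemma ipi2E (n : int) :
  n%:~R * (2 * (pi:R)%:C * 'i) = 'i * (n%:~R * (pi *+ 2) : R)%:C.
Proof. by rewrite rmorphM rmorph_int rmorphMn /= mulr2n; ring. Qed.

(** The modulus forces Re z = 0, and cos y = 1 is solved by reducing y modulo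
    2 pi to an interval around 0. *)
Lemma cexp_eq1 z : cexp z = 1 -> exists n : int, z = n%:~R * (2 * (pi:R)%:C * 'i).
Proof.
move=> h.
have : nm (cexp z) = 1 by rewrite h nm1.
rewrite nm_cexp => /(congr1 (@ln R)); rewrite expRK ln1 => re0.
move: h; rewrite cexpE re0 expR0 !mul1r => -[].
set y := complex.Im z => c1 s0.
have pp : 0 < (pi : R) *+ 2 by rewrite mulrn_wgt0 // pi_gt0.
pose n := Num.floor (y / (pi *+ 2)).
pose y' := y - n%:~R * (pi *+ 2).
have y'0 : 0 <= y'.
  rewrite subr_ge0 -ler_pdivlMr //; exact: ge_floor.
have y'1 : y' < pi *+ 2.
  rewrite ltrBlDr -[X in _ < X + _]mul1r -mulrDl -ltr_pdivrMr // addrC.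
  by have := lt_succ_floor (y / (pi *+ 2)); rewrite intrD.
have per (k : int) (t : R) : cos (t + k%:~R * (pi *+ 2)) = cos t.
  case: k => k; first by rewrite -pmulrn mulr_natl (periodicn (@cosD2pi R)).
  rewrite NegzE mulrNz mulNr -pmulrn mulr_natl.
  by rewrite -[LHS](periodicn (@cosD2pi R) k.+1) subrK.
have cy : cos y' = 1 by rewrite -c1 -(per n y') subrK.
have y'e : y' = 0.
  have [le|gt] := leP y' pi.
    by apply: cos_inj; rewrite ?in_itv /= ?y'0 ?lexx ?pi_ge0 // cos0.
  have : pi *+ 2 - y' = 0.
    apply: cos_inj; rewrite ?in_itv /= ?lexx ?pi_ge0 //.
      by rewrite subr_ge0 (ltW y'1) /= mulr2n; move: gt; lra.
    by rewrite cos0 -cosN opprB -cy; have := per (-1) y'; rewrite mulN1r.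
  by move: y'1; lra.
exists n; rewrite ipi2E; apply: eqC; rewrite ?ReM ?ImM /=.
  by rewrite re0 mul0r mulr0 subrr.
move/eqP: y'e; rewrite subr_eq0 -/y => /eqP ->.
by rewrite mul0r mul1r add0r.
Qed.

Lemma cexp_2pi (n : int) : cexp (n%:~R * (2 * (pi:R)%:C * 'i)) = 1.
Proof.
have h : cexp (2 * (pi:R)%:C * 'i) = 1.
  have := ipi2E 1; rewrite !mul1r => ->.
  have -> : pi *+ 2 = pi / 2 *+ 4 :> R by field.
  rewrite rmorphMn /= -mulr_natr mulrA mulr_natr.
  by rewrite cexpM_nat cexp_ipi2 (exprM _ 2 2) sqr_i sqrrN expr1n.
case: n => n; first by rewrite -pmulrn (mulr_natl _ n) cexpM_nat h expr1n.
by rewrite NegzE mulrNz mulNr cexpN -pmulrn (mulr_natl _ n.+1) cexpM_nat h expr1n invr1.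
Qed.

End ComplexExponential.

(** * Integrals and Cauchy's theorem on rectangles *)

Section LineIntegral.
Variable R : realType.
Local Notation C := R[i].
Implicit Types (u v U V : R -> C) (a b c x y : R).

Lemma Re_continuous : continuous (@complex.Re R : C -> R).
Proof.
move=> z; apply/(@cvgrPdist_lt _ _ _ _ (nbhs_filter z)) => e e0.
apply/nbhsCP; exists e => // w wz; rewrite -ReN -ReD.
by apply: le_lt_trans (Re_le_nm _) _; rewrite nmB.
Qed.

Lemma Im_continuous : continuous (@complex.Im R : C -> R).
Proof.
move=> z; apply/(@cvgrPdist_lt _ _ _ _ (nbhs_filter z)) => e e0.
apply/nbhsCP; exists e => // w wz; rewrite -ImN -ImD.
by apply: le_lt_trans (Im_le_nm _) _; rewrite nmB.
Qed.

Lemma real_constant (f : R -> R) : (forall x, is_derive x 1 f 0) -> forall x y, f x = f y.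
Proof.
move=> df.
suff H x y : x <= y -> f x = f y.
  by move=> x y; have [/H//|/ltW/H] := leP x y.
move=> xy; have [|c _] := @MVT_segment R f (fun=> 0) x y xy (fun z _ => df z).
  apply: continuous_subspaceT => z.
  by have [/derivable1_diffP/differentiable_continuous] := df z.
by rewrite mul0r => /eqP; rewrite subr_eq0 => /eqP.
Qed.

Lemma real_primitive (u : R -> R) : continuous u ->
  exists U : R -> R, forall x, is_derive x 1 U (u x).
Proof.
move=> cu.
pose V (k : nat) x := (\int[lebesgue_measure]_(t in [set` `[- k%:R, x]]) u t)%R.
have dV (k : nat) x : - k%:R < x -> is_derive x 1 (V k) (u x).
  move=> kx.
  have int : lebesgue_measure.-integrable `[- k%:R, x + 1] (EFin \o u).
    by apply: continuous_compact_integrable; [exact: segment_compact|exact: continuous_subspaceT].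
  have [d1 d2] := @continuous_FTC1_closed R u (- k%:R) x (x + 1) ltac:(by rewrite ltrDl) int kx (cu x).
  by apply: DeriveDef; [exact: d1|rewrite -derive1E; exact: d2].
have E (k l : nat) x : (0 < k)%N -> (k <= l)%N -> - k%:R < x -> V k x - V k 0 = V l x - V l 0.
  move=> k0 kl kx.
  have kl' : - l%:R <= - k%:R :> R by rewrite lerN2 ler_nat.
  have k0' : - k%:R < 0 :> R by rewrite oppr_lt0 ltr0n.
  pose f y := V k y - V l y.
  have df y : - k%:R < y -> is_derive y 1 f (u y - u y).
    by move=> ky; apply: is_deriveB; apply: dV => //; exact: le_lt_trans kl' _.
  suff H y z : - k%:R < y -> y <= z -> f y = f z.
    have : f x = f 0.
      have [x0|/ltW x0] := leP x 0; first exact: H.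
      by rewrite -(H 0 x).
    move=> fx0; have -> : V k x = f x + V l x by rewrite /f subrK.
    by rewrite fx0 /f; ring.
  move=> ky yz; have [||c _] := @MVT_segment R f (fun t => u t - u t) y z yz.
  - by move=> t /andP[]; rewrite !bnd_simp => yt _; apply: df; exact: lt_trans yt.
  - apply: derivable_within_continuous => t /andP[]; rewrite !bnd_simp => yt _.
    by apply: ex_derive; apply: df; exact: lt_le_trans yt.
  - by rewrite subrr mul0r => /eqP; rewrite subr_eq0 => /eqP.
pose n x := (Num.trunc `|x|).+1.
have nx x : - (n x)%:R < x.
  have : `|x| < (n x)%:R by rewrite /n; exact: truncnS_gt.
  by rewrite ltr_norml => /andP[].
exists (fun x => V (n x) x - V (n x) 0) => x.
pose k := (n x).+1.
have xk : `|x| + 1 < k%:R by rewrite /k -[in ltRHS]natr1 ltrD2r; exact: truncnS_gt.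
have dk : is_derive x 1 (fun y => V k y - V k 0) (u x - 0).
  by apply: is_deriveB; apply: dV; move: xk; rewrite -/k; have := ler_norm (- x); rewrite normrN; lra.
move: dk; rewrite subr0 => /is_deriveRP dk; apply/is_deriveRP => e e0.
have [d d0 hd] := dk e e0.
exists (Num.min d 1) => [|h]; first by rewrite lt_min d0 ltr01.
rewrite lt_min => /andP[hltd hlt1].
have W y : `|y - x| < 1 -> V (n y) y - V (n y) 0 = V k y - V k 0.
  move=> yx; apply: E => //; rewrite -ltnS -(ltr_nat R); apply: le_lt_trans (_ : `|y| + 1 < _).
    by rewrite /n -natr1 lerD2r; have := truncn_itv (normr_ge0 y) => /andP[].
  rewrite -natr1 ltrD2r; apply: le_lt_trans xk.
  by rewrite -{1}(subrK x y); apply: (le_trans (ler_normD _ _)); rewrite addrC lerD2l ltW.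
by rewrite (W (x + h)) ?(addrC x) ?addrK // W ?subrr ?normr0 // addrC; exact: hd.
Qed.

Definition isprim U u := forall x,
  is_derive x 1 (@complex.Re R \o U) (complex.Re (u x)) /\
  is_derive x 1 (@complex.Im R \o U) (complex.Im (u x)).

Lemma isprim_exists u : continuous u -> exists U, isprim U u.
Proof.
move=> cu.
have [|U1 h1] := @real_primitive (@complex.Re R \o u).
  by move=> x; apply: continuous_comp; [exact: cu|exact: Re_continuous].
have [|U2 h2] := @real_primitive (@complex.Im R \o u).
  by move=> x; apply: continuous_comp; [exact: cu|exact: Im_continuous].
by exists (fun x => U1 x +i* U2 x) => x; split; [exact: h1|exact: h2].
Qed.

Lemma isprimD U V u v : isprim U u -> isprim V v ->
  isprim (fun x => U x + V x) (fun x => u x + v x).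
Proof.
move=> hU hV x; have [a b] := hU x; have [c d] := hV x; split.
  have -> : @complex.Re R \o (fun x => U x + V x) = (@complex.Re R \o U) + (@complex.Re R \o V).
    by apply/funext => y /=; rewrite ReD.
  by rewrite ReD; apply: is_deriveD.
have -> : @complex.Im R \o (fun x => U x + V x) = (@complex.Im R \o U) + (@complex.Im R \o V).
  by apply/funext => y /=; rewrite ImD.
by rewrite ImD; apply: is_deriveD.
Qed.

Lemma isprimZ (k : C) U u : isprim U u -> isprim (fun x => k * U x) (fun x => k * u x).
Proof.
move=> hU x; have [a b] := hU x; split.
  have -> : @complex.Re R \o (fun x => k * U x) =
      complex.Re k *: (@complex.Re R \o U) - complex.Im k *: (@complex.Im R \o U).
    by apply/funext => y /=; rewrite ReM.
  by rewrite ReM; apply: is_deriveB; apply: is_deriveZ.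
have -> : @complex.Im R \o (fun x => k * U x) =
    complex.Re k *: (@complex.Im R \o U) + complex.Im k *: (@complex.Re R \o U).
  by apply/funext => y /=; rewrite ImM.
by rewrite ImM; apply: is_deriveD; apply: is_deriveZ.
Qed.

Lemma isprim_real (f f' : R -> R) : (forall x, is_derive x 1 f (f' x)) ->
  isprim (fun x => (f x)%:C) (fun x => (f' x)%:C).
Proof. by move=> h x; split; [exact: h|exact: is_derive_cst]. Qed.

Lemma isprim_lin : isprim (fun x => x%:C) (fun=> 1).
Proof. by apply: isprim_real => x; exact: is_derive_id. Qed.

Lemma isprim_sqr : isprim (fun x => (x ^+ 2 / 2)%:C) (fun x => x%:C).
Proof.
apply: isprim_real => x; apply/is_deriveRP => e e0; exists e => // h he.
have -> : (x + h) ^+ 2 / 2 - x ^+ 2 / 2 - x * h = h ^+ 2 / 2 by field.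
rewrite normrM normrX (ger0_norm (_ : 0 <= 2^-1)) ?invr_ge0 // expr2 -mulrA mulrC ler_wpM2r //.
have := normr_ge0 h; lra.
Qed.

Definition cprim u : R -> C := xget (fun=> 0) [set U | isprim U u].
(** The integral from a to b as an increment of a chosen primitive. Additivity
    and linearity are then immediate. *)
Definition cint u a b : C := cprim u b - cprim u a.

Lemma cprimP u : continuous u -> isprim (cprim u) u.
Proof. by move=> /isprim_exists[U hU]; rewrite /cprim; case: xgetP => // /(_ U). Qed.

Lemma isprim_cint U u a b : isprim U u -> cint u a b = U b - U a.
Proof.
move=> hU; have hV : isprim (cprim u) u.
  by rewrite /cprim; case: xgetP => // /(_ U).
rewrite /cint; set V := cprim u in hV *.
have hW := isprimD hV (isprimZ (-1) hU).
have W0 : isprim (fun x => V x + -1 * U x) (fun=> 0).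
  by move: hW; congr (isprim _ _); apply/funext => x; rewrite mulN1r subrr.
have := real_constant (fun x => (W0 x).1) a b; have := real_constant (fun x => (W0 x).2) a b.
move=> /= im re; have := eqC re im; rewrite !mulN1r => h.
by apply/eqP; rewrite -subr_eq0; move/eqP: h; rewrite eq_sym -subr_eq0 => /eqP h; apply/eqP; rewrite -[RHS]h; ring.
Qed.

Lemma cint_split u a b c : cint u a b + cint u b c = cint u a c.
Proof. by rewrite /cint; ring. Qed.

Lemma cintD u v a b : continuous u -> continuous v ->
  cint (fun x => u x + v x) a b = cint u a b + cint v a b.
Proof.
move=> /cprimP cu /cprimP cv; rewrite (isprim_cint a b (isprimD cu cv)) /cint; ring.
Qed.

Lemma cintZ (k : C) u a b : continuous u -> cint (fun x => k * u x) a b = k * cint u a b.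
Proof. by move=> /cprimP cu; rewrite (isprim_cint a b (isprimZ k cu)) /cint; ring. Qed.

Lemma cint_affine (A B : C) a b : cint (fun x => A + B * x%:C) a b =
  A * (b - a)%:C + B * (b ^+ 2 / 2 - a ^+ 2 / 2)%:C.
Proof.
have h := isprimD (isprimZ A isprim_lin) (isprimZ B isprim_sqr).
have {}h : isprim (fun x => A * x%:C + B * (x ^+ 2 / 2)%:C) (fun x => A + B * x%:C).
  by move: h; congr (isprim _ _); apply/funext => x; rewrite mulr1.
by rewrite (isprim_cint a b h) !rmorphB /=; ring.
Qed.

Lemma cint_cst (A : C) a b : cint (fun=> A) a b = A * (b - a)%:C.
Proof.
have := cint_affine A 0 a b; rewrite mul0r addr0 => <-; congr (cint _ _ _).
by apply/funext => x; rewrite mul0r addr0.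
Qed.

(** The mean value theorem bounds the real and the imaginary part separately;
    hence the factor 2. *)
Lemma cint_bound u a b (M : R) : continuous u -> a <= b ->
  (forall x, a <= x <= b -> nm (u x) <= M) -> nm (cint u a b) <= 2 * M * (b - a).
Proof.
move=> /cprimP cu ab hM; rewrite /cint; set U := cprim u in cu *.
have ba : 0 <= b - a by rewrite subr_ge0.
apply: le_trans (nm_le_ReIm _) _; rewrite !(ReD, ReN, ImD, ImN).
have cont (f f' : R -> R) : (forall x, is_derive x 1 f (f' x)) -> {within `[a, b], continuous f}.
  move=> df; apply: continuous_subspaceT => z.
  by have [/derivable1_diffP/differentiable_continuous] := df z.
have [c cab hc] := MVT_segment ab (fun z _ => (cu z).1) (cont _ _ (fun z => (cu z).1)).
have [d dab hd] := MVT_segment ab (fun z _ => (cu z).2) (cont _ _ (fun z => (cu z).2)).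
move: hc hd => /= -> ->; rewrite !normrM (ger0_norm ba) -mulrDl ler_wpM2r //.
move: cab dab; rewrite !in_itv /= => /hM hc /hM hd.
have := Re_le_nm (u c); have := Im_le_nm (u d); lra.
Qed.

End LineIntegral.

Section ComplexCalculus.
Variable R : realType.
Local Notation C := R[i].
Implicit Types (f g : C -> C) (z w : C).

Lemma is_deriveC_comp f g z (df dg : C) :
  is_derive z 1 g dg -> is_derive (g z) 1 f df ->
  is_derive z 1 (fun x => f (g x)) (df * dg).
Proof.
move=> /is_deriveCP hg /is_deriveCP hf; apply/is_deriveCP => e e0.
have fp : 0 < 2 * (nm df + 1) by rewrite mulr_gt0 // ltr_wpDl // nm_ge0.
have gp : 0 < 2 * (nm dg + 1) by rewrite mulr_gt0 // ltr_wpDl // nm_ge0.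
have [e1 e10 [e11 e12]] : exists2 e1 : R, 0 < e1 & e1 <= 1 /\ e1 <= e / (2 * (nm df + 1)).
  exists (Num.min 1 (e / (2 * (nm df + 1)))); first by rewrite lt_min ltr01 divr_gt0.
  by rewrite !ge_min !lexx orbT.
have [d1 d10 h1] := hg _ e10.
have [d2 d20 h2] := hf _ (divr_gt0 e0 gp).
exists (Num.min d1 (d2 / (nm dg + 1))).
  by rewrite lt_min d10 divr_gt0 // ltr_wpDl // nm_ge0.
move=> h; rewrite lt_min => /andP[hd1 hd2].
set k := g (z + h) - g z; have gk : g (z + h) = g z + k by rewrite /k; ring.
have n0 := nm_ge0 h; have ndg := nm_ge0 dg; have ndf := nm_ge0 df.
have k1 : nm (k - dg * h) <= e1 * nm h by apply: h1.
have k2 : nm k <= (nm dg + 1) * nm h.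
  rewrite -(subrK (dg * h) k); apply: (le_trans (nmD _ _)); rewrite nmM.
  have : e1 * nm h <= nm h by rewrite ler_piMl.
  by move: k1; rewrite mulrDl; lra.
have kd : nm k < d2.
  by apply: (le_lt_trans k2); rewrite mulrC -ltr_pdivlMr // ltr_wpDl.
have k3 := h2 _ kd; rewrite gk.
have -> : f (g z + k) - f (g z) - df * dg * h =
  (f (g z + k) - f (g z) - df * k) + df * (k - dg * h) by ring.
apply: (le_trans (nmD _ _)); rewrite nmM.
have a1 : nm df * nm (k - dg * h) <= (e / 2) * nm h.
  apply: (@le_trans _ _ (nm df * (e1 * nm h))); first by rewrite ler_wpM2l.
  rewrite mulrA ler_wpM2r //.
  move: e12; rewrite ler_pdivlMr // => e12.
  by move: e10 e12; nra.
have a2 : e / (2 * (nm dg + 1)) * nm k <= (e / 2) * nm h.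
  apply: (@le_trans _ _ (e / (2 * (nm dg + 1)) * ((nm dg + 1) * nm h))).
    by rewrite ler_wpM2l // ltW // divr_gt0.
  rewrite le_eqVlt; apply/orP; left; apply/eqP; field.
  by rewrite lt0r_neq0 // ltr_wpDl.
by move: a1 a2 k3; lra.
Qed.

Definition dC f z := derivable f z (1 : C).

Lemma dCP f z : dC f z <-> exists c, is_derive z 1 f c.
Proof. by split=> [/derivableP|[c []]//]; exists ('D_1 f z). Qed.

Lemma dC_ex f z c : is_derive z 1 f c -> dC f z.
Proof. by case. Qed.

Lemma is_deriveC_cst (a z : C) : is_derive z 1 (fun=> a) 0.
Proof. exact: is_derive_cst. Qed.

Lemma is_deriveC_id z : is_derive z 1 (fun x : C => x) 1.
Proof. exact: is_derive_id. Qed.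

Lemma is_deriveC_D f g z (df dg : C) : is_derive z 1 f df -> is_derive z 1 g dg ->
  is_derive z 1 (fun x => f x + g x) (df + dg).
Proof. exact: is_deriveD. Qed.

Lemma is_deriveC_N f z (df : C) : is_derive z 1 f df ->
  is_derive z 1 (fun x => - f x) (- df).
Proof. exact: is_deriveN. Qed.

Lemma is_deriveC_B f g z (df dg : C) : is_derive z 1 f df -> is_derive z 1 g dg ->
  is_derive z 1 (fun x => f x - g x) (df - dg).
Proof. exact: is_deriveB. Qed.

Lemma is_deriveC_M f g z (df dg : C) : is_derive z 1 f df -> is_derive z 1 g dg ->
  is_derive z 1 (fun x => f x * g x) (df * g z + f z * dg).
Proof.
move=> hf hg; have := is_deriveM hf hg.
by rewrite -[f z *: dg]/(f z * dg) -[g z *: df]/(g z * df) addrC (mulrC (g z)).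
Qed.

Lemma is_deriveC_inv z : z != 0 -> is_derive z 1 (fun x : C => x^-1) (- z ^- 2).
Proof.
move=> z0; have hid := is_deriveC_id z.
have h : derivable (fun x : C => x^-1) z 1.
  exact: (@derivableV _ _ (fun x : C => x) z 1 z0 (dC_ex hid)).
have e : 'D_1 (fun x : C => x^-1) z = - z ^- 2.
  have := @deriveV _ _ (fun x : C => x) z 1 z0 (dC_ex hid).
  have -> : 'D_1 (fun x : C => x) z = 1 by case: hid.
  by move=> ->; rewrite -[_ *: _]/(_ * _) mulr1.
by split.
Qed.

Lemma dC_cst (a z : C) : dC (fun=> a) z.
Proof. exact: dC_ex (is_deriveC_cst a z). Qed.
Lemma dC_id z : dC (fun x => x) z.
Proof. exact: dC_ex (is_deriveC_id z). Qed.
Lemma dC_D f g z : dC f z -> dC g z -> dC (fun x => f x + g x) z.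
Proof. by move=> /dCP[a ha] /dCP[b hb]; exact: dC_ex (is_deriveC_D ha hb). Qed.
Lemma dC_N f z : dC f z -> dC (fun x => - f x) z.
Proof. by move=> /dCP[a ha]; exact: dC_ex (is_deriveC_N ha). Qed.
Lemma dC_B f g z : dC f z -> dC g z -> dC (fun x => f x - g x) z.
Proof. by move=> /dCP[a ha] /dCP[b hb]; exact: dC_ex (is_deriveC_B ha hb). Qed.
Lemma dC_M f g z : dC f z -> dC g z -> dC (fun x => f x * g x) z.
Proof. by move=> /dCP[a ha] /dCP[b hb]; exact: dC_ex (is_deriveC_M ha hb). Qed.
Lemma dC_comp f g z : dC g z -> dC f (g z) -> dC (fun x => f (g x)) z.
Proof. by move=> /dCP[a ha] /dCP[b hb]; exact: dC_ex (is_deriveC_comp ha hb). Qed.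
Lemma dC_inv f z : dC f z -> f z != 0 -> dC (fun x => (f x)^-1) z.
Proof.
by move=> hf f0; exact: (@dC_comp (fun x => x^-1) f z hf (dC_ex (is_deriveC_inv f0))).
Qed.
Lemma dC_div f g z : dC f z -> dC g z -> g z != 0 -> dC (fun x => f x / g x) z.
Proof. by move=> hf hg g0; exact: (dC_M hf (dC_inv hg g0)). Qed.
Lemma dC_cexp f z : dC f z -> dC (fun x => cexp (f x)) z.
Proof. by move=> hf; exact: (dC_comp hf (dC_ex (is_derive_cexp (f z)))). Qed.
Lemma dC_sum (I : Type) (s : seq I) (P : pred I) (F : I -> C -> C) z :
  (forall i, P i -> dC (F i) z) -> dC (fun x => \sum_(i <- s | P i) F i x) z.
Proof.
move=> h; elim: s => [|i s IH].
  have -> : (fun x => \sum_(i <- [::] | P i) F i x) = fun=> 0.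
    by apply/funext => x; rewrite big_nil.
  exact: dC_cst.
have -> : (fun x => \sum_(i <- i :: s | P i) F i x) =
    fun x => (if P i then F i x else 0) + \sum_(i <- s | P i) F i x.
  by apply/funext => x; rewrite big_cons; case: ifP => // _; rewrite add0r.
by apply: dC_D; [case: (boolP (P i)) => [/h|_]; [|exact: dC_cst]|exact: IH].
Qed.
Lemma dC_prod (I : Type) (s : seq I) (P : pred I) (F : I -> C -> C) z :
  (forall i, P i -> dC (F i) z) -> dC (fun x => \prod_(i <- s | P i) F i x) z.
Proof.
move=> h; elim: s => [|i s IH].
  have -> : (fun x => \prod_(i <- [::] | P i) F i x) = fun=> 1.
    by apply/funext => x; rewrite big_nil.
  exact: dC_cst.
have -> : (fun x => \prod_(i <- i :: s | P i) F i x) =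
    fun x => (if P i then F i x else 1) * \prod_(i <- s | P i) F i x.
  by apply/funext => x; rewrite big_cons; case: ifP => // _; rewrite mul1r.
by apply: dC_M; [case: (boolP (P i)) => [/h|_]; [|exact: dC_cst]|exact: IH].
Qed.
Lemma dC_X f n z : dC f z -> dC (fun x => f x ^+ n) z.
Proof.
move=> h; elim: n => [|n IH]; first exact: dC_cst.
have -> : (fun x => f x ^+ n.+1) = fun x => f x * f x ^+ n by apply/funext => x; rewrite exprS.
exact: dC_M.
Qed.
Lemma dC_cont f z : dC f z -> {for z, continuous f}.
Proof. exact: derivableC_cont. Qed.

Lemma is_deriveC_uniq f z a b : is_derive z 1 f a -> is_derive z 1 f b -> a = b.
Proof. by move=> [_ <-] [_ <-]. Qed.

Lemma dC_near f g z : (exists2 d : R, 0 < d & forall w, nm (w - z) < d -> f w = g w) ->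
  dC g z -> dC f z.
Proof.
move=> [d d0 hd] /dCP[c /is_deriveCP hc]; apply/dCP; exists c; apply/is_deriveCP => e e0.
have [d' d'0 hd'] := hc e e0; exists (Num.min d d'); first by rewrite lt_min d0.
move=> h; rewrite lt_min => /andP[h1 h2].
rewrite !hd ?subrr ?nm0 //; first exact: hd'.
by rewrite addrC addKr.
Qed.

Definition entire f := forall z, dC f z.

Lemma entire_cont f : entire f -> continuous f.
Proof. by move=> h z; exact: dC_cont. Qed.

End ComplexCalculus.

Section ContinuityC.
Variables (R : realType) (T : topologicalType).
Local Notation C := R[i].
Implicit Types (f g : T -> C) (x : T).

Lemma contD f g x : {for x, continuous f} -> {for x, continuous g} ->
  {for x, continuous (fun t => f t + g t)}.
Proof. by move=> hf hg; exact: (cvgD hf hg). Qed.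
Lemma contB f g x : {for x, continuous f} -> {for x, continuous g} ->
  {for x, continuous (fun t => f t - g t)}.
Proof. by move=> hf hg; exact: (cvgB hf hg). Qed.
Lemma contM f g x : {for x, continuous f} -> {for x, continuous g} ->
  {for x, continuous (fun t => f t * g t)}.
Proof. by move=> hf hg; exact: (cvgM hf hg). Qed.
Lemma contV f x : {for x, continuous f} -> f x != 0 -> {for x, continuous (fun t => (f t)^-1)}.
Proof. by move=> hf fx; exact: (cvgV fx hf). Qed.
Lemma contcst (a : C) x : {for x, continuous (fun _ : T => a)}.
Proof. exact: cvg_cst. Qed.
Lemma contcomp (f : T -> C) (h : C -> C) x : {for x, continuous f} ->
  {for f x, continuous h} -> {for x, continuous (fun t => h (f t))}.
Proof. by move=> hf hh; exact: (continuous_comp hf hh). Qed.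
Lemma contsum (I : Type) (s : seq I) (P : pred I) (F : I -> T -> C) x :
  (forall i, {for x, continuous (F i)}) ->
  {for x, continuous (fun t => \sum_(i <- s | P i) F i t)}.
Proof.
move=> h; elim: s => [|i s IH].
  have -> : (fun t => \sum_(i <- [::] | P i) F i t) = fun=> 0.
    by apply/funext => t; rewrite big_nil.
  exact: contcst.
have -> : (fun t => \sum_(i <- i :: s | P i) F i t) =
    fun t => (if P i then F i t else 0) + \sum_(i <- s | P i) F i t.
  by apply/funext => t; rewrite big_cons; case: ifP => // _; rewrite add0r.
by apply: contD; [case: (P i); [exact: h|exact: contcst]|exact: IH].
Qed.
Lemma contprod (I : Type) (s : seq I) (P : pred I) (F : I -> T -> C) x :
  (forall i, {for x, continuous (F i)}) ->
  {for x, continuous (fun t => \prod_(i <- s | P i) F i t)}.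
Proof.
move=> h; elim: s => [|i s IH].
  have -> : (fun t => \prod_(i <- [::] | P i) F i t) = fun=> 1.
    by apply/funext => t; rewrite big_nil.
  exact: contcst.
have -> : (fun t => \prod_(i <- i :: s | P i) F i t) =
    fun t => (if P i then F i t else 1) * \prod_(i <- s | P i) F i t.
  by apply/funext => t; rewrite big_cons; case: ifP => // _; rewrite mul1r.
by apply: contM; [case: (P i); [exact: h|exact: contcst]|exact: IH].
Qed.
End ContinuityC.

Section Goursat.
Variable R : realType.
Local Notation C := R[i].
Implicit Types (f g : C -> C) (z w : C) (x y a b : R).

Lemma ptE x y : x +i* y = x%:C + 'i * y%:C :> C.
Proof. by apply: eqC; rewrite ?ReD ?ImD ?ReM ?ImM /= ?mul0r ?mul1r ?subr0 ?oppr0 ?addr0 ?add0r. Qed.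

Lemma nm_pt x y x' y' : nm ((x +i* y) - (x' +i* y')) <= `|x - x'| + `|y - y'|.
Proof. by apply: le_trans (nm_le_ReIm _) _; rewrite ReD ImD ReN ImN. Qed.

Lemma cont_of_eps (u : R -> C) : (forall x0 (e : R), 0 < e -> exists2 d : R, 0 < d &
   forall x, `|x - x0| < d -> nm (u x - u x0) < e) -> continuous u.
Proof.
move=> h x0; apply/(@cvgCP _ _ (nbhs x0) (nbhs_filter x0)) => e e0.
have [d d0 hd] := h x0 e e0; apply/nbhs_ballP; exists d => // x.
by rewrite /ball /= distrC; exact: hd.
Qed.

Lemma hcont g y : continuous g -> continuous (fun x : R => g (x +i* y)).
Proof.
move=> cg; apply: cont_of_eps => x0 e e0.
have /contCP/(_ e e0)[d d0 hd] := cg (x0 +i* y).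
exists d => // x xd; apply: hd; apply: le_lt_trans (nm_pt _ _ _ _) _.
by rewrite subrr normr0 addr0.
Qed.

Lemma vcont g x : continuous g -> continuous (fun y : R => g (x +i* y)).
Proof.
move=> cg; apply: cont_of_eps => y0 e e0.
have /contCP/(_ e e0)[d d0 hd] := cg (x +i* y0).
exists d => // y yd; apply: hd; apply: le_lt_trans (nm_pt _ _ _ _) _.
by rewrite subrr normr0 add0r.
Qed.

(** The integral of g along the boundary of the rectangle [x0, x1] x [y0, y1],
    counterclockwise. *)
Definition rect g x0 x1 y0 y1 : C :=
  cint (fun x => g (x +i* y0)) x0 x1 - cint (fun x => g (x +i* y1)) x0 x1 +
  'i * (cint (fun y => g (x1 +i* y)) y0 y1 - cint (fun y => g (x0 +i* y)) y0 y1).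

Lemma rect_splitx g x0 x1 x2 y0 y1 :
  rect g x0 x2 y0 y1 = rect g x0 x1 y0 y1 + rect g x1 x2 y0 y1.
Proof. by rewrite /rect -!(cint_split _ x0 x1 x2); ring. Qed.

Lemma rect_splity g x0 x1 y0 y1 y2 :
  rect g x0 x1 y0 y2 = rect g x0 x1 y0 y1 + rect g x0 x1 y1 y2.
Proof. by rewrite /rect -!(cint_split _ y0 y1 y2); ring. Qed.

Lemma rectD f g x0 x1 y0 y1 : continuous f -> continuous g ->
  rect (fun z => f z + g z) x0 x1 y0 y1 = rect f x0 x1 y0 y1 + rect g x0 x1 y0 y1.
Proof.
move=> cf cg; rewrite /rect !cintD; do ?[exact: hcont|exact: vcont].
by ring.
Qed.

(** An affine function has a quadratic primitive, so its integral along a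
    closed path vanishes. *)
Lemma rect_affine (A B : C) x0 x1 y0 y1 : rect (fun z => A + B * z) x0 x1 y0 y1 = 0.
Proof.
have H y : (fun x => A + B * (x +i* y)) = (fun x => (A + B * 'i * y%:C) + B * x%:C).
  by apply/funext => x; rewrite ptE; ring.
have V x : (fun y => A + B * (x +i* y)) = (fun y => (A + B * x%:C) + (B * 'i) * y%:C).
  by apply/funext => y; rewrite ptE; ring.
by rewrite /rect !H !V !cint_affine !rmorphB /=; ring.
Qed.

Lemma rect_bound g x0 x1 y0 y1 (M : R) : continuous g -> x0 <= x1 -> y0 <= y1 ->
  (forall x y, x0 <= x <= x1 -> y0 <= y <= y1 -> nm (g (x +i* y)) <= M) ->
  nm (rect g x0 x1 y0 y1) <= 4 * M * ((x1 - x0) + (y1 - y0)).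
Proof.
move=> cg xx yy hM; rewrite /rect.
apply: le_trans (nmD _ _) _; rewrite nmM nmi mul1r.
have h1 := cint_bound (hcont (y:=y0) cg) xx (fun x hx => hM x y0 hx (introT andP (conj (lexx _) yy))).
have h2 := cint_bound (hcont (y:=y1) cg) xx (fun x hx => hM x y1 hx (introT andP (conj yy (lexx _)))).
have h3 := cint_bound (vcont (x:=x1) cg) yy (fun y hy => hM x1 y (introT andP (conj xx (lexx _))) hy).
have h4 := cint_bound (vcont (x:=x0) cg) yy (fun y hy => hM x0 y (introT andP (conj (lexx _) xx)) hy).
have k1 := nmBD (cint (fun x => g (x +i* y0)) x0 x1) (cint (fun x => g (x +i* y1)) x0 x1).
have k2 := nmBD (cint (fun y => g (x1 +i* y)) y0 y1) (cint (fun y => g (x0 +i* y)) y0 y1).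
lra.
Qed.

(** The four boundary integrals of the quarters add up to the whole, so one of
    them carries at least a quarter of it. *)
Lemma goursat_step g (hx hy x y : R) : 0 <= hx -> 0 <= hy ->
  exists q : R * R, [/\ x <= q.1 <= x + hx, y <= q.2 <= y + hy &
   nm (rect g x (x + (hx + hx)) y (y + (hy + hy))) <=
   4 * nm (rect g q.1 (q.1 + hx) q.2 (q.2 + hy))].
Proof.
move=> hx0 hy0; set A := rect g x _ y _.
have E : A = rect g x (x + hx) y (y + hy) + rect g x (x + hx) (y + hy) (y + hy + hy) +
   (rect g (x + hx) (x + hx + hx) y (y + hy) + rect g (x + hx) (x + hx + hx) (y + hy) (y + hy + hy)).
  by rewrite /A !(addrA x) !(addrA y) (rect_splitx g x (x + hx)) !(rect_splity g _ _ y (y + hy) (y + hy + hy)).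
have [h1|h1] := leP (nm A) (4 * nm (rect g x (x + hx) y (y + hy))).
  by exists (x, y); split; rewrite /= ?lexx ?lerDl ?hx0 ?hy0.
have [h2|h2] := leP (nm A) (4 * nm (rect g x (x + hx) (y + hy) (y + hy + hy))).
  by exists (x, y + hy); split; rewrite /= ?lexx ?lerDl ?hx0 ?hy0.
have [h3|h3] := leP (nm A) (4 * nm (rect g (x + hx) (x + hx + hx) y (y + hy))).
  by exists (x + hx, y); split; rewrite /= ?lexx ?lerDl ?hx0 ?hy0.
have [h4|h4] := leP (nm A) (4 * nm (rect g (x + hx) (x + hx + hx) (y + hy) (y + hy + hy))).
  by exists (x + hx, y + hy); split; rewrite /= ?lexx ?lerDl ?hx0 ?hy0.
exfalso; have := nmD (rect g x (x + hx) y (y + hy) + rect g x (x + hx) (y + hy) (y + hy + hy))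
  (rect g (x + hx) (x + hx + hx) y (y + hy) + rect g (x + hx) (x + hx + hx) (y + hy) (y + hy + hy)).
rewrite -E.
have := nmD (rect g x (x + hx) y (y + hy)) (rect g x (x + hx) (y + hy) (y + hy + hy)).
have := nmD (rect g (x + hx) (x + hx + hx) y (y + hy)) (rect g (x + hx) (x + hx + hx) (y + hy) (y + hy + hy)).
by move: h1 h2 h3 h4; lra.
Qed.

(** Completeness of the real line in the form needed by bisection. *)
Lemma nested_limit (p : nat -> R) (a : R) : 0 <= a ->
  (forall n, p n <= p n.+1 <= p n + a / 2 ^+ n.+1) ->
  exists X, forall n, p n <= X <= p n + a / 2 ^+ n.
Proof.
move=> a0 hp.
have pos n : 0 <= a / 2 ^+ n by rewrite divr_ge0 // exprn_ge0.
have half n : a / 2 ^+ n = a / 2 ^+ n.+1 + a / 2 ^+ n.+1.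
  by rewrite exprS; field; rewrite expf_neq0.
have up n k : p n <= p (n + k)%N.
  elim: k => [|k IH]; first by rewrite addn0.
  by rewrite addnS; apply: le_trans IH _; have /andP[] := hp (n + k)%N.
have dn n k : p (n + k)%N + a / 2 ^+ (n + k)%N <= p n + a / 2 ^+ n.
  elim: k => [|k IH]; first by rewrite addn0.
  rewrite addnS; apply: le_trans IH; rewrite [in leRHS]half.
  by have /andP[_] := hp (n + k)%N; lra.
have both n m : p m <= p n + a / 2 ^+ n.
  have [/subnKC <-|/ltnW/subnKC e] := leqP n m.
    by apply: le_trans (dn n (m - n)%N); rewrite lerDl.
  by apply: (@le_trans _ _ (p n)); [rewrite -e|rewrite lerDl].
exists (sup (range p)) => n; apply/andP; split.
  by apply: ub_le_sup; [exists (p 0%N + a / 2 ^+ 0) => _ [m _ <-]; exact: both|exists n].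
by apply: ge_sup; [exists (p n); exists n|move=> _ [m _ <-]; exact: both].
Qed.

Lemma exists_small (a d : R) : 0 <= a -> 0 < d -> exists n : nat, a / 2 ^+ n < d.
Proof.
move=> a0 d0; pose n := (Num.trunc (a / d)).+1; exists n.
have h : a / d < n%:R by exact: truncnS_gt.
have h2 : n%:R <= 2 ^+ n :> R by rewrite -natrX ler_nat; exact/ltnW/ltn_expl.
rewrite ltr_pdivrMr ?exprn_gt0 // mulrC -ltr_pdivrMr //; exact: lt_le_trans h2.
Qed.

(** Goursat's theorem by bisection: at the limit point of a nested sequence of
    quarters, differentiability makes g affine up to a relative error e, so
    the boundary integral over the n-th rectangle is at most e / 4^n times a
    constant, while it is at least 4^-n times the first one. *)
Lemma goursat g x0 x1 y0 y1 : continuous g -> x0 <= x1 -> y0 <= y1 ->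
  (forall x y, x0 <= x <= x1 -> y0 <= y <= y1 -> dC g (x +i* y)) ->
  rect g x0 x1 y0 y1 = 0.
Proof.
move=> cg xx yy dg.
pose a := x1 - x0; pose b := y1 - y0.
have a0 : 0 <= a by rewrite subr_ge0.
have b0 : 0 <= b by rewrite subr_ge0.
have half c n : c / 2 ^+ n = c / 2 ^+ n.+1 + c / 2 ^+ n.+1 :> R.
  by rewrite exprS; field; rewrite expf_neq0.
pose S n (q : R * R) := rect g q.1 (q.1 + a / 2 ^+ n) q.2 (q.2 + b / 2 ^+ n).
have step (nq : nat * (R * R)) : exists q', [/\ nq.2.1 <= q'.1 <= nq.2.1 + a / 2 ^+ nq.1.+1,
    nq.2.2 <= q'.2 <= nq.2.2 + b / 2 ^+ nq.1.+1 & nm (S nq.1 nq.2) <= 4 * nm (S nq.1.+1 q')].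
  rewrite /S (half a nq.1) (half b nq.1); apply: goursat_step; by rewrite divr_ge0 // exprn_ge0.
have [next hn] := choice step.
pose p := fix p n := if n is n'.+1 then next (n', p n') else (x0, y0).
have hp n := hn (n, p n).
have [X hX] : exists X, forall n, (p n).1 <= X <= (p n).1 + a / 2 ^+ n.
  by apply: (nested_limit (p := fun n => (p n).1)) => // n; have [] := hp n.
have [Y hY] : exists X, forall n, (p n).2 <= X <= (p n).2 + b / 2 ^+ n.
  by apply: (nested_limit (p := fun n => (p n).2)) => // n; have [] := hp n.
have grow n : nm (S 0%N (p 0%N)) <= 4 ^+ n * nm (S n (p n)).
  elim: n => [|n IH]; first by rewrite expr0 mul1r.
  apply: le_trans IH _; rewrite exprSr -mulrA ler_wpM2l ?exprn_ge0 //.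
  by have [_ _] := hp n.
have E0 : S 0%N (p 0%N) = rect g x0 x1 y0 y1.
  by rewrite /S /= expr0 !divr1 /a /b !subrKC.
have XY : x0 <= X <= x1 /\ y0 <= Y <= y1.
  by have := hX 0%N; have := hY 0%N; rewrite /= expr0 !divr1 /a /b !subrKC.
rewrite -E0; apply: nm0_eq0; apply/ler_addgt0Pr => e e0; rewrite add0r.
have /dCP[c /is_deriveCP hc] := dg X Y XY.1 XY.2.
set Z := X +i* Y in hc.
pose e' := e / (16 * (a + b + 1) ^+ 2).
have ab1 : 0 < a + b + 1 by rewrite ltr_wpDl // addr_ge0.
have e'0 : 0 < e' by rewrite divr_gt0 // mulr_gt0 // exprn_gt0.
have [d d0 hd] := hc e' e'0.
have [n hnd] := exists_small (addr_ge0 a0 b0) d0.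
apply: le_trans (grow n) _.
have Sn : S n (p n) = rect (fun z => g z - g Z - c * (z - Z)) (p n).1 ((p n).1 + a / 2 ^+ n) (p n).2 ((p n).2 + b / 2 ^+ n).
  rewrite /S.
  have -> : (fun z => g z - g Z - c * (z - Z)) = (fun z => g z + ((- g Z + c * Z) + (- c) * z)).
    by apply/funext => z; ring.
  have ca : continuous (fun z => (- g Z + c * Z) + (- c) * z).
    apply: entire_cont => z.
    by apply: dC_D; [exact: dC_cst|apply: dC_M; [exact: dC_cst|exact: dC_id]].
  by rewrite (rectD _ _ _ _ cg ca) rect_affine addr0.
have an : 0 <= a / 2 ^+ n by rewrite divr_ge0 // exprn_ge0.
have bn : 0 <= b / 2 ^+ n by rewrite divr_ge0 // exprn_ge0.
have bound : nm (S n (p n)) <= 4 * (e' * ((a + b) / 2 ^+ n)) * ((a + b) / 2 ^+ n).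
  rewrite Sn; apply: le_trans (rect_bound (M := e' * ((a + b) / 2 ^+ n)) _ _ _ _) _.
  - have cc : continuous (fun z => g Z + c * (z - Z)).
      apply: entire_cont => z; apply: dC_D; first exact: dC_cst.
      by apply: dC_M; [exact: dC_cst|apply: dC_B; [exact: dC_id|exact: dC_cst]].
    have -> : (fun z => g z - g Z - c * (z - Z)) = (fun z => g z - (g Z + c * (z - Z))).
      by apply/funext => z; ring.
    by move=> z; exact: (contB (cg z) (cc z)).
  - by rewrite lerDl.
  - by rewrite lerDl.
  - move=> x y hx hy.
    have near1 : nm ((x +i* y) - Z) <= (a + b) / 2 ^+ n.
      apply: le_trans (nm_pt _ _ _ _) _; rewrite mulrDl.
      have := hX n; have := hY n => /andP[k1 k2] /andP[k3 k4].
      move: hx hy => /andP[k5 k6] /andP[k7 k8].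
      by apply: lerD; rewrite ler_norml; apply/andP; split; lra.
    have := hd ((x +i* y) - Z) (le_lt_trans near1 hnd); rewrite subrKC => h.
    by apply: le_trans h _; rewrite ler_wpM2l // ltW.
  - have K (u v : R) : u + v - u = v by ring.
    by rewrite !K -mulrDl.
apply: (@le_trans _ _ (4 ^+ n * (4 * (e' * ((a + b) / 2 ^+ n)) * ((a + b) / 2 ^+ n)))).
  by rewrite ler_wpM2l // exprn_ge0.
have -> : 4 ^+ n * (4 * (e' * ((a + b) / 2 ^+ n)) * ((a + b) / 2 ^+ n)) = 4 * e' * (a + b) ^+ 2.
  have -> : 4 ^+ n = 2 ^+ n * 2 ^+ n :> R by rewrite -exprMn; congr (_ ^+ n); ring.
  by field; rewrite expf_neq0.
rewrite /e'.
have h2 : (a + b) ^+ 2 <= (a + b + 1) ^+ 2 by rewrite !expr2; move: a0 b0; nra.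
have -> : 4 * (e / (16 * (a + b + 1) ^+ 2)) * (a + b) ^+ 2 = (e / 4) * ((a + b) ^+ 2 / (a + b + 1) ^+ 2).
  by field; rewrite lt0r_neq0.
have : (a + b) ^+ 2 / (a + b + 1) ^+ 2 <= 1 by rewrite ler_pdivrMr ?exprn_gt0 // mul1r.
have : 0 <= (a + b) ^+ 2 / (a + b + 1) ^+ 2 by rewrite divr_ge0 ?sqr_ge0.
set t := (_ / _); nra.
Qed.

End Goursat.

(** * Taylor expansions of entire functions and Liouville's theorem *)

Definition tau {R : realType} : R := pi *+ 2.

Section CauchyTaylor.
Variable R : realType.
Local Notation C := R[i].
Implicit Types (f g : C -> C) (z w : C) (x y a b : R).

Lemma tau_gt0 : 0 < (tau : R).
Proof. by rewrite /tau mulrn_wgt0 // pi_gt0. Qed.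

Lemma tauR_neq0 : (tau : R) != 0.
Proof. by rewrite lt0r_neq0 // tau_gt0. Qed.

Lemma cancel2 (t e : R) : t != 0 -> 2 * (e / (2 * t)) * t = e.
Proof. by move=> t0; field. Qed.

Lemma cancel4 (t e : R) : t != 0 -> 2 * (e / (4 * t)) * t = e / 2.
Proof. by move=> t0; field. Qed.

(** The integral over a full vertical period; for g = f(z0 + exp _) it is an
    integral over the circle of radius exp x. Circles are handled through the
    exponential so that only rectangles have to be integrated along. *)
Definition vint g x : C := cint (fun y => g (x +i* y)) 0 tau.

Lemma vint_near g x0 (e : R) : continuous g -> 0 < e ->
  exists2 d : R, 0 < d & forall x, `|x - x0| < d -> nm (vint g x - vint g x0) <= 2 * e * tau.
Proof.
move=> cg e0.
have K := @segment_compact R 0 (tau : R); move/compact_near_coveringP in K.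
have := K R (nbhs x0) (fun x y => nm (g (x +i* y) - g (x0 +i* y)) < e) (nbhs_filter x0).
case.
  move=> y _.
  have /contCP/(_ (e/2) (divr_gt0 e0 (ltr0Sn _ 1)))[d d0 hd] := cg (x0 +i* y).
  have d20 : 0 < d / 2 by rewrite divr_gt0.
  exists (ball y (d / 2), ball x0 (d / 2)); first by split; apply/nbhs_ballP; exists (d / 2).
  case=> y' x' [] /=; rewrite /ball /= => hy hx.
  have h1 := hd (x' +i* y'); have h2 := hd (x0 +i* y').
  have {}h1 : nm (g (x' +i* y') - g (x0 +i* y)) < e / 2.
    apply: h1; apply: le_lt_trans (nm_pt _ _ _ _) _; rewrite distrC (distrC y').
    by move: hx hy; rewrite /=; lra.
  have {}h2 : nm (g (x0 +i* y') - g (x0 +i* y)) < e / 2.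
    apply: h2; apply: le_lt_trans (nm_pt _ _ _ _) _; rewrite subrr normr0 distrC.
    by move: hx hy; rewrite /=; lra.
  have -> : g (x' +i* y') - g (x0 +i* y') =
    (g (x' +i* y') - g (x0 +i* y)) - (g (x0 +i* y') - g (x0 +i* y)) by ring.
  by apply: le_lt_trans (nmBD _ _) _; lra.
move=> d /= d0 hd; exists d => // x xd.
have hx : ball x0 d x by rewrite /ball /= distrC.
have {}hd := hd x hx.
have -> : vint g x - vint g x0 = cint (fun y => g (x +i* y) + (-1) * g (x0 +i* y)) 0 tau.
  have c0 := vcont (x:=x0) cg.
  rewrite (cintD _ _ (vcont (x:=x) cg) (fun y => cvgM (@contcst _ _ (-1) y) (c0 y))).
  by rewrite cintZ // mulN1r.
rewrite -[in leRHS](subr0 tau); apply: cint_bound.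
- move=> y; exact: (contD (@vcont _ _ x cg y) (contM (@contcst _ _ (-1) y) (@vcont _ _ x0 cg y))).
- exact/ltW/tau_gt0.
- move=> y hy; rewrite mulN1r; apply/ltW/hd.
  by rewrite /= in_itv.
Qed.

Lemma vint_bound g x (M : R) : continuous g -> (forall y, nm (g (x +i* y)) <= M) ->
  nm (vint g x) <= 2 * M * tau.
Proof.
move=> cg hM; rewrite -[in leRHS](subr0 tau).
by apply: cint_bound; [exact: vcont|exact/ltW/tau_gt0|move=> y _; exact: hM].
Qed.

Lemma vintD f g x : continuous f -> continuous g ->
  vint (fun z => f z + g z) x = vint f x + vint g x.
Proof. by move=> cf cg; exact: (cintD _ _ (vcont (x:=x) cf) (vcont (x:=x) cg)). Qed.

Lemma vintZ (k : C) g x : continuous g -> vint (fun z => k * g z) x = k * vint g x.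
Proof. by move=> cg; exact: (cintZ k 0 tau (vcont (x:=x) cg)). Qed.

Lemma vint_cst (k : C) x : vint (fun=> k) x = k * tau%:C.
Proof. by rewrite /vint cint_cst subr0. Qed.

Definition periodic2 g := forall x, g (x +i* tau) = g (x +i* 0).

(** Cauchy's theorem on a rectangle one period high: the horizontal sides
    cancel by periodicity. Near its vertical sides, where g is only
    continuous, the rectangle is shrunk. *)
Lemma vint_strip g x0 x1 : continuous g -> periodic2 g -> x0 <= x1 ->
  (forall z, x0 < complex.Re z < x1 -> dC g z) -> vint g x0 = vint g x1.
Proof.
move=> cg pg; rewrite le_eqVlt => /orP[/eqP -> //|xx] dg.
have inner s t : x0 < s -> s <= t -> t < x1 -> vint g s = vint g t.
  move=> s0 st t1.
  have : rect g s t 0 tau = 0.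
    apply: goursat => //; first exact/ltW/tau_gt0.
    by move=> x y /andP[h1 h2] _; apply: dg => /=; apply/andP; split; lra.
  rewrite /rect.
  have -> : (fun x => g (x +i* tau)) = (fun x => g (x +i* 0)) by apply/funext.
  rewrite subrr add0r => /eqP; rewrite mulf_eq0 => /orP[|].
    by rewrite -nm_eq0 nmi oner_eq0.
  by rewrite subr_eq0 => /eqP.
apply/eqP; rewrite -subr_eq0; apply/eqP/nm0_eq0/ler_addgt0Pr => e e0; rewrite add0r.
have e'0 : 0 < e / (4 * tau) by rewrite divr_gt0 // mulr_gt0 // tau_gt0.
have [d0 d00 h0] := vint_near x0 cg e'0.
have [d1 d10 h1] := vint_near x1 cg e'0.
pose d := Num.min (x1 - x0) (Num.min d0 d1).
have d_gt0 : 0 < d by rewrite !lt_min subr_gt0 xx d00.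
have [dx [dd0 dd1]] : d <= x1 - x0 /\ d <= d0 /\ d <= d1.
  by rewrite /d !ge_min !lexx !orbT.
clearbody d.
have {}h0 := h0 (x0 + d / 2); have {}h1 := h1 (x1 - d / 2).
have E : vint g (x0 + d / 2) = vint g (x1 - d / 2) by apply: inner; lra.
have -> : vint g x0 - vint g x1 = (vint g (x1 - d / 2) - vint g x1) - (vint g (x0 + d / 2) - vint g x0).
  by rewrite E; ring.
apply: le_trans (nmBD _ _) _.
have k0 : `|x0 + d / 2 - x0| < d0 by rewrite addrAC subrr add0r ger0_norm; lra.
have k1 : `|x1 - d / 2 - x1| < d1 by rewrite addrAC subrr add0r normrN ger0_norm; lra.
have := cancel4 e tauR_neq0.
by have := h0 k0; have := h1 k1; lra.
Qed.

(** The exceptional vertical line is approached from both sides. *)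
Lemma vint_const g (r : R) : continuous g -> periodic2 g ->
  (forall z, complex.Re z != r -> dC g z) -> forall x0 x1, vint g x0 = vint g x1.
Proof.
move=> cg pg dg.
suff H x0 x1 : x0 <= x1 -> vint g x0 = vint g x1.
  by move=> x0 x1; have [/H|/ltW/H] := leP x0 x1.
move=> xx; have [r0|r0] := leP r x0.
  by apply: vint_strip => // z /andP[h _]; apply: dg; rewrite gt_eqF //; exact: le_lt_trans h.
have [r1|r1] := leP x1 r.
  by apply: vint_strip => // z /andP[_ h]; apply: dg; rewrite lt_eqF //; exact: lt_le_trans r1.
rewrite (@vint_strip g x0 r) //; last 2 first.
- exact: ltW.
- by move=> z /andP[_ h]; apply: dg; rewrite lt_eqF.
by apply: vint_strip => //; [exact: ltW|move=> z /andP[h _]; apply: dg; rewrite gt_eqF].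
Qed.

Lemma cexp_tau z : cexp (z + 'i * tau%:C) = cexp z.
Proof. by rewrite cexpD /tau -[(pi *+ 2)]mul1r -[1]/(1%:~R) -ipi2E cexp_2pi mulr1. Qed.

Lemma periodic_cexp (H : C -> C) z0 : periodic2 (fun w => H (z0 + cexp w)).
Proof. by move=> x; rewrite !ptE cexp_tau mulr0 addr0. Qed.

Lemma entire_cexp : entire (@cexp R).
Proof. by move=> z; exact: dC_ex (is_derive_cexp z). Qed.

Lemma dC_circle z0 z : dC (fun w => z0 + cexp w) z.
Proof. by apply: dC_D; [exact: dC_cst|exact: entire_cexp]. Qed.

Lemma cont_circle (H : C -> C) z0 : continuous H -> continuous (fun w => H (z0 + cexp w)).
Proof. by move=> cH w; exact: (@contcomp _ _ (fun w => z0 + cexp w) H w (dC_cont (@dC_circle z0 w)) (cH (z0 + cexp w))). Qed.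

Lemma nm_cexp_pt x y : nm (cexp (x +i* y)) = expR x :> R.
Proof. by rewrite nm_cexp. Qed.

(** The integral does not depend on the radius, even across an exceptional
    point a at which H is only continuous; as the radius tends to 0 it tends
    to H(z0) times the full turn. *)
Lemma circle_mean (H : C -> C) z0 (a : C) x : continuous H -> (forall z, z != a -> dC H z) ->
  vint (fun w => H (z0 + cexp w)) x = H z0 * tau%:C.
Proof.
move=> cH dH.
set g := fun w => _.
have cg : continuous g by exact: cont_circle.
have pg : periodic2 g by exact: periodic_cexp.
have cst : forall x0 x1, vint g x0 = vint g x1.
  apply: (vint_const (r := ln (nm (a - z0)))) => // z zr.
  apply: (dC_comp (@dC_circle z0 z)); apply: dH; apply: contraNneq zr => /(canRL (addKr _)) h.
  by rewrite -(expRK (complex.Re z)) -nm_cexp h addrC.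
rewrite (cst x 0).
apply/eqP; rewrite -subr_eq0; apply/eqP/nm0_eq0/ler_addgt0Pr => e e0; rewrite add0r.
have e'0 : 0 < e / (2 * tau) by rewrite divr_gt0 // mulr_gt0 // tau_gt0.
have /contCP/(_ _ e'0)[d d0 hd] := cH z0.
rewrite (cst 0 (ln (d / 2))).
have -> : vint g (ln (d / 2)) - H z0 * tau%:C = vint (fun w => g w + - H z0) (ln (d / 2)).
  by rewrite (vintD _ cg (fun z => @contcst _ _ (- H z0) z)) vint_cst mulNr.
rewrite -[leRHS](cancel2 e tauR_neq0).
apply: vint_bound.
  by move=> z; exact: (contD (cg z) (@contcst _ _ _ z)).
move=> y; apply/ltW/hd; rewrite addrAC subrr add0r nm_cexp_pt lnK ?posrE ?divr_gt0 //.
by lra.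
Qed.

Definition quo f (a c z : C) : C := if z == a then c else (f z - f a) / (z - a).

Lemma quo_cont f (a c : C) : is_derive a 1 f c -> entire f -> continuous (quo f a c).
Proof.
move=> /is_deriveCP hc ef z; have [->|za] := eqVneq z a; last first.
  apply: (@dC_cont _ _ z).
  apply: (@dC_near _ _ (fun z => (f z - f a) / (z - a))).
    exists (nm (z - a)); first by rewrite nm_gt0 subr_eq0.
    move=> w wz; rewrite /quo; case: eqP => // wa.
    by move: wz; rewrite wa nmB ltxx.
  apply: dC_div; [|apply: dC_B; [exact: dC_id|exact: dC_cst]|by rewrite subr_eq0].
  by apply: dC_B; [exact: ef|exact: dC_cst].
apply/contCP => e e0; have e20 : 0 < e / 2 by rewrite divr_gt0.
have [d d0 hd] := hc _ e20; exists d => // w wd.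
rewrite /quo eqxx; case: (eqVneq w a) => [_|wa]; first by rewrite subrr nm0.
have := hd _ wd; rewrite subrKC => h.
have wa0 : w - a != 0 by rewrite subr_eq0.
have -> : (f w - f a) / (w - a) - c = (f w - f a - c * (w - a)) / (w - a) by field.
rewrite nm_div ltr_pdivrMr ?nm_gt0 //; apply: le_lt_trans h _.
by rewrite ltr_pM2r ?nm_gt0 //; lra.
Qed.

Lemma quo_dC f (a c z : C) : entire f -> z != a -> dC (quo f a c) z.
Proof.
move=> ef za.
apply: (@dC_near _ _ (fun z => (f z - f a) / (z - a))).
  exists (nm (z - a)); first by rewrite nm_gt0 subr_eq0.
  move=> w wz; rewrite /quo; case: eqP => // wa.
  by move: wz; rewrite wa nmB ltxx.
apply: dC_div; [|apply: dC_B; [exact: dC_id|exact: dC_cst]|by rewrite subr_eq0].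
by apply: dC_B; [exact: ef|exact: dC_cst].
Qed.

Definition Epow (n : nat) (w : C) : C := cexp (- (w *+ n)).

Lemma entire_Epow n : entire (Epow n).
Proof.
move=> z; apply: dC_cexp; apply: dC_N.
have -> : (fun x : C => x *+ n) = (fun x : C => n%:R * x) by apply/funext => x; rewrite mulr_natl.
by apply: dC_M; [exact: dC_cst|exact: dC_id].
Qed.

Lemma EpowE n w : Epow n w = (cexp w) ^- n.
Proof. by rewrite /Epow cexpN cexpM_nat. Qed.

(** Taylor coefficients as Cauchy integrals over the unit circle. *)
Definition taylor_coef f z0 n : C := vint (fun w => f (z0 + cexp w) * Epow n w) 0 / tau%:C.

Lemma tau_neq0 : tau%:C != 0 :> C.
Proof. by rewrite (inj_eq (@complexI R) _ 0) lt0r_neq0 // tau_gt0. Qed.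

Lemma cont_fE f z0 n : continuous f -> continuous (fun w => f (z0 + cexp w) * Epow n w).
Proof.
by move=> cf w; exact: (contM (@cont_circle _ z0 cf w) (dC_cont (@entire_Epow n w))).
Qed.

(** The circle may have any radius: the integrand is holomorphic in the
    exponential coordinate. *)
Lemma vint_taylor_coef f z0 n x : entire f ->
  vint (fun w => f (z0 + cexp w) * Epow n w) x = taylor_coef f z0 n * tau%:C.
Proof.
move=> ef; rewrite /taylor_coef divfK ?tau_neq0 //.
apply: (vint_const (r := 0)).
- by apply: cont_fE; exact: entire_cont.
- by move=> y; rewrite !EpowE !ptE cexp_tau mulr0 addr0.
- move=> z _; apply: dC_M; last exact: entire_Epow.
  by apply: (dC_comp (@dC_circle z0 z)); exact: ef.
Qed.

Lemma vint_Epow n x : vint (Epow n) x = (n == 0%N)%:R * tau%:C.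
Proof.
case: n => [|n].
  have -> : Epow 0 = fun=> 1 by apply/funext => w; rewrite EpowE expr0 invr1.
  by rewrite vint_cst.
rewrite mul0r.
have cst x0 x1 : vint (Epow n.+1) x0 = vint (Epow n.+1) x1.
  apply: (vint_const (r := 0)).
  - exact: entire_cont (@entire_Epow _).
  - by move=> y; rewrite !EpowE !ptE cexp_tau mulr0 addr0.
  - by move=> z _; exact: entire_Epow.
apply/nm0_eq0/ler_addgt0Pr => e e0; rewrite add0r.
pose M := e / (2 * tau).
have M0 : 0 < M by rewrite divr_gt0 // mulr_gt0 // tau_gt0.
rewrite (cst x (Num.max 0 (- ln M))).
rewrite -[leRHS](cancel2 e tauR_neq0) -/M.
apply: vint_bound; first exact: entire_cont (@entire_Epow _).
move=> y; rewrite /Epow nm_cexp ReN -[leRHS]lnK ?posrE // ler_expR.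
rewrite -[complex.Re _]/(@complex.Re R ((_ +i* y) *+ n.+1)).
have -> (t : R) (k : nat) : complex.Re ((t +i* y) *+ k) = t *+ k.
  by elim: k => [|k IH] //; rewrite !mulrS ReD IH.
set t := Num.max _ _; have t0 : 0 <= t by rewrite le_max lexx.
have tM : - ln M <= t by rewrite le_max lexx orbT.
rewrite mulrS; have : 0 <= t *+ n by rewrite mulrn_wge0.
lra.
Qed.

(** Cauchy's estimates. *)
Lemma cauchy_estimate f z0 n (r B : R) : entire f -> 0 < r ->
  (forall z, nm (z - z0) = r -> nm (f z) <= B) -> nm (taylor_coef f z0 n) <= 2 * B / r ^+ n.
Proof.
move=> ef r0 hB.
have h : nm (taylor_coef f z0 n * tau%:C) <= 2 * (B / r ^+ n) * tau.
  rewrite -(vint_taylor_coef _ _ (ln r) ef); apply: vint_bound; first exact/cont_fE/entire_cont.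
  move=> y; rewrite nmM EpowE nmV nmX nm_cexp_pt lnK ?posrE // ler_wpM2r //.
    by rewrite invr_ge0 exprn_ge0 // ltW.
  by apply: hB; rewrite addrAC subrr add0r nm_cexp_pt lnK ?posrE.
move: h; rewrite nmM nm_real ger0_norm ?(ltW tau_gt0) // ler_pM2r ?tau_gt0 //.
by rewrite mulrA.
Qed.

End CauchyTaylor.

Section CompactPlane.
Variable R : realType.
Local Notation C := R[i].

Lemma nm_continuous : continuous (@nm R : C -> R).
Proof.
move=> z; apply/(@cvgrPdist_lt _ _ _ _ (nbhs_filter z)) => e e0.
apply/nbhsCP; exists e => // w wz; apply: le_lt_trans wz.
rewrite ler_norml; apply/andP; split.
  by rewrite lerNl opprB; exact: nm_le_sub.
by rewrite nmB; exact: nm_le_sub.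
Qed.

Lemma pt_continuous : continuous (fun q : R * R => q.1 +i* q.2 : C).
Proof.
move=> q; apply/(@cvgCP _ _ _ (nbhs_filter q)) => e e0.
have e20 : 0 < e / 2 by rewrite divr_gt0.
exists (ball q.1 (e / 2), ball q.2 (e / 2)).
  by split; apply/nbhs_ballP; exists (e / 2).
case=> x y [] /=; rewrite /ball /= => hx hy.
by apply: le_lt_trans (nm_pt _ _ _ _) _; rewrite distrC (distrC y); lra.
Qed.

Lemma crect_compact (a b c d : R) :
  compact [set z : C | a <= complex.Re z <= b /\ c <= complex.Im z <= d].
Proof.
have -> : [set z : C | a <= complex.Re z <= b /\ c <= complex.Im z <= d] =
   (fun q : R * R => q.1 +i* q.2) @` (`[a, b] `*` `[c, d]).
  apply/seteqP; split=> [z [h1 h2]|z [[x y] [/= h1 h2] <-]].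
    exists (complex.Re z, complex.Im z); first by split; rewrite /= in_itv.
    exact/eqC.
  by move: h1 h2; rewrite !in_itv.
apply: continuous_compact; last by apply: compact_setX; exact: segment_compact.
by apply: continuous_subspaceT; exact: pt_continuous.
Qed.

Lemma closed_nm_le (z0 : C) (r : R) : closed [set z : C | nm (z - z0) <= r].
Proof.
have -> : [set z : C | nm (z - z0) <= r] = (fun z => nm (z - z0)) @^-1` [set x | x <= r] by [].
apply: closed_comp; last exact: closed_le.
move=> z _; apply: (@continuous_comp _ _ _ (fun z => z - z0) (@nm R)); last exact: nm_continuous.
by apply: contB; [exact: cvg_id|exact: contcst].
Qed.

Lemma cball_compact (z0 : C) (r : R) : compact [set z : C | nm (z - z0) <= r].
Proof.
apply: (subclosed_compact (@closed_nm_le z0 r) (@crect_compact (complex.Re z0 - r) (complex.Re z0 + r)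
   (complex.Im z0 - r) (complex.Im z0 + r))).
move=> z /= h.
have := le_trans (Re_le_nm _) h; have := le_trans (Im_le_nm _) h.
rewrite ReD ImD ReN ImN !ler_norml => /andP[h1 h2] /andP[h3 h4].
by split; apply/andP; split; lra.
Qed.

Lemma cont_bounded (f : C -> C) (z0 : C) (r : R) : continuous f ->
  exists2 B : R, 0 < B & forall z, nm (z - z0) <= r -> nm (f z) <= B.
Proof.
move=> cf; have [r0|r0] := ltP r 0.
  by exists 1 => // z h; have := le_lt_trans (le_trans (nm_ge0 _) h) r0; rewrite ltxx.
have ne : [set z : C | nm (z - z0) <= r] !=set0 by exists z0; rewrite /= subrr nm0.
have [|c _ hc] := @compact_EVT_max _ R (fun z => nm (f z)) _ ne (@cball_compact z0 r).
  apply: continuous_subspaceT => z.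
  by apply: (@continuous_comp _ _ _ f (@nm R)); [exact: cf|exact: nm_continuous].
exists (nm (f c) + 1); first by rewrite ltr_wpDl // nm_ge0.
by move=> z hz; have := hc z; rewrite inE => /(_ hz); lra.
Qed.

End CompactPlane.

Section Taylor.
Variable R : realType.
Local Notation C := R[i].
Implicit Types (f g u v : C -> C) (z w a h : C).

Lemma vint_sum (n : nat) (F : 'I_n -> C -> C) (x : R) : (forall i, continuous (F i)) ->
  vint (fun z => \sum_(i < n) F i z) x = \sum_(i < n) vint (F i) x.
Proof.
elim: n F => [|n IH] F cF.
  rewrite big_ord0; have -> : (fun z => \sum_(i < 0) F i z) = fun=> 0.
    by apply/funext => z; rewrite big_ord0.
  by rewrite vint_cst mul0r.
have -> : (fun z => \sum_(i < n.+1) F i z) =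
    (fun z => \sum_(i < n) F (widen_ord (leqnSn n) i) z + F ord_max z).
  by apply/funext => z; rewrite big_ord_recr.
rewrite vintD; [|by move=> z; apply: contsum => i; exact: cF|exact: cF].
by rewrite big_ord_recr /= IH // => i; exact: cF.
Qed.

(** Put a = z0 + h. The function (z - z0) (f z - f a) / (z - a) vanishes at
    z0, so its mean over the circle of radius r is zero; a finite geometric
    expansion of 1 / (z - a) turns this into the Taylor polynomial and its
    remainder. *)
Lemma taylor_rem f z0 (r B : R) h (n : nat) : entire f -> 0 < r ->
  (forall z, nm (z - z0) <= r -> nm (f z) <= B) -> nm h < r ->
  nm (f (z0 + h) - \sum_(i < n.+1) taylor_coef f z0 i * h ^+ i) <=
    4 * B * (nm h / r) ^+ n.+1 / (1 - nm h / r).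
Proof.
move=> ef r0 hB hr; set a := z0 + h; set rho := nm h / r.
have rho0 : 0 <= rho by rewrite divr_ge0 ?nm_ge0 // ltW.
have rho1 : rho < 1 by rewrite ltr_pdivrMr // mul1r.
have /dCP[c hc] := ef a.
have cf := entire_cont ef.
pose H z := (z - z0) * quo f a c z.
have cid : continuous (fun z : C => z - z0).
  by apply: entire_cont => z; apply: dC_B; [exact: dC_id|exact: dC_cst].
have cH : continuous H.
  by move=> z; exact: (contM (cid z) (@quo_cont _ f a c hc ef z)).
have dH z : z != a -> dC H z.
  move=> za; apply: dC_M; last exact: quo_dC.
  by apply: dC_B; [exact: dC_id|exact: dC_cst].
pose x := ln r.
have I0 := circle_mean z0 x cH dH.
rewrite {2}/H subrr !mul0r in I0.
pose G (i : nat) w := h ^+ i * (f (z0 + cexp w) * Epow i w + (- f a) * Epow i w).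
have cG1 i : continuous (fun w : C => f (z0 + cexp w) * Epow i w) by exact: cont_fE.
have cG2 i : continuous (fun w : C => (- f a) * Epow i w).
  by move=> w; exact: (contM (@contcst _ _ (- f a) w) (dC_cont (@entire_Epow _ i w))).
have cG3 i : continuous (fun w : C => f (z0 + cexp w) * Epow i w + (- f a) * Epow i w).
  by move=> w; exact: (contD (cG1 i w) (cG2 i w)).
have cG i : continuous (G i).
  by move=> w; exact: (contM (@contcst _ _ (h ^+ i) w) (cG3 i w)).
have IG i : vint (G i) x = h ^+ i * (taylor_coef f z0 i * tau%:C - f a * ((i == 0%N)%:R * tau%:C)).
  rewrite /G (vintZ _ _ (cG3 i)) (vintD _ (cG1 i) (cG2 i)) vint_taylor_coef //.
  by rewrite (vintZ _ _ (entire_cont (@entire_Epow _ i))) vint_Epow mulNr.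
have cS : continuous (fun w => \sum_(i < n.+1) G i w).
  by move=> w; apply: contsum => i; exact: cG.
have cHc : continuous (fun w => H (z0 + cexp w)) by exact: cont_circle.
pose rem w := H (z0 + cexp w) + (-1) * (\sum_(i < n.+1) G i w).
have cm : continuous (fun w => (-1) * (\sum_(i < n.+1) G i w)).
  by move=> w; exact: (contM (@contcst _ _ (-1) w) (cS w)).
have crem : continuous rem by move=> w; exact: (contD (cHc w) (cm w)).
have Irem : vint rem x = (f a - \sum_(i < n.+1) taylor_coef f z0 i * h ^+ i) * tau%:C.
  rewrite /rem (vintD _ cHc cm) I0 (vintZ _ _ cS) add0r mulN1r.
  rewrite vint_sum; last by move=> i; exact: cG.
  under eq_bigr => i _ do rewrite IG.
  rewrite mulrBl mulr_suml -sumrN big_ord_recl [in RHS]big_ord_recl /= !expr0 !mul1r mulr1.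
  rewrite sumrN (eq_bigr (fun i : 'I_n => taylor_coef f z0 (bump 0 i) * h ^+ bump 0 i * tau%:C)).
    by ring.
  by move=> i _; rewrite mul0r mulr0 subr0; ring.
have b : nm (vint rem x) <= 2 * (2 * B * rho ^+ n.+1 / (1 - rho)) * tau.
  apply: vint_bound => // y.
  set w := x +i* y; pose q := h / cexp w.
  have nw : nm (cexp w) = r by rewrite nm_cexp_pt lnK.
  have nq : nm q = rho by rewrite nm_div nw.
  have w0 : cexp w != 0 by exact: cexp_neq0.
  have q1 : 1 - q != 0.
    by apply/eqP => /eqP; rewrite subr_eq0 => /eqP q1; move: rho1; rewrite -nq -q1 nm1 ltxx.
  have wh : cexp w - h != 0.
    have -> : cexp w - h = cexp w * (1 - q) by rewrite /q; field.
    by rewrite mulf_neq0.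
  have GE : \sum_(i < n.+1) G i w = (f (z0 + cexp w) - f a) * \sum_(i < n.+1) q ^+ i.
    rewrite mulr_sumr; apply: eq_bigr => i _; rewrite /G !EpowE /q expr_div_n; ring.
  have HE : H (z0 + cexp w) = (f (z0 + cexp w) - f a) / (1 - q).
    rewrite /H /quo; have wa : z0 + cexp w == a = false.
      apply/negbTE; rewrite -subr_eq0 /a.
      by have -> : z0 + cexp w - (z0 + h) = cexp w - h by ring.
    rewrite wa /a /q.
    have -> : z0 + cexp w - (z0 + h) = cexp w - h by ring.
    have -> : 1 - h / cexp w = (cexp w - h) / cexp w by field.
    by field; rewrite wh w0.
  have geo : (1 - q) * \sum_(i < n.+1) q ^+ i = 1 - q ^+ n.+1.
    by rewrite -opprB mulNr -subrX1 opprB.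
  have -> : rem w = (f (z0 + cexp w) - f a) * (q ^+ n.+1 / (1 - q)).
    rewrite /rem GE HE mulN1r -mulrBr; congr (_ * _).
    apply: (mulfI q1); rewrite mulrBr geo mulfV // mulrCA mulfV // mulr1; ring.
  rewrite nmM nm_div nmX nq -mulrA.
  have n1q : 1 - rho <= nm (1 - q) by rewrite -nq -(@nm1 R) nm_le_sub.
  have B0 : 0 <= B by apply: le_trans (nm_ge0 _) (hB z0 _); rewrite subrr nm0 ltW.
  apply: ler_pM; rewrite ?nm_ge0 ?divr_ge0 ?exprn_ge0 ?nm_ge0 //.
    apply: le_trans (nmBD _ _) _.
    have : nm (f (z0 + cexp w)) <= B by apply: hB; rewrite addrAC subrr add0r nw.
    have : nm (f a) <= B by apply: hB; rewrite /a addrAC subrr add0r ltW.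
    lra.
  rewrite ler_wpM2l ?exprn_ge0 // lef_pV2 ?posrE ?subr_gt0 ?nm_gt0 //.
move: b; rewrite Irem nmM nm_real ger0_norm ?(ltW (tau_gt0 R)) // ler_pM2r ?tau_gt0 //.
by move/le_trans; apply; rewrite le_eqVlt; apply/orP; left; apply/eqP; ring.
Qed.

Lemma taylor_local f z0 (n : nat) (B : R) : entire f ->
  (forall z, nm (z - z0) <= 1 -> nm (f z) <= B) ->
  forall h, nm h <= 1 / 2 ->
   nm (f (z0 + h) - \sum_(i < n.+1) taylor_coef f z0 i * h ^+ i) <= 8 * B * nm h ^+ n.+1.
Proof.
move=> ef hB h hh.
have B0 : 0 <= B by apply: le_trans (nm_ge0 _) (hB z0 _); rewrite subrr nm0.
apply: le_trans (@taylor_rem f z0 1 B h n ef ltr01 hB _) _; first by lra.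
rewrite divr1 -!mulrA; set t := nm h ^+ n.+1; have t0 : 0 <= t by rewrite exprn_ge0 ?nm_ge0.
have : (1 - nm h)^-1 <= 2 by rewrite invf_ple ?posrE ?subr_gt0; lra.
have : 0 <= (1 - nm h)^-1 by rewrite invr_ge0; lra.
set s := (1 - nm h)^-1 => s0 s2.
have : B * (t * s) <= B * (t * 2) by rewrite !ler_wpM2l.
lra.
Qed.

Lemma entire_bounded f z0 (r : R) : entire f ->
  exists2 B : R, 0 < B & forall z, nm (z - z0) <= r -> nm (f z) <= B.
Proof. by move=> /entire_cont; exact: cont_bounded. Qed.

Lemma taylor_coef0 f z0 : entire f -> taylor_coef f z0 0 = f z0.
Proof.
move=> ef; have [B B0 hB] := entire_bounded z0 1 ef.
have h12 : 0 <= 1 / 2 :> R by lra.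
have := @taylor_local f z0 0 B ef hB 0; rewrite nm0 => /(_ h12).
rewrite big_ord1 expr1 mulr0 addr0 expr0 mulr1 => /nm0_eq0/eqP.
by rewrite subr_eq0 => /eqP.
Qed.

(** The Taylor remainder of order 2 identifies the first coefficient as the
    derivative. *)
Lemma taylor_coef1 f z0 : entire f -> is_derive z0 1 f (taylor_coef f z0 1).
Proof.
move=> ef; apply/is_deriveCP => e e0; have [B B0 hB] := entire_bounded z0 1 ef.
have hT := @taylor_local f z0 1 B ef hB.
exists (Num.min (1/2) (e / (8 * B))); first by rewrite lt_min !divr_gt0 // mulr_gt0.
move=> h; rewrite lt_min => /andP[h1 h2].
have := hT h (ltW h1); rewrite big_ord_recl big_ord1 /= expr0 mulr1 expr1 taylor_coef0 //.
rewrite opprD addrA => /le_trans; apply.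
rewrite expr2 mulrA ler_wpM2r ?nm_ge0 //.
by move: h2; rewrite ltr_pdivlMr ?mulr_gt0 // mulrC => /ltW.
Qed.

(** Riemann's removable singularity for difference quotients: the Taylor
    expansion of f gives one for the quotient. *)
Lemma quo_entire f a c : is_derive a 1 f c -> entire f -> entire (quo f a c).
Proof.
move=> hc ef z; have [->{z}|za] := eqVneq z a; last exact: quo_dC.
have [B B0 hB] := entire_bounded a 1 ef.
have hT := @taylor_local f a 2 B ef hB.
apply/dCP; exists (taylor_coef f a 2); apply/is_deriveCP => e e0.
exists (Num.min (1/2) (e / (8 * B))); first by rewrite lt_min !divr_gt0 // mulr_gt0.
move=> h; rewrite lt_min => /andP[h1 h2].
have [->|h0] := eqVneq h 0; first by rewrite addr0 subrr mulr0 subrr nm0 mulr0.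
have := hT h (ltW h1); rewrite !big_ord_recl big_ord0 /= expr0 mulr1 expr1 addr0 taylor_coef0 //.
have -> : taylor_coef f a 1 = c by exact: is_deriveC_uniq (taylor_coef1 a ef) hc.
rewrite /quo eqxx; have -> : (a + h == a) = false by rewrite -subr_eq0 addrC addKr (negbTE h0).
have -> : a + h - a = h by rewrite addrC addKr.
rewrite /bump /= !add1n => k.
have -> : (f (a + h) - f a) / h - c - taylor_coef f a 2 * h =
  (f (a + h) - (f a + (c * h + taylor_coef f a 2 * h ^+ 2))) / h by field.
rewrite nm_div ler_pdivrMr ?nm_gt0 //; apply: (le_trans k).
have -> : 8 * B * nm h ^+ 3 = (8 * B * nm h) * (nm h * nm h) by ring.
rewrite -[leRHS]mulrA ler_wpM2r ?mulr_ge0 ?nm_ge0 //.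
by move: h2; rewrite ltr_pdivlMr ?mulr_gt0 // mulrC => /ltW.
Qed.

Lemma entire_factor f a : entire f -> f a = 0 ->
  exists2 g, entire g & forall z, f z = (z - a) * g z.
Proof.
move=> ef fa; have hc := taylor_coef1 a ef; exists (quo f a (taylor_coef f a 1)); first exact: quo_entire.
move=> z; rewrite /quo; case: eqP => [->|/eqP za]; first by rewrite subrr mul0r.
by rewrite fa subr0 mulrCA mulfV ?mulr1 // subr_eq0.
Qed.

Lemma le0_geometric (x K : R) : (forall n : nat, x <= K / 2 ^+ n) -> x <= 0.
Proof.
move=> hx; rewrite leNgt; apply/negP => x0.
have K0 : 0 <= K by have := hx 0%N; rewrite expr0 divr1; lra.
have [n] := exists_small K0 x0; have := hx n; lra.
Qed.

(** All Taylor polynomials of order at least k agree, and on a circle of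
    radius more than 2 |h| their remainders at h decrease geometrically. *)
Lemma taylor_eq f z0 (k : nat) : entire f -> (forall n, (k <= n)%N -> taylor_coef f z0 n = 0) ->
  forall h, f (z0 + h) = \sum_(i < k) taylor_coef f z0 i * h ^+ i.
Proof.
move=> ef h0 h; pose r := 2 * nm h + 1.
have r0 : 0 < r by rewrite /r; have := nm_ge0 h; lra.
have [B B0 hB] := entire_bounded z0 r ef.
apply/eqP; rewrite -subr_eq0; apply/eqP/nm0_eq0.
apply: (@le0_geometric _ (8 * B)) => n.
have hr : nm h < r by rewrite /r; have := nm_ge0 h; lra.
have E : \sum_(i < k) taylor_coef f z0 i * h ^+ i = \sum_(i < (k + n).+1) taylor_coef f z0 i * h ^+ i.
  rewrite -addnS big_split_ord /= [X in _ + X]big1 ?addr0 // => i _.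
  by rewrite h0 ?mul0r //= leq_addr.
rewrite E; apply: le_trans (taylor_rem (k + n) ef r0 hB hr) _.
have rh : nm h / r <= 1 / 2 by rewrite ler_pdivrMr // /r; have := nm_ge0 h; lra.
have rh0 : 0 <= nm h / r by rewrite divr_ge0 ?nm_ge0 ?ltW.
have p1 : (nm h / r) ^+ (k + n).+1 <= (1 / 2) ^+ n.
  apply: (@le_trans _ _ ((1/2) ^+ (k+n).+1)); first by rewrite lerXn2r ?nnegrE //; lra.
  by apply: ler_wiXn2l; [lra|lra|rewrite leqW // leq_addl].
have p2 : (1 - nm h / r)^-1 <= 2 by rewrite invf_ple ?posrE ?subr_gt0; lra.
have p3 : 0 <= (1 - nm h / r)^-1 by rewrite invr_ge0; lra.
have p4 : 0 <= (nm h / r) ^+ (k + n).+1 by rewrite exprn_ge0.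
apply: (@le_trans _ _ (4 * B * (1 / 2) ^+ n * 2)).
  by apply: ler_pM => //; [rewrite !mulr_ge0 // ltW|rewrite ler_wpM2l // mulr_ge0 // ltW].
by rewrite expr_div_n expr1n le_eqVlt; apply/orP; left; apply/eqP; field; rewrite expf_neq0.
Qed.

(** Cauchy's estimates on circles of growing radius kill all coefficients of
    order at least 2. *)
Lemma liouville_linear f (A : R) : entire f -> (forall z, nm (f z) <= A * (1 + nm z)) ->
  exists c d, forall z, f z = c + d * z.
Proof.
move=> ef hA; exists (taylor_coef f 0 0), (taylor_coef f 0 1) => z.
have A0 : 0 <= A by have := le_trans (nm_ge0 _) (hA 0); rewrite nm0 addr0 mulr1.
have := @taylor_eq f 0 2 ef _ z; rewrite !add0r big_ord_recl big_ord1 /= expr0 mulr1 expr1.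
apply=> n n2; apply/nm0_eq0; rewrite leNgt; apply/negP => t0.
set t := nm _ in t0; pose r := Num.max 1 (4 * A / t + 1).
have r1 : 1 <= r by rewrite le_max lexx.
have r0 : 0 < r by lra.
have rt : 4 * A / t < r by rewrite lt_max; apply/orP; right; lra.
have := @cauchy_estimate _ f 0 n r (A * (1 + r)) ef r0; rewrite -/t.
case: (boolP (t <= 2 * (A * (1 + r)) / r ^+ n)) => [h _|_ h]; last first.
  by suff : false by []; apply: h => y; rewrite subr0 => <-; exact: hA.
move: h; rewrite ler_pdivlMr ?exprn_gt0 // => h.
have : r ^+ 2 <= r ^+ n by rewrite ler_weXn2l.
move: rt; rewrite ltr_pdivrMr // => rt h2.
have h3 : t * r ^+ 2 <= t * r ^+ n by rewrite ler_wpM2l // ltW.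
have h4 : A * (1 + r) <= A * (2 * r) by rewrite ler_wpM2l //; lra.
have h5 : t * r * r <= 4 * A * r by move: h3; rewrite expr2; lra.
have : t * r <= 4 * A by move: h5; rewrite ler_pM2r.
by rewrite mulrC; lra.
Qed.

(** Otherwise f is divisible by every power of (z - a), so all its Taylor
    coefficients at a vanish and f is identically zero. *)
Lemma entire_order f a : entire f -> (exists z, f z != 0) ->
  exists k g, [/\ entire g, g a != 0 & forall z, f z = (z - a) ^+ k * g z].
Proof.
move=> ef [z1 fz1]; apply: contrapT => H.
have all k : exists2 g, entire g & forall z, f z = (z - a) ^+ k * g z.
  elim: k => [|k [g eg hg]]; first by exists f => // z; rewrite expr0 mul1r.
  have [ga|ga] := eqVneq (g a) 0; last by case: H; exists k, g.
  have [g' eg' hg'] := entire_factor eg ga; exists g' => // z.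
  by rewrite hg hg' exprSr mulrA.
have t0 n : taylor_coef f a n = 0.
  have [g eg hg] := all n.+1.
  rewrite /taylor_coef; have -> : (fun w => f (a + cexp w) * Epow n w) =
     (fun w => (fun z => (z - a) * g z) (a + cexp w)).
    apply/funext => w; rewrite hg EpowE.
    have -> : a + cexp w - a = cexp w by ring.
    by rewrite exprS; field; rewrite expf_neq0 // cexp_neq0.
  have eH : entire (fun z => (z - a) * g z).
    by move=> z; apply: dC_M; [apply: dC_B; [exact: dC_id|exact: dC_cst]|exact: eg].
  rewrite (circle_mean a 0 (entire_cont eH) (a:=a)); last by move=> z _; exact: eH.
  by rewrite subrr !mul0r.
have := @taylor_eq f a 0 ef (fun n _ => t0 n) (z1 - a).
by rewrite subrKC big_ord0 => /eqP; rewrite (negbTE fz1).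
Qed.

Lemma isolated_zeros f a : entire f -> (exists z, f z != 0) ->
  exists2 d : R, 0 < d & forall z, 0 < nm (z - a) < d -> f z != 0.
Proof.
move=> ef hf; have [k [g [eg ga hg]]] := entire_order a ef hf.
have /contCP/(_ (nm (g a)))[|d d0 hd] := @entire_cont _ g eg a; first by rewrite nm_gt0.
exists d => // z /andP[z0 zd]; rewrite hg mulf_neq0 ?expf_neq0 -?nm_gt0 //.
rewrite nm_gt0; apply/eqP => gz; have := hd z zd; rewrite gz sub0r nmN ltxx //.
Qed.

End Taylor.

Section EntireFunctions.
Variable R : realType.
Local Notation C := R[i].
Implicit Types (f g u v : C -> C) (z w a h : C).

Lemma contC_eps f a : {for a, continuous f} -> forall e : R, 0 < e ->
  exists2 d : R, 0 < d & forall z, nm (z - a) < d -> nm (f z - f a) < e.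
Proof. by move=> /contCP. Qed.

Lemma taylor_local2 f z0 (B : R) : entire f ->
  (forall z, nm (z - z0) <= 1 -> nm (f z) <= B) ->
  forall h, nm h <= 1 / 2 ->
   nm (f (z0 + h) - (f z0 + taylor_coef f z0 1 * h)) <= 8 * B * nm h ^+ 2.
Proof.
move=> ef hB h hh; have := taylor_local 1 ef hB hh.
by rewrite big_ord_recl big_ord1 /= expr0 mulr1 expr1 (taylor_coef0 z0 ef).
Qed.

Lemma point_near a (d : R) : 0 < d -> exists z, 0 < nm (z - a) < d.
Proof.
move=> d0; exists (a + (d / 2)%:C).
have -> : a + (d / 2)%:C - a = (d / 2)%:C by ring.
by rewrite nm_real ger0_norm; [apply/andP; split; lra|lra].
Qed.

(** At a zero of v the bound forces u to vanish to at least the same order, so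
    a power of (z - a) cancels. *)
Lemma quotient_local u v a (A : R) : entire u -> entire v -> (exists z, v z != 0) ->
  (forall z, v z != 0 -> nm (u z) <= A * (1 + nm z) * nm (v z)) ->
  exists W, exists2 d : R, 0 < d & [/\ dC W a, u a = W a * v a &
     forall z, 0 < nm (z - a) < d -> v z != 0 /\ W z = u z / v z].
Proof.
move=> eu ev hv hA.
have [k [v1 [ev1 v1a hv1]]] := entire_order a ev hv.
have [d0 d00 hd0] := isolated_zeros a ev hv.
(* the factors (z - a) are split off from u one at a time, as long as v has
   more of them *)
have [u1 eu1 hu1] : exists2 u1, entire u1 & forall z, u z = (z - a) ^+ k * u1 z.
  suff H j : (j <= k)%N -> exists2 u1, entire u1 & forall z, u z = (z - a) ^+ j * u1 z by exact: H.
  elim: j => [|j IH] jk; first by exists u => // z; rewrite expr0 mul1r.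
  have [uj euj huj] := IH (ltnW jk).
  suff uja : uj a = 0.
    have [u' eu' hu'] := entire_factor euj uja; exists u' => // z.
    by rewrite huj hu' exprSr mulrA.
  apply/nm0_eq0/ler_addgt0Pr => e e0; rewrite add0r.
  have e20 : 0 < e / 2 by rewrite divr_gt0.
  have [d1 d10 hd1] := contC_eps (dC_cont (euj a)) e20.
  have [B B0 hB] := entire_bounded a 1 ev1.
  have M0 : 0 < `|A| * (2 + nm a) * B + 1.
    by rewrite ltr_wpDl // !mulr_ge0 ?addr_ge0 ?nm_ge0 // ltW.
  pose d := Num.min (Num.min d0 d1) (Num.min 1 (e / 2 / (`|A| * (2 + nm a) * B + 1))).
  have d_gt0 : 0 < d by rewrite !lt_min d00 d10 ltr01 divr_gt0.
  have [z /andP[z0 zd]] := point_near a d_gt0.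
  move: zd; rewrite !lt_min => /andP[/andP[z1 z2] /andP[z3 z4]].
  have vz : v z != 0 by apply: hd0; rewrite z0.
  have := hA z vz; rewrite huj hv1 !nmM !nmX.
  set t := nm (z - a) in z0 z1 z2 z3 z4 *.
  rewrite -{1}(subnKC jk) exprD exprSr => h.
  have tj : 0 < t ^+ j by rewrite exprn_gt0.
  have {}h : nm (uj z) <= A * (1 + nm z) * (t * t ^+ (k - j.+1) * nm (v1 z)).
    rewrite -(ler_pM2l tj); apply: le_trans h _.
    by rewrite le_eqVlt; apply/orP; left; apply/eqP; ring.
  have nz : nm z <= 1 + nm a.
    by rewrite -(subrK a z); apply: le_trans (nmD _ _) _; rewrite lerD2r ltW.
  have vB : nm (v1 z) <= B by apply: hB; exact: ltW.
  have tk : t ^+ (k - j.+1) <= 1 by rewrite exprn_ile1 // ltW.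
  have tk0 : 0 <= t ^+ (k - j.+1) by rewrite exprn_ge0 // ltW.
  have h2 : nm (uj z) <= `|A| * (2 + nm a) * B * t.
    apply: le_trans h _.
    apply: (@le_trans _ _ (`|A| * (1 + nm z) * (t * t ^+ (k - j.+1) * nm (v1 z)))).
      have q0 : 0 <= t * t ^+ (k - j.+1) * nm (v1 z) by rewrite !mulr_ge0 ?nm_ge0 // ltW.
      rewrite (ler_wpM2r q0) //; have q1 : 0 <= 1 + nm z by rewrite addr_ge0 ?nm_ge0.
      by rewrite (ler_wpM2r q1) // ler_norm.
    have -> : `|A| * (2 + nm a) * B * t = `|A| * (2 + nm a) * (t * 1 * B) by ring.
    have t0 := ltW z0; have B0' := ltW B0.
    apply: ler_pM; rewrite ?mulr_ge0 ?addr_ge0 ?nm_ge0 //.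
      by apply: ler_wpM2l; [exact: normr_ge0|lra].
    by apply: ler_pM; rewrite ?mulr_ge0 ?nm_ge0 // ler_wpM2l.
  have h3 : (`|A| * (2 + nm a) * B + 1) * t < e / 2.
    by move: z4; rewrite ltr_pdivlMr // mulrC.
  have h4 := hd1 z z2.
  have h5 : nm (uj a) <= nm (uj z - uj a) + nm (uj z).
    have := nmBD (uj z) (uj z - uj a).
    have -> : uj z - (uj z - uj a) = uj a by ring.
    lra.
  by move: h3; rewrite mulrDl; move: z0; lra.
exists (fun z => u1 z / v1 z), d0 => //; split.
- by apply: dC_div; [exact: eu1|exact: ev1|].
- by rewrite hu1 hv1; field.
- move=> z zd; have vz := hd0 z zd; split=> //.
  rewrite hu1 hv1; have : (z - a) ^+ k != 0.
    by rewrite expf_neq0 // -nm_gt0; case/andP: zd.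
  move: vz; rewrite hv1 mulf_eq0 negb_or => /andP[_ v1z] za.
  by field; rewrite v1z za.
Qed.

(** Liouville's theorem for quotients: u / v has removable singularities and
    at most linear growth, hence is a polynomial of degree at most one. Every
    meromorphic function below is handled as such a pair of entire functions. *)
Lemma quotient_liouville u v (A : R) : entire u -> entire v -> (exists z, v z != 0) ->
  (forall z, v z != 0 -> nm (u z) <= A * (1 + nm z) * nm (v z)) ->
  exists c d, forall z, u z = (c + d * z) * v z.
Proof.
move=> eu ev hv hA.
have H a : exists om : C, exists W, exists2 d : R, 0 < d & [/\ dC W a, om = W a,
   u a = W a * v a & forall z, 0 < nm (z - a) < d -> v z != 0 /\ W z = u z / v z].
  have [W [d d0 [h1 h2 h3]]] := quotient_local a eu ev hv hA.
  by exists (W a), W, d.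
have [om hom] := choice H.
pose w z := if v z != 0 then u z / v z else om z.
have loc a : exists W, exists2 d : R, 0 < d & dC W a /\ forall z, nm (z - a) < d -> w z = W z.
  have [W [d d0 [h1 h2 h3 h4]]] := hom a; exists W, d => //; split=> // z zd.
  have [->|za] := eqVneq z a.
    rewrite /w; case: ifP => [va|_]; last exact: h2.
    by rewrite h3 mulfK.
  have [|vz ->] := h4 z; first by rewrite zd nm_gt0 subr_eq0 za.
  by rewrite /w vz.
have ew : entire w.
  by move=> a; have [W [d d0 [dW hW]]] := loc a; apply: dC_near dW; exists d.
have uw z : u z = w z * v z.
  rewrite /w; case: ifP => [vz|/negbFE/eqP vz]; first by rewrite divfK.
  by have [W [d d0 [_ _ -> _]]] := hom z; rewrite vz !mulr0.
have A0 : 0 <= `|A| by [].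
have growth z : nm (w z) <= (2 * `|A| + 1) * (1 + nm z).
  have [vz|vz] := eqVneq (v z) 0; last first.
    have n0 : 0 < nm (v z) by rewrite nm_gt0.
    have := hA z vz; rewrite uw nmM ler_pM2r // => /le_trans; apply.
    rewrite ler_wpM2r ?addr_ge0 ?nm_ge0 //; have := ler_norm A; lra.
  have [d1 d10 hd1] := contC_eps (dC_cont (ew z)) (ltr01 (R:=R)).
  have [d2 d20 hd2] := isolated_zeros z ev hv.
  pose d := Num.min 1 (Num.min d1 d2).
  have d_gt0 : 0 < d by rewrite !lt_min ltr01 d10.
  have [y /andP[y0 yd]] := point_near z d_gt0.
  move: yd; rewrite !lt_min => /and3P[y1 y2 y3].
  have vy : v y != 0 by apply: hd2; rewrite y0.
  have n0 : 0 < nm (v y) by rewrite nm_gt0.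
  have := hA y vy; rewrite uw nmM ler_pM2r // => hy.
  have ny : nm y <= 1 + nm z.
    by rewrite -(subrK z y); apply: le_trans (nmD _ _) _; rewrite lerD2r ltW.
  have h4 := hd1 y y2.
  have h5 : nm (w z) <= nm (w y - w z) + nm (w y).
    have := nmBD (w y) (w y - w z).
    have -> : w y - (w y - w z) = w z by ring.
    lra.
  have h6 : A * (1 + nm y) <= `|A| * (2 + nm z).
    apply: (@le_trans _ _ (`|A| * (1 + nm y))).
      by rewrite ler_wpM2r ?addr_ge0 ?nm_ge0 ?ler_norm.
    by rewrite ler_wpM2l //; lra.
  have := nm_ge0 z; nra.
have [c [d hcd]] := liouville_linear ew growth.
by exists c, d => z; rewrite uw hcd.
Qed.

Definition loc_unif (F : nat -> C -> C) f := forall (r e : R), 0 < e ->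
  exists N, forall n z, (N <= n)%N -> nm z <= r -> nm (F n z - f z) <= e.

Lemma loc_unif_cont (F : nat -> C -> C) f : (forall n, entire (F n)) -> loc_unif F f ->
  continuous f.
Proof.
move=> eF hF a; apply/contCP => e e0.
have e40 : 0 < e / 4 by rewrite divr_gt0.
have [N hN] := hF (nm a + 1) (e / 4) e40.
have [d d0 hd] := contC_eps (dC_cont (eF N a)) e40.
exists (Num.min 1 d); first by rewrite lt_min ltr01.
move=> z; rewrite lt_min => /andP[z1 z2].
have nz : nm z <= nm a + 1.
  by rewrite -(subrK a z) addrC; apply: le_trans (nmD _ _) _; rewrite lerD2l ltW.
have h1 := hN N z (leqnn _) nz.
have h2 : nm (F N a - f a) <= e / 4 by apply: hN => //; lra.
have h3 := hd z z2.
have -> : f z - f a = (F N z - F N a) - (F N z - f z) + (F N a - f a) by ring.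
have := nmD (F N z - F N a - (F N z - f z)) (F N a - f a).
have := nmBD (F N z - F N a) (F N z - f z).
lra.
Qed.

(** The Taylor coefficients, being integrals, converge with the functions, and
    the Taylor remainder bound is preserved in the limit. *)
Lemma weierstrass_limit (F : nat -> C -> C) f : (forall n, entire (F n)) -> loc_unif F f ->
  entire f.
Proof.
move=> eF hF a; have cf := loc_unif_cont eF hF.
have [B B0 hB] := cont_bounded a 1 cf.
apply/dCP; exists (taylor_coef f a 1); apply/is_deriveCP => e e0.
exists (Num.min (1/2) (e / (8 * (B + 1)))).
  by rewrite lt_min !divr_gt0 // mulr_gt0 // ltr_wpDl // ltW.
move=> h; rewrite lt_min => /andP[h1 h2].
apply: (@le_trans _ _ (8 * (B + 1) * nm h ^+ 2)); last first.
  rewrite expr2 mulrA ler_wpM2r ?nm_ge0 //.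
  by move: h2; rewrite ltr_pdivlMr ?mulr_gt0 ?ltr_wpDl ?(ltW B0) // mulrC => /ltW.
apply/ler_addgt0Pr => eta eta0.
pose e' := Num.min 1 (eta / 4).
have e'0 : 0 < e' by rewrite lt_min ltr01 divr_gt0.
have [e'1 e'2] : e' <= 1 /\ e' <= eta / 4 by rewrite /e' !ge_min !lexx orbT.
clearbody e'.
have [N hN] := hF (nm a + 1) e' e'0.
have hN1 z : nm (z - a) <= 1 -> nm (F N z - f z) <= e'.
  move=> za; apply: hN => //; rewrite -(subrK a z) addrC.
  by apply: le_trans (nmD _ _) _; rewrite lerD2l.
have hB1 z : nm (z - a) <= 1 -> nm (F N z) <= B + 1.
  move=> za; have := hN1 z za; have := hB z za.
  by have := nmD (F N z - f z) (f z); rewrite subrK; lra.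
have T := taylor_local2 (eF N) hB1 (ltW h1).
have tcd : nm (taylor_coef (F N) a 1 - taylor_coef f a 1) <= 2 * e'.
  have c1 := cont_fE (z0:=a) (n:=1%N) (entire_cont (eF N)).
  have c2 := cont_fE (z0:=a) (n:=1%N) cf.
  have c3 : continuous (fun w => (-1) * (f (a + cexp w) * Epow 1 w)).
    by move=> w; exact: (contM (@contcst _ _ (-1) w) (c2 w)).
  have -> : taylor_coef (F N) a 1 - taylor_coef f a 1 =
    vint (fun w => F N (a + cexp w) * Epow 1 w + (-1) * (f (a + cexp w) * Epow 1 w)) 0 / tau%:C.
    by rewrite (vintD _ c1 c3) (vintZ _ _ c2) /taylor_coef; ring.
  rewrite nm_div nm_real ger0_norm ?(ltW (tau_gt0 R)) // ler_pdivrMr ?tau_gt0 //.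
  apply: vint_bound; first by move=> w; exact: (contD (c1 w) (c3 w)).
  move=> y; set w := _ +i* y; rewrite mulN1r -mulrBl nmM EpowE nmV nmX nm_cexp_pt expR0 expr1n invr1 mulr1.
  by apply: hN1; rewrite addrAC subrr add0r nm_cexp_pt expR0.
have a0 : nm (a - a) <= 1 by rewrite subrr nm0.
have ah : nm (a + h - a) <= 1 by rewrite addrAC subrr add0r; lra.
have k1 := hN1 _ ah; have k2 := hN1 _ a0.
have -> : f (a + h) - f a - taylor_coef f a 1 * h =
  (F N (a + h) - (F N a + taylor_coef (F N) a 1 * h)) - (F N (a + h) - f (a + h)) + (F N a - f a)
  + (taylor_coef (F N) a 1 - taylor_coef f a 1) * h by ring.
set X := (F N (a + h) - _) in T *.
have := nmD (X - (F N (a + h) - f (a + h)) + (F N a - f a)) ((taylor_coef (F N) a 1 - taylor_coef f a 1) * h).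
have := nmD (X - (F N (a + h) - f (a + h))) (F N a - f a).
have := nmBD X (F N (a + h) - f (a + h)).
rewrite nmM.
have : nm (taylor_coef (F N) a 1 - taylor_coef f a 1) * nm h <= 2 * e' * 1.
  by apply: ler_pM; rewrite ?nm_ge0 //; lra.
lra.
Qed.

(** The derivative of an entire function as a Taylor coefficient, a form in
    which it is visibly entire in turn. *)
Definition cderive f z := taylor_coef f z 1.

Lemma cderiveP f z : entire f -> is_derive z 1 f (cderive f z).
Proof. exact: taylor_coef1. Qed.

Lemma cderive_eq f z c : is_derive z 1 f c -> entire f -> cderive f z = c.
Proof. by move=> h ef; exact: is_deriveC_uniq (cderiveP z ef) h. Qed.

(** The derivative is the locally uniform limit of difference quotients, each
    of which is entire. *)
Lemma entire_cderive f : entire f -> entire (cderive f).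
Proof.
move=> ef.
pose F (n : nat) z := (f (z + (n.+2%:R^-1)%:C) - f z) * n.+2%:R.
apply: (@weierstrass_limit F).
  move=> n z; apply: dC_M; last exact: dC_cst.
  apply: dC_B; last exact: ef.
  apply: (@dC_comp _ f (fun z => z + (n.+2%:R^-1)%:C)); last exact: ef.
  by apply: dC_D; [exact: dC_id|exact: dC_cst].
move=> r e e0; have [B B0 hB] := entire_bounded 0 (r + 1) ef.
pose N := (Num.trunc (8 * B / e)).+1; exists N => n z Nn zr.
have hB1 y : nm (y - z) <= 1 -> nm (f y) <= B.
  move=> yz; apply: hB; rewrite subr0 -(subrK z y) addrC.
  by apply: le_trans (nmD _ _) _; apply: lerD.
set h := n.+2%:R^-1 : R.
have n20 : 0 < n.+2%:R :> R by rewrite ltr0n.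
have h0 : 0 < h by rewrite invr_gt0.
have h2 : h <= 1 / 2 by rewrite /h div1r lef_pV2 ?posrE // ler_nat.
have nh : nm (h%:C) = h by rewrite nm_real ger0_norm // ltW.
have hh : nm (h%:C : C) <= 1 / 2 by rewrite nh.
have T := taylor_local2 ef hB1 hh.
rewrite nh in T.
have hC : (h%:C : C) = n.+2%:R^-1 by rewrite /h fmorphV rmorph_nat.
have n2C : (n.+2%:R : C) != 0 by rewrite pnatr_eq0.
have -> : F n z - cderive f z = (f (z + h%:C) - (f z + taylor_coef f z 1 * h%:C)) * n.+2%:R.
  by rewrite /F /cderive -/h hC; field.
rewrite nmM nm_nat; apply: (@le_trans _ _ (8 * B * h ^+ 2 * n.+2%:R)).
  by rewrite ler_wpM2r // ltW.
have -> : 8 * B * h ^+ 2 * n.+2%:R = 8 * B * h by rewrite /h; field.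
rewrite /h ler_pdivrMr // -ler_pdivrMl // [leLHS]mulrC.
apply: (@le_trans _ _ N%:R); first by apply: ltW; exact: truncnS_gt.
by rewrite ler_nat; lia.
Qed.

End EntireFunctions.

(** * Symmetric products and the geometry of the lattice *)

Section Sequences.
Variable R : realType.
Local Notation C := R[i].
Implicit Types (a b : nat -> C) (l : C).

Lemma seqCP a l : a @ \oo --> l <->
  forall e : R, 0 < e -> exists N, forall n, (N <= n)%N -> nm (a n - l) < e.
Proof.
split=> [/(@cvgCP _ _ \oo _) h e e0|h].
  by have [N _ hN] := h e e0; exists N => n Nn; exact: hN.
apply/(@cvgCP _ _ \oo _) => e e0; have [N hN] := h e e0.
by exists N => // n /= Nn; exact: hN.
Qed.

Lemma seqC_uniq a l l' : a @ \oo --> l -> a @ \oo --> l' -> l = l'.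
Proof.
move=> /seqCP h /seqCP h'; apply/eqP; rewrite -subr_eq0; apply/eqP/nm0_eq0.
apply/ler_addgt0Pr => e e0; rewrite add0r.
have e20 : 0 < e / 2 by rewrite divr_gt0.
have [N hN] := h _ e20; have [N' hN'] := h' _ e20.
have k1 := hN (maxn N N') (leq_maxl _ _); have k2 := hN' (maxn N N') (leq_maxr _ _).
have -> : l - l' = (a (maxn N N') - l') - (a (maxn N N') - l) by ring.
by apply: le_trans (nmBD _ _) _; lra.
Qed.

Lemma real_cauchy (x : nat -> R) : (forall e : R, 0 < e -> exists N, forall m n,
   (N <= m)%N -> (N <= n)%N -> `|x m - x n| < e) -> exists l : R, x @ \oo --> l.
Proof.
move=> h; suff : cvg (x @ \oo) by move=> c; exists (lim (x @ \oo)).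
apply/cauchy_cvgP/cauchyP => e e0.
have [N hN] := h e e0; exists (x N); exists N => // n /= Nn.
by rewrite /ball /=; apply: hN.
Qed.

Lemma complex_cauchy a : (forall e : R, 0 < e -> exists N, forall m n,
   (N <= m)%N -> (N <= n)%N -> nm (a m - a n) < e) -> exists l, a @ \oo --> l.
Proof.
move=> h.
have [|lr hr] := @real_cauchy (fun n => complex.Re (a n)).
  move=> e e0; have [N hN] := h e e0; exists N => m n Nm Nn.
  by rewrite -ReN -ReD; apply: le_lt_trans (Re_le_nm _) _; exact: hN.
have [|li hi] := @real_cauchy (fun n => complex.Im (a n)).
  move=> e e0; have [N hN] := h e e0; exists N => m n Nm Nn.
  by rewrite -ImN -ImD; apply: le_lt_trans (Im_le_nm _) _; exact: hN.
exists (lr +i* li); apply/seqCP => e e0.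
have e20 : 0 < e / 2 by rewrite divr_gt0.
move/cvgrPdist_lt/(_ _ e20): hr => [N1 _ h1].
move/cvgrPdist_lt/(_ _ e20): hi => [N2 _ h2].
exists (maxn N1 N2) => n; rewrite geq_max => /andP[n1 n2].
have := h1 n n1; have := h2 n n2 => /= k2 k1.
apply: le_lt_trans (nm_le_ReIm _) _; rewrite ReD ReN ImD ImN /= distrC (distrC (complex.Im _)).
lra.
Qed.

Lemma cvg_ReIm a l : (fun n => complex.Re (a n)) @ \oo --> complex.Re l ->
  (fun n => complex.Im (a n)) @ \oo --> complex.Im l -> a @ \oo --> l.
Proof.
move=> hr hi; apply/seqCP => e e0.
have e20 : 0 < e / 2 by rewrite divr_gt0.
move/cvgrPdist_lt/(_ _ e20): hr => [N1 _ h1].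
move/cvgrPdist_lt/(_ _ e20): hi => [N2 _ h2].
exists (maxn N1 N2) => n; rewrite geq_max => /andP[n1 n2].
have := h1 n n1; have := h2 n n2 => /= k2 k1.
apply: le_lt_trans (nm_le_ReIm _) _; rewrite ReD ReN ImD ImN /= distrC (distrC (complex.Im _)).
lra.
Qed.

Lemma seqC_bound a l (B : R) : a @ \oo --> l -> (exists N, forall n, (N <= n)%N -> nm (a n) <= B) ->
  nm l <= B.
Proof.
move=> /seqCP h [N hN]; apply/ler_addgt0Pr => e e0; have [M hM] := h e e0.
have k1 := hM (maxn N M) (leq_maxr _ _); have k2 := hN (maxn N M) (leq_maxl _ _).
have -> : l = a (maxn N M) - (a (maxn N M) - l) by ring.
by apply: le_trans (nmBD _ _) _; lra.
Qed.

Lemma inv_nat_small (K e : R) : 0 < e -> exists N : nat, forall n, (N <= n)%N -> K / n.+1%:R < e.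
Proof.
move=> e0; exists (Num.trunc (K / e)).+1 => n Nn.
have h : K / e < (Num.trunc (K / e)).+1%:R by exact: truncnS_gt.
rewrite ltr_pdivrMr ?ltr0n // mulrC -ltr_pdivrMr //; apply: lt_le_trans h _.
by rewrite ler_nat; lia.
Qed.

End Sequences.

Section NearOne.
Variable R : realType.
Local Notation C := R[i].

(** A product of n factors within d of 1 stays within 2 n d of 1 as long as n
    d is at most one half. *)
Lemma prod_near1 (I : Type) (s : seq I) (x : I -> C) (d : R) : 0 <= d ->
  2 * (size s)%:R * d <= 1 -> (forall i, nm (x i - 1) <= d) ->
  nm (\prod_(i <- s) x i - 1) <= 2 * (size s)%:R * d.
Proof.
move=> d0; elim: s => [|i s IH] hs hx; first by rewrite big_nil subrr nm0 mulr0 mul0r.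
rewrite big_cons /=; set P := \prod_(i <- s) x i in IH *.
have s0 : 0 <= (size s)%:R :> R by rewrite ler0n.
move: hs; rewrite /= -natr1 => hs.
have n0 : 0 <= 2 * (size s)%:R * d by rewrite !mulr_ge0.
have h1 : nm (P - 1) <= 2 * (size s)%:R * d by apply: IH => //; nra.
have h2 := hx i.
have -> : x i * P - 1 = (P - 1) * (x i - 1) + (P - 1) + (x i - 1) by ring.
apply: le_trans (nmD _ _) _.
have := nmD ((P - 1) * (x i - 1)) (P - 1).
have : nm ((P - 1) * (x i - 1)) <= 1 * d.
  by rewrite nmM; apply: ler_pM; rewrite ?nm_ge0 //; nra.
nra.
Qed.

End NearOne.

Section SymmetricProducts.
Variable R : realType.
Local Notation C := R[i].
Implicit Types (F G : int -> C) (K : nat).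

(** Product over the integers m with |m| at most K, the shape in which the
    partial products of sigma arrive. *)
Definition rprod K F : C := \prod_(i < K.*2.+1) F ((i : nat)%:Z - K%:Z).
Definition rsum K F : C := \sum_(i < K.*2.+1) F ((i : nat)%:Z - K%:Z).

Lemma rprod0 F : rprod 0 F = F 0.
Proof. by rewrite /rprod big_ord1. Qed.

Lemma rprodS K F : rprod K.+1 F = F (- K.+1%:Z) * rprod K F * F K.+1%:Z.
Proof.
rewrite /rprod doubleS big_ord_recl /= big_ord_recr /= mulrA.
congr (_ * _ * _).
- by congr F; rewrite sub0r.
- by apply: eq_bigr => i _; congr F; rewrite /bump /=; lia.
- by congr F; rewrite /bump /=; lia.
Qed.

Lemma rprodM K F G : rprod K (fun m => F m * G m) = rprod K F * rprod K G.
Proof. exact: big_split. Qed.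

Lemma rprod_ext K F G : (forall m, (`|m|%N <= K)%N -> F m = G m) -> rprod K F = rprod K G.
Proof. by move=> h; apply: eq_bigr => i _; apply: h; have := ltn_ord i; lia. Qed.

Lemma rprod_opp K F : rprod K (fun m => F (- m)) = rprod K F.
Proof.
elim: K => [|K IH]; first by rewrite !rprod0 oppr0.
by rewrite !rprodS IH opprK; ring.
Qed.

Lemma rprod_cexp K F : rprod K (fun m => cexp (F m)) = cexp (rsum K F).
Proof. by rewrite /rprod /rsum cexp_sum. Qed.

Lemma rprod_cst K (c : C) : rprod K (fun=> c) = c ^+ K.*2.+1.
Proof. by rewrite /rprod prodr_const card_ord. Qed.

Lemma rprod_eq0 K F m : (`|m|%N <= K)%N -> F m = 0 -> rprod K F = 0.
Proof.
move=> mK Fm; have h : (`|(m + K%:Z)%R|%N < K.*2.+1)%N by lia.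
rewrite /rprod (bigD1 (Ordinal h)) //=.
have -> : (`|(m + K%:Z)%R|%N)%:Z - K%:Z = m by lia.
by rewrite Fm mul0r.
Qed.

Lemma rprod_neq0 K F : (forall m, (`|m|%N <= K)%N -> F m != 0) -> rprod K F != 0.
Proof.
move=> h; apply/prodf_neq0 => i _; apply: h; have := ltn_ord i; lia.
Qed.

Lemma rprodV K F : rprod K (fun m => (F m)^-1) = (rprod K F)^-1.
Proof. by rewrite /rprod prodfV. Qed.

(** Translating the index by one only exchanges the two extreme factors. All
    telescoping in the quasi-periodicity of sigma comes from here. *)
Lemma rprod_shift K F : rprod K (fun m => F (m - 1)) * F K%:Z = rprod K F * F (- K.+1%:Z).
Proof.
elim: K => [|K IH]; first by rewrite !rprod0 sub0r mulrC.
rewrite !rprodS.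
have -> : K.+1%:Z - 1 = K%:Z by lia.
have -> : - K.+1%:Z - 1 = - K.+2%:Z by lia.
rewrite -(mulrA _ _ (F K)) IH; ring.
Qed.

Lemma rsum_opp K F : rsum K (fun m => F (- m)) = rsum K F.
Proof.
rewrite /rsum (reindex_inj rev_ord_inj) /=; apply: eq_bigr => i _; congr F.
by have := ltn_ord i; lia.
Qed.

Lemma rsumZ K (c : C) F : rsum K (fun m => c * F m) = c * rsum K F.
Proof. by rewrite /rsum mulr_sumr. Qed.

Lemma rsumN K F : rsum K (fun m => - F m) = - rsum K F.
Proof. by rewrite /rsum sumrN. Qed.

Lemma rsumD K F G : rsum K (fun m => F m + G m) = rsum K F + rsum K G.
Proof. exact: big_split. Qed.

Lemma rprod_near1 K F (d : R) : 0 <= d -> 2 * K.*2.+1%:R * d <= 1 ->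
  (forall m, (`|m|%N <= K)%N -> nm (F m - 1) <= d) -> nm (rprod K F - 1) <= 2 * K.*2.+1%:R * d.
Proof.
move=> d0 hK hF; have := @prod_near1 R _ (index_enum 'I_K.*2.+1) (fun i => F ((i : nat)%:Z - K%:Z)) d d0.
have -> : size (index_enum 'I_K.*2.+1) = K.*2.+1.
  by rewrite -[index_enum _]/(Finite.enum _) -enumT size_enum_ord.
by apply=> // i; apply: hF; have := ltn_ord i; lia.
Qed.

(** A product of 2 K + 1 factors that are 1 + O(1 / K^2). *)
Lemma rprod_cvg1 (x : nat -> int -> C) (B : R) : 0 <= B ->
  (exists N, forall K, (N <= K)%N -> forall m, (`|m|%N <= K)%N -> nm (x K m - 1) <= B / K.+1%:R ^+ 2) ->
  (fun K => rprod K (x K)) @ \oo --> (1 : C).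
Proof.
move=> B0 [N hN]; apply/seqCP => e e0.
pose e' := Num.min 1 e; have e'0 : 0 < e' by rewrite lt_min ltr01 e0.
have [e1' e2'] : e' <= 1 /\ e' <= e by rewrite /e' !ge_min !lexx orbT.
clearbody e'; have [M hM] := inv_nat_small (4 * B) e'0.
exists (maxn N M) => K; rewrite geq_max => /andP[NK MK].
have K0 : 0 < K.+1%:R :> R by rewrite ltr0n.
have h4 : 2 * K.*2.+1%:R * (B / K.+1%:R ^+ 2) <= 4 * B / K.+1%:R.
  have -> : 4 * B / K.+1%:R = 2 * (2 * K.+1%:R) * (B / K.+1%:R ^+ 2) by field; rewrite lt0r_neq0.
  rewrite ler_wpM2r ?divr_ge0 ?exprn_ge0 ?(ltW K0) // ler_wpM2l // -natrM ler_nat; lia.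
have h5 := hM K MK.
apply: le_lt_trans (rprod_near1 _ _ (hN K NK)) _.
- by rewrite divr_ge0 // exprn_ge0 // ltW.
- by apply: le_trans h4 _; exact/ltW/(lt_le_trans h5 e1').
- by apply: le_lt_trans h4 _; exact: lt_le_trans h5 e2'.
Qed.

End SymmetricProducts.

Section LatticeGeometry.
Variables (R : realType) (e1 e2 : R[i]).
Hypothesis e_gen : lattice_generators e1 e2.
Local Notation C := R[i].
Implicit Types (z w : C).

(** The signed area of the period parallelogram. *)
Definition ldet : R := complex.Re e1 * complex.Im e2 - complex.Im e1 * complex.Re e2.

Lemma ldet_neq0 : ldet != 0.
Proof.
apply/eqP => d0.
have [] := e_gen (s := complex.Im e2) (t := - complex.Im e1).
  apply: eqC; rewrite !(ReD, ImD, ReM, ImM) /=; last by ring.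
  by rewrite -[RHS]d0 /ldet; ring.
move=> i2 /eqP; rewrite oppr_eq0 => /eqP i1.
have [] := e_gen (s := complex.Re e2) (t := - complex.Re e1).
  apply: eqC; rewrite !(ReD, ImD, ReM, ImM) /=; first by ring.
  by rewrite i1 i2; ring.
move=> r2 /eqP; rewrite oppr_eq0 => /eqP r1.
have [] := e_gen (s := 1) (t := 0); last by move/eqP; rewrite oner_eq0.
by apply: eqC; rewrite !(ReD, ImD, ReM, ImM) /= r1 r2 i1 i2; ring.
Qed.

(** Real coordinates with respect to the basis e1, e2, by Cramer's rule. *)
Definition crd1 z : R := (complex.Re z * complex.Im e2 - complex.Im z * complex.Re e2) / ldet.
Definition crd2 z : R := (complex.Re e1 * complex.Im z - complex.Im e1 * complex.Re z) / ldet.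

Lemma crdE z : z = (crd1 z)%:C * e1 + (crd2 z)%:C * e2.
Proof.
have d0 := ldet_neq0; apply: eqC; rewrite !(ReD, ImD, ReM, ImM) /= /crd1 /crd2 /ldet; field; exact: d0.
Qed.

Lemma crd_comb (s t : R) : crd1 (s%:C * e1 + t%:C * e2) = s /\ crd2 (s%:C * e1 + t%:C * e2) = t.
Proof.
have d0 := ldet_neq0; split; rewrite /crd1 /crd2 !(ReD, ImD, ReM, ImM) /= /ldet; field; exact: d0.
Qed.

Lemma crd1D z w : crd1 (z + w) = crd1 z + crd1 w.
Proof. by rewrite /crd1 ReD ImD -mulrDl; congr (_ / _); ring. Qed.
Lemma crd2D z w : crd2 (z + w) = crd2 z + crd2 w.
Proof. by rewrite /crd2 ReD ImD -mulrDl; congr (_ / _); ring. Qed.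
Lemma crd1N z : crd1 (- z) = - crd1 z.
Proof. by have d0 := ldet_neq0; rewrite /crd1 ReN ImN; field. Qed.
Lemma crd2N z : crd2 (- z) = - crd2 z.
Proof. by have d0 := ldet_neq0; rewrite /crd2 ReN ImN; field. Qed.

Lemma lattE (m n : int) : latt e1 e2 m n = (m%:~R : R)%:C * e1 + (n%:~R : R)%:C * e2.
Proof. by rewrite /latt !rmorph_int. Qed.

Lemma crd_latt (m n : int) : crd1 (latt e1 e2 m n) = m%:~R /\ crd2 (latt e1 e2 m n) = n%:~R.
Proof. by rewrite lattE; exact: crd_comb. Qed.

Definition lbound : R := (nm e1 + nm e2) / `|ldet|.

Lemma lbound_ge0 : 0 <= lbound.
Proof. by rewrite divr_ge0 // addr_ge0 ?nm_ge0. Qed.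

Lemma crd_le z : `|crd1 z| <= 2 * lbound * nm z /\ `|crd2 z| <= 2 * lbound * nm z.
Proof.
have d0 : 0 < `|ldet| by rewrite normr_gt0 ldet_neq0.
have h (a b c d : R) M : `|a| <= nm z -> `|b| <= M -> `|c| <= nm z -> `|d| <= M ->
   M <= nm e1 + nm e2 -> `|(a * b - c * d) / ldet| <= 2 * lbound * nm z.
  move=> ha hb hc hd hM; rewrite normrM normfV ler_pdivrMr //.
  have -> : 2 * lbound * nm z * `|ldet| = 2 * (nm z * (nm e1 + nm e2)).
    by rewrite /lbound; field; rewrite lt0r_neq0.
  apply: le_trans (ler_normB _ _) _; rewrite !normrM.
  have : `|a| * `|b| <= nm z * (nm e1 + nm e2) by apply: ler_pM => //; lra.
  have : `|c| * `|d| <= nm z * (nm e1 + nm e2) by apply: ler_pM => //; lra.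
  lra.
split.
  apply: (h _ _ _ _ (nm e2)); rewrite ?Re_le_nm ?Im_le_nm //.
  by rewrite lerDr nm_ge0.
rewrite /crd2 (mulrC (complex.Re e1)) (mulrC (complex.Im e1)).
apply: (h _ _ _ _ (nm e1)); rewrite ?Re_le_nm ?Im_le_nm //.
by rewrite lerDl nm_ge0.
Qed.

Lemma lattice_crd z : lattice e1 e2 z <-> exists m n : int, crd1 z = m%:~R /\ crd2 z = n%:~R.
Proof.
split=> [[m [n ->]]|[m [n [h1 h2]]]]; first by exists m, n; exact: crd_latt.
by exists m, n; rewrite {1}(crdE z) h1 h2 lattE.
Qed.

Lemma lattice0 : lattice e1 e2 0.
Proof. by exists 0, 0; rewrite /latt !mul0r addr0. Qed.

Lemma latticeD z w : lattice e1 e2 z -> lattice e1 e2 w -> lattice e1 e2 (z + w).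
Proof.
by move=> [m [n ->]] [m' [n' ->]]; exists (m + m'), (n + n'); rewrite /latt !rmorphD /=; ring.
Qed.

Lemma latticeN z : lattice e1 e2 z -> lattice e1 e2 (- z).
Proof. by move=> [m [n ->]]; exists (- m), (- n); rewrite /latt !rmorphN /=; ring. Qed.

Lemma latticeB z w : lattice e1 e2 z -> lattice e1 e2 w -> lattice e1 e2 (z - w).
Proof. by move=> hz hw; apply: latticeD => //; exact: latticeN. Qed.

Lemma lattice_e1 : lattice e1 e2 e1.
Proof. by exists 1, 0; rewrite /latt mul1r mul0r addr0. Qed.
Lemma lattDr z w : lattice e1 e2 w -> lattice e1 e2 (z + w) <-> lattice e1 e2 z.
Proof.
move=> hw; split=> [h|h]; last exact: latticeD.
by rewrite -(addrK w z); exact: latticeB.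
Qed.

(** The coordinates are bounded by a multiple of the modulus, so lattice
    vectors with a large index are large. *)
Lemma latt_ge (m n : int) (K : nat) : (K <= `|m| \/ K <= `|n|)%N ->
  K%:R <= 2 * lbound * nm (latt e1 e2 m n).
Proof.
have nat_abs (k : int) : (`|k|%N)%:R = `|k%:~R| :> R by rewrite -intr_norm -natr_absz pmulrn.
have [h1 h2] := crd_le (latt e1 e2 m n); have [c1 c2] := crd_latt m n.
case=> h; [apply: le_trans h1|apply: le_trans h2]; rewrite ?c1 ?c2 -nat_abs ler_nat //.
Qed.

Lemma lattice_discrete : exists2 d : R, 0 < d & forall z, lattice e1 e2 z -> nm z < d -> z = 0.
Proof.
have b0 : 0 < 2 * lbound + 1 by have := lbound_ge0; lra.
exists (2 * lbound + 1)^-1; first by rewrite invr_gt0.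
move=> z [m [n ->]]; set w := latt _ _ _ _ => wd.
have w1 : 2 * lbound * nm w < 1.
  have : (2 * lbound + 1) * nm w < 1 by rewrite mulrC -ltr_pdivlMr // mul1r.
  by have := nm_ge0 w; lra.
have H (k : nat) : (k <= `|m| \/ k <= `|n|)%N -> (k = 0)%N.
  move=> /latt_ge; rewrite -/w => hk; have : k%:R < 1%:R :> R by lra.
  by rewrite ltr_nat; lia.
have m0 : m = 0 by have := H `|m|%N (or_introl (leqnn _)); lia.
have n0 : n = 0 by have := H `|n|%N (or_intror (leqnn _)); lia.
by rewrite /w m0 n0 /latt !mul0r addr0.
Qed.

End LatticeGeometry.

(** * The Weierstrass sigma function *)

Section ElementaryFactor.
Variable R : realType.
Local Notation C := R[i].

(** The elementary factor of genus 2, (1 - u) exp(u + u^2 / 2). *)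
Definition elementary (u : C) : C := (1 - u) * cexp (u + 2^-1 * u ^+ 2).

Lemma is_derive_elementary (u : C) : is_derive u 1 elementary (- u ^+ 2 * cexp (u + 2^-1 * u ^+ 2)).
Proof.
have h1 : is_derive u 1 (fun u : C => 1 - u) (0 - 1).
  exact: (is_deriveC_B (@is_deriveC_cst R 1 u) (@is_deriveC_id R u)).
have h2 : is_derive u 1 (fun u : C => u + 2^-1 * (u * u)) (1 + (0 * (u * u) + 2^-1 * (1 * u + u * 1))).
  exact: (is_deriveC_D (@is_deriveC_id R u) (is_deriveC_M (@is_deriveC_cst R 2^-1 u)
    (is_deriveC_M (@is_deriveC_id R u) (@is_deriveC_id R u)))).
have h3 := is_deriveC_comp h2 (@is_derive_cexp R (u + 2^-1 * (u * u))).
have := is_deriveC_M h1 h3.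
have -> : (fun x : C => (1 - x) * cexp (x + 2^-1 * (x * x))) = elementary by apply/funext => x; rewrite /elementary expr2.
congr (is_derive _ _ _ _); rewrite -expr2.
by set X := cexp _; field.
Qed.

Lemma entire_elementary : entire elementary.
Proof. by move=> u; exact: dC_ex (@is_derive_elementary u). Qed.

(** The derivative is - u^2 exp(u + u^2 / 2), so the first two Taylor
    coefficients of the elementary factor vanish. *)
Lemma elementary_bound : exists2 A : R, 0 < A & forall u, nm u <= 1 -> nm (elementary u - 1) <= A * nm u ^+ 3.
Proof.
have eE1 : entire (fun u => elementary u - 1).
  by move=> u; apply: dC_B; [exact: entire_elementary|exact: dC_cst].
have E0 : elementary 0 - 1 = 0.
  by rewrite /elementary expr0n mulr0 addr0 cexp0 subr0 mulr1 subrr.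
have [q1 eq1 hq1] := entire_factor eE1 E0.
have d1 u : cderive q1 u * u + q1 u = - u ^+ 2 * cexp (u + 2^-1 * u ^+ 2).
  have h1 : is_derive u 1 (fun u => elementary u - 1) (- u ^+ 2 * cexp (u + 2^-1 * u ^+ 2) - 0).
    exact: (is_deriveC_B (@is_derive_elementary u) (@is_deriveC_cst R 1 u)).
  have h2 : is_derive u 1 (fun u => elementary u - 1) ((1 - 0) * q1 u + (u - 0) * cderive q1 u).
    have -> : (fun u => elementary u - 1) = (fun u => (u - 0) * q1 u) by apply/funext.
    exact: (is_deriveC_M (is_deriveC_B (@is_deriveC_id R u) (@is_deriveC_cst R 0 u)) (@cderiveP R q1 u eq1)).
  by have := is_deriveC_uniq h1 h2; rewrite subr0 => ->; ring.
have q10 : q1 0 = 0 by have := d1 0; rewrite mulr0 add0r expr0n oppr0 mul0r.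
have [q2 eq2 hq2] := entire_factor eq1 q10.
have d2 u : cderive q1 u = q2 u + u * cderive q2 u.
  apply: cderive_eq => //.
  have -> : q1 = (fun u => (u - 0) * q2 u) by apply/funext.
  have -> : q2 u + u * cderive q2 u = (1 - 0) * q2 u + (u - 0) * cderive q2 u by ring.
  exact: (is_deriveC_M (is_deriveC_B (@is_deriveC_id R u) (@is_deriveC_cst R 0 u)) (@cderiveP R q2 u eq2)).
pose k u := 2 * q2 u + u * cderive q2 u + u * cexp (u + 2^-1 * u ^+ 2).
have ek : entire k.
  move=> u; apply: dC_D; first apply: dC_D.
  - by apply: dC_M; [exact: dC_cst|exact: eq2].
  - by apply: dC_M; [exact: dC_id|exact: entire_cderive].
  - apply: dC_M; first exact: dC_id.
    apply: dC_cexp; apply: dC_D; first exact: dC_id.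
    by apply: dC_M; [exact: dC_cst|apply: dC_X; exact: dC_id].
have k0 u : u != 0 -> k u = 0.
  move=> u0; apply: (mulfI u0); rewrite mulr0 /k.
  have := d1 u; rewrite d2 hq2 subr0 => h.
  have -> : u * (2 * q2 u + u * cderive q2 u + u * cexp (u + 2^-1 * u ^+ 2)) =
    ((q2 u + u * cderive q2 u) * u + u * q2 u) + u ^+ 2 * cexp (u + 2^-1 * u ^+ 2) by ring.
  by rewrite h mulNr addNr.
have kz : k 0 = 0.
  apply: contrapT => /eqP kn0.
  have n0 : 0 < nm (k 0) by rewrite nm_gt0.
  have [d d0 hd] := contC_eps (dC_cont (ek 0)) n0.
  have [z /andP[z0 zd]] := point_near 0 d0; have := hd z zd.
  by rewrite k0 ?sub0r ?nmN ?ltxx // -(subr0 z) -nm_gt0.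
have q20 : q2 0 = 0.
  move: kz; rewrite /k !mul0r !addr0 => /eqP; rewrite mulf_eq0 pnatr_eq0 /= => /eqP //.
have [q3 eq3 hq3] := entire_factor eq2 q20.
have [B B0 hB] := entire_bounded 0 1 eq3.
exists B => // u u1; rewrite hq1 hq2 hq3 !subr0 !nmM.
have -> : nm u * (nm u * (nm u * nm (q3 u))) = nm (q3 u) * nm u ^+ 3 by ring.
by rewrite ler_wpM2r ?exprn_ge0 ?nm_ge0 //; apply: hB; rewrite subr0.
Qed.

Lemma sigma_factorE (e z : C) : sigma_factor e z = elementary (z / e).
Proof. by rewrite /sigma_factor /elementary expr_div_n. Qed.

End ElementaryFactor.

Lemma ring_size1 K : (K.+1.*2.+1 <= 3 * K.+1)%N.
Proof. lia. Qed.

Lemma ring_size2 K : (K.*2.+1 <= 3 * K.+1)%N.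
Proof. lia. Qed.

Section InfiniteProduct.
Variable R : realType.
Local Notation C := R[i].

(** Multiplying by factors 1 + O(1 / K^2) changes a product by a relative
    error O(1 / K1) from K1 on; the bound on the partial products is carried
    along by the induction. *)
Lemma product_tail (P : nat -> C) (D : R) (K1 : nat) : 0 <= D -> (0 < K1)%N -> 2 * D <= K1%:R ->
  (forall K, (K1 <= K)%N -> nm (P K.+1 - P K) <= nm (P K) * (D / K.+1%:R ^+ 2)) ->
  forall K, (K1 <= K)%N -> nm (P K - P K1) <= nm (P K1) * (2 * D / K1%:R).
Proof.
move=> D0 K10 DK h.
have K1R : 0 < K1%:R :> R by rewrite ltr0n.
suff H K : (K1 <= K)%N -> nm (P K - P K1) <= nm (P K1) * (2 * D * (K1%:R^-1 - K%:R^-1)).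
  move=> K KK; apply: le_trans (H K KK) _; rewrite ler_wpM2l ?nm_ge0 //.
  rewrite ler_wpM2l ?mulr_ge0 // lerBlDr lerDl invr_ge0 ler0n //.
move=> /subnKC <-; elim: (K - K1)%N => [|k IH].
  by rewrite addn0 !subrr nm0 mulr0 mulr0.
rewrite addnS; set n := (K1 + k)%N in IH *.
have n0 : 0 < n%:R :> R by rewrite ltr0n /n; lia.
have n1 : 0 < n.+1%:R :> R by rewrite ltr0n.
have := h n (leq_addr _ _) => hn.
set p := nm (P K1) in IH *; have p0 : 0 <= p by exact: nm_ge0.
have le1 : 2 * D * (K1%:R^-1 - n%:R^-1) <= 1.
  apply: (@le_trans _ _ (2 * D * K1%:R^-1)).
    by rewrite ler_wpM2l ?mulr_ge0 // lerBlDr lerDl invr_ge0 ltW.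
  by rewrite ler_pdivrMr // mul1r.
have Pn : nm (P n) <= 2 * p.
  have : nm (P n) <= nm (P n - P K1) + p by rewrite -{1}(subrK (P K1) (P n)) nmD.
  have : p * (2 * D * (K1%:R^-1 - n%:R^-1)) <= p * 1 by rewrite ler_wpM2l.
  by move: IH; lra.
have inv1 : (n.+1%:R ^+ 2)^-1 <= n%:R^-1 - n.+1%:R^-1 :> R.
  have -> : n%:R^-1 - n.+1%:R^-1 = (n%:R * n.+1%:R)^-1 :> R.
    by rewrite -natr1; field; rewrite natr1 !lt0r_neq0.
  rewrite lef_pV2 ?posrE ?exprn_gt0 ?mulr_gt0 // expr2 ler_wpM2r ?(ltW n1) //.
  by rewrite ler_nat.
have -> : P n.+1 - P K1 = (P n.+1 - P n) + (P n - P K1) by ring.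
apply: le_trans (nmD _ _) _.
have s1 : nm (P n) * (D / n.+1%:R ^+ 2) <= 2 * p * (D * (n%:R^-1 - n.+1%:R^-1)).
  apply: ler_pM; rewrite ?nm_ge0 ?divr_ge0 ?exprn_ge0 ?(ltW n1) //.
  by rewrite ler_wpM2l.
move: IH (le_trans hn s1); set a := n%:R^-1; set b := n.+1%:R^-1; set c := K1%:R^-1; lra.
Qed.

End InfiniteProduct.

Section WeierstrassSigma.
Variables (R : realType) (e1 e2 : R[i]).
Hypothesis e_gen : lattice_generators e1 e2.
Local Notation C := R[i].
Implicit Types (z w : C).
Local Notation latt := (latt e1 e2).
Local Notation sigma := (weierstrass_sigma e1 e2).

(** The factor of sigma at the lattice point of index (m, n), with 1 in place
    of the missing factor at the origin. *)
Definition sf z (m n : int) : C := if (m == 0) && (n == 0) then 1 else elementary (z / latt m n).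
(** Product over the square of indices of absolute value at most K. *)
Definition r2 K (F : int -> int -> C) := rprod K (fun m => rprod K (F m)).
(** The partial products whose limit, multiplied by z, is sigma. *)
Definition Pp K z := r2 K (sf z).
(** The function sigma(z) / z, continued to the origin. *)
Definition Pinf z : C := lim ((fun K => Pp K z) @ \oo).

Lemma sigmaE z : sigma z = z * Pinf z.
Proof.
have H (f g : nat -> C) : f = g -> lim (f @ \oo) = lim (g @ \oo) by move=> ->.
rewrite /weierstrass_sigma /Pinf; congr (_ * _); apply: H; apply/funext => K.
apply: eq_bigr => i _; rewrite big_mkcond; apply: eq_bigr => j _ /=.
rewrite /sf sigma_factorE xpair_eqE !subr_eq0 !eqz_nat.
by case: ((i : nat) == K) => //=; case: ((j : nat) == K).
Qed.

(** The factors on the boundary of the square of size K + 1; consecutive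
    squares differ by this ring. *)
Definition ring_prod K (F : int -> int -> C) :=
  rprod K.+1 (F (- K.+1%:Z)) * rprod K (fun m => F m (- K.+1%:Z)) *
  rprod K (fun m => F m K.+1%:Z) * rprod K.+1 (F K.+1%:Z).

Lemma r2S K F : r2 K.+1 F = ring_prod K F * r2 K F.
Proof.
rewrite /r2 /ring_prod rprodS.
have -> : rprod K (fun m => rprod K.+1 (F m)) =
   rprod K (fun m => F m (- K.+1%:Z)) * rprod K (fun m => rprod K (F m)) * rprod K (fun m => F m K.+1%:Z).
  by rewrite -!rprodM; congr (rprod _ _); apply/funext => m; rewrite rprodS.
by ring.
Qed.

(** On the ring of size K + 1 the elementary factors are 1 + O(1 / K^3), and
    there are O(K) of them. *)
Lemma ring_near1 (r : R) : 0 <= r -> exists2 D : R, 0 <= D & exists K0, forall K z,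
  (K0 <= K)%N -> nm z <= r -> nm (ring_prod K (sf z) - 1) <= D / K.+1%:R ^+ 2.
Proof.
move=> r0; have [A A0 hA] := elementary_bound R.
pose b := 2 * lbound e1 e2; have b0 : 0 <= b by rewrite mulr_ge0 // lbound_ge0.
pose G := A * (r * b) ^+ 3.
have G0 : 0 <= G by rewrite mulr_ge0 ?(ltW A0) // exprn_ge0 // mulr_ge0.
have Gdef : G = A * (r * b) ^+ 3 by [].
clearbody G; exists (48 * G); first by rewrite mulr_ge0.
have [N1 hN1] := inv_nat_small (r * b) (ltr01 (R:=R)).
have [N2 hN2] := inv_nat_small (48 * G) (ltr01 (R:=R)).
exists (maxn N1 N2) => K z; rewrite geq_max => /andP[K1 K2] zr.
have k1 := hN1 K K1; have k2 := hN2 K K2.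
set k := K.+1%:R : R in k1 k2 *.
have kp : 0 < k by rewrite ltr0n.
have kge1 : 1 <= k by rewrite ler1n.
pose d := G / k ^+ 3; have d0 : 0 <= d by rewrite divr_ge0 // exprn_ge0 // ltW.
have near m n : (K.+1 <= `|m| \/ K.+1 <= `|n|)%N -> nm (sf z m n - 1) <= d.
  move=> mn; have hl := latt_ge e_gen mn.
  rewrite /sf; case: ifP => [_|nz]; first by rewrite subrr nm0.
  have lp : 0 < nm (latt m n).
    by rewrite lt_neqAle nm_ge0 andbT; apply: contraTneq hl => <-; rewrite mulr0 -ltNge.
  have u : nm (z / latt m n) <= r * b / k.
    rewrite nm_div ler_pdivrMr //.
    have -> : r * b / k * nm (latt m n) = r * (b * nm (latt m n) / k) by ring.
    apply: le_trans zr _; rewrite ler_peMr // ler_pdivlMr // mul1r.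
    exact: hl.
  have u1 : nm (z / latt m n) <= 1 by apply: le_trans u (ltW k1).
  apply: le_trans (hA _ u1) _.
  have -> : d = A * (r * b / k) ^+ 3 by rewrite /d Gdef; field; rewrite lt0r_neq0.
  have rbk : 0 <= r * b / k by rewrite divr_ge0 ?(ltW kp) // mulr_ge0.
  by rewrite ler_wpM2l ?(ltW A0) // lerXn2r // nnegrE ?nm_ge0 ?rbk.
pose eta := 6 * G / k ^+ 2.
have eta0 : 0 <= eta by apply: divr_ge0; [exact: mulr_ge0|exact/exprn_ge0/ltW].
have keta : 8 * eta = 48 * G / k ^+ 2 by rewrite /eta; ring.
have eta1 : 8 * eta <= 1.
  rewrite keta; apply: le_trans (ltW k2).
  rewrite ler_wpM2l ?mulr_ge0 // lef_pV2 ?posrE ?exprn_gt0 // expr2 ler_peMl // ltW.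
have size3 (n : nat) : (n <= 3 * K.+1)%N -> 2 * n%:R * d <= eta.
  move=> hn; have -> : eta = 2 * (3 * K.+1)%:R * d.
    by rewrite /eta /d natrM -/k; field; rewrite lt0r_neq0.
  by rewrite ler_wpM2r // ler_wpM2l // ler_nat.
have s1 := size3 _ (ring_size1 K); have s2 := size3 _ (ring_size2 K).
clear size3; clearbody eta d; have eta_le1 : eta <= 1 by lra.
have s3 := le_trans s1 eta_le1; have s4 := le_trans s2 eta_le1.
have b1 : nm (rprod K.+1 (sf z (- K.+1%:Z)) - 1) <= eta.
  by apply: le_trans s1; apply: rprod_near1 => // m _; apply: near; left; rewrite abszN.
have b2 : nm (rprod K (fun m => sf z m (- K.+1%:Z)) - 1) <= eta.
  by apply: le_trans s2; apply: rprod_near1 => // m _; apply: near; right; rewrite abszN.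
have b3 : nm (rprod K (fun m => sf z m K.+1%:Z) - 1) <= eta.
  by apply: le_trans s2; apply: rprod_near1 => // m _; apply: near; right.
have b4 : nm (rprod K.+1 (sf z K.+1%:Z) - 1) <= eta.
  by apply: le_trans s1; apply: rprod_near1 => // m _; apply: near; left.
rewrite -keta /ring_prod.
set B1 := rprod _ _ in b1 *; set B2 := rprod _ _ in b2 *.
set B3 := rprod _ _ in b3 *; set B4 := rprod _ _ in b4 *.
pose B (i : nat) := nth 1 [:: B1; B2; B3; B4] i.
have := @prod_near1 R nat [:: 0; 1; 2; 3]%N B eta eta0.
rewrite !big_cons big_nil /= mulr1 !mulrA => h; apply: le_trans (h _ _) _; try lra.
move=> i; rewrite /B; do 4 (case: i => [|i] //=).
by rewrite nth_nil subrr nm0.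
Qed.

Lemma entire_Pp K : entire (Pp K).
Proof.
move=> z; apply: dC_prod => i _; apply: dC_prod => j _; rewrite /sf.
case: (_ && _); first exact: dC_cst.
apply: (@dC_comp _ (@elementary R)); last exact: entire_elementary.
by apply: dC_M; [exact: dC_id|exact: dC_cst].
Qed.

Lemma Pp_tail (r : R) : 0 <= r -> exists2 D : R, 0 <= D & exists K1 : nat,
  [/\ (0 < K1)%N, 2 * D < K1%:R & forall J K z, (K1 <= J)%N -> (J <= K)%N -> nm z <= r ->
    nm (Pp K z - Pp J z) <= nm (Pp J z) * (2 * D / J%:R)].
Proof.
move=> r0; have [D D0 [K0 hK0]] := ring_near1 r0; exists D => //.
pose M := (Num.trunc (2 * D)).+1.
have hM : 2 * D < M%:R by exact: truncnS_gt.
exists (maxn K0 M); split.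
- by rewrite leq_max orbT.
- by apply: lt_le_trans hM _; rewrite ler_nat leq_maxr.
- move=> J K z KJ JK zr; move: KJ; rewrite geq_max => /andP[KJ MJ].
  apply: (@product_tail R (fun K => Pp K z)) => //; first exact: leq_trans MJ.
    by apply: le_trans (ltW hM) _; rewrite ler_nat.
  move=> L JL; rewrite /Pp r2S.
  have -> : ring_prod L (sf z) * r2 L (sf z) - r2 L (sf z) = r2 L (sf z) * (ring_prod L (sf z) - 1) by ring.
  by rewrite nmM ler_wpM2l ?nm_ge0 //; apply: hK0 => //; exact: leq_trans JL.
Qed.

Lemma Pp_bounded (r : R) : 0 <= r -> exists2 B : R, 0 < B & exists K1 : nat,
  (0 < K1)%N /\ forall J K z, (K1 <= J)%N -> (J <= K)%N -> nm z <= r ->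
    nm (Pp K z - Pp J z) <= B / J%:R.
Proof.
move=> r0; have [D D0 [K1 [K10 DK1 h]]] := Pp_tail r0.
have [B B0 hB] := entire_bounded 0 r (@entire_Pp K1).
exists (2 * B * (2 * D) + 1); first by rewrite ltr_wpDl // !mulr_ge0 // ltW.
exists K1; split=> // J K z KJ JK zr.
have zB : nm (Pp K1 z) <= B by apply: hB; rewrite subr0.
have J0 : 0 < J%:R :> R by rewrite ltr0n (leq_trans K10).
have JB : nm (Pp J z) <= 2 * B.
  have hh := h K1 J z (leqnn _) KJ zr.
  have K1R : 0 < K1%:R :> R by rewrite ltr0n.
  have : nm (Pp K1 z) * (2 * D / K1%:R) <= B * 1.
    apply: ler_pM; rewrite ?nm_ge0 ?divr_ge0 ?mulr_ge0 ?(ltW K1R) //.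
    by rewrite ler_pdivrMr // mul1r ltW.
  have := nmD (Pp J z - Pp K1 z) (Pp K1 z); rewrite subrK; lra.
apply: le_trans (h J K z KJ JK zr) _; rewrite mulrA ler_wpM2r ?invr_ge0 ?(ltW J0) //.
have : nm (Pp J z) * (2 * D) <= 2 * B * (2 * D) by rewrite ler_wpM2r // mulr_ge0.
lra.
Qed.

Lemma small_over (B e : R) (K1 : nat) : 0 < e -> exists J, (K1 <= J)%N /\ (0 < J)%N /\ forall n, (J <= n)%N -> B / n%:R < e.
Proof.
move=> e0; have [N hN] := inv_nat_small B e0; exists (maxn K1 N).+1.
split; first by rewrite (leq_trans (leq_maxl K1 N)).
split=> // -[//|n]; rewrite ltnS geq_max => /andP[_ Nn]; exact: hN.
Qed.

Lemma Pp_cvg z : (fun K => Pp K z) @ \oo --> Pinf z.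
Proof.
have [B B0 [K1 [K10 h]]] := Pp_bounded (nm_ge0 z).
have [|l hl] := @complex_cauchy R (fun K => Pp K z).
  move=> e e0; have e20 : 0 < e / 2 by rewrite divr_gt0.
  have [J [KJ [J0 hJ]]] := small_over B K1 e20; exists J => m n Jm Jn.
  have := h J m z KJ Jm (lexx _); have := h J n z KJ Jn (lexx _); have := hJ J (leqnn _).
  have -> : Pp m z - Pp n z = (Pp m z - Pp J z) - (Pp n z - Pp J z) by ring.
  by move=> *; apply: le_lt_trans (nmBD _ _) _; lra.
by rewrite /Pinf (cvg_lim _ hl).
Qed.

Lemma Pp_unif : loc_unif Pp Pinf.
Proof.
move=> r e e0; pose r' := Num.max 0 r.
have r0 : 0 <= r' by rewrite le_max lexx.
have [B B0 [K1 [K10 h]]] := Pp_bounded r0.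
have [J [KJ [J0 hJ]]] := small_over B K1 e0; exists J => n z Jn zr.
have zr' : nm z <= r' by rewrite le_max zr orbT.
have c := @Pp_cvg z.
have {}c : (fun K => Pp n z - Pp K z) @ \oo --> Pp n z - Pinf z.
  exact: (cvgB (cvg_cst _) c).
apply: (seqC_bound c); exists n => K nK; rewrite nmB.
by apply: le_trans (h n K z (leq_trans KJ Jn) nK zr') _; exact/ltW/hJ.
Qed.

Lemma entire_Pinf : entire Pinf.
Proof. exact: weierstrass_limit entire_Pp Pp_unif. Qed.

Lemma entire_sigma : entire sigma.
Proof.
have -> : sigma = (fun z => z * Pinf z) by apply/funext => z; exact: sigmaE.
by move=> z; apply: dC_M; [exact: dC_id|exact: entire_Pinf].
Qed.

Lemma Pinf0 : Pinf 0 = 1.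
Proof.
apply: (seqC_uniq (@Pp_cvg 0)).
have -> : (fun K => Pp K 0) = fun=> 1; last exact: cvg_cst.
apply/funext => K; rewrite /Pp /r2 /rprod big1 // => i _; rewrite big1 // => j _.
rewrite /sf; case: ifP => // _; rewrite mul0r /elementary subr0 mul1r expr0n mulr0 addr0.
exact: cexp0.
Qed.

Lemma sigma0 : sigma 0 = 0.
Proof. by rewrite sigmaE mul0r. Qed.

Lemma is_derive_sigma0 : is_derive (0 : C) 1 sigma 1.
Proof.
have -> : sigma = (fun z => z * Pinf z) by apply/funext => z; exact: sigmaE.
have := is_deriveC_M (is_deriveC_id (0 : C)) (cderiveP 0 entire_Pinf).
by rewrite Pinf0 mul1r mul0r addr0.
Qed.

Lemma lattN m n : latt (- m) (- n) = - latt m n.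
Proof. by rewrite /Defs.latt !rmorphN /=; ring. Qed.

Lemma latt_eq0 m n : (latt m n == 0) = (m == 0) && (n == 0).
Proof.
apply/eqP/andP => [h|[/eqP -> /eqP ->]]; last by rewrite /Defs.latt !mul0r addr0.
have [h1 h2] := crd_latt e_gen m n; rewrite h in h1 h2.
have z1 : crd1 e1 e2 0 = 0 by rewrite /crd1 /= !mul0r subrr mul0r.
have z2 : crd2 e1 e2 0 = 0 by rewrite /crd2 /= !mulr0 subrr mul0r.
move: h1 h2; rewrite z1 z2 => /esym/eqP; rewrite intr_eq0 => -> /esym/eqP.
by rewrite intr_eq0.
Qed.

Lemma r2_opp K F : r2 K (fun m n => F (- m) (- n)) = r2 K F.
Proof.
rewrite /r2 -[RHS]rprod_opp; congr (rprod _ _); apply/funext => m.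
exact: rprod_opp.
Qed.

(** The squares of indices are symmetric about the origin. *)
Lemma sigmaN z : sigma (- z) = - sigma z.
Proof.
rewrite !sigmaE mulNr; congr (- (_ * _)).
rewrite /Pinf; have -> // : (fun K => Pp K (- z)) = (fun K => Pp K z).
apply/funext => K.
rewrite /Pp -[RHS]r2_opp; congr (r2 _ _); apply/funext => m; apply/funext => n.
by rewrite /sf !oppr_eq0 lattN invrN mulrN mulNr.
Qed.

Lemma sf_eq0 z m n : sf z m n = 0 -> z = latt m n.
Proof.
rewrite /sf; case: ifP => [_ /eqP|h]; first by rewrite oner_eq0.
rewrite /elementary => /eqP; rewrite mulf_eq0 (negbTE (cexp_neq0 _)) orbF subr_eq0 => /eqP h1.
by apply/eqP; rewrite -subr_eq0; apply/eqP; rewrite -{1}(divfK (x:=latt m n) _ z) ?latt_eq0 ?h // -h1 mul1r subrr.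
Qed.

(** The tail product tends to 1, so the limit vanishes only where one of the
    finitely many first factors does. *)
Lemma sigma_eq0 z : sigma z = 0 <-> lattice e1 e2 z.
Proof.
rewrite sigmaE; split.
  move/eqP; rewrite mulf_eq0 => /orP[/eqP ->|/eqP P0]; first exact: lattice0.
  apply: contrapT => zl.
  have [D D0 [K1 [K10 DK1 h]]] := Pp_tail (nm_ge0 z).
  have P1 : 0 < nm (Pp K1 z).
    rewrite nm_gt0; apply: rprod_neq0 => m _; apply: rprod_neq0 => n _.
    by apply/eqP => /sf_eq0 e; apply: zl; exists m, n.
  have K1R : 0 < K1%:R :> R by rewrite ltr0n.
  have c : (fun K => Pp K z - Pp K1 z) @ \oo --> Pinf z - Pp K1 z.
    by apply: cvgB; [exact: @Pp_cvg|exact: cvg_cst].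
  have hb : nm (Pinf z - Pp K1 z) <= nm (Pp K1 z) * (2 * D / K1%:R).
    by apply: (seqC_bound c); exists K1 => K KK; exact: h.
  move: hb; rewrite P0 sub0r nmN leNgt => /negP; apply.
  by rewrite gtr_pMr // ltr_pdivrMr // mul1r.
move=> [m [n ->]]; have [->|h] := eqVneq (latt m n) 0; first by rewrite mul0r.
suff -> : Pinf (latt m n) = 0 by rewrite mulr0.
apply: (seqC_uniq (@Pp_cvg _)); apply/seqCP => e ep.
exists (maxn `|m| `|n|) => K; rewrite geq_max => /andP[mK nK].
suff -> : Pp K (latt m n) = 0 by rewrite subrr nm0.
apply: (rprod_eq0 mK); apply: (rprod_eq0 nK).
rewrite /sf -latt_eq0 (negbTE h) divff // /elementary subrr mul0r //.
Qed.

Lemma sigma_neq0 z : ~ lattice e1 e2 z -> sigma z != 0.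
Proof. by move=> h; apply/eqP => /sigma_eq0. Qed.

End WeierstrassSigma.

(** * Quasi-periodicity of sigma and Legendre's relation *)

Section ExponentialBounds.
Variable R : realType.
Local Notation C := R[i].

(** The linear terms cancel. *)
Lemma onep_bound : exists2 A : R, 0 < A &
  forall v : C, nm v <= 1/2 -> nm ((1 + v) * cexp (- v) - 1) <= A * nm v ^+ 2.
Proof.
pose f (v : C) := (1 + v) * cexp (- v).
have d1 (v : C) : is_derive v 1 (fun v : C => 1 + v) (0 + 1).
  exact: (is_deriveC_D (@is_deriveC_cst R 1 v) (@is_deriveC_id R v)).
have d2 (v : C) : is_derive v 1 (fun v : C => cexp (- v)) (cexp (- v) * - 1).
  exact: (is_deriveC_comp (is_deriveC_N (@is_deriveC_id R v)) (@is_derive_cexp R (- v))).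
have ef : entire f by move=> v; exact: dC_ex (is_deriveC_M (d1 v) (d2 v)).
have [B B0 hB] := entire_bounded 0 1 ef.
exists (8 * B); first by rewrite mulr_gt0.
move=> v hv; have := taylor_local2 ef hB hv.
have -> : taylor_coef f 0 1 = 0.
  apply: (@is_deriveC_uniq R f 0); first exact: taylor_coef1.
  have := is_deriveC_M (d1 0) (d2 0).
  by rewrite oppr0 cexp0 add0r addr0 !mul1r subrr.
rewrite mul0r addr0 add0r; have -> : f 0 = 1 by rewrite /f oppr0 cexp0 addr0 mulr1.
by [].
Qed.

Lemma cexp_cont_seq (a : nat -> C) (l : C) : a @ \oo --> l -> (fun n => cexp (a n)) @ \oo --> cexp l.
Proof.
move=> h; have c := @dC_cont R (@cexp R) l (@entire_cexp R l).
exact: (continuous_cvg _ c h).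
Qed.

Lemma nm_cvg (a : nat -> C) (l : C) : a @ \oo --> l -> (fun n => nm (a n)) @ \oo --> nm l.
Proof. move=> h; exact: (continuous_cvg _ (@nm_continuous R l) h). Qed.

(** The modulus of the exponential determines the real part of the exponent. *)
Lemma cvg_ln_nm (x : nat -> C) (l : C) : l != 0 -> (fun n => cexp (x n)) @ \oo --> l ->
  (fun n => complex.Re (x n)) @ \oo --> ln (nm l).
Proof.
move=> l0 h; have -> : (fun n => complex.Re (x n)) = (fun n => ln (nm (cexp (x n)))).
  by apply/funext => n; rewrite nm_cexp expRK.
have p : 0 < nm l by rewrite nm_gt0.
exact: (continuous_cvg _ (@continuous_ln R (nm l) p) (nm_cvg h)).
Qed.

(** Convergence of the exponentials gives, through their moduli, convergence
    of the real parts of d t_n and of i d t_n. This avoids any choice of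
    logarithm. *)
Lemma exp_limit_converges (t : nat -> C) (d : R) (l1 l2 : C) : 0 < d -> l1 != 0 -> l2 != 0 ->
  (fun n => cexp (d%:C * t n)) @ \oo --> l1 ->
  (fun n => cexp ('i * d%:C * t n)) @ \oo --> l2 ->
  exists l : C, t @ \oo --> l.
Proof.
move=> d0 l10 l20 h1 h2.
have k1 := cvg_ln_nm l10 h1; have k2 := cvg_ln_nm l20 h2.
have dn : d != 0 by exact: lt0r_neq0.
exists ((ln (nm l1) / d) +i* - (ln (nm l2) / d)).
apply: cvg_ReIm => /=.
- have -> : (fun n => complex.Re (t n)) = (fun n => complex.Re (d%:C * t n) / d).
    by apply/funext => n; rewrite ReM /= mul0r subr0 mulrAC mulfV ?mul1r.
  exact: (cvgM k1 (cvg_cst d^-1)).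
- have -> : (fun n => complex.Im (t n)) = (fun n => - (complex.Re ('i * d%:C * t n) / d)).
    apply/funext => n; rewrite !ReM !ImM /= !(mul0r, mulr0, mul1r, add0r, subr0, sub0r, addr0, oppr0).
    by rewrite mulNr opprK mulrAC mulfV ?mul1r.
  exact: (cvgN (cvgM k2 (cvg_cst d^-1))).
Qed.

End ExponentialBounds.

Section QuasiPeriods.
Variables (R : realType) (e1 e2 : R[i]).
Hypothesis e_gen : lattice_generators e1 e2.
Local Notation C := R[i].
Implicit Types (z w u : C).
Local Notation latt := (latt e1 e2).
Local Notation sigma := (weierstrass_sigma e1 e2).
Local Notation r2 := (@r2 R).

(** The Eisenstein sum of weight 2, over a square of indices. *)
Definition cK K : C := rsum K (fun m => rsum K (fun n => (latt m n) ^- 2)).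
(** The sum of the inverses of the lattice points in the K-th column. *)
Definition hK K : C := rsum K (fun n => (latt K%:Z n)^-1).
(** The partial products without the convergence factors: a polynomial in z
    with the lattice points of the square as roots. *)
Definition QK K z : C := r2 K (fun m n => z - latt m n).
(** The constants that turn z - e_mn into 1 - z / e_mn. *)
Definition kappa (m n : int) : C := if (m == 0) && (n == 0) then 1 else - (latt m n)^-1.
(** The partial products of sigma. *)
Definition SK K z : C := z * Pp e1 e2 K z.

Lemma r2M K F G : r2 K (fun m n => F m n * G m n) = r2 K F * r2 K G.
Proof. by rewrite /r2 -rprodM; congr (rprod _ _); apply/funext => m; rewrite rprodM. Qed.

Lemma r2_center K F G : (forall m n, ~~ ((m == 0) && (n == 0)) -> F m n = G m n) ->
  F 0 0 * r2 K G = G 0 0 * r2 K F.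
Proof.
move=> FG; elim: K => [|K IH]; first by rewrite /r2 !rprod0 mulrC.
rewrite !r2S.
have -> : ring_prod K F = ring_prod K G.
  rewrite /ring_prod; congr (_ * _ * _ * _).
  - by congr (rprod _ _); apply/funext => n; apply: FG; rewrite negb_and; apply/orP; left.
  - by congr (rprod _ _); apply/funext => n; apply: FG; rewrite negb_and; apply/orP; right.
  - by congr (rprod _ _); apply/funext => n; apply: FG; rewrite negb_and; apply/orP; right.
  - by congr (rprod _ _); apply/funext => n; apply: FG; rewrite negb_and; apply/orP; left.
by rewrite mulrCA IH mulrCA.
Qed.

Lemma latt00 : latt 0 0 = 0.
Proof. by rewrite /Defs.latt !mul0r addr0. Qed.

Lemma rsum_odd K F : (forall m, F (- m) = - F m) -> rsum K F = 0 :> C.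
Proof.
move=> odd; have h : rsum K F = - rsum K F.
  by rewrite -{1}rsum_opp -rsumN; congr (rsum _ _); apply/funext.
have : rsum K F *+ 2 == 0 by rewrite mulr2n {1}h addNr.
by rewrite mulrn_eq0 /= => /eqP.
Qed.

(** The convergence factors multiply to an exponential: the linear terms
    cancel by symmetry and the quadratic terms add up to [cK]. *)
Lemma SKE K z : SK K z = r2 K kappa * cexp (2^-1 * z ^+ 2 * cK K) * QK K z.
Proof.
pose G m n : C := kappa m n * cexp (z * (latt m n)^-1 + 2^-1 * z ^+ 2 * (latt m n) ^- 2) * (z - latt m n).
have h : sf e1 e2 z 0 0 * r2 K G = G 0 0 * r2 K (sf e1 e2 z).
  apply: r2_center => m n mn; rewrite /sf /G /kappa (negbTE mn) /elementary.
  have l0 : latt m n != 0 by rewrite (latt_eq0 e_gen).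
  have -> : 2^-1 * (z / latt m n) ^+ 2 = 2^-1 * z ^+ 2 * (latt m n) ^- 2 by field.
  by set X := cexp _; field.
have s00 : sf e1 e2 z 0 0 = 1 by rewrite /sf !eqxx.
have G00 : G 0 0 = z.
  rewrite /G /kappa !eqxx /= latt00 invr0 expr0n invr0 !mulr0 addr0 cexp0.
  by rewrite subr0 !mul1r.
move: h; rewrite s00 G00 mul1r /SK /Pp => <-.
rewrite /G r2M r2M; congr (_ * _ * _).
rewrite /r2; have -> : (fun m => rprod K (fun n => cexp (z * (latt m n)^-1 + 2^-1 * z ^+ 2 * (latt m n) ^- 2))) =
   (fun m => cexp (z * rsum K (fun n => (latt m n)^-1) + 2^-1 * z ^+ 2 * rsum K (fun n => (latt m n) ^- 2))).
  by apply/funext => m; rewrite rprod_cexp rsumD !rsumZ.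
rewrite rprod_cexp rsumD !rsumZ -/(cK K).
have -> : rsum K (fun m => rsum K (fun n => (latt m n)^-1)) = 0.
  apply: rsum_odd => m; rewrite -rsum_opp -rsumN; congr (rsum _ _); apply/funext => n.
  by rewrite lattN invrN.
by rewrite mulr0 add0r.
Qed.

Lemma lattB1 m n : latt (m - 1) n = latt m n - e1.
Proof. by rewrite /Defs.latt rmorphB /=; ring. Qed.

(** Translating z by e1 shifts the square of lattice points by one column. *)
Lemma QK_shift K z :
  QK K (z + e1) * rprod K (fun n => latt K%:Z n - z) = - QK K z * rprod K (fun n => latt K%:Z n + z + e1).
Proof.
pose H m := rprod K (fun n => z - latt m n).
have E1 : QK K (z + e1) = rprod K (fun m => H (m - 1)).
  rewrite /QK /r2; congr (rprod _ _); apply/funext => m; rewrite /H.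
  by congr (rprod _ _); apply/funext => n; rewrite lattB1; ring.
have E2 : rprod K (fun n => latt K%:Z n - z) = - H K%:Z.
  have -> : (fun n => latt K%:Z n - z) = (fun n => -1 * (z - latt K%:Z n)).
    by apply/funext => n; ring.
  by rewrite rprodM rprod_cst -signr_odd /= odd_double expr1 mulN1r.
have E3 : H (- K.+1%:Z) = rprod K (fun n => latt K%:Z n + z + e1).
  rewrite /H -rprod_opp; congr (rprod _ _); apply/funext => n.
  rewrite lattN opprK.
  have -> : latt K%:Z n = latt K.+1%:Z n - e1.
    by rewrite -lattB1; congr (latt _ _); lia.
  by ring.
by rewrite E1 E2 mulrN rprod_shift -/(QK K z) E3 mulNr; congr (- _); rewrite /QK.
Qed.

(** Half of the quasi-period eta1, at the stage K. *)
Definition tK K : C := 2^-1 * e1 * cK K + hK K.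

(** What remains of the quotient of the two exchanged columns after its
    leading part exp((2 z + e1) / e_Kn) is split off; each factor is 1 + O(1 /
    K^2). *)
Definition xK z K (n : int) : C :=
  (1 + (2 * z + e1) / (latt K%:Z n - z)) * cexp (- ((2 * z + e1) / latt K%:Z n)).

(** Quasi-periodicity at a finite stage, with the error term explicit. *)
Lemma SK_shift z K : (forall n, (`|n|%N <= K)%N -> latt K%:Z n != z) ->
  SK K (z + e1) = - SK K z * cexp ((2 * z + e1) * tK K) * rprod K (xK z K).
Proof.
move=> nz; set u := 2 * z + e1.
have n0 : rprod K (fun n => latt K%:Z n - z) != 0.
  by apply: rprod_neq0 => n nK; rewrite subr_eq0 nz.
have X : rprod K (xK z K) * cexp (u * hK K) * rprod K (fun n => latt K%:Z n - z) =
    rprod K (fun n => latt K%:Z n + z + e1).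
  have -> : cexp (u * hK K) = rprod K (fun n => cexp (u * (latt K%:Z n)^-1)).
    by rewrite rprod_cexp rsumZ.
  rewrite -!rprodM; apply: rprod_ext => n nK; rewrite /xK -/u cexpN.
  have l0 : latt K%:Z n - z != 0 by rewrite subr_eq0 nz.
  have X0 : cexp (u / latt K%:Z n) != 0 by exact: cexp_neq0.
  set Y := cexp _ in X0 *.
  have -> : (1 + u / (latt K n - z)) / Y * Y * (latt K n - z) = (latt K n - z) + u by field; rewrite l0 X0.
  by rewrite /u; ring.
apply: (mulIf n0).
rewrite !SKE.
have -> : 2^-1 * (z + e1) ^+ 2 * cK K = 2^-1 * z ^+ 2 * cK K + u * (2^-1 * e1 * cK K).
  by rewrite /u; field.
rewrite cexpD /tK mulrDr cexpD.
have := QK_shift K z; rewrite -X => Q.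
set k := r2 K kappa; set a := cexp (2^-1 * _ * _); set b := cexp (u * _).
have -> : k * (a * b) * QK K (z + e1) * rprod K (fun n => latt K n - z) =
   k * (a * b) * (QK K (z + e1) * rprod K (fun n => latt K n - z)) by ring.
by rewrite Q; ring.
Qed.

Lemma latt_row_ge K n : K%:R <= 2 * lbound e1 e2 * nm (latt K%:Z n).
Proof. by apply: (latt_ge e_gen); left. Qed.

Lemma lbound_gt0 : 0 < 2 * lbound e1 e2.
Proof.
have := latt_row_ge 1 0; have := lbound_ge0 e1 e2; have := nm_ge0 (latt 1%:Z 0).
rewrite le_eqVlt => /orP[/eqP <-|n0]; first by rewrite mulr0; lra.
rewrite le_eqVlt => /orP[/eqP <-|b0]; first by rewrite mulr0 mul0r; lra.
by move=> _; rewrite mulr_gt0.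
Qed.

Lemma row_inv_le K (c : R) (w : C) : 0 < c -> K.+1%:R <= c * nm w -> (nm w)^-1 <= c / K.+1%:R.
Proof.
move=> c0 h; have k0 : 0 < K.+1%:R :> R by rewrite ltr0n.
have w0 : 0 < nm w by rewrite -(pmulr_rgt0 _ c0); exact: lt_le_trans h.
by rewrite ler_pdivlMr // ler_pdivrMl // mulrC.
Qed.

Lemma row_succ_ge K n : (0 < K)%N -> K.+1%:R <= 2 * (2 * lbound e1 e2) * nm (latt K%:Z n).
Proof.
move=> K0; have := latt_row_ge K n.
have : K.+1%:R <= 2 * K%:R :> R by rewrite -natrM ler_nat; lia.
lra.
Qed.

Lemma xK_cvg z : (fun K => rprod K (xK z K)) @ \oo --> (1 : C).
Proof.
have [A A0 hA] := onep_bound R.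
set b := 2 * (2 * lbound e1 e2); have b0 : 0 < b by rewrite mulr_gt0 // lbound_gt0.
pose u := 2 * z + e1.
have [N1 hN1] := inv_nat_small (2 * b * (1 + nm z)) (ltr01 (R:=R)).
have [N2 hN2] := inv_nat_small (2 * b * (1 + nm u)) (ltr01 (R:=R)).
have nz0 := nm_ge0 z; have nu0 := nm_ge0 u; have b0' := ltW b0; have A0' := ltW A0.
pose B := expR 1 * (2 * b ^+ 2 * nm u * nm z) + A * (b * nm u) ^+ 2.
have B0 : 0 <= B.
  apply: addr_ge0; apply: mulr_ge0 => //; last by rewrite exprn_ge0 // mulr_ge0.
  by apply: mulr_ge0 => //; apply: mulr_ge0 => //; apply: mulr_ge0 => //; exact: exprn_ge0.
apply: (rprod_cvg1 B0).
exists (maxn 1 (maxn N1 N2)) => K; rewrite !geq_max => /and3P[K1 KN1 KN2] n _.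
have := hN1 K KN1; have := hN2 K KN2; have wk := row_succ_ge n K1; rewrite -/b in wk.
have i1 := row_inv_le b0 wk.
set k := K.+1%:R : R in wk i1 * => k2 k1.
have k0 : 0 < k by rewrite ltr0n.
set w := latt K n in wk i1 *.
have kk1 : 2 * b * (1 + nm z) < k by move: k1; rewrite ltr_pdivrMr // mul1r.
have kk2 : 2 * b * (1 + nm u) < k by move: k2; rewrite ltr_pdivrMr // mul1r.
have w0 : 0 < nm w by rewrite -(pmulr_rgt0 _ b0); exact: lt_le_trans wk.
have wz : k <= 2 * b * nm (w - z).
  have : 2 * b * nm w <= 2 * b * (nm (w - z) + nm z).
    have h : nm w <= nm (w - z) + nm z by have := nmD (w - z) z; rewrite subrK.
    by apply: (ler_wpM2l _ h); exact: mulr_ge0.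
  by rewrite !mulrDr; move: kk1; rewrite mulrDr mulr1; lra.
have i2 : (nm (w - z))^-1 <= 2 * b / k by apply: row_inv_le => //; rewrite mulr_gt0.
have wz0 : 0 < nm (w - z).
  have : 0 < 2 * b * nm (w - z) by exact: lt_le_trans wz.
  by rewrite pmulr_rgt0 // mulr_gt0.
have wn : w != 0 by rewrite -nm_gt0.
have wzn : w - z != 0 by rewrite -nm_gt0.
pose v := u / w.
have vb : nm v <= b * nm u / k.
  rewrite /v nm_div; apply: (@le_trans _ _ (nm u * (b / k))); first by rewrite ler_wpM2l.
  by rewrite le_eqVlt; apply/orP; left; apply/eqP; ring.
have v12 : nm v <= 1/2.
  apply: le_trans vb _; rewrite ler_pdivrMr //.
  by move: kk2; rewrite mulrDr mulr1; lra.
have -> : xK z K n - 1 = (u * z / (w * (w - z))) * cexp (- v) + ((1 + v) * cexp (- v) - 1).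
  rewrite /xK -/u -/w -/v; set X := cexp _.
  have -> : u / (w - z) = v + u * z / (w * (w - z)) by rewrite /v; field; rewrite wn wzn.
  by ring.
apply: le_trans (nmD _ _) _; rewrite [leRHS]mulrDl; apply: lerD.
  rewrite nmM mulrC -[leRHS]mulrA; apply: ler_pM; rewrite ?nm_ge0 //.
    rewrite nm_cexp ler_expR ReN; have := Re_le_nm v; rewrite ler_norml => /andP[h _].
    by apply: le_trans (_ : 1/2 <= 1); lra.
  rewrite nm_div !nmM invfM.
  have -> : 2 * b ^+ 2 * nm u * nm z / k ^+ 2 = nm u * nm z * ((b / k) * (2 * b / k)) by field; exact: lt0r_neq0.
  rewrite ler_wpM2l ?mulr_ge0 //; apply: ler_pM; rewrite ?invr_ge0 ?nm_ge0 //.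
apply: le_trans (hA _ v12) _; rewrite -mulrA ler_wpM2l // -expr_div_n.
have q0 : 0 <= b * nm u / k by exact: (divr_ge0 (mulr_ge0 b0' nu0) (ltW k0)).
by rewrite lerXn2r // nnegrE ?nm_ge0.
Qed.

Lemma SK_cvg z : (fun K => SK K z) @ \oo --> sigma z.
Proof. by rewrite sigmaE; exact: (cvgM (cvg_cst z) (@Pp_cvg R e1 e2 e_gen z)). Qed.

Lemma SK_neq0 z K : ~ lattice e1 e2 z -> SK K z != 0.
Proof.
move=> zl; rewrite mulf_neq0 //.
  by apply/eqP => z0; apply: zl; rewrite z0; exact: lattice0.
apply: rprod_neq0 => m _; apply: rprod_neq0 => n _.
by apply/eqP => /(sf_eq0 e_gen) e; apply: zl; exists m, n.
Qed.

Lemma SK_shift_off z K : ~ lattice e1 e2 z ->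
  SK K (z + e1) = - SK K z * cexp ((2 * z + e1) * tK K) * rprod K (xK z K).
Proof.
move=> zl; apply: SK_shift => n _; apply/eqP => h; apply: zl.
by exists K%:Z, n.
Qed.

(** In the quasi-periodicity at the stage K all other terms converge, for
    every argument off the lattice; the unknown t_K is thereby controlled only
    through exponentials of its multiples. *)
Lemma exp_tK_cvg u : ~ lattice e1 e2 u -> exists2 l : C, l != 0 & (fun K => cexp (u * tK K)) @ \oo --> l.
Proof.
move=> ul; pose z := (u - e1) / 2.
have uz : u = 2 * z + e1 by rewrite /z; field.
have l1 := lattice_e1 e1 e2.
have zl : ~ lattice e1 e2 z.
  by move=> h; apply: ul; rewrite uz mulr2n mulrDl !mul1r; do 2?[apply: latticeD].
have zel : ~ lattice e1 e2 (z + e1) by rewrite lattDr.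
exists (sigma (z + e1) / - sigma z).
  by rewrite mulf_neq0 ?invr_eq0 ?oppr_eq0 ?(sigma_neq0 e_gen).
have -> : (fun K => cexp (u * tK K)) = (fun K => SK K (z + e1) / (- SK K z * rprod K (xK z K))).
  apply/funext => K; have S0 := SK_neq0 K zl; have S1 := SK_neq0 K zel.
  have := SK_shift_off K zl; rewrite -uz => E.
  have X0 : rprod K (xK z K) != 0.
    by apply/eqP => X0; move: S1; rewrite E X0 mulr0 eqxx.
  rewrite E; set X := cexp _; set Y := rprod _ _ in X0 *.
  by field; rewrite S0 X0.
apply: cvgM; first exact: SK_cvg.
apply: cvgV; first by rewrite oppr_eq0 (sigma_neq0 e_gen).
have := cvgM (cvgN (@SK_cvg z)) (@xK_cvg z); rewrite mulr1; exact.
Qed.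

(** By [exp_limit_converges], applied to a small real and a small imaginary
    multiple. *)
Lemma tK_cvg : exists t : C, tK @ \oo --> t.
Proof.
have [d d0 hd] := lattice_discrete e_gen.
have d20 : 0 < d / 2 by rewrite divr_gt0.
have off u : nm u = d / 2 -> ~ lattice e1 e2 u.
  move=> nu ul; have u0 := hd u ul; rewrite nu in u0.
  by move: nu; rewrite u0 ?nm0; lra.
have n1 : nm ((d / 2)%:C : C) = d / 2 by rewrite nm_real ger0_norm // ltW.
have n2 : nm ('i * (d / 2)%:C : C) = d / 2 by rewrite nmM nmi mul1r.
have [l1 l10 h1] := exp_tK_cvg (off _ n1); have [l2 l20 h2] := exp_tK_cvg (off _ n2).
exact: exp_limit_converges d20 l10 l20 h1 h2.
Qed.

(** The quasi-periodicity of sigma as the limit of [SK_shift]. *)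
Lemma sigma_shift1 t z : tK @ \oo --> t -> sigma (z + e1) = - cexp ((2 * z + e1) * t) * sigma z.
Proof.
move=> ht; have [zl|zl] := pselect (lattice e1 e2 z).
  have l1 := lattice_e1 e1 e2.
  by rewrite ((sigma_eq0 e_gen z).2 zl) ((sigma_eq0 e_gen (z + e1)).2 (latticeD zl l1)) mulr0.
apply: (seqC_uniq (@SK_cvg (z + e1))).
have -> : (fun K => SK K (z + e1)) = (fun K => - SK K z * cexp ((2 * z + e1) * tK K) * rprod K (xK z K)).
  by apply/funext => K; exact: SK_shift_off.
have -> : - cexp ((2 * z + e1) * t) * sigma z = - sigma z * cexp ((2 * z + e1) * t) * 1 by ring.
exact: (cvgM (cvgM (cvgN (@SK_cvg z)) (cexp_cont_seq (cvgM (cvg_cst _) ht))) (@xK_cvg z)).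
Qed.

End QuasiPeriods.

Section LegendreRelation.
Variable R : realType.
Local Notation C := R[i].

Lemma lattice_generators_swap (e1 e2 : C) : lattice_generators e1 e2 -> lattice_generators e2 e1.
Proof. by move=> h s t; rewrite addrC => /h[]. Qed.

Lemma latt_swap (e1 e2 : C) m n : latt e2 e1 m n = latt e1 e2 n m.
Proof. by rewrite /latt addrC. Qed.

Lemma sigma_swap (e1 e2 z : C) : weierstrass_sigma e2 e1 z = weierstrass_sigma e1 e2 z.
Proof.
rewrite !sigmaE /Pinf; congr (_ * _).
have -> // : (fun K => Pp e2 e1 K z) = (fun K => Pp e1 e2 K z).
apply/funext => K; rewrite /Pp /r2 /rprod exchange_big; apply: eq_bigr => i _; apply: eq_bigr => j _.
by rewrite /sf latt_swap andbC.
Qed.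

Lemma cK_swap (e1 e2 : C) K : cK e2 e1 K = cK e1 e2 K.
Proof.
rewrite /cK /rsum exchange_big; apply: eq_bigr => i _; apply: eq_bigr => j _.
by rewrite latt_swap.
Qed.

Lemma e1_subr_e2 (e1 e2 : C) : lattice_generators e1 e2 -> e1 - e2 != 0.
Proof.
move=> h; apply/eqP => e0; have [] := h 1 (- 1); last by move=> /eqP; rewrite oner_eq0.
by rewrite rmorphN /= mul1r mulN1r e0.
Qed.

Lemma e1_addr_e2 (e1 e2 : C) : lattice_generators e1 e2 -> e1 + e2 != 0.
Proof.
move=> h; apply/eqP => e0; have [] := h 1 1; last by move=> /eqP; rewrite oner_eq0.
by rewrite !mul1r e0.
Qed.

(** The product of (e_Kn + e2) / e_Kn over a column telescopes, and exp(e2 /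
    e_Kn) is that quotient up to 1 + O(1 / K^2). The limit is the quotient of
    the two corners of the square. *)
Lemma exp_hK_cvg (e1 e2 : C) : lattice_generators e1 e2 ->
  (fun K => cexp (e2 * hK e1 e2 K)) @ \oo --> (e1 + e2) / (e1 - e2).
Proof.
move=> e_gen; have [A A0 hA] := onep_bound R; have A0' := ltW A0.
set b := 2 * (2 * lbound e1 e2); have b0 : 0 < b by rewrite mulr_gt0 // lbound_gt0.
have b0' := ltW b0; have n0 := nm_ge0 e2.
pose x K n := (1 + e2 / latt e1 e2 K%:Z n) * cexp (- (e2 / latt e1 e2 K%:Z n)).
have xc : (fun K => rprod K (x K)) @ \oo --> (1 : C).
  have [N hN] := inv_nat_small (2 * (b * nm e2)) (ltr01 (R:=R)).
  apply: (@rprod_cvg1 R x (A * (b * nm e2) ^+ 2)).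
    by rewrite mulr_ge0 // exprn_ge0 // mulr_ge0.
  exists (maxn 1 N) => K; rewrite geq_max => /andP[K1 KN] n _.
  have hk := hN K KN; have wk := row_succ_ge e_gen n K1; rewrite -/b in wk.
  have i1 := row_inv_le b0 wk.
  set k := K.+1%:R : R in wk i1 hk *.
  have k0 : 0 < k by rewrite ltr0n.
  have vb : nm (e2 / latt e1 e2 K%:Z n) <= b * nm e2 / k.
    rewrite nm_div; apply: (@le_trans _ _ (nm e2 * (b / k))); first by rewrite ler_wpM2l.
    by rewrite le_eqVlt; apply/orP; left; apply/eqP; ring.
  have v12 : nm (e2 / latt e1 e2 K%:Z n) <= 1/2.
    apply: le_trans vb _; rewrite ler_pdivrMr //.
    by move: hk; rewrite ltr_pdivrMr // mul1r; lra.
  apply: le_trans (hA _ v12) _; rewrite -mulrA ler_wpM2l // -expr_div_n.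
  have q0 : 0 <= b * nm e2 / k by exact: (divr_ge0 (mulr_ge0 b0' n0) (ltW k0)).
  by rewrite lerXn2r // nnegrE ?nm_ge0.
have w0 (K : nat) n : (0 < K)%N -> latt e1 e2 K%:Z n != 0.
  by move=> K0; rewrite (latt_eq0 e_gen) negb_and; apply/orP; left; rewrite eqz_nat -lt0n.
have d0 := e1_subr_e2 e_gen.
have E (K : nat) : (0 < K)%N -> rprod K (x K) * cexp (e2 * hK e1 e2 K) =
    (latt e1 e2 K%:Z K.+1%:Z) / (latt e1 e2 K%:Z (- K%:Z)).
  move=> K0; rewrite -rsumZ -rprod_cexp -rprodM.
  have -> : rprod K (fun n => x K n * cexp (e2 * (latt e1 e2 K n)^-1)) =
      rprod K (fun n => latt e1 e2 K (n + 1) / latt e1 e2 K n).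
    apply: rprod_ext => n _; have l0 := w0 K n K0; rewrite /x cexpN.
    have X0 : cexp (e2 / latt e1 e2 K n) != 0 by exact: cexp_neq0.
    set X := cexp _ in X0 *.
    have -> : latt e1 e2 K (n + 1) = latt e1 e2 K n + e2 by rewrite /latt rmorphD /=; ring.
    by field; rewrite l0 X0.
  rewrite rprodM rprodV.
  have P0 : rprod K (latt e1 e2 K) != 0 by apply: rprod_neq0 => n _; exact: w0.
  have := rprod_shift K (fun n => latt e1 e2 K (n + 1)).
  have -> : (fun m => latt e1 e2 K (m - 1 + 1)) = latt e1 e2 K by apply/funext => m; rewrite subrK.
  have -> : K%:Z + 1 = K.+1%:Z by lia.
  have -> : - K.+1%:Z + 1 = - K%:Z by lia.
  have q0 := w0 K (- K%:Z) K0; move=> h.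
  by apply: (mulIf P0); rewrite divfK //; apply: (mulIf q0); rewrite -h mulrAC divfK // mulrC.
have lim2 : (fun K => (latt e1 e2 K.+1%:Z K.+2%:Z) / (latt e1 e2 K.+1%:Z (- K.+1%:Z))) @ \oo --> (e1 + e2) / (e1 - e2).
  apply/seqCP => e e0.
  have [N hN] := inv_nat_small (nm e2 / nm (e1 - e2)) e0.
  exists N => K NK; have := hN K NK.
  have k0 : (K.+1%:R : C) != 0 by rewrite pnatr_eq0.
  have -> : latt e1 e2 K.+1%:Z K.+2%:Z = K.+1%:R * (e1 + e2) + e2.
    by rewrite /latt -!pmulrn -natr1; ring.
  have -> : latt e1 e2 K.+1%:Z (- K.+1%:Z) = K.+1%:R * (e1 - e2).
    by rewrite /latt mulrNz -!pmulrn; ring.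
  have -> : (K.+1%:R * (e1 + e2) + e2) / (K.+1%:R * (e1 - e2)) - (e1 + e2) / (e1 - e2) =
     e2 / (e1 - e2) / K.+1%:R by move: (K.+1%:R : C) k0 => q q0; field; rewrite q0 d0.
  by rewrite !nm_div nm_nat.
have shift (a : nat -> C) (l : C) : (fun K => a K.+1) @ \oo --> l -> a @ \oo --> l.
  move=> /seqCP h; apply/seqCP => e e0; have [N hN] := h e e0.
  by exists N.+1 => -[//|n]; rewrite ltnS; exact: hN.
apply: shift.
have xc' : (fun K => rprod K.+1 (x K.+1)) @ \oo --> (1 : C).
  move/seqCP: xc => h; apply/seqCP => e e0; have [N hN] := h e e0.
  by exists N => n Nn; apply: hN; rewrite leqW.
have X0 (K : nat) : (0 < K)%N -> rprod K (x K) != 0.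
  move=> K0; apply/eqP => X0; have := E K K0; rewrite X0 mul0r => /esym/eqP.
  by rewrite mulf_eq0 invr_eq0 (negbTE (w0 K _ K0)) (negbTE (w0 K _ K0)).
have -> : (fun K => cexp (e2 * hK e1 e2 K.+1)) =
  (fun K => (latt e1 e2 K.+1%:Z K.+2%:Z) / (latt e1 e2 K.+1%:Z (- K.+1%:Z)) / rprod K.+1 (x K.+1)).
  by apply/funext => K; rewrite -E // mulrAC mulfV ?mul1r // X0.
have -> : (e1 + e2) / (e1 - e2) = (e1 + e2) / (e1 - e2) * 1^-1 by rewrite invr1 mulr1.
exact: (cvgM lim2 (cvgV (oner_neq0 _) xc')).
Qed.

Lemma ImV (w : C) : complex.Im w^-1 = - complex.Im w / (complex.Re w ^+ 2 + complex.Im w ^+ 2).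
Proof. by case: w => x y; rewrite /GRing.inv /= mulNr. Qed.

(** By the mean value theorem, comparing 1 / (1 + c^2) with 1 / (1 + p^2) for
    c within 1 / B of p. *)
Lemma atan_step (B x : R) : 0 < B ->
  B / (B ^+ 2 + x ^+ 2) <= (1 + B^-1 + B^-1 ^+ 2) * (atan ((x + 1) / B) - atan (x / B)).
Proof.
move=> B0; have i0 : 0 < B^-1 by rewrite invr_gt0.
have le : x / B <= (x + 1) / B by rewrite ler_pM2r // lerDl.
have [c|c cab hc] := @MVT_segment R (@atan R) (fun x => (1 + x ^+ 2)^-1) _ _ le (fun z _ => is_derive1_atan z).
  by apply: continuous_subspaceT => y; exact: continuous_atan.
rewrite hc; have -> : (x + 1) / B - x / B = B^-1 by rewrite -mulrBl addrAC subrr add0r mul1r.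
set p := x / B in cab le *.
have Bn := lt0r_neq0 B0.
have -> : B / (B ^+ 2 + x ^+ 2) = (1 + p ^+ 2)^-1 * B^-1.
  have n1 : B ^+ 2 + x ^+ 2 != 0 by rewrite lt0r_neq0 // ltr_pwDl ?exprn_gt0 // sqr_ge0.
  have n2 : 1 + p ^+ 2 != 0 by rewrite lt0r_neq0 // ltr_pwDl // sqr_ge0.
  have e : (1 + p ^+ 2) * B ^+ 2 = B ^+ 2 + x ^+ 2 by rewrite /p; field.
  by rewrite -e; field; rewrite Bn n2.
rewrite mulrA ler_pM2r //.
have q1 : 0 < 1 + p ^+ 2 by rewrite ltr_pwDl // sqr_ge0.
have q2 : 0 < 1 + c ^+ 2 by rewrite ltr_pwDl // sqr_ge0.
rewrite ler_pdivlMr // ler_pdivrMl //.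
move: cab; rewrite in_itv /= => /andP[pc cp].
have cp2 : c <= p + B^-1 by apply: le_trans cp _; rewrite mulrDl mul1r.
set i := B^-1 in i0 cp2 *; pose d := c - p.
have d0 : 0 <= d by rewrite subr_ge0.
have di : d <= i by rewrite /d; lra.
have -> : c = p + d by rewrite /d; ring.
have h1 : 2 * p * d <= (1 + p ^+ 2) * i.
  apply: (@le_trans _ _ ((1 + p ^+ 2) * d)); last by rewrite ler_wpM2l // ltW.
  by rewrite ler_wpM2r //; have := sqr_ge0 (p - 1); rewrite sqrrB; lra.
have h2 : d ^+ 2 <= i ^+ 2 by rewrite lerXn2r // nnegrE ltW.
have h3 : i ^+ 2 <= (1 + p ^+ 2) * i ^+ 2 by rewrite ler_peMl ?sqr_ge0 // lerDl sqr_ge0.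
by move: h1 h2 h3; rewrite sqrrD; nra.
Qed.

Lemma atan_sum (B c : R) (M : nat) : 0 < B ->
  \sum_(i < M) B / (B ^+ 2 + (c + i%:R) ^+ 2) <= (1 + B^-1 + B^-1 ^+ 2) * pi.
Proof.
move=> B0; have i0 : 0 < B^-1 by rewrite invr_gt0.
apply: (@le_trans _ _ ((1 + B^-1 + B^-1 ^+ 2) * (atan ((c + M%:R) / B) - atan (c / B)))).
  have -> : atan ((c + M%:R) / B) - atan (c / B) =
     \sum_(0 <= i < M) (atan ((c + i.+1%:R) / B) - atan ((c + i%:R) / B)).
    by rewrite (telescope_sumr (fun i => atan ((c + i%:R) / B))) // addr0.
  rewrite big_mkord mulr_sumr; apply: ler_sum => i _.
  have -> : c + i.+1%:R = c + i%:R + 1 :> R by rewrite -natr1 addrA.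
  exact: atan_step.
rewrite ler_wpM2l //; last first.
  by have := atan_ltpi2 ((c + M%:R) / B); have := atan_gtNpi2 (c / B); lra.
by rewrite !addr_ge0 ?exprn_ge0 // ltW.
Qed.

(** The imaginary parts of e2 / e_Kn are values of B / (B^2 + x^2) at points x
    spaced by one, with B proportional to K; their sum approximates an
    integral of total mass pi. *)
Lemma Im_hK_bound (e1 e2 : C) : lattice_generators e1 e2 ->
  exists N, forall K, (N <= K)%N -> `|complex.Im (e2 * hK e1 e2 K)| <= 5 / 4 * pi.
Proof.
move=> e_gen; have e20 : e2 != 0.
  apply/eqP => e0; have [] := e_gen 0 1; last by move=> _ /eqP; rewrite oner_eq0.
  by rewrite e0 mulr0 mul0r addr0.
pose s := e1 / e2; pose a := complex.Re s; pose b := complex.Im s.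
have e1E : e1 = s * e2 by rewrite /s divfK.
have b0 : b != 0.
  apply/eqP => b0; have [] := e_gen 1 (- a); last by move=> /eqP; rewrite oner_eq0.
  have -> : e1 = a%:C * e2 by rewrite {1}e1E; congr (_ * _); apply: eqC.
  by rewrite mul1r rmorphN /=; ring.
have nb : 0 < `|b| by rewrite normr_gt0.
(* for such K the factor 1 + 1/B + 1/B^2 of the comparison is below 5/4, so
   that two such sums stay below 3 pi *)
have [N hN] := inv_nat_small (8 / `|b|) (ltr01 (R:=R)).
exists N.+1 => -[//|K] NK; rewrite -rsumZ.
have K0 : 0 < K.+1%:R :> R by rewrite ltr0n.
pose B := K.+1%:R * `|b|; have B0 : 0 < B by rewrite mulr_gt0.
have B8 : B^-1 <= 1 / 8.
  have := hN K; rewrite ltnS in NK; move=> /(_ NK).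
  rewrite ltr_pdivrMr // mul1r ltr_pdivrMr // -/B => h.
  by rewrite mul1r in h; rewrite lef_pV2 ?posrE //; exact: ltW.
have term (n : int) : `|complex.Im (e2 * (latt e1 e2 K.+1%:Z n)^-1)| <=
    B / (B ^+ 2 + (K.+1%:R * a + n%:~R) ^+ 2).
  have -> : e2 * (latt e1 e2 K.+1%:Z n)^-1 = ((K.+1%:R * a + n%:~R) +i* (K.+1%:R * b))^-1.
    have -> : latt e1 e2 K.+1%:Z n = ((K.+1%:R * a + n%:~R) +i* (K.+1%:R * b)) * e2.
      rewrite /latt {1}e1E mulrA -mulrDl; congr (_ * _); apply: eqC.
        by rewrite ReD ReM -!(rmorph_int (real_complex R)) /= mul0r subr0 -pmulrn.
      by rewrite ImD ImM -!(rmorph_int (real_complex R)) /= mul0r !addr0 -pmulrn.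
    by rewrite invfM mulrCA mulfV // mulr1.
  have q : 0 <= (K.+1%:R * a + n%:~R) ^+ 2 + (K.+1%:R * b) ^+ 2 by exact: addr_ge0 (sqr_ge0 _) (sqr_ge0 _).
  rewrite ImV /= normrM normrN [`|_^-1|]ger0_norm ?invr_ge0 // /B normrM (ger0_norm (ltW K0)) !exprMn.
  by rewrite real_normK ?num_real // addrC.
have -> : complex.Im (rsum K.+1 (fun n => e2 * (latt e1 e2 K.+1 n)^-1)) =
   \sum_(i < K.+1.*2.+1) complex.Im (e2 * (latt e1 e2 K.+1 ((i : nat)%:Z - K.+1%:Z))^-1).
  by rewrite /rsum (big_morph (@complex.Im R) (@ImD R) (erefl : complex.Im 0 = 0)).
apply: le_trans (ler_norm_sum _ _ _) _.
apply: (@le_trans _ _ (\sum_(i < K.+1.*2.+1) B / (B ^+ 2 + ((K.+1%:R * a - K.+1%:R) + i%:R) ^+ 2))).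
  apply: ler_sum => i _; apply: le_trans (term _) _.
  rewrite rmorphB /= -!pmulrn.
  by have -> : K.+1%:R * a + (i%:R - K.+1%:R) = K.+1%:R * a - K.+1%:R + i%:R by ring.
apply: le_trans (atan_sum _ _ B0) _; rewrite ler_wpM2r ?pi_ge0 //.
have i0 : 0 < B^-1 by rewrite invr_gt0.
set i := B^-1 in B8 i0 *; nra.
Qed.

Lemma cexp_eqN1 (x : C) : cexp x = -1 -> `|complex.Im x| < 3 * pi ->
  x = 'i * (pi : R)%:C \/ x = - ('i * (pi : R)%:C).
Proof.
move=> hx im.
have ip : cexp ('i * (pi : R)%:C) = -1 :> C.
  have -> : 'i * (pi : R)%:C = 'i * (pi / 2 : R)%:C + 'i * (pi / 2 : R)%:C :> C.
    by rewrite -mulrDr -rmorphD /=; congr (_ * _%:C); field.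
  by rewrite cexpD cexp_ipi2 -expr2 sqr_i.
have : cexp (x - 'i * (pi : R)%:C) = 1 by rewrite cexpB hx ip divff // oppr_eq0 oner_eq0.
move=> /cexp_eq1[n]; rewrite ipi2E => /eqP; rewrite subr_eq -mulrDr -rmorphD /= => /eqP xE.
move: im; rewrite xE ImM /= mul0r mul1r add0r.
have -> : n%:~R * (pi *+ 2) + pi = (2 * n + 1)%:~R * pi :> R.
  by rewrite rmorphD rmorphM /= mulr2n; ring.
rewrite normrM (ger0_norm (pi_ge0 R)) ltr_pM2r ?pi_gt0 // -intr_norm (_ : 3 = 3%:~R :> R) // ltr_int => hn.
have [->|->] : n = 0 \/ n = -1 by lia.
  by left; rewrite mulr0 add0r mul1r.
right; have -> : (2 * (-1) + 1)%:~R * pi = - pi :> R by rewrite (_ : 2 * -1 + 1 = -1) // rmorphN mulN1r.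
by rewrite rmorphN mulrN.
Qed.

(** Legendre's relation up to the orientation of the basis. The two limits of
    [exp_hK_cvg] are opposite to each other, so the exponential of t1 e2 - t2
    e1 is -1; the Eisenstein sums cancel in this combination, and the bound on
    the imaginary parts singles out +- i pi among the logarithms of -1. *)
Lemma legendre_relation (e1 e2 t1 t2 : C) : lattice_generators e1 e2 ->
  tK e1 e2 @ \oo --> t1 -> tK e2 e1 @ \oo --> t2 ->
  t1 * e2 - t2 * e1 = 'i * (pi : R)%:C \/ t1 * e2 - t2 * e1 = - ('i * (pi : R)%:C).
Proof.
move=> e_gen h1 h2; have e_gen' := lattice_generators_swap e_gen.
have c : (fun K => e2 * hK e1 e2 K - e1 * hK e2 e1 K) @ \oo --> t1 * e2 - t2 * e1.
  have -> : (fun K => e2 * hK e1 e2 K - e1 * hK e2 e1 K) = (fun K => tK e1 e2 K * e2 - tK e2 e1 K * e1).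
    by apply/funext => K; rewrite /tK (cK_swap e1 e2); ring.
  exact: (cvgB (cvgM h1 (cvg_cst e2)) (cvgM h2 (cvg_cst e1))).
apply: cexp_eqN1.
  apply: (seqC_uniq (cexp_cont_seq c)).
  have d0 := e1_subr_e2 e_gen; have d1 := e1_addr_e2 e_gen; have d2 := e1_subr_e2 e_gen'.
  have d3 : (e2 + e1) / (e2 - e1) != 0 by rewrite mulf_neq0 ?invr_eq0 // addrC.
  have -> : (fun K => cexp (e2 * hK e1 e2 K - e1 * hK e2 e1 K)) =
    (fun K => cexp (e2 * hK e1 e2 K) * (cexp (e1 * hK e2 e1 K))^-1).
    by apply/funext => K; rewrite cexpB.
  have <- : (e1 + e2) / (e1 - e2) * ((e2 + e1) / (e2 - e1))^-1 = -1.
    by field; rewrite d0 d2 addrC d1.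
  exact: (cvgM (exp_hK_cvg e_gen) (cvgV d3 (exp_hK_cvg e_gen'))).
have [N1 hN1] := Im_hK_bound e_gen; have [N2 hN2] := Im_hK_bound e_gen'.
have pp := pi_gt0 R.
apply: (@le_lt_trans _ _ (5 / 2 * pi)); last by lra.
apply/ler_addgt0Pr => e e0; move/seqCP: c => /(_ e e0)[N hN].
pose K := maxn N (maxn N1 N2).
have k1 := hN K (leq_maxl _ _).
have k2 : (N1 <= K)%N by rewrite /K !leq_max leqnn orbT.
have k3 : (N2 <= K)%N by rewrite /K !leq_max leqnn !orbT.
have := hN1 K k2; have := hN2 K k3.
have := le_trans (Im_le_nm _) (ltW k1); rewrite ImD ImN.
rewrite (ImD (e2 * hK e1 e2 K)) ImN.
set X := complex.Im (e2 * _); set Y := complex.Im (e1 * _); set Z := complex.Im (t1 * e2 - _).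
rewrite !ler_norml => /andP[a1 a2] /andP[a3 a4] /andP[a5 a6].
by apply/andP; split; lra.
Qed.

End LegendreRelation.

(** * The zeta function, the kernel Phi and the coefficients of the curve *)

Section PolynomialFamilies.
Variables (K : comNzRingType) (T : Type) (Pr : (T -> K) -> Prop).
Hypothesis Pc : forall c, Pr (fun=> c).
Hypothesis Pd : forall f g, Pr f -> Pr g -> Pr (fun t => f t + g t).
Hypothesis Pm : forall f g, Pr f -> Pr g -> Pr (fun t => f t * g t).

Lemma family_sum (I : Type) (s : seq I) (F : I -> T -> K) :
  (forall i, Pr (F i)) -> Pr (fun t => \sum_(i <- s) F i t).
Proof.
move=> h; elim: s => [|i s IH].
  by have -> : (fun t => \sum_(i <- [::]) F i t) = (fun=> 0); [apply/funext => t; rewrite big_nil|exact: Pc].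
have -> : (fun t => \sum_(j <- i :: s) F j t) = (fun t => F i t + \sum_(j <- s) F j t).
  by apply/funext => t; rewrite big_cons.
exact: (Pd (h i) IH).
Qed.

(** Determinants of polynomial matrices depend on a parameter as their entries
    do, whichever algebra of functions the entries belong to: below, functions
    differentiable, or continuous, at a given point. *)
Definition coefwise (G : T -> {poly K}) := forall k, Pr (fun t => (G t)`_k).

Lemma coefwise_sum (I : Type) (s : seq I) (F : I -> T -> {poly K}) :
  (forall i, coefwise (F i)) -> coefwise (fun t => \sum_(i <- s) F i t).
Proof.
move=> h k; have -> : (fun t => (\sum_(i <- s) F i t)`_k) = (fun t => \sum_(i <- s) (F i t)`_k).
  by apply/funext => t; rewrite coef_sum.
by apply: family_sum => i; exact: h.
Qed.

Lemma coefwise_mul F G : coefwise F -> coefwise G -> coefwise (fun t => F t * G t).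
Proof.
move=> hF hG k; have -> : (fun t => (F t * G t)`_k) = (fun t => \sum_(j <- index_enum 'I_k.+1) (F t)`_j * (G t)`_(k - j)).
  by apply/funext => t; rewrite coefM.
by apply: family_sum => i; apply: Pm.
Qed.

Lemma coefwise_cst c : coefwise (fun=> c).
Proof. by move=> k; exact: Pc. Qed.

Lemma coefwise_prod (I : Type) (s : seq I) (F : I -> T -> {poly K}) :
  (forall i, coefwise (F i)) -> coefwise (fun t => \prod_(i <- s) F i t).
Proof.
move=> h; elim: s => [|i s IH].
  have -> : (fun t => \prod_(i <- [::]) F i t) = (fun=> 1); first by apply/funext => t; rewrite big_nil.
  exact: coefwise_cst.
have -> : (fun t => \prod_(j <- i :: s) F j t) = (fun t => F i t * \prod_(j <- s) F j t).
  by apply/funext => t; rewrite big_cons.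
exact: coefwise_mul.
Qed.

Lemma coefwise_det (n : nat) (A : T -> 'M[{poly K}]_n) :
  (forall i j, coefwise (fun t => A t i j)) -> coefwise (fun t => \det (A t)).
Proof.
move=> h; rewrite /determinant; apply: coefwise_sum => s.
apply: coefwise_mul; first exact: coefwise_cst.
by apply: coefwise_prod => i; exact: h.
Qed.

End PolynomialFamilies.

Section QuasiPeriodData.
Variables (R : realType) (e1 e2 : R[i]).
Local Notation C := R[i].
Local Notation sigma := (weierstrass_sigma e1 e2).

Definition twopii : C := 2 * (pi : R)%:C * 'i.

(** What is used about the quasi-periods eta1, eta2: the factors acquired by
    sigma, and Legendre's relation up to sign. *)
Definition quasi_periods (eta1 eta2 : C) : Prop :=
  [/\ forall z, sigma (z + e1) = - cexp ((z + e1 / 2) * eta1) * sigma z,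
      forall z, sigma (z + e2) = - cexp ((z + e2 / 2) * eta2) * sigma z &
      eta1 * e2 - eta2 * e1 = twopii \/ eta1 * e2 - eta2 * e1 = - twopii].

Lemma quasi_periods_exist : lattice_generators e1 e2 -> exists eta1 eta2, quasi_periods eta1 eta2.
Proof.
move=> e_gen; have e_gen' := lattice_generators_swap e_gen.
have [t1 h1] := tK_cvg e_gen; have [t2 h2] := tK_cvg e_gen'.
exists (2 * t1), (2 * t2); split.
- by move=> z; rewrite (sigma_shift1 e_gen z h1); congr (- cexp _ * _); field.
- by move=> z; rewrite -!(sigma_swap e1 e2) (sigma_shift1 e_gen' z h2); congr (- cexp _ * _); field.
by have [h|h] := legendre_relation e_gen h1 h2; [left|right]; rewrite -!mulrA -mulrBr h /twopii; ring.
Qed.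

Lemma twopii_neq0 : twopii != 0.
Proof.
rewrite /twopii !mulf_neq0 ?pnatr_eq0 //; last by rewrite -nm_gt0 nmi.
by rewrite -nm_gt0 nm_real normr_gt0 lt0r_neq0 // pi_gt0.
Qed.

End QuasiPeriodData.

Section Zeta.
Variables (R : realType) (e1 e2 eta1 eta2 : R[i]).
Hypothesis e_gen : lattice_generators e1 e2.
Hypothesis qp : quasi_periods e1 e2 eta1 eta2.
Local Notation C := R[i].
Implicit Types (z w u : C).
Local Notation latt := (latt e1 e2).
Local Notation lattice := (lattice e1 e2).
Local Notation sigma := (weierstrass_sigma e1 e2).
Local Notation zeta := (weierstrass_zeta e1 e2).
Local Notation Phi := (Phi e1 e2).

Definition dsigma := cderive sigma.

Lemma esig : entire sigma. Proof. exact: entire_sigma e_gen. Qed.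
Lemma edsig : entire dsigma. Proof. exact: entire_cderive esig. Qed.
Lemma dsigmaP z : is_derive z 1 sigma (dsigma z). Proof. exact: cderiveP z esig. Qed.

Lemma dsigma0 : dsigma 0 = 1.
Proof. exact: cderive_eq (is_derive_sigma0 e_gen) esig. Qed.

Lemma zetaE z : zeta z = dsigma z / sigma z.
Proof.
rewrite /weierstrass_zeta; congr (_ / _).
have h := dsigmaP z.
by rewrite derive1E; exact: (@derive_val _ _ _ _ _ _ _ h).
Qed.

Lemma dC_zeta z : ~ lattice z -> dC zeta z.
Proof.
move=> zl; have -> : zeta = (fun z => dsigma z / sigma z) by apply/funext => w; exact: zetaE.
exact: (dC_div (@edsig z) (@esig z) (sigma_neq0 e_gen zl)).
Qed.

Lemma is_derive_affine (a b z : C) : is_derive z 1 (fun x : C => a * x + b) a.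
Proof.
have := is_deriveC_D (is_deriveC_M (@is_deriveC_cst R a z) (@is_deriveC_id R z)) (@is_deriveC_cst R b z).
by rewrite mul0r add0r addr0 mulr1.
Qed.

Lemma dC_affine (a b z : C) : dC (fun x : C => a * x + b) z.
Proof. exact: dC_ex (is_derive_affine a b z). Qed.

Lemma is_derive_scale f (a b z d : C) : is_derive (a * z + b) 1 f d ->
  is_derive z 1 (fun x : C => f (a * x + b)) (d * a).
Proof. move=> h; exact: (is_deriveC_comp (is_derive_affine a b z) h). Qed.

(** With the constant left unspecified the relation is stable under addition
    and negation of l. *)
Definition sigma_shift (l h : C) := exists2 c : C, c != 0 &
  forall z, sigma (z + l) = c * cexp (h * z) * sigma z.

Lemma sigma_shift0 : sigma_shift 0 0.
Proof. by exists 1; rewrite ?oner_eq0 // => z; rewrite addr0 mul0r cexp0 !mul1r. Qed.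

Lemma sigma_shiftD l h l' h' : sigma_shift l h -> sigma_shift l' h' -> sigma_shift (l + l') (h + h').
Proof.
move=> [c c0 H] [c' c'0 H']; exists (c * c' * cexp (h' * l)).
  exact: (mulf_neq0 (mulf_neq0 c0 c'0) (cexp_neq0 _)).
by move=> z; rewrite addrA H' H mulrDr mulrDl !cexpD; ring.
Qed.

Lemma sigma_shiftN l h : sigma_shift l h -> sigma_shift (- l) (- h).
Proof.
move=> [c c0 H]; exists (c^-1 * cexp (h * l)); first by rewrite mulf_neq0 ?cexp_neq0 ?invr_eq0.
move=> z; have := H (z - l); rewrite subrK => ->.
rewrite mulNr cexpN mulrBr cexpB; have := cexp_neq0 (h * z); have := cexp_neq0 (h * l).
set X := cexp _; set Y := cexp (_ * z) => X0 Y0; set s := sigma _.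
by field; rewrite X0 Y0 c0.
Qed.

Lemma sigma_shiftZ l h (m : int) : sigma_shift l h -> sigma_shift (m%:~R * l) (m%:~R * h).
Proof.
move=> H; have nat_case (n : nat) : sigma_shift (n%:R * l) (n%:R * h).
  elim: n => [|n IH]; first by rewrite !mul0r; exact: sigma_shift0.
  by rewrite -natr1 !mulrDl !mul1r; exact: sigma_shiftD.
case: m => n; first by rewrite -!pmulrn; exact: nat_case.
by rewrite NegzE !mulrNz !mulNr -!pmulrn; exact/sigma_shiftN/nat_case.
Qed.

(** The quasi-period of the lattice vector of index (m, n). *)
Definition eta (m n : int) : C := m%:~R * eta1 + n%:~R * eta2.

Lemma etaE m n : eta m n = m%:~R * eta1 + n%:~R * eta2.
Proof. by []. Qed.

Lemma sigma_latt m n : sigma_shift (latt m n) (eta m n).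
Proof.
have [h1 h2 _] := qp; apply: sigma_shiftD; apply: sigma_shiftZ.
- exists (- cexp (e1 / 2 * eta1)); first by rewrite oppr_eq0 cexp_neq0.
  by move=> z; rewrite h1 mulrDl cexpD (mulrC z); ring.
- exists (- cexp (e2 / 2 * eta2)); first by rewrite oppr_eq0 cexp_neq0.
  by move=> z; rewrite h2 mulrDl cexpD (mulrC z); ring.
Qed.

Lemma exists_nonlattice : exists z, ~ lattice z.
Proof.
have [d d0 hd] := lattice_discrete e_gen.
have [z /andP[z0 zd]] := point_near (0 : C) d0; exists z => zl; move: z0.
by rewrite subr0 in zd *; rewrite (hd z zl zd) nm0 ltxx.
Qed.

(** The multiplier constant is determined up to sign by the oddness of sigma. *)
Lemma sigma_shift_sqr l h c : (forall z, sigma (z + l) = c * cexp (h * z) * sigma z) ->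
  c ^+ 2 = cexp (h * l).
Proof.
move=> H; have [z zl] := exists_nonlattice; have s0 := sigma_neq0 e_gen zl.
have := H (- (z + l)).
have -> : - (z + l) + l = - z by ring.
rewrite !sigmaN (H z) (mulrN h) cexpN mulrDr cexpD.
have X0 := cexp_neq0 (h * z); have Y0 := cexp_neq0 (h * l).
set X := cexp _ in X0 *; set Y := cexp _ in Y0 *.
have -> : c * (X * Y)^-1 * - (c * X * sigma z) = - (c ^+ 2 / Y) * sigma z by field; rewrite X0 Y0.
rewrite -mulN1r => /(mulIf s0)/oppr_inj/esym/(canRL (divfK Y0)); rewrite mul1r; exact.
Qed.

Lemma dsigma_shift l h c : (forall z, sigma (z + l) = c * cexp (h * z) * sigma z) ->
  forall z, dsigma (z + l) = c * cexp (h * z) * (dsigma z + h * sigma z).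
Proof.
move=> H z; have d1 : is_derive z 1 (fun x => sigma (x + l)) (dsigma (z + l)).
  have := @is_derive_scale sigma 1 l z (dsigma (z + l)); rewrite mul1r mulr1 => /(_ (dsigmaP _)).
  by have -> : (fun x => sigma (1 * x + l)) = (fun x => sigma (x + l)) by apply/funext => x; rewrite mul1r.
have d2 : is_derive z 1 (fun x => cexp (h * x)) (cexp (h * z) * h).
  have := @is_derive_scale (@cexp R) h 0 z (cexp (h * z)); rewrite addr0 => /(_ (is_derive_cexp _)).
  by have -> : (fun x => cexp (h * x + 0)) = (fun x => cexp (h * x)) by apply/funext => x; rewrite addr0.
have d3 := is_deriveC_M (is_deriveC_M (@is_deriveC_cst R c z) d2) (dsigmaP z).
have E : (fun x => sigma (x + l)) = (fun x => c * cexp (h * x) * sigma x) by apply/funext.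
rewrite E in d1; rewrite (is_deriveC_uniq d1 d3); ring.
Qed.

(** Logarithmic derivative of the quasi-periodicity of sigma. *)
Lemma zeta_shift m n z : ~ lattice z -> zeta (z + latt m n) = zeta z + eta m n.
Proof.
move=> zl; have [c c0 H] := sigma_latt m n; have s0 := sigma_neq0 e_gen zl.
rewrite !zetaE (dsigma_shift H) H; have X0 := cexp_neq0 (eta m n * z).
by set X := cexp _ in X0 *; field; rewrite s0 X0 c0.
Qed.

(** The factors exp(eta z) coming from the two sigmas and from zeta in the
    exponent cancel; this is why the exponential is part of the definition of
    [Phi]. *)
Lemma Phi_periodic z a l : lattice l -> ~ lattice a -> Phi z (a + l) = Phi z a.
Proof.
move=> [m [n ->]] al; have [c c0 H] := sigma_latt m n; have s0 := sigma_neq0 e_gen al.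
rewrite /Defs.Phi (zeta_shift m n al).
have -> : a + latt m n - z = (a - z) + latt m n by ring.
rewrite !H; move: (eta m n) => h; rewrite mulrDl cexpD mulrBr cexpB.
have X0 := cexp_neq0 (h * a); have Y0 := cexp_neq0 (h * z).
set X := cexp (h * a) in X0 *; set Y := cexp (h * z) in Y0 *; set W := cexp _.
have [->|sz] := eqVneq (sigma z) 0; first by rewrite !mulr0 invr0 !mulr0 !mul0r.
by field; rewrite X0 Y0 c0 s0 sz.
Qed.

Lemma Phi_shift z a m n : ~ lattice z -> ~ lattice a ->
  Phi (z + latt m n) a = cexp (zeta a * latt m n - eta m n * a) * Phi z a.
Proof.
move=> zl al; have [c c0 H] := sigma_latt m n; have c2 := sigma_shift_sqr H.
have s0 := sigma_neq0 e_gen al; have sz := sigma_neq0 e_gen zl.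
rewrite /Defs.Phi H.
have -> : sigma (a - (z + latt m n)) = (c * cexp (eta m n * (a - (z + latt m n))))^-1 * sigma (a - z).
  have := H (a - (z + latt m n)); have -> : a - (z + latt m n) + latt m n = a - z by ring.
  move=> ->; rewrite mulKf // mulf_neq0 ?cexp_neq0 //.
rewrite mulrBr mulrDr (mulrDr (zeta a)) !(cexpB, cexpD); set h := eta m n; rewrite -c2.
have X0 := cexp_neq0 (h * a); have Y0 := cexp_neq0 (h * z).
set X := cexp (h * a) in X0 *; set Y := cexp (h * z) in Y0 *; set W := cexp _; set V := cexp _.
by field; rewrite X0 Y0 c0 s0 sz.
Qed.

Lemma dC_Phi z a : ~ lattice z -> ~ lattice a -> dC (Phi z) a.
Proof.
move=> zl al; have d1 : dC (fun a => sigma (a - z)) a.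
  exact: (@dC_comp R sigma (fun x => x - z) a (dC_B (@dC_id R a) (@dC_cst R z a)) (@esig _)).
have d2 := dC_M (@esig a) (@dC_cst R (sigma z) a).
have d3 := dC_cexp (dC_M (dC_zeta al) (@dC_cst R z a)).
have n0 : sigma a * sigma z != 0 by rewrite mulf_neq0 ?(sigma_neq0 e_gen).
exact: (dC_M (dC_div d1 d2 n0) d3).
Qed.

End Zeta.

Section QCoefficients.
Variables (R : realType) (e1 e2 eta1 eta2 : R[i]) (N : nat) (p : 'I_N -> R[i]).
Hypothesis e_gen : lattice_generators e1 e2.
Hypothesis qp : quasi_periods e1 e2 eta1 eta2.
Hypothesis p_inj : injective (fun j => torus_pi e1 e2 (p j)).
Local Notation C := R[i].

Lemma p_diff l m : l != m -> ~ lattice e1 e2 (p m - p l).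
Proof. by move=> lm h; move: lm; rewrite (p_inj ((torus_piP e1 e2 _ _).2 h)) eqxx. Qed.

Lemma q_coef_periodic i a l : lattice e1 e2 l -> ~ lattice e1 e2 a ->
  q_coef e1 e2 p i (a + l) = q_coef e1 e2 p i a.
Proof.
move=> ll al; rewrite /q_coef.
have -> // : spectral_mx e1 e2 p 0 (a + l) = spectral_mx e1 e2 p 0 a.
by apply/matrixP => j k; rewrite !mxE; case: eqVneq => // _; rewrite (Phi_periodic e_gen qp).
Qed.

(** The entries of the matrix are differentiable in alpha, and the
    coefficients are polynomials in them. *)
Lemma q_coef_dC i a : ~ lattice e1 e2 a -> dC (q_coef e1 e2 p i) a.
Proof.
move=> al; rewrite /q_coef /char_poly.
apply: (@coefwise_det C C (fun f => dC f a)).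
- move=> c; exact: dC_cst.
- move=> f g; exact: dC_D.
- move=> f g; exact: dC_M.
move=> l m k; have -> : (fun t => (char_poly_mx (- spectral_mx e1 e2 p 0 t) l m)`_k) =
   (fun t => ('X *+ (l == m))`_k + (if k == 0%N then spectral_mx e1 e2 p 0 t l m else 0)).
  by apply/funext => t; rewrite !mxE coefB coefC; case: ifP => _; rewrite ?opprK ?subr0 ?addr0.
apply: dC_D; first exact: dC_cst.
have [_|_] := eqVneq k 0%N; last exact: dC_cst.
have -> : (fun t => spectral_mx e1 e2 p 0 t l m) = (fun t => if l == m then 0 else Phi e1 e2 (p m - p l) t).
  by apply/funext => t; rewrite mxE.
case: eqVneq => lm; first exact: dC_cst.
exact: (dC_Phi e_gen (p_diff lm) al).
Qed.

End QCoefficients.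

(** * Quasi-periodic functions with poles *)

Section Landau.
Variable R : realType.
Local Notation C := R[i].
Implicit Types (f : C -> C) (z w : C).

Lemma posC (e : C) : 0 < e -> exists2 r : R, 0 < r & e = r%:C.
Proof.
case: e => a b; rewrite ltcE /= => /andP[/eqP b0 a0]; exists a => //.
by rewrite b0.
Qed.

Lemma cst_posC (r : R) : 0 < r -> 0 < r%:C :> C.
Proof. by rewrite ltcR. Qed.

Lemma norm_leP (z w : C) (r : R) : (`|z| <= r%:C * `|w|) = (nm z <= r * nm w).
Proof. by rewrite -!nmE -rmorphM lecR. Qed.

(** The Cauchy-Riemann equation says exactly that the real differential is
    multiplication by a complex number. *)
Lemma dbar_eq0P f z : dbar_eq0 f z <-> dC f z.
Proof.
split=> [[fx [fy [/eqoP h fxy]]]|/dCP[c /is_deriveCP h]].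
  have fyE : fy = 'i * fx.
    have : 'i * (fx + 'i * fy) = 0 by rewrite fxy mulr0.
    rewrite mulrDr mulrA -expr2 sqr_i mulN1r => /eqP; rewrite subr_eq0 => /eqP -> //.
  apply/dCP; exists fx; apply/is_deriveCP => e e0.
  have /nbhsCP[d d0 hd] := h e%:C (cst_posC e0).
  exists d => // k kd; have := hd k; rewrite subr0 => /(_ kd) /=.
  rewrite norm_leP; suff -> : (complex.Re k)%:C * fx + (complex.Im k)%:C * fy = fx * k by [].
  by rewrite fyE {3}(complexRI k); ring.
exists c, ('i * c); split; last by rewrite mulrA -expr2 sqr_i mulN1r subrr.
apply/eqoP => e /posC[r r0 ->]; apply/nbhsCP; have [d d0 hd] := h r r0.
exists d => // k; rewrite subr0 => kd; have := hd k kd; rewrite norm_leP /=.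
suff -> : (complex.Re k)%:C * c + (complex.Im k)%:C * ('i * c) = c * k by [].
by rewrite {3}(complexRI k); ring.
Qed.

Lemma bigO_puncturedP f (g : C -> C) z :
  (f =O_ ((z)^') g) <->
  exists d B : R, [/\ 0 < d, 0 < B & forall w, 0 < nm (w - z) < d -> nm (f w) <= B * nm (g w)].
Proof.
split=> [/eqO_exP[k k0 h]|[d [B [d0 B0 h]]]].
  have [B B0 kB] := posC k0; rewrite kB in h.
  have /nbhsCP[d d0 hd] : nbhs z (fun w => w != z -> `|f w| <= B%:C * `|g w|) by exact: h.
  exists d, B; split=> // w /andP[w0 wd].
  by have := hd w wd; rewrite -subr_eq0 -nm_gt0 => /(_ w0); rewrite norm_leP.
apply/eqO_exP; exists B%:C; first exact: cst_posC.
suff : nbhs z (fun w => w != z -> `|f w| <= B%:C * `|g w|) by [].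
apply/nbhsCP; exists d => // w wd; rewrite -subr_eq0 -nm_gt0 => w0.
by rewrite norm_leP; apply: h; rewrite w0.
Qed.

End Landau.

Section CompactLocal.
Variable R : realType.
Local Notation C := R[i].

Lemma compact_local_bound (T : topologicalType) (K : set T) (P : set T) (f : T -> R) : compact K ->
  (forall x, K x -> exists B : R, \forall z \near x, P z -> f z <= B) ->
  exists2 B : R, 0 < B & forall z, K z -> P z -> f z <= B.
Proof.
move=> /compact_near_coveringP cK h.
have : \forall B \near +oo, K `<=` (fun z => P z -> f z <= B).
  apply: cK => x /h[B hB]; exists ([set z | P z -> f z <= B], [set B' | B <= B']) => /=.
    by split=> //; exact: nbhs_pinfty_ge (num_real _).
  by move=> [z B'] /= [zB BB'] Pz; apply: le_trans BB'; exact: zB.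
move=> H; have H0 : \forall B \near +oo, (0 : R) < B by exact: nbhs_pinfty_gt (num_real _).
have [B [h1 h2]] := filter_ex (filterI H H0).
by exists B => // z Kz Pz; exact: h1.
Qed.

Lemma nonzero_common (I : Type) (s : seq I) (F : I -> C -> C) (a : C) :
  (forall i, entire (F i)) -> (forall i, exists z, F i z != 0) ->
  exists2 d : R, 0 < d & forall z, 0 < nm (z - a) < d -> \prod_(i <- s) F i z != 0.
Proof.
move=> eF nF; elim: s => [|i s [d d0 hd]].
  by exists 1 => // z _; rewrite big_nil oner_eq0.
have [d' d'0 hd'] := isolated_zeros a (eF i) (nF i).
exists (Num.min d d'); first by rewrite lt_min d0.
by move=> z /andP[z0]; rewrite lt_min => /andP[z1 z2]; rewrite big_cons mulf_neq0 ?hd ?hd' ?z0.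
Qed.

Lemma int_lipschitz (x : int -> R) (c : R) : (forall m, `|x (m + 1) - x m| <= c) ->
  forall m, x m <= x 0 + `|m%:~R| * c.
Proof.
move=> h [n|n].
  elim: n => [|n IH]; first by rewrite normr0 mul0r addr0.
  have := h n%:Z; have -> : n%:Z + 1 = n.+1%:Z by lia.
  rewrite ler_norml => /andP[_ h1]; move: IH; rewrite -!pmulrn !normr_nat -natr1 mulrDl mul1r; lra.
rewrite NegzE; elim: n => [|n IH].
  have := h (-1); rewrite addNr distrC ler_norml => /andP[_ h1].
  by rewrite rmorphN /= normrN normr1 mul1r; lra.
have := h (- n.+2%:Z); have -> : - n.+2%:Z + 1 = - n.+1%:Z by lia.
rewrite distrC ler_norml => /andP[_ h1]; move: IH; rewrite !mulrNz !normrN -!pmulrn !normr_nat.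
have -> : n.+2%:R = n.+1%:R + 1 :> R by rewrite natr1.
by rewrite mulrDl mul1r; lra.
Qed.

End CompactLocal.

Section Parallelogram.
Variables (R : realType) (e1 e2 : R[i]).
Hypothesis e_gen : lattice_generators e1 e2.
Local Notation C := R[i].
Implicit Types (z w : C).

(** The period parallelogram, centred so that the origin is its only lattice
    point. *)
Definition cell : set C := [set z | `|crd1 e1 e2 z| <= 1/2 /\ `|crd2 e1 e2 z| <= 1/2].

Lemma cell_compact : compact cell.
Proof.
pose f (z : C) : C := (complex.Re z)%:C * e1 + (complex.Im z)%:C * e2.
have E : cell = f @` [set z : C | -(1/2) <= complex.Re z <= 1/2 /\ -(1/2) <= complex.Im z <= 1/2].
  apply/seteqP; split=> [z [h1 h2]|_ [z [h1 h2] <-]].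
    exists (crd1 e1 e2 z +i* crd2 e1 e2 z); first by split; rewrite /= -ler_norml.
    by rewrite /f /= -crdE.
  have [q1 q2] := crd_comb e_gen (complex.Re z) (complex.Im z).
  by rewrite /cell /f /= q1 q2 !ler_norml.
rewrite E; apply: continuous_compact; last exact: crect_compact.
apply: continuous_subspaceT => z; apply/contCP => e e0.
have M0 : 0 < nm e1 + nm e2 + 1 by have := nm_ge0 e1; have := nm_ge0 e2; lra.
exists (e / (nm e1 + nm e2 + 1)); first exact: divr_gt0.
move=> w wz; have -> : f w - f z = (complex.Re (w - z))%:C * e1 + (complex.Im (w - z))%:C * e2.
  by rewrite /f ReD ReN ImD ImN !rmorphB /=; ring.
apply: le_lt_trans (nmD _ _) _; rewrite !nmM !nm_real.
have n1 := nm_ge0 e1; have n2 := nm_ge0 e2; have n3 := nm_ge0 (w - z).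
have h1 := ler_wpM2r n1 (Re_le_nm (w - z)); have h2 := ler_wpM2r n2 (Im_le_nm (w - z)).
by move: wz; rewrite ltr_pdivlMr //; lra.
Qed.

Lemma cell_reduce z : exists m n, cell (z - latt e1 e2 m n) /\
  `|m%:~R : R| <= `|crd1 e1 e2 z| + 1 /\ `|n%:~R : R| <= `|crd2 e1 e2 z| + 1.
Proof.
have key (s : R) : exists m : int, `|s - m%:~R| <= 1/2 /\ `|m%:~R : R| <= `|s| + 1.
  exists (Num.floor (s + 1/2)); have := floor_le (s + 1/2); have := lt_succ_floor (s + 1/2).
  rewrite intrD1; set f := (Num.floor _)%:~R : R => h1 h2.
  have h3 : `|s - f| <= 1/2 by rewrite ler_norml; apply/andP; split; lra.
  split=> //; have -> : f = s - (s - f) by ring.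
  by apply: le_trans (ler_normB _ _) _; lra.
have [m [m1 m2]] := key (crd1 e1 e2 z); have [n [n1 n2]] := key (crd2 e1 e2 z).
exists m, n; have [q1 q2] := crd_latt e_gen m n.
split; last by [].
have E1 : crd1 e1 e2 (z - latt e1 e2 m n) = crd1 e1 e2 z - m%:~R by rewrite crd1D (crd1N e_gen) q1.
have E2 : crd2 e1 e2 (z - latt e1 e2 m n) = crd2 e1 e2 z - n%:~R by rewrite crd2D (crd2N e_gen) q2.
by split; rewrite ?E1 ?E2.
Qed.

Lemma cell_lattice z : cell z -> lattice e1 e2 z -> z = 0.
Proof.
move=> [h1 h2] /(lattice_crd e_gen)[m [n [q1 q2]]].
have key (k : int) : `|k%:~R : R| <= 1/2 -> k = 0.
  rewrite -intr_norm => h.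
  have : (`|k| : int)%:~R < 1%:~R :> R by lra.
  by rewrite ltr_int; lia.
rewrite q1 in h1; rewrite q2 in h2.
by rewrite (crdE e_gen z) q1 q2 (key _ h1) (key _ h2) !mul0r addr0.
Qed.

End Parallelogram.

Section PoleLiouville.
Variables (R : realType) (e1 e2 eta1 eta2 : R[i]) (N : nat) (p : 'I_N -> R[i]).
Hypothesis e_gen : lattice_generators e1 e2.
Local Notation C := R[i].
Implicit Types (f : C -> C) (z w x : C).
Local Notation latt := (latt e1 e2).
Local Notation sigma := (weierstrass_sigma e1 e2).
Local Notation poles := (poles e1 e2 p).

(** Entire, with a double zero at every possible pole: it absorbs a function
    that is merely known to be bounded there. *)
Definition pole_den z : C := \prod_(j < N) sigma (z - p j) ^+ 2.

Lemma dC_subr (a z : C) : dC (fun x => x - a) z.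
Proof. exact: (dC_B (@dC_id R z) (@dC_cst R a z)). Qed.

Lemma entire_sub f (a : C) : entire f -> entire (fun z => f (z - a)).
Proof. move=> ef z; exact: (@dC_comp R f (fun x => x - a) z (@dC_subr a z) (ef (z - a))). Qed.

Lemma entire_mul f g : entire f -> entire g -> entire (fun z => f z * g z : C).
Proof. move=> hf hg z; exact: (dC_M (hf z) (hg z)). Qed.

Lemma entire_add f g : entire f -> entire g -> entire (fun z => f z + g z : C).
Proof. move=> hf hg z; exact: (dC_D (hf z) (hg z)). Qed.

Lemma entire_pole_den : entire pole_den.
Proof.
move=> z; apply: dC_prod => j _; apply: (@dC_X R (fun z => sigma (z - p j)) 2 z).
exact: (entire_sub (entire_sigma e_gen)).
Qed.

Lemma polesP z : poles z <-> pole_den z = 0.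
Proof.
split=> [[j zj]|/eqP].
  by rewrite /pole_den (bigD1 j) //= ((sigma_eq0 e_gen _).2 zj) expr0n mul0r.
rewrite /pole_den prodf_seq_eq0 => /hasP[j _]; rewrite /= expf_eq0 /= => /eqP/(sigma_eq0 e_gen) h.
by exists j.
Qed.

Lemma pole_den_neq0 z : ~ poles z -> pole_den z != 0.
Proof. by move=> zp; apply/eqP => h; apply: zp; apply/polesP. Qed.

Lemma poles_shift m n z : poles (z + latt m n) <-> poles z.
Proof.
have ll : lattice e1 e2 (latt m n) by exists m, n.
by split=> -[j h]; exists j; move: h; rewrite -addrAC; [move/(lattDr _ ll)|move=> h; apply/(lattDr _ ll)].
Qed.

Lemma nonpole_near (a : C) : exists2 d : R, 0 < d & forall z, 0 < nm (z - a) < d -> ~ poles z.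
Proof.
have nz (j : 'I_N) : exists z, sigma (z - p j) ^+ 2 != 0.
  have [z zl] := exists_nonlattice e_gen; exists (z + p j).
  by rewrite addrK expf_neq0 // sigma_neq0.
have en (j : 'I_N) : entire (fun z => sigma (z - p j) ^+ 2).
  move=> z; apply: (@dC_X R (fun z => sigma (z - p j)) 2 z).
  exact: (entire_sub (entire_sigma e_gen)).
have [d d0 hd] := nonzero_common (index_enum 'I_N) a en nz.
by exists d => // z /hd zd /polesP zp; move: zd; rewrite -/(pole_den z) zp eqxx.
Qed.

Lemma nonpole_open z : ~ poles z -> exists2 d : R, 0 < d & forall w, nm (w - z) < d -> ~ poles w.
Proof.
move=> zp; have [d d0 hd] := nonpole_near z; exists d => // w wd.
have [->//|wz] := eqVneq w z; apply: hd; rewrite wd andbT nm_gt0 subr_eq0 //.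
Qed.

Lemma exists_nonpole : exists z, ~ poles z.
Proof.
have [d d0 hd] := nonpole_near 0; have [z zd] := point_near (0 : C) d0.
by exists z; apply: hd.
Qed.

Lemma pole_den_order x : poles x -> exists2 B : R, 0 < B &
  forall z, nm (z - x) <= 1 -> nm (pole_den z) <= B * nm (z - x) ^+ 2.
Proof.
move=> [j xj]; have s0 := (sigma_eq0 e_gen _).2 xj.
have [g eg hg] := entire_factor (entire_sub (a := p j) (entire_sigma e_gen)) s0.
pose G z := g z ^+ 2 * \prod_(i < N | i != j) sigma (z - p i) ^+ 2.
have eG : entire G.
  move=> z; apply: dC_M; first exact: (@dC_X R g 2 z (eg z)).
  apply: dC_prod => i _; apply: (@dC_X R (fun z => sigma (z - p i)) 2 z).
  exact: (entire_sub (entire_sigma e_gen)).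
have [B B0 hB] := entire_bounded x 1 eG; exists B => // z zx.
rewrite /pole_den (bigD1 j) //= hg exprMn -mulrA -/(G z) nmM nmX mulrC ler_wpM2r ?exprn_ge0 ?nm_ge0 //.
exact: hB.
Qed.

(** The product f v, with v as in [pole_den]; its value at the poles, where f
    has junk values, is the limit 0. *)
Definition cleared f z : C := if `[< poles z >] then 0 else f z * pole_den z.

(** Near a pole the product is O((z - x)^2), hence differentiable with
    derivative 0. *)
Lemma cleared_entire f : (forall z, ~ poles z -> dC f z) ->
  (forall x, poles x -> exists d B : R, 0 < d /\ forall z, nm (z - x) < d -> ~ poles z -> nm (f z) <= B) ->
  entire (cleared f).
Proof.
move=> df bf x; have [xp|xp] := pselect (poles x); last first.
  have [d d0 hd] := nonpole_open xp.
  apply: (@dC_near R _ (fun z => f z * pole_den z)).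
    by exists d => // w /hd wp; rewrite /cleared; case: asboolP.
  exact: (dC_M (df x xp) (@entire_pole_den x)).
have [d [B [d0 hB]]] := bf x xp; have [K K0 hK] := pole_den_order xp.
apply: (@dC_ex R _ x 0); apply/is_deriveCP => e e0.
have B1 : 0 < `|B| * K + 1 by rewrite ltr_wpDl // mulr_ge0 // ltW.
exists (Num.min (Num.min d 1) (e / (`|B| * K + 1))); first by rewrite !lt_min d0 ltr01 divr_gt0.
move=> h; rewrite !lt_min => /andP[/andP[hd h1] he].
have -> : cleared f x = 0 by rewrite /cleared; case: asboolP.
rewrite mul0r !subr0 /cleared; case: asboolP => [_|xh].
  by rewrite nm0 mulr_ge0 ?nm_ge0 // ltW.
have hx : x + h - x = h by ring.
have b1 := hB (x + h); rewrite hx in b1; have {}b1 := b1 hd xh.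
have b2 := hK (x + h); rewrite hx in b2; have {}b2 := b2 (ltW h1).
have n0 := nm_ge0 h.
rewrite nmM; apply: (@le_trans _ _ (`|B| * (K * nm h ^+ 2))).
  by apply: ler_pM; rewrite ?nm_ge0 //; apply: le_trans b1 _; exact: ler_norm.
have -> : `|B| * (K * nm h ^+ 2) = (`|B| * K * nm h) * nm h by ring.
rewrite ler_wpM2r //; apply: le_trans (_ : (`|B| * K + 1) * nm h <= _).
  by rewrite ler_wpM2r // lerDl.
by rewrite mulrC -ler_pdivlMr // ltW.
Qed.

Lemma shift_bound f (a1 a2 c1 c2 : C) : nm a1 = 1 -> nm a2 = 1 ->
  (forall z, ~ poles z -> f (z + e1) = a1 * f z + c1) ->
  (forall z, ~ poles z -> f (z + e2) = a2 * f z + c2) ->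
  forall z m n, ~ poles z ->
    nm (f (z + latt m n)) <= nm (f z) + `|m%:~R| * nm c1 + `|n%:~R| * nm c2.
Proof.
move=> na1 na2 h1 h2 z m n zp.
have step (a c u v : C) : nm a = 1 -> v = a * u + c -> `|nm v - nm u| <= nm c.
  move=> na ->; have n1 : nm (a * u) = nm u by rewrite nmM na mul1r.
  rewrite ler_norml -n1 lerBlDl nmD andbT.
  have := nm_le_sub (a * u) (a * u + c); have -> : a * u - (a * u + c) = - c by ring.
  by rewrite nmN; lra.
have A := @int_lipschitz R (fun m => nm (f (z + latt m 0))) (nm c1).
have B := @int_lipschitz R (fun n => nm (f (z + latt m n))) (nm c2).
have {}A : nm (f (z + latt m 0)) <= nm (f z) + `|m%:~R| * nm c1.
  have := A _ m; rewrite /= latt00 addr0; apply=> k; apply: step na1 _.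
  rewrite -h1; last by move/poles_shift.
  by congr (f _); rewrite /Defs.latt rmorphD /=; ring.
have {}B : nm (f (z + latt m n)) <= nm (f (z + latt m 0)) + `|n%:~R| * nm c2.
  apply: B => k; apply: step na2 _.
  rewrite -h2; last by move/poles_shift.
  by congr (f _); rewrite /Defs.latt rmorphD /=; ring.
lra.
Qed.

(** A function with poles at most at p_j + Lambda, in fact bounded there, and
    periodic up to constants of modulus one and additive constants, is affine:
    the translations give at most linear growth from the bound on a compact
    cell, and [quotient_liouville] applies to the pair (f v, v). *)
Lemma liouville_poles f (a1 a2 c1 c2 : C) : nm a1 = 1 -> nm a2 = 1 ->
  (forall z, ~ poles z -> dC f z) ->
  (forall j, exists d B : R, 0 < d /\ forall z, 0 < nm (z - p j) < d -> nm (f z) <= B) ->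
  (forall z, ~ poles z -> f (z + e1) = a1 * f z + c1) ->
  (forall z, ~ poles z -> f (z + e2) = a2 * f z + c2) ->
  exists c d, forall z, ~ poles z -> f z = c + d * z.
Proof.
move=> na1 na2 df bf h1 h2; have sb := shift_bound na1 na2 h1 h2.
have lb x : poles x -> exists d B : R, 0 < d /\ forall z, nm (z - x) < d -> ~ poles z -> nm (f z) <= B.
  move=> [j [m [n xE]]]; have [d [B [d0 hB]]] := bf j.
  exists d, (B + `|m%:~R| * nm c1 + `|n%:~R| * nm c2); split=> // z zd zp.
  have zE : z = (z - latt m n) + latt m n by rewrite subrK.
  have zp' : ~ poles (z - latt m n) by move/(poles_shift m n); rewrite subrK.
  have := sb _ m n zp'; rewrite -zE => hz; apply: le_trans hz _; rewrite !lerD2r.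
  apply: hB; have -> : z - latt m n - p j = z - x by rewrite -xE; ring.
  rewrite zd andbT nm_gt0 subr_eq0; apply/eqP => zx; apply: zp; rewrite zx.
  by exists j, m, n.
have [B B0 hB] : exists2 B : R, 0 < B & forall z, cell e1 e2 z -> ~ poles z -> nm (f z) <= B.
  apply: (@compact_local_bound R C (cell e1 e2) (~` poles) (fun z => nm (f z)) (cell_compact e_gen)).
  move=> x _; have [xp|xp] := pselect (poles x).
    have [d [B [d0 hB]]] := lb x xp; exists B; apply/nbhsCP; exists d => // w wd wp; exact: hB.
  exists (nm (f x) + 1); have [d d0 hd] := contC_eps (dC_cont (df x xp)) (ltr01 (R:=R)).
  apply/nbhsCP; exists d => // w /hd wd _.
  by have := nm_le_sub (f w) (f x); lra.
pose L := 2 * lbound e1 e2; have L0 : 0 <= L by rewrite mulr_ge0 ?lbound_ge0.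
pose K := nm c1 + nm c2; have n1 := nm_ge0 c1; have n2 := nm_ge0 c2.
have grow z : ~ poles z -> nm (f z) <= (B + K * (L + 1)) * (1 + nm z).
  move=> zp; have [m [n [cz [hm hn]]]] := cell_reduce e_gen z.
  have zp' : ~ poles (z - latt m n) by move/(poles_shift m n); rewrite subrK.
  have := sb _ m n zp'; rewrite subrK => hz; apply: le_trans hz _.
  have b := hB _ cz zp'; have [k1 k2] := crd_le e_gen z; rewrite -/L in k1 k2.
  have nz := nm_ge0 z.
  have m1 : `|m%:~R| * nm c1 <= (L * nm z + 1) * nm c1 by rewrite ler_wpM2r //; lra.
  have m2 : `|n%:~R| * nm c2 <= (L * nm z + 1) * nm c2 by rewrite ler_wpM2r //; lra.
  have q1 : 0 <= B * nm z by rewrite mulr_ge0 // ltW.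
  have q2 : 0 <= K * L by rewrite mulr_ge0 // addr_ge0.
  have q3 : 0 <= K * nm z by rewrite mulr_ge0 // addr_ge0.
  rewrite /K in q2 q3 *; nra.
have eu := cleared_entire df lb.
have nz : exists z, pole_den z != 0 by have [z zp] := exists_nonpole; exists z; exact: pole_den_neq0.
have [|c [d hcd]] := quotient_liouville (A := B + K * (L + 1)) eu entire_pole_den nz.
  move=> z z0; have zp : ~ poles z by move/polesP => h; rewrite h eqxx in z0.
  rewrite /cleared; case: asboolP => // _; rewrite nmM ler_wpM2r ?nm_ge0 //; exact: grow.
exists c, d => z zp; have := hcd z; rewrite /cleared; case: asboolP => // _.
by move/(mulIf (pole_den_neq0 zp)).
Qed.

End PoleLiouville.

(** * The solutions of the linear problem *)

Section PolarParts.
Variables (R : realType) (e1 e2 : R[i]) (N : nat) (p : 'I_N -> R[i]).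
Hypothesis e_gen : lattice_generators e1 e2.
Hypothesis p_inj : injective (fun j => torus_pi e1 e2 (p j)).
Local Notation C := R[i].
Implicit Types (f y psi : C -> C) (z w x : C) (a : 'I_N -> C).
Local Notation sigma := (weierstrass_sigma e1 e2).
Local Notation poles := (poles e1 e2 p).
Local Notation Pinf := (Pinf e1 e2).

Lemma PinfN z : Pinf (- z) = Pinf z.
Proof.
have [->|z0] := eqVneq z 0; first by rewrite oppr0.
apply: (mulfI z0); have := sigmaN e1 e2 z; rewrite !sigmaE mulNr; exact: oppr_inj.
Qed.

Lemma is_derive_Pinf0 : is_derive (0 : C) 1 Pinf 0.
Proof.
have h := @cderiveP R Pinf 0 (entire_Pinf e_gen).
have h2 := @is_derive_scale R Pinf (-1) 0 0 (cderive Pinf 0).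
rewrite mulr0 addr0 mulrN1 in h2; have {}h2 := h2 h.
have E : (fun x => Pinf (-1 * x + 0)) = Pinf by apply/funext => x; rewrite addr0 mulN1r PinfN.
rewrite E in h2; have e := is_deriveC_uniq h h2.
have : cderive Pinf 0 *+ 2 == 0 by rewrite mulr2n {1}e addNr.
by rewrite mulrn_eq0 /= => /eqP e0; rewrite e0 in h.
Qed.

Lemma dC_lipschitz f z : dC f z -> exists d B : R, [/\ 0 < d, 0 < B &
  forall w, nm (w - z) < d -> nm (f w - f z) <= B * nm (w - z)].
Proof.
move=> /dCP[c /is_deriveCP h]; have [d d0 hd] := h 1 ltr01.
exists d, (1 + nm c); split=> //; first by have := nm_ge0 c; lra.
move=> w wd; have := hd (w - z) wd; have -> : z + (w - z) = w by ring.
move=> h1; have -> : f w - f z = (f w - f z - c * (w - z)) + c * (w - z) by ring.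
by apply: le_trans (nmD _ _) _; rewrite nmM mulrDl; apply: lerD.
Qed.

Lemma zero_of_small (k x : C) (d B : R) : 0 < d ->
  (forall z, 0 < nm (z - x) < d -> nm k <= B * nm (z - x)) -> k = 0.
Proof.
move=> d0 h; apply: nm0_eq0; apply/ler_addgt0Pr => e e0; rewrite add0r.
have d1 : 0 < Num.min d (e / (`|B| + 1)) by rewrite lt_min d0 divr_gt0 // ltr_wpDl.
have [z /andP[z0]] := point_near x d1; rewrite lt_min => /andP[zd ze].
apply: le_trans (h z _) _; first by rewrite z0.
have B1 : 0 < `|B| + 1 by rewrite ltr_wpDl.
move: ze; rewrite ltr_pdivlMr // => ze; apply: le_trans (ltW ze).
rewrite mulrC ler_wpM2l ?ltW //; have := ler_norm B; lra.
Qed.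

Section Form.
Variables (nu kappa : C) (y : C -> C).
Hypothesis ey : entire y.
Hypothesis y0 : y 0 = 1.
Hypothesis dy : is_derive (0 : C) 1 y kappa.

(** The Laurent expansion at the origin: sigma(z) = z + O(z^3) because sigma
    is odd. *)
Lemma polar_expansion : exists d B : R, [/\ 0 < d, 0 < B &
  forall h, 0 < nm h < d -> nm (y h / sigma h - h^-1 - kappa) <= B * nm h].
Proof.
pose num h := y h - (kappa * h + 1) * Pinf h.
have ePinf := entire_Pinf e_gen; have P0 := Pinf0 e_gen.
have en : entire num.
  have ea : entire (fun h : C => kappa * h + 1) by move=> h; exact: dC_affine.
  have em := entire_mul ea ePinf.
  by move=> h; rewrite /num; apply: dC_B; [exact: ey|exact: em].
have n0 : num 0 = 0 by rewrite /num y0 P0 mulr0 add0r mulr1 subrr.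
have dn : taylor_coef num 0 1 = 0.
  apply: (@is_deriveC_uniq R num 0); first exact: (@taylor_coef1 R num 0 en).
  have := is_deriveC_B dy (is_deriveC_M (@is_derive_affine R kappa 1 0) is_derive_Pinf0).
  by rewrite P0 mulr1 mulr0 addr0 subrr.
have [B B0 hB] := entire_bounded 0 1 en.
have tl := taylor_local2 en hB; rewrite n0 dn in tl.
have half : 0 < 1/2 :> R by lra.
have [d d0 hd] := contC_eps (dC_cont (ePinf 0)) half.
exists (Num.min d (1/2)), (16 * B); split; [by rewrite lt_min d0; lra|by rewrite mulr_gt0|].
move=> h /andP[h0]; rewrite lt_min => /andP[hd1 h12].
have := hd h; rewrite subr0 P0 => /(_ hd1) Pd.
have Ph : 1/2 <= nm (Pinf h).
  by have := nm_le_sub 1 (Pinf h); rewrite nm1 (nmB 1); lra.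
have Pn : Pinf h != 0 by rewrite -nm_gt0; lra.
have hn : h != 0 by rewrite -nm_gt0.
have -> : y h / sigma h - h^-1 - kappa = num h / (h * Pinf h).
  by rewrite /num sigmaE; field; rewrite hn Pn.
have := tl h (ltW h12); rewrite mul0r addr0 add0r subr0 nm_div nmM => b.
rewrite ler_pdivrMr ?mulr_gt0 //; last by lra.
apply: le_trans b _; rewrite expr2.
have -> : 16 * B * nm h * (nm h * nm (Pinf h)) = 8 * B * (nm h * nm h) * (2 * nm (Pinf h)) by ring.
rewrite ler_peMr //; last by lra.
by rewrite !mulr_ge0 ?nm_ge0 // ltW.
Qed.

(** The general solution candidate: a superposition of translates of a
    function with a simple pole at each p_j, plus an exponential term, which
    occurs for the trivial twist. The entire function y encodes the twist, the
    basic function being y / sigma. *)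
Definition pform a (c z : C) : C := \sum_j a j * (y (z - p j) / sigma (z - p j)) + c * cexp (nu * z).
(** The part of [pform] that is regular at p_l. *)
Definition prest a c l z : C := \sum_(j | j != l) a j * (y (z - p j) / sigma (z - p j)) + c * cexp (nu * z).

Lemma dC_quot_shift (j : 'I_N) z : ~ lattice e1 e2 (z - p j) ->
  dC (fun z => y (z - p j) / sigma (z - p j)) z.
Proof.
move=> zl; have e' := @entire_sub R y (p j) ey; have es := @entire_sub R sigma (p j) (entire_sigma e_gen).
exact: (dC_div (e' z) (es z) (sigma_neq0 e_gen zl)).
Qed.

Lemma dC_expl (c z : C) : dC (fun z => c * cexp (nu * z)) z.
Proof. exact: (dC_M (@dC_cst R c z) (dC_cexp (dC_M (@dC_cst R nu z) (@dC_id R z)))). Qed.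

Lemma dC_pform a c z : ~ poles z -> dC (pform a c) z.
Proof.
move=> zp; apply: dC_D; last exact: dC_expl.
apply: dC_sum => j _; apply: dC_M; first exact: dC_cst.
by apply: dC_quot_shift => h; apply: zp; exists j.
Qed.

Lemma dC_prest a c l : dC (prest a c l) (p l).
Proof.
apply: dC_D; last exact: dC_expl.
apply: dC_sum => j jl; apply: dC_M; first exact: dC_cst.
by apply: dC_quot_shift; apply: (p_diff p_inj).
Qed.

Lemma pform_rest a c l z : pform a c z = a l * (y (z - p l) / sigma (z - p l)) + prest a c l z.
Proof. by rewrite /pform /prest (bigD1 l) //= addrA. Qed.

(** The constant term of the Laurent expansion of [pform] at p_l: the
    condition psi = a / (z - p) + O(z - p) says that it vanishes. *)
Definition pconst a c l : C := a l * kappa + prest a c l (p l).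

Lemma pform_expansion a c l : exists d B : R, [/\ 0 < d, 0 < B &
  forall z, 0 < nm (z - p l) < d ->
    nm (pform a c z - a l / (z - p l) - pconst a c l) <= B * nm (z - p l)].
Proof.
have [d1 [B1 [d10 B10 h1]]] := polar_expansion.
have [d2 [B2 [d20 B20 h2]]] := dC_lipschitz (dC_prest (a := a) (c := c) (l := l)).
have na := nm_ge0 (a l).
exists (Num.min d1 d2), (nm (a l) * B1 + B2); split.
- by rewrite lt_min d10.
- by rewrite ltr_wpDl // mulr_ge0 // ltW.
move=> z /andP[z0]; rewrite lt_min => /andP[zd1 zd2].
rewrite (pform_rest _ _ l) /pconst; set Y := y _ / _.
have -> : a l * Y + prest a c l z - a l / (z - p l) - (a l * kappa + prest a c l (p l)) =
  a l * (Y - (z - p l)^-1 - kappa) + (prest a c l z - prest a c l (p l)) by ring.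
apply: le_trans (nmD _ _) _; rewrite nmM mulrDl -mulrA; apply: lerD; last exact: h2.
by apply: ler_wpM2l => //; apply: h1; rewrite z0.
Qed.

Lemma pform_bigO a c l : (fun z => pform a c z - a l / (z - p l)) =O_ ((p l)^') (fun z => z - p l) <->
  pconst a c l = 0.
Proof.
have [d [B [d0 B0 h]]] := pform_expansion a c l.
split=> [/bigO_puncturedP[d' [B' [d'0 B'0 h']]]|c0].
  apply: (@zero_of_small _ (p l) (Num.min d d') (B + B')); first by rewrite lt_min d0.
  move=> z /andP[z0]; rewrite lt_min => /andP[zd zd'].
  have {}h := h z; have {}h' := h' z; rewrite z0 zd in h; rewrite z0 zd' in h'.
  have {}h := h isT; have {}h' := h' isT; set X := pform a c z - a l / (z - p l) in h h' *.
  have -> : pconst a c l = X - (X - pconst a c l) by ring.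
  by apply: le_trans (nmBD _ _) _; rewrite mulrDl addrC; apply: lerD.
apply/bigO_puncturedP; exists d, B; split=> // z zd.
by have := h z zd; rewrite c0 subr0.
Qed.

End Form.

(** Solutions with given multipliers and residues; the problem in terms of k
    only sees the multipliers. *)
Definition multi_solution (b : C * C) a psi :=
  [/\ forall z, ~ poles z -> dC psi z,
      forall z, ~ poles z -> psi (z + e1) = b.1 * psi z /\ psi (z + e2) = b.2 * psi z &
      forall j, (fun z => psi z - a j / (z - p j)) =O_ ((p j)^') (fun z => z - p j)].

(** The two equations for k are a linear system whose determinant is the area
    of the lattice. *)
Lemma bloch_surj (b : C * C) : b.1 != 0 -> b.2 != 0 -> exists k, bloch_factors e1 e2 k = b.
Proof.
move=> /cexp_surj[l1 h1] /cexp_surj[l2 h2].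
pose w := 2 * (pi : R)%:C * 'i : C; have w0 : w != 0 by exact: twopii_neq0.
have D0 : (ldet e1 e2)%:C != 0 :> C by rewrite -nm_gt0 nm_real normr_gt0 ldet_neq0.
have DE : (ldet e1 e2)%:C = (complex.Re e1)%:C * (complex.Im e2)%:C - (complex.Im e1)%:C * (complex.Re e2)%:C :> C.
  by rewrite /ldet rmorphB !rmorphM.
pose D : C := (ldet e1 e2)%:C.
pose k : C * C := ((l1 / w * (complex.Im e2)%:C - l2 / w * (complex.Im e1)%:C) / D,
  (l2 / w * (complex.Re e1)%:C - l1 / w * (complex.Re e2)%:C) / D).
exists k; rewrite [b]surjective_pairing -h1 -h2 /bloch_factors /bloch_factor /pairing /k /= -/w.
move: D0; rewrite -/D; move: DE; rewrite -/D.
move: (complex.Re e1)%:C (complex.Im e1)%:C (complex.Re e2)%:C (complex.Im e2)%:C => x1 y1 x2 y2 DE D0.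
by congr (cexp _, cexp _); rewrite DE in D0 *; field; rewrite w0 D0.
Qed.

Lemma solution_withP b psi : solution_with e1 e2 p b psi <->
  [/\ b.1 != 0, b.2 != 0 & exists a, multi_solution b a psi].
Proof.
split=> [[k [a [<- [h1 h2 h3]]]]|[b1 b2 [a [h1 h2 h3]]]].
  split; [exact: cexp_neq0|exact: cexp_neq0|exists a; split=> //].
  by move=> z /h1/dbar_eq0P.
have [k hk] := bloch_surj b1 b2; exists k, a; split=> //; split=> //.
  by move=> z zp; apply/dbar_eq0P; exact: h1.
by move=> z zp; have := h2 z zp; rewrite -hk.
Qed.

(** Near a pole with nonzero residue the function is large. *)
Lemma residue_nonzero b a psi j : multi_solution b a psi -> a j != 0 -> nonzero_solution e1 e2 p psi.
Proof.
move=> [_ _ /(_ j)/bigO_puncturedP[d [B [d0 B0 h]]]] aj; apply: contrapT => H; move/eqP: aj; apply.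
have [d' d'0 hd'] := nonpole_near p e_gen (p j).
have d1 : 0 < Num.min (Num.min d d') 1 by rewrite !lt_min d0 d'0 ltr01.
apply: (@zero_of_small _ (p j) _ B d1) => z /andP[z0]; rewrite !lt_min => /andP[/andP[zd zd'] z1].
have zp : ~ poles z by apply: hd'; rewrite z0.
have psi0 : psi z = 0 by apply: contrapT => /eqP pz; apply: H; exists z.
have := h z; rewrite z0 zd psi0 sub0r nmN nm_div => /(_ isT).
rewrite ler_pdivrMr // => b1; apply: le_trans b1 _.
by rewrite -[leRHS]mulr1; apply: ler_wpM2l; [apply: mulr_ge0; exact: ltW|exact: ltW].
Qed.

(** Subtracting a form with the same residues leaves no poles. *)
Lemma difference_bounded nu nu' kappa y b a psi j : entire y -> y 0 = 1 -> is_derive (0 : C) 1 y kappa ->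
  multi_solution b a psi -> exists d B : R, 0 < d /\
    forall z, 0 < nm (z - p j) < d -> nm ((psi z - pform nu y a 0 z) * cexp (- (nu' * z))) <= B.
Proof.
move=> ey y0 dy [_ _ /(_ j)/bigO_puncturedP[d1 [B1 [d10 B10 h1]]]].
have [d2 [B2 [d20 B20 h2]]] := pform_expansion nu ey y0 dy a 0 j.
have ee : entire (fun z => cexp (- (nu' * z))).
  by move=> z; exact: (dC_cexp (dC_N (dC_M (@dC_cst R nu' z) (@dC_id R z)))).
have [B3 B30 h3] := entire_bounded (p j) 1 ee.
set k := pconst nu kappa y a 0 j in h2.
exists (Num.min (Num.min d1 d2) 1), ((B1 + B2 + nm k) * B3); split.
  by rewrite !lt_min d10 d20 ltr01.
move=> z /andP[z0]; rewrite !lt_min => /andP[/andP[zd1 zd2] z1].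
rewrite nmM; apply: ler_pM; rewrite ?nm_ge0 //; last by apply: h3; exact: ltW.
have {}h1 := h1 z; have {}h2 := h2 z; rewrite z0 zd1 in h1; rewrite z0 zd2 in h2.
have {}h1 := h1 isT; have {}h2 := h2 isT.
have -> : psi z - pform nu y a 0 z = (psi z - a j / (z - p j)) - (pform nu y a 0 z - a j / (z - p j) - k) - k by ring.
apply: le_trans (nmBD _ _) _; rewrite lerD2r; apply: le_trans (nmBD _ _) _; apply: lerD.
  by apply: le_trans h1 _; rewrite ler_piMr // ltW.
by apply: le_trans h2 _; rewrite ler_piMr // ltW.
Qed.

Lemma solution_congr b a psi psi' : (forall z, ~ poles z -> psi z = psi' z) ->
  multi_solution b a psi -> multi_solution b a psi'.
Proof.
move=> E [h1 h2 h3]; split.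
- move=> z zp; apply: (@dC_near R _ psi); last exact: h1.
  have [d d0 hd] := nonpole_open e_gen zp; exists d => // w /hd wp; by rewrite E.
- move=> z zp; have [q1 q2] := h2 z zp.
  have l1 : ~ poles (z + e1).
    have := @poles_shift R e1 e2 N p 1 0 z; rewrite /latt mul1r mul0r addr0 => H; by move/H.
  have l2 : ~ poles (z + e2).
    have := @poles_shift R e1 e2 N p 0 1 z; rewrite /latt mul1r mul0r add0r => H; by move/H.
  by rewrite -!E.
- move=> j; have /bigO_puncturedP[d [B [d0 B0 h]]] := h3 j.
  have [d' d'0 hd'] := nonpole_near p e_gen (p j).
  apply/bigO_puncturedP; exists (Num.min d d'), B; split=> //; first by rewrite lt_min d0.
  move=> z /andP[z0]; rewrite lt_min => /andP[zd zd'].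
  by rewrite -E; [apply: h|apply: hd']; rewrite z0.
Qed.

End PolarParts.

(* keeps rewriting from matching products and quotients inside these functions *)
Opaque cexp weierstrass_sigma weierstrass_zeta dsigma.

Section SolutionSpaces.
Variables (R : realType) (e1 e2 eta1 eta2 : R[i]) (N : nat) (p : 'I_N -> R[i]).
Hypothesis e_gen : lattice_generators e1 e2.
Hypothesis qp : quasi_periods e1 e2 eta1 eta2.
Hypothesis p_inj : injective (fun j => torus_pi e1 e2 (p j)).
Local Notation C := R[i].
Implicit Types (f y psi : C -> C) (z w x nu alpha : C) (a : 'I_N -> C).
Local Notation lattice := (lattice e1 e2).
Local Notation sigma := (weierstrass_sigma e1 e2).
Local Notation zeta := (weierstrass_zeta e1 e2).
Local Notation dsigma := (dsigma e1 e2).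
Local Notation Phi := (Phi e1 e2).
Local Notation poles := (poles e1 e2 p).
Local Notation msol := (multi_solution e1 e2 p).

(** The multipliers as functions of alpha and of nu = mu + zeta(alpha). In the
    variable nu they are entire, and alpha = 0 is no longer exceptional. *)
Definition Psi nu alpha : C * C := (cexp (nu * e1 - eta1 * alpha), cexp (nu * e2 - eta2 * alpha)).

Lemma PsiE nu alpha : Psi nu alpha = (cexp (nu * e1 - eta1 * alpha), cexp (nu * e2 - eta2 * alpha)).
Proof. by []. Qed.

Lemma shift_e1 z : z + e1 = z + latt e1 e2 1 0.
Proof. by rewrite /latt mul1r mul0r addr0. Qed.

Lemma shift_e2 z : z + e2 = z + latt e1 e2 0 1.
Proof. by rewrite /latt mul1r mul0r add0r. Qed.

Lemma eta10 : eta eta1 eta2 1 0 = eta1. Proof. by rewrite /eta mul1r mul0r addr0. Qed.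
Lemma eta01 : eta eta1 eta2 0 1 = eta2. Proof. by rewrite /eta mul1r mul0r add0r. Qed.
Lemma latt10 : latt e1 e2 1 0 = e1. Proof. by rewrite /latt mul1r mul0r addr0. Qed.
Lemma latt01 : latt e1 e2 0 1 = e2. Proof. by rewrite /latt mul1r mul0r add0r. Qed.

Lemma zeta_e1 z : ~ lattice z -> zeta (z + e1) = zeta z + eta1.
Proof. by move=> zl; rewrite shift_e1 (zeta_shift e_gen qp) // eta10. Qed.
Lemma zeta_e2 z : ~ lattice z -> zeta (z + e2) = zeta z + eta2.
Proof. by move=> zl; rewrite shift_e2 (zeta_shift e_gen qp) // eta01. Qed.

Lemma nonpole_e1 z : ~ poles z -> ~ poles (z + e1).
Proof. by rewrite shift_e1 => zp /poles_shift. Qed.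
Lemma nonpole_e2 z : ~ poles z -> ~ poles (z + e2).
Proof. by rewrite shift_e2 => zp /poles_shift. Qed.

Lemma nonpole_sub z j : ~ poles z -> ~ lattice (z - p j).
Proof. by move=> zp h; apply: zp; exists j. Qed.

Lemma legendre_neq0 : eta1 * e2 - eta2 * e1 != 0.
Proof. by have [_ _ [->|->]] := qp; rewrite ?oppr_eq0 twopii_neq0. Qed.

(** By Legendre's relation (eta1, eta2) is not proportional to (e1, e2). *)
Lemma legendre_solve k l : k * eta1 = l * e1 -> k * eta2 = l * e2 -> k = 0.
Proof.
move=> h1 h2; have : k * (eta1 * e2 - eta2 * e1) = 0.
  by rewrite mulrBr !mulrA h1 h2; ring.
by move/eqP; rewrite mulf_eq0 (negbTE legendre_neq0) orbF => /eqP.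
Qed.

Lemma e1_neq0 : e1 != 0.
Proof.
apply/eqP => h; have [|q] := e_gen (s := 1) (t := 0); last by move: q => /eqP; rewrite oner_eq0.
by rewrite h mulr0 mul0r addr0.
Qed.

(** One exponential factor makes both multipliers of modulus one: e1 and e2
    are linearly independent over the reals. *)
Lemma solve_moduli (r1 r2 : R) : exists nu : C, complex.Re (nu * e1) = r1 /\ complex.Re (nu * e2) = r2.
Proof.
have D0 := ldet_neq0 e_gen; pose D := ldet e1 e2.
pose x := (r1 * complex.Im e2 - r2 * complex.Im e1) / D.
pose y := (r1 * complex.Re e2 - r2 * complex.Re e1) / D.
exists (x +i* y); rewrite !ReM /x /y /= /D.
move: D0; rewrite /ldet; move: (complex.Re e1) (complex.Im e1) (complex.Re e2) (complex.Im e2) => x1 y1 x2 y2 D0.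
by split; field.
Qed.

(** For a nontrivial twist alpha the basic function is exp(nu z) sigma(alpha -
    z) / (sigma(alpha) sigma(z)), that is exp(mu z) Phi(z, alpha). *)
Definition ygen nu alpha z : C := cexp (nu * z) * (sigma (alpha - z) / sigma alpha).
(** For the trivial twist alpha = 0 the basic function is exp(nu z) zeta(z),
    which is quasi-periodic only up to an additive term. *)
Definition ytriv nu z : C := cexp (nu * z) * dsigma z.

Lemma is_derive_exp nu z : is_derive z 1 (fun x : C => cexp (nu * x)) (cexp (nu * z) * nu).
Proof.
have := @is_derive_scale R (@cexp R) nu 0 z (cexp (nu * z)); rewrite addr0 => /(_ (is_derive_cexp _)).
by have -> : (fun x => cexp (nu * x + 0)) = (fun x => cexp (nu * x)) by apply/funext => x; rewrite addr0.
Qed.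

Lemma entire_exp nu : entire (fun x : C => cexp (nu * x)).
Proof. by move=> z; exact: dC_ex (is_derive_exp nu z). Qed.

Lemma entire_ygen nu alpha : entire (ygen nu alpha).
Proof.
have e : entire (fun z => sigma (alpha - z) / sigma alpha).
  move=> z; apply: (@dC_M R (fun z => sigma (alpha - z)) (fun=> (sigma alpha)^-1) z); last exact: dC_cst.
  apply: (@dC_comp R sigma (fun x => alpha - x) z (dC_B (@dC_cst R alpha z) (@dC_id R z))).
  exact: (entire_sigma e_gen).
exact: (entire_mul (entire_exp (nu := nu)) e).
Qed.

Lemma entire_ytriv nu : entire (ytriv nu).
Proof. exact: (entire_mul (entire_exp (nu := nu)) (edsig e_gen)). Qed.

Lemma ygen0 nu alpha : ~ lattice alpha -> ygen nu alpha 0 = 1.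
Proof. by move=> al; rewrite /ygen mulr0 cexp0 mul1r subr0 divff // (sigma_neq0 e_gen). Qed.

Lemma ytriv0 nu : ytriv nu 0 = 1.
Proof. by rewrite /ytriv mulr0 cexp0 mul1r (dsigma0 e_gen). Qed.

Lemma is_derive_ygen nu alpha : ~ lattice alpha -> is_derive (0 : C) 1 (ygen nu alpha) (nu - zeta alpha).
Proof.
move=> al; have s0 := sigma_neq0 e_gen al.
have d1 := @is_derive_scale R sigma (-1) alpha 0 (dsigma alpha).
rewrite mulr0 add0r in d1; have {}d1 := d1 (dsigmaP e_gen alpha).
have d2 := is_deriveC_M (is_derive_exp nu 0) (is_deriveC_M d1 (@is_deriveC_cst R (sigma alpha)^-1 0)).
have E : (fun x => cexp (nu * x) * (sigma (-1 * x + alpha) * (sigma alpha)^-1)) = ygen nu alpha.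
  by apply/funext => x; rewrite /ygen mulN1r addrC.
rewrite E in d2.
have -> : nu - zeta alpha = cexp (nu * 0) * nu * (sigma (-1 * 0 + alpha) * (sigma alpha)^-1) +
   cexp (nu * 0) * (dsigma alpha * -1 * (sigma alpha)^-1 + sigma (-1 * 0 + alpha) * 0).
  by rewrite !mulr0 cexp0 add0r !mul1r addr0 divff // (zetaE e_gen) mulr1 mulrN1 mulNr.
exact: d2.
Qed.

Lemma dsigmaN z : dsigma (- z) = dsigma z.
Proof.
have d1 := @is_derive_scale R sigma (-1) 0 z (dsigma (- z)).
rewrite addr0 mulN1r in d1; have {}d1 := d1 (dsigmaP e_gen (- z)).
have E : (fun x => sigma (-1 * x + 0)) = (fun x => - sigma x).
  by apply/funext => x; rewrite addr0 mulN1r sigmaN.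
rewrite E in d1; have := is_deriveC_uniq d1 (is_deriveC_N (dsigmaP e_gen z)).
by rewrite mulrN1 => /oppr_inj.
Qed.

Lemma is_derive_dsigma0 : is_derive (0 : C) 1 dsigma 0.
Proof.
have h := @cderiveP R dsigma 0 (edsig e_gen).
have h2 := @is_derive_scale R dsigma (-1) 0 0 (cderive dsigma 0).
rewrite mulr0 addr0 mulrN1 in h2; have {}h2 := h2 h.
have E : (fun x => dsigma (-1 * x + 0)) = dsigma by apply/funext => x; rewrite addr0 mulN1r dsigmaN.
rewrite E in h2; have e := is_deriveC_uniq h h2.
have : cderive dsigma 0 *+ 2 == 0 by rewrite mulr2n {1}e addNr.
by rewrite mulrn_eq0 /= => /eqP e0; rewrite e0 in h.
Qed.

Lemma is_derive_ytriv nu : is_derive (0 : C) 1 (ytriv nu) nu.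
Proof.
have := is_deriveC_M (is_derive_exp nu 0) is_derive_dsigma0.
by rewrite !mulr0 cexp0 mul1r (dsigma0 e_gen) mulr1 addr0.
Qed.

Lemma ygenE nu alpha z : ygen nu alpha z / sigma z = cexp ((nu - zeta alpha) * z) * Phi z alpha.
Proof.
rewrite /ygen /Defs.Phi mulrBl cexpB [(sigma alpha * sigma z)^-1]invfM; have := cexp_neq0 (zeta alpha * z).
move: (cexp (zeta alpha * z)) (sigma alpha)^-1 (sigma z)^-1 => X u v X0.
by field.
Qed.

Lemma ytrivE nu z : ytriv nu z / sigma z = cexp (nu * z) * zeta z.
Proof. by rewrite /ytriv (zetaE e_gen) mulrA. Qed.

Lemma Phi_e1 z alpha : ~ lattice z -> ~ lattice alpha ->
  Phi (z + e1) alpha = cexp (zeta alpha * e1 - eta1 * alpha) * Phi z alpha.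
Proof. by move=> zl al; rewrite shift_e1 (Phi_shift e_gen qp) // latt10 eta10. Qed.

Lemma Phi_e2 z alpha : ~ lattice z -> ~ lattice alpha ->
  Phi (z + e2) alpha = cexp (zeta alpha * e2 - eta2 * alpha) * Phi z alpha.
Proof. by move=> zl al; rewrite shift_e2 (Phi_shift e_gen qp) // latt01 eta01. Qed.

Lemma ygen_shift nu alpha z : ~ lattice alpha -> ~ lattice z ->
  ygen nu alpha (z + e1) / sigma (z + e1) = (Psi nu alpha).1 * (ygen nu alpha z / sigma z) /\
  ygen nu alpha (z + e2) / sigma (z + e2) = (Psi nu alpha).2 * (ygen nu alpha z / sigma z).
Proof.
move=> al zl; have E (e et : C) : cexp ((nu - zeta alpha) * (z + e)) * cexp (zeta alpha * e - et * alpha) =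
    cexp (nu * e - et * alpha) * cexp ((nu - zeta alpha) * z).
  by rewrite -!cexpD; congr cexp; ring.
by rewrite !ygenE Phi_e1 // Phi_e2 //; split; rewrite mulrA E -mulrA.
Qed.

Lemma pform_gen_shift nu alpha a z : ~ lattice alpha -> ~ poles z ->
  pform e1 e2 p nu (ygen nu alpha) a 0 (z + e1) = (Psi nu alpha).1 * pform e1 e2 p nu (ygen nu alpha) a 0 z /\
  pform e1 e2 p nu (ygen nu alpha) a 0 (z + e2) = (Psi nu alpha).2 * pform e1 e2 p nu (ygen nu alpha) a 0 z.
Proof.
move=> al zp; rewrite /pform !mul0r !addr0 !mulr_sumr; split; apply: eq_bigr => j _;
  have [h1 h2] := ygen_shift nu al (nonpole_sub (j := j) zp); rewrite [RHS]mulrCA; congr (_ * _).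
  by rewrite -h1 [z - p j + _]addrAC.
by rewrite -h2 [z - p j + _]addrAC.
Qed.

(** After multiplication by an exponential the multipliers have modulus one,
    so the function is affine by [liouville_poles]; an affine function with
    these multipliers vanishes unless both are 1, which would make alpha a
    lattice point. *)
Lemma twist_liouville nu alpha f : ~ lattice alpha ->
  (forall z, ~ poles z -> dC f z) ->
  (forall nu' j, exists d B : R, 0 < d /\ forall z, 0 < nm (z - p j) < d -> nm (f z * cexp (- (nu' * z))) <= B) ->
  (forall z, ~ poles z -> f (z + e1) = (Psi nu alpha).1 * f z /\ f (z + e2) = (Psi nu alpha).2 * f z) ->
  forall z, ~ poles z -> f z = 0.
Proof.
move=> al df bf hs.
(* exp(- nu' z) f has multipliers of modulus one *)
have [nu' [r1 r2]] := solve_moduli (complex.Re (nu * e1 - eta1 * alpha)) (complex.Re (nu * e2 - eta2 * alpha)).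
pose b1 := cexp (nu * e1 - eta1 * alpha - nu' * e1); pose b2 := cexp (nu * e2 - eta2 * alpha - nu' * e2).
pose g z := f z * cexp (- (nu' * z)).
have n1 : nm b1 = 1 by rewrite nm_cexp ReD ReN r1 subrr expR0.
have n2 : nm b2 = 1 by rewrite nm_cexp ReD ReN r2 subrr expR0.
have g1 z : ~ poles z -> g (z + e1) = b1 * g z + 0.
  move=> zp; rewrite /g (hs z zp).1 /= addr0 [RHS]mulrCA [_ * f z]mulrC -mulrA /b1 -!cexpD.
  by congr (_ * cexp _); ring.
have g2 z : ~ poles z -> g (z + e2) = b2 * g z + 0.
  move=> zp; rewrite /g (hs z zp).2 /= addr0 [RHS]mulrCA [_ * f z]mulrC -mulrA /b2 -!cexpD.
  by congr (_ * cexp _); ring.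
have dg z : ~ poles z -> dC g z.
  by move=> zp; apply: dC_M; [exact: df|exact: (dC_cexp (dC_N (dC_M (@dC_cst R nu' z) (@dC_id R z))))].
have [c [d hcd]] := liouville_poles e_gen n1 n2 dg (bf nu') g1 g2.
have [z0 z0p] := exists_nonpole p e_gen.
have z1p := nonpole_e1 z0p; have z2p := nonpole_e2 z0p; have z11p := nonpole_e1 z1p.
have z12p := nonpole_e2 z1p.
have := g1 _ z0p; rewrite !hcd // addr0 => k1; have := g2 _ z0p; rewrite !hcd // addr0 => k2.
have := g1 _ z1p; rewrite !hcd // addr0 => k11; have := g2 _ z1p; rewrite !hcd // addr0 => k21.
have q1 : (b1 - 1) * (d * e1) = 0.
  have -> : (b1 - 1) * (d * e1) = (b1 * (c + d * (z0 + e1)) - b1 * (c + d * z0)) - d * e1 by ring.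
  by rewrite -k11 -k1; ring.
have q2 : (b2 - 1) * (d * e1) = 0.
  have -> : (b2 - 1) * (d * e1) = (b2 * (c + d * (z0 + e1)) - b2 * (c + d * z0)) - d * e1 by ring.
  by rewrite -k21 -k2; ring.
have d0 : d = 0.
  apply/eqP; apply: contraT => dn; have b11 : b1 = 1.
    by move/eqP: q1; rewrite !mulf_eq0 (negbTE dn) (negbTE e1_neq0) !orbF subr_eq0 => /eqP.
  move: k1; rewrite b11 mul1r => /addrI/(mulfI dn)/eqP.
  by rewrite -subr_eq0 addrAC subrr add0r (negbTE e1_neq0).
rewrite d0 !mul0r !addr0 in k1 k2.
have c0 : c = 0.
  apply/eqP; apply: contraT => cn.
  have b11 : b1 = 1 by apply: (mulIf cn); rewrite -k1 mul1r.
  have b21 : b2 = 1 by apply: (mulIf cn); rewrite -k2 mul1r.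
  case: al; have [m hm] := cexp_eq1 b11; have [n hn] := cexp_eq1 b21.
  have [_ _ leg] := qp; rewrite -/(twopii R) in hm hn; have w0 := twopii_neq0 R.
  have key : alpha * (eta1 * e2 - eta2 * e1) = (n%:~R * e1 - m%:~R * e2) * twopii R.
    have -> : (n%:~R * e1 - m%:~R * e2) * twopii R = (n%:~R * twopii R) * e1 - (m%:~R * twopii R) * e2 by ring.
    by rewrite -hm -hn; ring.
  move: key; have [->|->] := leg.
    move=> /(mulIf w0) ->; exists n, (- m); by rewrite /latt mulrNz mulNr.
  rewrite mulrN -mulNr => /(mulIf w0) h; exists (- n), m.
  by rewrite -(opprK alpha) h /latt mulrNz; ring.
move=> z zp; have := hcd z zp; rewrite c0 d0 mul0r addr0 /g => /eqP.
by rewrite mulf_eq0 (negbTE (cexp_neq0 _)) orbF => /eqP.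
Qed.

(** The difference of a solution and the form with the same residues has no
    poles, hence vanishes. *)
Lemma solution_gen nu alpha a psi : ~ lattice alpha -> msol (Psi nu alpha) a psi ->
  (forall z, ~ poles z -> psi z = pform e1 e2 p nu (ygen nu alpha) a 0 z) /\
  forall l, pconst e1 e2 p nu (nu - zeta alpha) (ygen nu alpha) a 0 l = 0.
Proof.
move=> al sol; have [h1 h2 h3] := sol.
have ey := entire_ygen (nu := nu) (alpha := alpha); have y0 := ygen0 nu al; have dy := is_derive_ygen nu al.
have E z : ~ poles z -> psi z = pform e1 e2 p nu (ygen nu alpha) a 0 z.
  move=> zp; apply/eqP; rewrite -subr_eq0; apply/eqP; move: z zp.
  apply: (@twist_liouville nu alpha (fun z => psi z - pform e1 e2 p nu (ygen nu alpha) a 0 z) al).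
  - by move=> z zp; apply: dC_B; [exact: h1|exact: dC_pform].
  - by move=> nu' j; apply: (difference_bounded e_gen p_inj nu nu' j ey y0 dy sol).
  - move=> z zp; have [q1 q2] := h2 z zp; have [r1 r2] := pform_gen_shift nu a al zp.
    by rewrite q1 q2 r1 r2 !mulrBr.
split=> // l; apply/(pform_bigO e_gen p_inj nu ey y0 dy a 0 l).
by have [_ _ /(_ l)] := solution_congr e_gen E sol.
Qed.

Lemma gen_solution nu alpha a : ~ lattice alpha ->
  (forall l, pconst e1 e2 p nu (nu - zeta alpha) (ygen nu alpha) a 0 l = 0) ->
  msol (Psi nu alpha) a (pform e1 e2 p nu (ygen nu alpha) a 0).
Proof.
move=> al h; have ey := entire_ygen (nu := nu) (alpha := alpha); have y0 := ygen0 nu al; have dy := is_derive_ygen nu al.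
split.
- by move=> z zp; exact: dC_pform.
- by move=> z zp; exact: pform_gen_shift.
- by move=> j; apply/(pform_bigO e_gen p_inj nu ey y0 dy a 0 j).
Qed.

(** The residues seen by the additive terms of zeta: their sum must vanish for
    the form to be quasi-periodic. *)
Definition wsum nu a : C := \sum_j a j * cexp (- (nu * p j)).

Lemma ytriv_shift nu z : ~ lattice z ->
  ytriv nu (z + e1) / sigma (z + e1) = cexp (nu * e1) * (ytriv nu z / sigma z + cexp (nu * z) * eta1) /\
  ytriv nu (z + e2) / sigma (z + e2) = cexp (nu * e2) * (ytriv nu z / sigma z + cexp (nu * z) * eta2).
Proof.
move=> zl; suff H (a b c : C) : a = cexp (nu * (z + e1)) * zeta (z + e1) ->
    b = cexp (nu * (z + e2)) * zeta (z + e2) -> c = cexp (nu * z) * zeta z ->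
    a = cexp (nu * e1) * (c + cexp (nu * z) * eta1) /\ b = cexp (nu * e2) * (c + cexp (nu * z) * eta2).
  exact: (H _ _ _ (ytrivE nu (z + e1)) (ytrivE nu (z + e2)) (ytrivE nu z)).
move=> -> -> ->; rewrite (zeta_e1 zl) (zeta_e2 zl).
have E (e : C) : cexp (nu * (z + e)) = cexp (nu * e) * cexp (nu * z).
  by rewrite -cexpD; congr cexp; ring.
split.
  rewrite (E e1).
  move: (cexp (nu * e1)) (cexp (nu * z)) (zeta z) => X Z W.
  by ring.
rewrite (E e2).
move: (cexp (nu * e2)) (cexp (nu * z)) (zeta z) => X Z W.
by ring.
Qed.

Lemma pform_triv_shift nu a c z : ~ poles z ->
  pform e1 e2 p nu (ytriv nu) a c (z + e1) =
    cexp (nu * e1) * (pform e1 e2 p nu (ytriv nu) a c z + wsum nu a * eta1 * cexp (nu * z)) /\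
  pform e1 e2 p nu (ytriv nu) a c (z + e2) =
    cexp (nu * e2) * (pform e1 e2 p nu (ytriv nu) a c z + wsum nu a * eta2 * cexp (nu * z)).
Proof.
move=> zp.
have S j := ytriv_shift nu (nonpole_sub (j := j) zp).
have key (e et : C) : (forall j, ytriv nu (z - p j + e) / sigma (z - p j + e) =
    cexp (nu * e) * (ytriv nu (z - p j) / sigma (z - p j) + cexp (nu * (z - p j)) * et)) ->
  pform e1 e2 p nu (ytriv nu) a c (z + e) =
    cexp (nu * e) * (pform e1 e2 p nu (ytriv nu) a c z + wsum nu a * et * cexp (nu * z)).
  move=> h; rewrite /pform (mulrDr nu) cexpD.
  have -> : \sum_j a j * (ytriv nu (z + e - p j) / sigma (z + e - p j)) =
     cexp (nu * e) * (\sum_j a j * (ytriv nu (z - p j) / sigma (z - p j)) + wsum nu a * et * cexp (nu * z)).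
    rewrite /wsum !mulr_suml -big_split /= mulr_sumr; apply: eq_bigr => j _.
    rewrite addrAC h mulrBr cexpD; ring.
  ring.
by split; apply: key => j; have [? ?] := S j.
Qed.

(** The difference from the form is exp(nu z) times a function with additive
    periods proportional to (eta1, eta2). It is affine, and Legendre's
    relation forces both the linear part and the weighted sum of the residues
    to vanish. *)
Lemma solution_triv nu a psi : msol (Psi nu 0) a psi ->
  wsum nu a = 0 /\ exists c, (forall z, ~ poles z -> psi z = pform e1 e2 p nu (ytriv nu) a c z) /\
  forall l, pconst e1 e2 p nu nu (ytriv nu) a c l = 0.
Proof.
move=> sol; have [h1 h2 h3] := sol.
have ey := entire_ytriv (nu := nu); have y0 := ytriv0 nu; have dy := is_derive_ytriv nu.
pose f z := (psi z - pform e1 e2 p nu (ytriv nu) a 0 z) * cexp (- (nu * z)).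
have df z : ~ poles z -> dC f z.
  move=> zp; apply: dC_M; last exact: (dC_cexp (dC_N (dC_M (@dC_cst R nu z) (@dC_id R z)))).
  by apply: dC_B; [exact: h1|exact: dC_pform].
have bf j : exists d B : R, 0 < d /\ forall z, 0 < nm (z - p j) < d -> nm (f z) <= B.
  exact: (difference_bounded e_gen p_inj nu nu j ey y0 dy sol).
have key (e et : C) z : psi (z + e) = cexp (nu * e) * psi z ->
   pform e1 e2 p nu (ytriv nu) a 0 (z + e) =
    cexp (nu * e) * (pform e1 e2 p nu (ytriv nu) a 0 z + wsum nu a * et * cexp (nu * z)) ->
   f (z + e) = 1 * f z + - (wsum nu a * et).
  move=> k1 k2; rewrite /f k1 k2 mul1r (mulrDr nu) opprD cexpD !cexpN.
  have := cexp_neq0 (nu * z); have := cexp_neq0 (nu * e).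
  move: (cexp (nu * z)) (cexp (nu * e)) => X Y Y0 X0.
  by field; rewrite X0 Y0.
have f1 z : ~ poles z -> f (z + e1) = 1 * f z + - (wsum nu a * eta1).
  move=> zp; apply: key; last exact: (pform_triv_shift nu a 0 zp).1.
  by have [-> _] := h2 z zp; rewrite /= mulr0 subr0.
have f2 z : ~ poles z -> f (z + e2) = 1 * f z + - (wsum nu a * eta2).
  move=> zp; apply: key; last exact: (pform_triv_shift nu a 0 zp).2.
  by have [_ ->] := h2 z zp; rewrite /= mulr0 subr0.
have [c [d hcd]] := liouville_poles e_gen (nm1 R) (nm1 R) df bf f1 f2.
have [z0 z0p] := exists_nonpole p e_gen.
have := f1 _ z0p; rewrite !hcd //; last exact: nonpole_e1.
have := f2 _ z0p; rewrite !hcd //; last exact: nonpole_e2.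
rewrite !mul1r => k2 k1.
have q1 : wsum nu a * eta1 = (- d) * e1.
  have -> : wsum nu a * eta1 = c + d * z0 - (c + d * z0 + - (wsum nu a * eta1)) by ring.
  by rewrite -k1; ring.
have q2 : wsum nu a * eta2 = (- d) * e2.
  have -> : wsum nu a * eta2 = c + d * z0 - (c + d * z0 + - (wsum nu a * eta2)) by ring.
  by rewrite -k2; ring.
have w0 := legendre_solve q1 q2; split=> //.
have d0 : d = 0.
  by move/eqP: q1; rewrite w0 mul0r eq_sym mulf_eq0 oppr_eq0 (negbTE e1_neq0) orbF => /eqP.
exists c; have E z : ~ poles z -> psi z = pform e1 e2 p nu (ytriv nu) a c z.
  move=> zp; have := hcd z zp; rewrite d0 mul0r addr0 /f => <-.
  rewrite /pform mul0r addr0 -mulrA cexpN mulVf ?cexp_neq0 // mulr1; ring.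
split=> // l; apply/(pform_bigO e_gen p_inj nu ey y0 dy a c l).
by have [_ _ /(_ l)] := solution_congr e_gen E sol.
Qed.

Lemma triv_solution nu a c : wsum nu a = 0 ->
  (forall l, pconst e1 e2 p nu nu (ytriv nu) a c l = 0) ->
  msol (Psi nu 0) a (pform e1 e2 p nu (ytriv nu) a c).
Proof.
move=> w0 h; have ey := entire_ytriv (nu := nu); have y0 := ytriv0 nu; have dy := is_derive_ytriv nu.
split.
- by move=> z zp; exact: dC_pform.
- by move=> z zp; have [-> ->] := pform_triv_shift nu a c zp; rewrite w0 !mul0r !addr0 /= !mulr0 !subr0.
- by move=> j; apply/(pform_bigO e_gen p_inj nu ey y0 dy a c j).
Qed.

End SolutionSpaces.

(** * The spectral determinant, regularized at alpha = 0 *)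

Section SpectralMatrix.
Variables (R : realType) (e1 e2 eta1 eta2 : R[i]) (N : nat) (p : 'I_N -> R[i]).
Hypothesis N_gt0 : (0 < N)%N.
Hypothesis e_gen : lattice_generators e1 e2.
Hypothesis qp : quasi_periods e1 e2 eta1 eta2.
Hypothesis p_inj : injective (fun j => torus_pi e1 e2 (p j)).
Local Notation C := R[i].
Implicit Types (f y psi : C -> C) (z w x nu mu alpha : C) (a : 'I_N -> C).
Local Notation lattice := (lattice e1 e2).
Local Notation sigma := (weierstrass_sigma e1 e2).
Local Notation zeta := (weierstrass_zeta e1 e2).
Local Notation dsigma := (dsigma e1 e2).
Local Notation Phi := (Phi e1 e2).
Local Notation poles := (poles e1 e2 p).
Local Notation msol := (multi_solution e1 e2 p).
Local Notation Psi := (Psi e1 e2 eta1 eta2).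
Local Notation spmx := (spectral_mx e1 e2 p).
Local Notation S := (solution_factors e1 e2 p).

(** The kernel without its exponential factor. *)
Definition gker alpha z : C := sigma (alpha - z) / (sigma alpha * sigma z).

(** The kernel with its pole at alpha = 0 removed: sigma(alpha - z) /
    (sigma(alpha) sigma(z)) = - 1 / alpha + zeta(z) + O(alpha), and
    zeta(alpha) = 1 / alpha + O(alpha^3). At lattice points it takes the value
    of the limit at 0. *)
Definition chi z alpha : C := if `[< lattice alpha >] then zeta z else gker alpha z + zeta alpha.

Definition Cmx alpha : 'M[C]_N := \matrix_(l, m) (if l == m then 0 else chi (p m - p l) alpha).

(** The bordered matrix regularizing the spectral matrix at alpha = 0. The
    extra row and column stand for the term exp(nu z) in the trivial case and,
    for alpha nonzero, undo the rank-one change from Phi to [chi]; at alpha =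
    0 the kernel conditions of the trivial twist appear. *)
Definition Fmx nu alpha : 'M[C]_(N + 1) :=
  block_mx (nu%:M + Cmx alpha) (const_mx (dsigma alpha)) (const_mx 1) (const_mx (sigma alpha)).

(** For alpha nonzero this is sigma(alpha) times the left-hand side of the
    equation of the curve, in the coordinate nu; it is continuous in (nu,
    alpha) at alpha = 0 as well. *)
Definition Fdet nu alpha : C := \det (Fmx nu alpha).

Lemma PhiE z alpha : Phi z alpha = gker alpha z * cexp (zeta alpha * z).
Proof. by []. Qed.

(** Conjugation by a diagonal matrix turns the residues into the kernel vector
    of the spectral matrix. *)
Definition twisted mu a : 'rV[C]_N := \row_j (a j * cexp (- (mu * p j))).

(** The constant terms at the p_l are the entries of the product of the
    residues with the spectral matrix. *)
Lemma gen_kernel nu alpha a : let mu := nu - zeta alpha in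
  (forall l, pconst e1 e2 p nu mu (ygen e1 e2 nu alpha) a 0 l = 0) <->
  twisted mu a *m spmx mu alpha = 0.
Proof.
move=> mu; have E l : (twisted mu a *m spmx mu alpha) 0 l =
    cexp (- (mu * p l)) * pconst e1 e2 p nu mu (ygen e1 e2 nu alpha) a 0 l.
  rewrite mxE (bigD1 l) //= !mxE eqxx /pconst /prest mul0r addr0 [RHS]mulrDr; congr (_ + _).
    by ring.
  rewrite mulr_sumr; apply: eq_bigr => j jl; rewrite !mxE (negbTE jl).
  rewrite (ygenE e1 e2 nu alpha (p l - p j)) -/mu.
  have -> : cexp (- (mu * p j)) = cexp (- (mu * p l)) * cexp (mu * (p l - p j)).
    by rewrite -cexpD; congr cexp; ring.
  by ring.
split=> [h|h l]; first by apply/rowP => l; rewrite E h mulr0 mxE.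
have := E l; rewrite h mxE => /esym/eqP; rewrite mulf_eq0 (negbTE (cexp_neq0 _)) => /eqP; exact.
Qed.

Lemma triv_kernel nu a (c : C) :
  (wsum p nu a = 0 /\ forall l, pconst e1 e2 p nu nu (ytriv e1 e2 nu) a c l = 0) <->
  row_mx (twisted nu a) (const_mx c) *m Fmx nu 0 = 0.
Proof.
have l0 := lattice0 e1 e2.
have E l : (twisted nu a *m (nu%:M + Cmx 0)) 0 l + c =
    cexp (- (nu * p l)) * pconst e1 e2 p nu nu (ytriv e1 e2 nu) a c l.
  rewrite mxE (bigD1 l) //= !mxE eqxx addr0 mulr1n /pconst /prest !mulrDr -!addrA; congr (_ + _).
    by ring.
  congr (_ + _).
    rewrite mulr_sumr; apply: eq_bigr => j jl; rewrite !mxE (negbTE jl) mulr0n add0r.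
    rewrite (ytrivE e_gen nu (p l - p j)) /chi; case: asboolP => // _.
    have -> : cexp (- (nu * p j)) = cexp (- (nu * p l)) * cexp (nu * (p l - p j)).
      by rewrite -cexpD; congr cexp; ring.
    by ring.
  by rewrite mulrCA -cexpD addNr cexp0 mulr1.
have W : (twisted nu a *m const_mx (dsigma 0) : 'M[C]_(1, 1)) 0 0 = wsum p nu a.
  by rewrite mxE /wsum; apply: eq_bigr => j _; rewrite !mxE (dsigma0 e_gen) mulr1.
have cc (n : nat) (d : C) : (const_mx c : 'M[C]_(1, 1)) *m (const_mx d : 'M[C]_(1, n)) = const_mx (c * d).
  by apply/matrixP => i j; rewrite mxE big_ord1 !mxE.
rewrite /Fmx mul_row_block !cc (sigma_eq0 e_gen 0).2 // mulr0 mulr1.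
split=> [[w0 h]|].
  rewrite -[RHS]row_mx0; congr row_mx; apply/rowP => l.
    by rewrite !mxE; have := E l; rewrite h mulr0 mxE.
  by rewrite (ord1 l) mxE W w0 !mxE addr0.
rewrite -[X in _ = X]row_mx0 => /eq_row_mx[h1 h2]; split.
  by have := congr1 (fun M : 'M[C]_(1, 1) => M 0 0) h2; rewrite /= mxE W !mxE addr0.
move=> l; have := congr1 (fun M : 'M[C]_(1, N) => M 0 l) h1; rewrite /= mxE [X in _ + X]mxE E mxE.
by move=> /eqP; rewrite mulf_eq0 (negbTE (cexp_neq0 _)) => /eqP.
Qed.

Lemma det_conj_diag (n : nat) (d : 'I_n -> C) (A B : 'M[C]_n) : (forall i, d i != 0) ->
  (forall l m, B l m * d m = d l * A l m) -> \det B = \det A.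
Proof.
move=> d0 h; pose D := diag_mx (\row_i d i).
have E : B *m D = D *m A.
  by apply/matrixP => l m; rewrite mul_mx_diag mul_diag_mx !mxE.
have Dn : \det D != 0 by rewrite det_diag; apply/prodf_neq0 => i _; rewrite mxE.
have := congr1 determinant E; rewrite !det_mulmx mulrC; exact: mulfI.
Qed.

(** Elimination of the border: zeta(alpha) = sigma'(alpha) / sigma(alpha) is
    subtracted from all entries. *)
Lemma Fdet_gen nu alpha : ~ lattice alpha ->
  Fdet nu alpha = sigma alpha * \det (spmx (nu - zeta alpha) alpha).
Proof.
move=> al; have s0 := sigma_neq0 e_gen al.
pose L : 'M[C]_(N + 1) := block_mx 1%:M 0 (const_mx (- (sigma alpha)^-1)) 1%:M.
pose B := nu%:M + Cmx alpha - const_mx (zeta alpha).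
have E : Fmx nu alpha *m L = block_mx B (const_mx (dsigma alpha)) 0 (const_mx (sigma alpha)).
  rewrite /Fmx /L mulmx_block !mulmx1 !mulmx0 !add0r; congr block_mx.
    rewrite /B; congr (_ + _); apply/matrixP => i j.
    by rewrite mxE big_ord1 !mxE (zetaE e_gen) mulrN.
  by apply/matrixP => i j; rewrite mxE [X in _ + X]mxE big_ord1 !mxE mulrN mulfV // subrr.
have dL : \det L = 1 by rewrite det_lblock !det1 mulr1.
have := congr1 determinant E; rewrite det_mulmx dL mulr1 det_ublock -/(Fdet nu alpha) => ->.
rewrite mulrC; congr (_ * _); first by rewrite det_mx11 mxE.
apply: (@det_conj_diag N (fun l => cexp (zeta alpha * p l))); first by move=> i; exact: cexp_neq0.
move=> l m; rewrite !mxE; case: eqVneq => [->|lm]; first by rewrite mulr1n addr0 mulrC.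
rewrite mulr0n add0r /chi; case: asboolP => // _; rewrite addrK PhiE.
have -> : cexp (zeta alpha * p m) = cexp (zeta alpha * p l) * cexp (zeta alpha * (p m - p l)).
  by rewrite -cexpD; congr cexp; ring.
by move: (gker _ _) (cexp _) (cexp _) => u v w; ring.
Qed.

Lemma Psi_neq0 nu alpha : (Psi nu alpha).1 != 0 /\ (Psi nu alpha).2 != 0.
Proof. by split; exact: cexp_neq0. Qed.

Lemma solution_factors_gen nu alpha : ~ lattice alpha ->
  S (Psi nu alpha) <-> \det (spmx (nu - zeta alpha) alpha) = 0.
Proof.
move=> al; split=> [[psi /solution_withP[]// _ _ [a sol] [z zp psiz]]|/eqP/det0P[v v0 hv]].
  have [E h] := solution_gen e_gen qp p_inj al sol.
  apply/eqP/det0P; exists (twisted (nu - zeta alpha) a); last exact/gen_kernel.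
  apply/eqP => t0; move/eqP: psiz; apply; rewrite E // /pform mul0r addr0 big1 // => j _.
  have := congr1 (fun M : 'rV[C]_N => M 0 j) t0; rewrite !mxE => /eqP.
  by rewrite mulf_eq0 (negbTE (cexp_neq0 _)) orbF => /eqP ->; rewrite mul0r.
pose mu := nu - zeta alpha; pose a j := v 0 j * cexp (mu * p j).
have tv : twisted mu a = v.
  by apply/rowP => j; rewrite mxE /a -mulrA -cexpD subrr cexp0 mulr1.
have sol : msol (Psi nu alpha) a (pform e1 e2 p nu (ygen e1 e2 nu alpha) a 0).
  by apply: (gen_solution e_gen qp p_inj al); apply/gen_kernel; rewrite -/mu tv.
exists (pform e1 e2 p nu (ygen e1 e2 nu alpha) a 0).
  by apply/(solution_withP p e_gen); have [? ?] := Psi_neq0 nu alpha; split=> //; exists a.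
have [j vj] : exists j, v 0 j != 0 by apply/rV0Pn.
by apply: (residue_nonzero e_gen (j := j) sol); rewrite mulf_neq0 ?cexp_neq0.
Qed.

Lemma solution_factors_triv nu : S (Psi nu 0) <-> Fdet nu 0 = 0.
Proof.
split=> [[psi /solution_withP[]// _ _ [a sol] [z zp psiz]]|/eqP/det0P[v v0 hv]].
  have [w0 [c [E h]]] := solution_triv e_gen qp p_inj sol.
  apply/eqP/det0P; exists (row_mx (twisted nu a) (const_mx c)); last exact/triv_kernel.
  apply/eqP; rewrite -row_mx0 => /eq_row_mx[t0 c0]; move/eqP: psiz; apply; rewrite E // /pform.
  have -> : c = 0 by have := congr1 (fun M : 'M[C]_(1, 1) => M 0 0) c0; rewrite !mxE.
  rewrite mul0r addr0 big1 // => j _.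
  have := congr1 (fun M : 'rV[C]_N => M 0 j) t0; rewrite !mxE => /eqP.
  by rewrite mulf_eq0 (negbTE (cexp_neq0 _)) orbF => /eqP ->; rewrite mul0r.
pose a j := lsubmx v 0 j * cexp (nu * p j); pose c := rsubmx v 0 0.
have tv : twisted nu a = lsubmx v.
  by apply/rowP => j; rewrite mxE /a -mulrA -cexpD subrr cexp0 mulr1.
have cv : const_mx c = rsubmx v :> 'M[C]_(1, 1) by apply/rowP => j; rewrite (ord1 j) mxE.
have K : row_mx (twisted nu a) (const_mx c) *m Fmx nu 0 = 0 by rewrite tv cv hsubmxK.
have [w0 h] := (triv_kernel nu a c).2 K.
have sol := triv_solution e_gen qp p_inj w0 h.
exists (pform e1 e2 p nu (ytriv e1 e2 nu) a c).
  by apply/(solution_withP p e_gen); have [? ?] := Psi_neq0 nu 0; split=> //; exists a.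
have [j aj] : exists j, a j != 0.
  apply: contrapT => H; have a0 j : a j = 0.
    by apply: contrapT => /eqP aj; apply: H; exists j.
  have c0 : c = 0.
    have := h (Ordinal N_gt0); rewrite /pconst /prest a0 mul0r add0r big1 ?add0r => [|j _]; last by rewrite a0 mul0r.
    by move=> /eqP; rewrite mulf_eq0 (negbTE (cexp_neq0 _)) orbF => /eqP.
  move/eqP: v0; apply; rewrite -(hsubmxK v) -tv -cv c0 -[RHS]row_mx0; have -> : twisted nu a = 0 by apply/rowP => i; rewrite !mxE a0 mul0r.
  by congr row_mx; apply/rowP => i; rewrite !mxE.
exact: (residue_nonzero e_gen sol aj).
Qed.

(** Both kinds of twist at once: the multipliers of [Psi] admit a nonzero
    solution exactly on the curve F = 0. *)
Lemma solution_factorsP nu alpha : ~ lattice alpha \/ alpha = 0 ->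
  S (Psi nu alpha) <-> Fdet nu alpha = 0.
Proof.
move=> [al|->]; last exact: solution_factors_triv.
rewrite Fdet_gen //; split=> [/(solution_factors_gen nu al) ->|]; first by rewrite mulr0.
move=> /eqP; rewrite mulf_eq0 (negbTE (sigma_neq0 e_gen al)) => /eqP h.
exact/solution_factors_gen.
Qed.

(** A solution is determined by its residues, and these by the kernel of the
    spectral matrix. *)
Lemma unique_gen nu alpha : ~ lattice alpha ->
  (forall v w : 'rV[C]_N, v *m spmx (nu - zeta alpha) alpha = 0 -> w *m spmx (nu - zeta alpha) alpha = 0 ->
     v != 0 -> exists t, w = t *: v) ->
  unique_up_to_scale e1 e2 p (Psi nu alpha).
Proof.
move=> al H psi1 psi2 /solution_withP[]// _ _ [a1 sol1] /solution_withP[]// _ _ [a2 sol2] [z zp psiz].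
have [E1 h1] := solution_gen e_gen qp p_inj al sol1.
have [E2 h2] := solution_gen e_gen qp p_inj al sol2.
have k1 := (gen_kernel nu alpha a1).1 h1; have k2 := (gen_kernel nu alpha a2).1 h2.
have n1 : twisted (nu - zeta alpha) a1 != 0.
  apply/eqP => t0; move/eqP: psiz; apply; rewrite E1 // /pform mul0r addr0 big1 // => j _.
  have := congr1 (fun M : 'rV[C]_N => M 0 j) t0; rewrite !mxE => /eqP.
  by rewrite mulf_eq0 (negbTE (cexp_neq0 _)) orbF => /eqP ->; rewrite mul0r.
have [t ht] := H _ _ k1 k2 n1; exists t => w wp; rewrite E1 // E2 // /pform !mul0r !addr0 mulr_sumr.
apply: eq_bigr => j _; rewrite [RHS]mulrA; congr (_ * _).
have := congr1 (fun M : 'rV[C]_N => M 0 j) ht; rewrite !mxE mulrA.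
exact: (mulIf (cexp_neq0 _)).
Qed.

End SpectralMatrix.

(** * Power sums, multiple roots and eigenspaces *)

Section PolynomialAlgebra.
Variable R : realType.
Local Notation C := R[i].
Implicit Types (p q : {poly C}) (s t : seq C) (x y z w v : C).

(** The point 0 is exempted so that identities obtained by inverting the
    variable apply. *)
Lemma poly_eq_horner p q : (forall x, x != 0 -> p.[x] = q.[x]) -> p = q.
Proof.
move=> h; apply/eqP; rewrite -subr_eq0; apply/eqP; set r := p - q; apply/eqP.
apply: contraT => r0.
pose rs := [seq (k.+1%:R : C) | k <- iota 0 (size r)].
have rr : all (root r) rs.
  apply/allP => _ /mapP[k _ ->]; rewrite /root /r hornerD hornerN h ?subrr //.
have ur : uniq rs.
  rewrite map_inj_uniq ?iota_uniq // => k l /eqP; rewrite eqr_nat eqSS => /eqP //.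
by have := max_poly_roots r0 rr ur; rewrite size_map size_iota ltnn.
Qed.

Lemma horner_char_poly (n : nat) (A : 'M[C]_n) x : (char_poly A).[x] = \det (x%:M - A).
Proof.
rewrite /char_poly -horner_evalE -det_map_mx; congr (\det _).
by apply/matrixP => l m; rewrite !mxE /= /horner_eval !hornerE hornerMn hornerX.
Qed.

Lemma char_poly_roots (n : nat) (A : 'M[C]_n) :
  exists2 s, char_poly A = \prod_(z <- s) ('X - z%:P) & size s = n.
Proof.
have [s hs] := closed_field_poly_normal (char_poly A).
rewrite (monicP (char_poly_monic A)) scale1r in hs; exists s => //.
by have := size_char_poly A; rewrite hs size_prod_XsubC => -[].
Qed.

Definition mxpow (n : nat) (A : 'M[C]_n) k : 'M[C]_n := iter k (mulmx A) 1%:M.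

Lemma mxpow_trig (n : nat) (A : 'M[C]_n) k : is_trig_mx A ->
  is_trig_mx (mxpow A k) /\ forall i, mxpow A k i i = A i i ^+ k.
Proof.
move=> /is_trig_mxP tA; elim: k => [|k [/is_trig_mxP tk dk]].
  by split=> [|i]; [exact: scalar_mx_is_trig|rewrite mxE eqxx expr0].
split.
  apply/is_trig_mxP => i j ij; rewrite mxE big1 // => l _.
  have [il|li] := ltnP i l; first by rewrite tA ?mul0r.
  by rewrite tk ?mulr0 //; exact: leq_ltn_trans ij.
move=> i; rewrite mxE (bigD1 i) //= dk exprS big1 ?addr0 // => l li.
have [il|] := ltnP i l; first by rewrite tA ?mul0r.
by rewrite leq_eqVlt (negbTE (_ : (l : nat) != i)) //= => h; rewrite tk ?mulr0.
Qed.

(** After a unitary triangularization the diagonal consists of the roots of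
    the characteristic polynomial. *)
Lemma trace_power (n : nat) (A : 'M[C]_n) s k : (0 < n)%N -> char_poly A = \prod_(z <- s) ('X - z%:P) ->
  \tr (mxpow A k) = \sum_(z <- s) z ^+ k.
Proof.
move=> n0 hs; have [P /unitarymx_unit uP tT] := Schur A n0.
rewrite /similar_to /= conjumx // in tT; set T := P *m A *m invmx P in tT.
have cT : char_poly T = char_poly A.
  apply: poly_eq_horner => x _; rewrite !horner_char_poly.
  have -> : x%:M - T = P *m (x%:M - A) *m invmx P.
    by rewrite mulmxBr mulmxBl -/T scalar_mxC -mulmxA mulmxV // mulmx1.
  by rewrite !det_mulmx mulrAC -det_mulmx mulmxV // det1 mul1r.
have pT : mxpow T k = P *m mxpow A k *m invmx P.
  elim: k => [|k IH]; first by rewrite /mxpow /= mulmx1 mulmxV.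
  have -> : mxpow T k.+1 = T *m mxpow T k by [].
  by rewrite IH /T !mulmxA mulmxKV.
have -> : \tr (mxpow A k) = \tr (mxpow T k).
  by rewrite pT mxtrace_mulC mulmxA mulVmx // mul1mx.
have [_ dk] := mxpow_trig k tT.
have pe : perm_eq s [seq T i i | i <- index_enum 'I_n].
  by apply: prod_XsubC_eq; rewrite -hs -cT char_poly_trig // big_map.
by rewrite (perm_big _ pe) /= big_map /mxtrace; apply: eq_bigr => i _; rewrite dk.
Qed.

(** Hankel matrices of power sums. Their determinants detect the number of
    distinct roots and are polynomials in the coefficients of the polynomial,
    hence entire in alpha below. *)
Definition hankel (e : nat) (t : nat -> C) k : 'M[C]_k := \matrix_(i < k, j < k) t (i + j + e)%N.

Definition psum s k : C := \sum_(z <- s) z ^+ k.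

(** A Vandermonde matrix, a diagonal matrix of multiplicities, and the
    transpose. *)
Lemma hankel_factor s e k (u := undup s) :
  hankel e (psum s) k = (\matrix_(i < k, j < size u) u`_j ^+ i) *m
    diag_mx (\row_(j < size u) (u`_j ^+ e *+ count_mem u`_j s)) *m (\matrix_(j < size u, i < k) u`_j ^+ i).
Proof.
apply/matrixP => i j; rewrite mul_mx_diag !mxE /psum.
rewrite -big_undup_iterop_count (big_nth 0) big_mkord; apply: eq_bigr => l _; rewrite !mxE.
rewrite -[iterop _ _ _ _]/(_ *+ _) mulrnAr mulrnAl; congr (_ *+ _).
by rewrite !exprD; ring.
Qed.

Lemma hankel_det s k : (size (undup s) < k)%N -> \det (hankel 0 (psum s) k) = 0.
Proof.
move=> h; apply/eqP; rewrite -[_ == _]negbK -unitfE -unitmxE -row_free_unit hankel_factor.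
rewrite /row_free; apply/negP => /eqP e.
have := mxrankM_maxr ((\matrix_(i < k, j < size (undup s)) (undup s)`_j ^+ i) *m
    diag_mx (\row_(j < size (undup s)) ((undup s)`_j ^+ 0 *+ count_mem (undup s)`_j s)))
   (\matrix_(j < size (undup s), i < k) (undup s)`_j ^+ i).
rewrite e => le; have := leq_trans le (rank_leq_row _).
by rewrite leqNgt h.
Qed.

(** At the largest nonzero order the Vandermonde factors are invertible, and
    the trace of the product with the shifted Hankel matrix sums the distinct
    roots without multiplicity. *)
Lemma hankel_top s (k := size (undup s)) : \det (hankel 0 (psum s) k) != 0 /\
  \tr (hankel 1 (psum s) k *m \adj (hankel 0 (psum s) k)) =
    \det (hankel 0 (psum s) k) * \sum_(z <- undup s) z.
Proof.
pose u := undup s; pose V : 'M[C]_k := \matrix_(i < k, j < k) u`_j ^+ i.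
pose W : 'M[C]_k := \matrix_(j < k, i < k) u`_j ^+ i.
pose D e : 'M[C]_k := diag_mx (\row_(j < k) (u`_j ^+ e *+ count_mem u`_j s)).
pose L : 'M[C]_k := diag_mx (\row_(j < k) u`_j).
have H e : hankel e (psum s) k = V *m D e *m W by exact: hankel_factor.
have V0 : \det V != 0.
  have -> : V = Vandermonde k (\row_(j < k) u`_j) by apply/matrixP => i j; rewrite !mxE.
  rewrite det_Vandermonde; apply/prodf_neq0 => i _; apply/prodf_neq0 => j ij.
  rewrite !mxE subr_eq0 nth_uniq ?undup_uniq //; apply/eqP => e; move: ij; rewrite e ltnn //.
have VW : W = V^T by apply/matrixP => i j; rewrite !mxE.
have W0 : \det W != 0 by rewrite VW det_tr.
have D0 : \det (D 0%N) != 0.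
  rewrite det_diag; apply/prodf_neq0 => j _; rewrite mxE expr0 pnatr_eq0 -lt0n.
  by rewrite -has_count has_pred1 -mem_undup mem_nth.
have H0 : \det (hankel 0 (psum s) k) != 0 by rewrite H !det_mulmx !mulf_neq0.
have uV : V \in unitmx by rewrite unitmxE (unitfE (\det V)).
split=> //; have E : hankel 1 (psum s) k = V *m L *m invmx V *m hankel 0 (psum s) k.
  rewrite !H !mulmxA mulmxKV // -(mulmxA V L); congr (V *m _ *m W).
  by apply/matrixP => i j; rewrite mul_diag_mx !mxE; case: eqVneq => [->|_]; rewrite ?mulr0n ?mulr0 // !mulr1n expr1 expr0 mulrnAr mulr1.
rewrite E -!mulmxA mul_mx_adj mul_mx_scalar -!scalemxAr mxtraceZ; congr (_ * _).
rewrite mxtrace_mulC -mulmxA mulVmx // mulmx1 mxtrace_diag (big_nth 0) big_mkord.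
by apply: eq_bigr => j _; rewrite mxE.
Qed.

(** For P = (X - w)(X - v) q the divided difference P[w, v] vanishes; this
    also covers w = v. *)
Lemma divided_difference (P q : {poly C}) w v : P = ('X - w%:P) * (('X - v%:P) * q) ->
  \sum_(j < size P) P`_j * (\sum_(i < j) v ^+ (j.-1 - i) * w ^+ i) = 0.
Proof.
move=> E; have Pw : P.[w] = 0 by rewrite E hornerM hornerXsubC subrr mul0r.
pose P1 : {poly C} := \sum_(j < size P) P`_j *: (\sum_(i < j) 'X ^+ (j.-1 - i) * w%:P ^+ i).
have E1 : P = ('X - w%:P) * P1.
  transitivity (P - P.[w]%:P); first by rewrite Pw subr0.
  rewrite -{1}(coefK P) poly_def horner_coef rmorph_sum -sumrB mulr_sumr.
  apply: eq_bigr => j _; rewrite -scalerAr -subrXX rmorphM rmorphXn /= mul_polyC scalerBr.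
  exact: erefl.
have X0 : 'X - w%:P != 0 by rewrite polyXsubC_eq0.
have := mulfI X0 (etrans (esym E1) E) => E2.
have := congr1 (fun p => p.[v]) E2; rewrite /= hornerM hornerXsubC subrr mul0r => e0.
rewrite -[RHS]e0 /P1 horner_sum; apply: eq_bigr => j _; rewrite hornerZ horner_sum; congr (_ * _).
by apply: eq_bigr => i _; rewrite !hornerE.
Qed.

Lemma prod_far (K : R) s x : 0 < K -> K <= 1 -> (forall z, z \in s -> K <= nm (x - z)) ->
  K ^+ size s <= \prod_(z <- s) nm (x - z).
Proof.
move=> K0 K1; elim: s => [|y s IH] h; first by rewrite big_nil expr0.
rewrite big_cons exprS; apply: ler_pM.
- exact: ltW.
- exact: exprn_ge0 (ltW K0).
- by apply: h; rewrite mem_head.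
by apply: IH => z zs; apply: h; rewrite in_cons zs orbT.
Qed.

Lemma prod_far_mem (K : R) s x y : 0 < K -> K <= 1 -> y \in s -> (forall z, z \in s -> K <= nm (x - z)) ->
  nm (x - y) * K ^+ size s <= \prod_(z <- s) nm (x - z).
Proof.
move=> K0 K1 ys h; rewrite (big_rem y ys) /=; apply: ler_wpM2l; first exact: nm_ge0.
apply: le_trans (prod_far K0 K1 (s := rem y s) (x := x) _); last by move=> z /mem_rem; exact: h.
by apply: ler_wiXn2l; [exact: ltW|exact: K1|rewrite size_rem // leq_pred].
Qed.

(** Only the roots of multiplicity at least two contribute. *)
Lemma sum_undup_bound s (M : R) : 0 <= M -> (forall x, (1 < count_mem x s)%N -> nm x <= M) ->
  nm (\sum_(x <- s) x - \sum_(x <- undup s) x) <= (size s)%:R * M.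
Proof.
move=> M0; elim: s => [|y s IH] h; first by rewrite !big_nil subrr nm0 mul0r.
have {}IH := IH (fun x hx => h x (leq_trans hx (leq_addl _ _))).
rewrite big_cons /=; case: ifP => [ys|_].
  have yM : nm y <= M by apply: h; rewrite /= eqxx add1n ltnS -has_count has_pred1.
  rewrite -addrA; apply: le_trans (nmD _ _) _.
  have -> : (size s).+1%:R * M = M + (size s)%:R * M by rewrite -natr1; ring.
  by apply: lerD.
rewrite big_cons opprD addrACA subrr add0r; apply: le_trans IH _.
by rewrite ler_wpM2r // ler_nat.
Qed.

Lemma ltn_add_pred (m i j : nat) : (1 < i -> m.-1 <= j -> m < i + j)%N.
Proof. lia. Qed.

(** The eigenspaces of the n distinct roots are nonzero and in direct sum, so
    each of them is a line. *)
Lemma simple_eigenspace (n : nat) (A : 'M[C]_n) s (a : C) (v w : 'rV[C]_n) :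
  char_poly A = \prod_(z <- s) ('X - z%:P) -> uniq s ->
  v *m A = a *: v -> w *m A = a *: w -> v != 0 -> exists c : C, w = c *: v.
Proof.
move=> hs us hv hw v0.
have sn : size s = n by have := size_char_poly A; rewrite hs size_prod_XsubC => -[].
pose E (i : 'I_n) := eigenspace A s`_i.
have inj : {in predT &, injective (fun i : 'I_n => s`_i)}.
  by move=> i j _ _ /eqP; rewrite nth_uniq ?sn // => /eqP/val_inj.
have := mxdirect_sum_eigenspace A inj; rewrite mxdirectE /= => /eqP rk.
have rk1 (i : 'I_n) : (0 < \rank (E i))%N.
  rewrite lt0n mxrank_eq0; have : eigenvalue A s`_i; last by [].
  rewrite eigenvalue_root_char hs root_prod_XsubC mem_nth // sn //.
have ra : eigenvalue A a by apply/eigenvalueP; exists v.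
move: ra; rewrite eigenvalue_root_char hs root_prod_XsubC => /(nthP 0)[k]; rewrite sn => kn ka.
pose i0 := Ordinal kn.
have r1 : \rank (E i0) = 1%N.
  apply/eqP; rewrite eqn_leq rk1 andbT leqNgt; apply/negP => r2.
  have : (n < \sum_(i | predT i) \rank (E i))%N.
    rewrite (bigD1 i0) //=; have : (n.-1 <= \sum_(i < n | i != i0) \rank (E i))%N.
      apply: (@leq_trans (\sum_(i < n | i != i0) 1)).
        by rewrite sum1_card cardC1 card_ord.
      by apply: leq_sum => i _; exact: rk1.
    exact: ltn_add_pred r2.
  by rewrite -rk ltnNge rank_leq_col.
have vE : (v <= E i0)%MS by apply/eigenspaceP; rewrite hv -ka.
have wE : (w <= E i0)%MS by apply/eigenspaceP; rewrite hw -ka.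
have Ev : (E i0 <= v)%MS.
  by have := mxrank_leqif_sup vE; rewrite r1 rank_rV v0 => -[_ <-].
by apply/sub_rVP; exact: submx_trans wE Ev.
Qed.

End PolynomialAlgebra.

(** * The roots of the spectral equation and their dependence on alpha *)

Section LocalTools.
Variable R : realType.
Local Notation C := R[i].
Implicit Types (f g : C -> C).

Lemma cont_near f g (a : C) (d : R) : 0 < d -> (forall w, nm (w - a) < d -> f w = g w) ->
  {for a, continuous g} -> {for a, continuous f}.
Proof.
move=> d0 h /contCP cg; apply/contCP => e e0; have [d' d'0 h'] := cg e e0.
exists (Num.min d d'); first by rewrite lt_min d0.
move=> w; rewrite lt_min => /andP[w1 w2]; rewrite !h //; last by rewrite subrr nm0.
exact: h'.
Qed.

Lemma cont_near_bound f (a : C) : {for a, continuous f} ->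
  exists d B : R, [/\ 0 < d, 0 < B & forall w, nm (w - a) < d -> nm (f w) <= B].
Proof.
move=> cf; have [d d0 hd] := contC_eps cf (ltr01 (R:=R)).
exists d, (nm (f a) + 1); split=> //; first by have := nm_ge0 (f a); lra.
by move=> w /hd; have := nm_le_sub (f w) (f a); lra.
Qed.

Lemma cont_near_bounds (f : nat -> C -> C) (a : C) n : (forall k, {for a, continuous (f k)}) ->
  exists d B : R, [/\ 0 < d, 0 < B & forall w k, (k < n)%N -> nm (w - a) < d -> nm (f k w) <= B].
Proof.
move=> cf; elim: n => [|n [d [B [d0 B0 h]]]]; first by exists 1, 1; split.
have [d' [B' [d'0 B'0 h']]] := cont_near_bound (cf n).
exists (Num.min d d'), (Num.max B B'); split; [by rewrite lt_min d0|by rewrite lt_max B0|].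
move=> w k; rewrite ltnS leq_eqVlt lt_min => /orP[/eqP ->|kn] /andP[w1 w2].
  by apply: le_trans (h' _ w2) _; rewrite le_max lexx orbT.
by apply: le_trans (h _ _ kn w1) _; rewrite le_max lexx.
Qed.

Lemma cont_near_lower f (a : C) (c : R) : {for a, continuous f} -> c < nm (f a) ->
  exists2 d : R, 0 < d & forall w, nm (w - a) < d -> c < nm (f w).
Proof.
move=> cf h; have e0 : 0 < nm (f a) - c by lra.
have [d d0 hd] := contC_eps cf e0; exists d => // w /hd.
by have := nm_le_sub (f a) (f w); rewrite (nmB (f a)); lra.
Qed.

Lemma nbhsC2P (a b : C) (A : set (C * C)) : nbhs (a, b) A <->
  exists2 d : R, 0 < d & forall x y, nm (x - a) < d -> nm (y - b) < d -> A (x, y).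
Proof.
split=> [[[P Q] /= [/nbhsCP[d1 d10 h1] /nbhsCP[d2 d20 h2]] h]|[d d0 h]].
  exists (Num.min d1 d2); first by rewrite lt_min d10.
  move=> x y; rewrite !lt_min => /andP[x1 _] /andP[_ y2].
  by apply: (h (x, y)); split=> /=; [exact: h1|exact: h2].
exists ([set x | nm (x - a) < d], [set y | nm (y - b) < d]) => /=.
  by split; apply/nbhsCP; exists d.
by move=> [x y] [/= xa yb]; exact: h.
Qed.

Lemma cont2P (f : C * C -> C) (a b : C) : {for (a, b), continuous f} <->
  forall e : R, 0 < e -> exists2 d : R, 0 < d &
    forall x y, nm (x - a) < d -> nm (y - b) < d -> nm (f (x, y) - f (a, b)) < e.
Proof.
split=> [h e e0|h].
  have H : nbhs (a, b) (fun t : C * C => nm (f t - f (a, b)) < e) by exact: ((cvgCP _ f (f (a, b))).1 h e e0).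
  by have [d d0 hd] := (nbhsC2P a b _).1 H; exists d => // x y xa yb; exact: (hd x y xa yb).
by apply/cvgCP => e e0; apply/nbhsC2P; exact: h.
Qed.

Lemma det_cont (T : topologicalType) (n : nat) (A : T -> 'M[C]_n) (x : T) :
  (forall i j, {for x, continuous (fun t => A t i j)}) -> {for x, continuous (fun t => \det (A t))}.
Proof.
move=> h; rewrite /determinant; apply: contsum => s; apply: contM; first exact: contcst.
by apply: contprod => i; exact: h.
Qed.

End LocalTools.

Section SpectralRoots.
Variables (R : realType) (e1 e2 eta1 eta2 : R[i]) (N : nat) (p : 'I_N -> R[i]).
Hypothesis N_gt0 : (0 < N)%N.
Hypothesis e_gen : lattice_generators e1 e2.
Hypothesis qp : quasi_periods e1 e2 eta1 eta2.
Hypothesis p_inj : injective (fun j => torus_pi e1 e2 (p j)).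
Local Notation C := R[i].
Implicit Types (z w x nu mu alpha : C).
Local Notation lattice := (lattice e1 e2).
Local Notation sigma := (weierstrass_sigma e1 e2).
Local Notation zeta := (weierstrass_zeta e1 e2).
Local Notation dsigma := (dsigma e1 e2).
Local Notation spmx := (spectral_mx e1 e2 p).
Local Notation gker := (gker e1 e2).
Local Notation chi := (chi e1 e2).
Local Notation Fdet := (Fdet e1 e2 p).
Local Notation Pinf := (Pinf e1 e2).

(** sigma(alpha) times the off-diagonal part of the spectral matrix, up to a
    diagonal conjugation: the entries are entire. *)
Definition scaled_mx alpha : 'M[C]_N :=
  \matrix_(l, m) (if l == m then 0 else sigma (alpha - (p m - p l)) / sigma (p m - p l)).

(** The eigenvalues of [- scaled_mx], that is sigma(alpha) mu, with multiplicities. *)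
Definition xs alpha : seq C := s2val (cid2 (char_poly_roots (- scaled_mx alpha))).

Lemma char_poly_scaled_mx alpha : char_poly (- scaled_mx alpha) = \prod_(z <- xs alpha) ('X - z%:P).
Proof. exact: s2valP (cid2 (char_poly_roots (- scaled_mx alpha))). Qed.

Lemma size_xs alpha : size (xs alpha) = N.
Proof. exact: s2valP' (cid2 (char_poly_roots (- scaled_mx alpha))). Qed.

Lemma sum_xs alpha : \sum_(x <- xs alpha) x = 0.
Proof.
have h := char_poly_trace (- scaled_mx alpha) N_gt0.
rewrite char_poly_scaled_mx -{1}(size_xs alpha) coefPn_prod_XsubC in h; last by rewrite size_xs -lt0n.
have -> := oppr_inj h; rewrite /mxtrace big1 // => i _; by rewrite !mxE eqxx oppr0.
Qed.

(** The roots mu of the equation above alpha, with multiplicities. *)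
Definition mus alpha : seq C := [seq x / sigma alpha | x <- xs alpha].
(** The same roots in the coordinate nu. *)
Definition nus alpha : seq C := [seq x / sigma alpha + zeta alpha | x <- xs alpha].

Lemma musE alpha : mus alpha = [seq x / sigma alpha | x <- xs alpha].
Proof. by []. Qed.

Lemma nusE alpha : nus alpha = [seq m + zeta alpha | m <- mus alpha].
Proof. by rewrite -map_comp. Qed.

Lemma size_nus alpha : size (nus alpha) = N.
Proof. by rewrite size_map size_xs. Qed.

Lemma sum_nus alpha : \sum_(x <- nus alpha) x = N%:R * zeta alpha.
Proof.
rewrite big_map big_split /= -mulr_suml sum_xs mul0r add0r big_const_seq count_predT size_xs iter_addr_0.
by rewrite mulr_natl.
Qed.

Lemma prodr_const_seqE (s : seq C) (c : C) : \prod_(x <- s) c = c ^+ size s.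
Proof. by rewrite big_const_seq count_predT -Monoid.iteropE. Qed.

Lemma det_spectral_mx mu alpha : ~ lattice alpha ->
  \det (spmx mu alpha) = \prod_(m <- mus alpha) (mu - m).
Proof.
move=> al; have s0 := sigma_neq0 e_gen al.
have D : \det (mu%:M + (sigma alpha)^-1 *: scaled_mx alpha) = \det (spmx mu alpha).
  apply: (@det_conj_diag R N (fun l => cexp (zeta alpha * p l))); first by move=> i; exact: cexp_neq0.
  move=> l m; rewrite !mxE; case: eqVneq => [->|lm]; first by rewrite mulr1n mulr0 addr0 mulrC.
  rewrite mulr0n add0r PhiE /gker.
  have -> : cexp (zeta alpha * p m) = cexp (zeta alpha * p l) * cexp (zeta alpha * (p m - p l)).
    by rewrite -cexpD; congr cexp; ring.
  have -> : (sigma alpha)^-1 * (sigma (alpha - (p m - p l)) / sigma (p m - p l)) =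
    sigma (alpha - (p m - p l)) / (sigma alpha * sigma (p m - p l)).
    by rewrite [(sigma alpha * sigma (p m - p l))^-1]invfM mulrCA.
  by move: (sigma (alpha - _) / _) (cexp _) (cexp _) => u v w; ring.
have sN0 : sigma alpha ^+ N != 0 by rewrite expf_neq0.
apply: (mulfI sN0); rewrite -D -detZ scalerDr scalerA mulfV // scale1r scale_scalar_mx.
have := horner_char_poly (- scaled_mx alpha) (sigma alpha * mu); rewrite opprK => <-.
have EN : sigma alpha ^+ N = \prod_(x <- xs alpha) sigma alpha by rewrite prodr_const_seqE size_xs.
rewrite EN char_poly_scaled_mx horner_prod big_map -big_split /=.
by apply: eq_bigr => x _; rewrite hornerXsubC mulrBr mulrCA mulfV // mulr1.
Qed.

Lemma Fdet_prod nu alpha : ~ lattice alpha ->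
  Fdet nu alpha = sigma alpha * \prod_(x <- nus alpha) (nu - x).
Proof.
move=> al; rewrite (Fdet_gen p e_gen nu al) det_spectral_mx // !big_map; congr (_ * _).
by apply: eq_bigr => x _; ring.
Qed.

Lemma Fdet_root nu alpha : ~ lattice alpha -> (Fdet nu alpha = 0 <-> nu \in nus alpha).
Proof.
move=> al; rewrite Fdet_prod //; have s0 := sigma_neq0 e_gen al; split=> [/eqP|h].
  rewrite mulf_eq0 (negbTE s0) /= prodf_seq_eq0 => /hasP[x xn]; rewrite /= subr_eq0 => /eqP ->.
  exact: xn.
by rewrite (big_rem nu h) /= subrr mul0r mulr0.
Qed.

Lemma nonlattice_open (a : C) : ~ lattice a -> exists2 d : R, 0 < d & forall w, nm (w - a) < d -> ~ lattice w.
Proof.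
move=> al; have s0 : 0 < nm (sigma a) by rewrite nm_gt0 (sigma_neq0 e_gen).
have [d d0 hd] := cont_near_lower (entire_cont (entire_sigma e_gen) (x := a)) s0.
by exists d => // w /hd wd /(sigma_eq0 e_gen) h; rewrite h nm0 ltxx in wd.
Qed.

Lemma nonlattice_punctured : exists2 d : R, 0 < d & forall w, 0 < nm w < d -> ~ lattice w.
Proof.
have [d d0 hd] := lattice_discrete e_gen; exists d => // w /andP[w0 wd] wl.
by move: w0; rewrite (hd w wl wd) nm0 ltxx.
Qed.

Lemma cont_sigma_sub z : continuous (fun a => sigma (a - z)).
Proof. exact: (entire_cont (entire_sub (a := z) (entire_sigma e_gen))). Qed.

(** At alpha = 0 the numerator sigma(alpha - z) + sigma'(alpha) sigma(z) has a
    zero, which cancels that of sigma(alpha); its derivative there is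
    sigma'(z), whence the value zeta(z). *)
Lemma chi_cont z alpha : ~ lattice z -> ~ lattice alpha \/ alpha = 0 -> {for alpha, continuous (chi z)}.
Proof.
move=> zl [al|->].
  have [d d0 hd] := nonlattice_open al.
  apply: (@cont_near R _ (fun a => gker a z + zeta a) alpha d d0).
    by move=> w /hd wl; rewrite /chi; case: asboolP.
  apply: contD; last exact: (dC_cont (dC_zeta e_gen al)).
  apply: contM; first exact: cont_sigma_sub.
  apply: contV; last by rewrite mulf_neq0 ?(sigma_neq0 e_gen).
  apply: contM; last exact: contcst.
  exact: (entire_cont (entire_sigma e_gen)).
have sz := sigma_neq0 e_gen zl.
pose num a := sigma (a - z) + dsigma a * sigma z.
have en : entire num.
  apply: entire_add; first exact: (entire_sub (entire_sigma e_gen)).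
  apply: entire_mul; first exact: (edsig e_gen).
  by move=> w; exact: dC_cst.
have n0 : num 0 = 0 by rewrite /num sub0r (sigmaN e1 e2 z) (dsigma0 e_gen) mul1r addNr.
have [g eg hg] := entire_factor en n0.
have dn : is_derive (0 : C) 1 num (dsigma z).
  have d1 := @is_derive_scale R sigma 1 (- z) 0 (dsigma (- z)).
  rewrite mulr0 add0r mulr1 (dsigmaN e_gen) in d1.
  have {}d1 := d1 _; have q : is_derive (- z) 1 sigma (dsigma z) by have := dsigmaP e_gen (- z); rewrite (dsigmaN e_gen).
  have {}d1 := d1 q; have d2 := is_deriveC_D d1 (is_deriveC_M (is_derive_dsigma0 e_gen) (@is_deriveC_cst R (sigma z) 0)).
  have E : (fun x => sigma (1 * x - z) + dsigma x * sigma z) = num by apply/funext => x; rewrite mul1r.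
  by rewrite E mul0r mulr0 !addr0 in d2.
have dn2 : is_derive (0 : C) 1 num (g 0).
  have [c hc] : exists c, is_derive (0 : C) 1 g c by apply/dCP; exact: eg.
  have := is_deriveC_M (@is_derive_affine R 1 0 0) hc.
  rewrite mul1r mulr0 add0r mul0r addr0.
  by have -> : (fun x => (1 * x + 0) * g x) = num by apply/funext => x; rewrite hg subr0 mul1r addr0.
have g0 : g 0 = dsigma z := is_deriveC_uniq dn2 dn.
have [d d0 hd] := nonlattice_punctured.
have P0 := Pinf0 e_gen.
apply: (@cont_near R _ (fun a => g a / (Pinf a * sigma z)) 0 d d0).
  move=> w; rewrite subr0 => wd; have [->|w0] := eqVneq w 0.
    rewrite /chi; case: asboolP => [_|h]; last by case: h; exact: lattice0.
    by rewrite g0 P0 mul1r (zetaE e_gen).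
  have wl : ~ lattice w by apply: hd; rewrite nm_gt0 w0.
  rewrite /chi; case: asboolP => // _; rewrite /gker (zetaE e_gen).
  have sw := sigma_neq0 e_gen wl.
  have -> : sigma (w - z) / (sigma w * sigma z) + dsigma w / sigma w = num w / (sigma w * sigma z).
    by rewrite /num; move: (sigma w) (sigma z) (sigma (w - z)) sw sz => u v t u0 v0; field; rewrite u0 v0.
  have Pw : Pinf w != 0 by apply/eqP => h; move: sw; rewrite sigmaE h mulr0 eqxx.
  rewrite hg subr0 sigmaE; move: (sigma z) (Pinf w) sz Pw => v t v0 t0.
  by field; rewrite w0 v0 t0.
apply: contM; first exact: (entire_cont eg).
apply: contV; last by rewrite P0 mul1r.
apply: contM; last exact: contcst.
exact: (entire_cont (entire_Pinf e_gen)).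
Qed.

Definition Fmxp alpha : 'M[{poly C}]_(N + 1) :=
  block_mx ('X%:M + map_mx polyC (Cmx e1 e2 p alpha)) (const_mx (dsigma alpha)%:P)
    (const_mx 1) (const_mx (sigma alpha)%:P).

(** The determinant as a polynomial in nu. Its degree drops from N to N - 1 at
    alpha = 0. *)
Definition Fpoly alpha : {poly C} := \det (Fmxp alpha).

Lemma Fpoly_horner nu alpha : (Fpoly alpha).[nu] = Fdet nu alpha.
Proof.
rewrite /Fpoly /Fmxp -horner_evalE -det_map_mx /Fdet /Fmx map_block_mx; congr (\det (block_mx _ _ _ _));
  apply/matrixP => i j; rewrite !mxE /= /horner_eval ?hornerC ?hornerE //.
by rewrite hornerMn hornerX.
Qed.

Lemma Cmx_cont l m alpha : ~ lattice alpha \/ alpha = 0 ->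
  {for alpha, continuous (fun a => Cmx e1 e2 p a l m)}.
Proof.
move=> aU; have [->|lm] := eqVneq l m.
  have -> : (fun a => Cmx e1 e2 p a m m) = (fun=> 0) by apply/funext => a; rewrite mxE eqxx.
  exact: contcst.
have -> : (fun a => Cmx e1 e2 p a l m) = chi (p m - p l) by apply/funext => a; rewrite mxE (negbTE lm).
exact: (chi_cont (p_diff p_inj lm) aU).
Qed.

Lemma Fpoly_cont k alpha : ~ lattice alpha \/ alpha = 0 ->
  {for alpha, continuous (fun a => (Fpoly a)`_k)}.
Proof.
move=> aU; apply: (@coefwise_det C C (fun f => {for alpha, continuous f})).
- by move=> c; exact: contcst.
- by move=> f g; exact: contD.
- by move=> f g; exact: contM.
have polyCc (f : C -> C) k' : {for alpha, continuous f} -> {for alpha, continuous (fun a => (f a)%:P`_k')}.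
  move=> cf; have -> : (fun a => (f a)%:P`_k') = (fun a => if k' == 0%N then f a else 0).
    by apply/funext => a; rewrite coefC.
  by case: (k' == 0%N); [exact: cf|exact: contcst].
move=> i j k'; have [i' ->|i' ->] := split_ordP i; have [j' ->|j' ->] := split_ordP j.
- have -> : (fun t => (Fmxp t (lshift 1 i') (lshift 1 j'))`_k') =
     (fun t => (('X : {poly C}) *+ (i' == j'))`_k' + (Cmx e1 e2 p t i' j')%:P`_k').
    by apply/funext => t; rewrite /Fmxp block_mxEul -coefD; congr (_`_k'); rewrite !mxE.
  apply: contD; first exact: contcst.
  exact: (polyCc (fun t => Cmx e1 e2 p t i' j') k' (@Cmx_cont i' j' alpha aU)).
- have -> : (fun t => (Fmxp t (lshift 1 i') (rshift N j'))`_k') = (fun t => (dsigma t)%:P`_k').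
    by apply/funext => t; rewrite /Fmxp block_mxEur mxE.
  exact: (polyCc dsigma k' (entire_cont (edsig e_gen) (x := alpha))).
- have -> : (fun t => (Fmxp t (rshift N i') (lshift 1 j'))`_k') = (fun t => (1 : {poly C})`_k').
    by apply/funext => t; rewrite /Fmxp block_mxEdl mxE.
  exact: contcst.
have -> : (fun t => (Fmxp t (rshift N i') (rshift N j'))`_k') = (fun t => (sigma t)%:P`_k').
  by apply/funext => t; rewrite /Fmxp block_mxEdr mxE.
exact: (polyCc sigma k' (entire_cont (entire_sigma e_gen) (x := alpha))).
Qed.

Lemma Fpoly_prod alpha : ~ lattice alpha -> Fpoly alpha = sigma alpha *: \prod_(x <- nus alpha) ('X - x%:P).
Proof.
move=> al; apply: poly_eq_horner => nu _; rewrite Fpoly_horner Fdet_prod // hornerZ horner_prod.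
by congr (_ * _); apply: eq_bigr => x _; rewrite hornerXsubC.
Qed.

Lemma size_Fpoly alpha : ~ lattice alpha -> size (Fpoly alpha) = N.+1.
Proof. by move=> al; rewrite Fpoly_prod // size_scale ?sigma_neq0 // size_prod_XsubC size_nus. Qed.

(** The trace of the spectral matrix in the coordinate nu is N zeta(alpha).
    Since sigma' does not vanish near the origin, the degree in nu is exactly
    N - 1 at alpha = 0. *)
Lemma Fpoly_coef1 alpha : ~ lattice alpha -> (Fpoly alpha)`_N.-1 = - (N%:R * dsigma alpha).
Proof.
move=> al; rewrite Fpoly_prod // coefZ -{1}(size_nus alpha) coefPn_prod_XsubC; last by rewrite size_nus -lt0n.
rewrite sum_nus (zetaE e_gen); have s0 := sigma_neq0 e_gen al.
by move: (sigma alpha) (dsigma alpha) s0 => u v u0; field.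
Qed.

Lemma Fdet_cont nu0 alpha0 : ~ lattice alpha0 \/ alpha0 = 0 ->
  {for (nu0, alpha0), continuous (fun t : C * C => Fdet t.1 t.2)}.
Proof.
move=> aU; rewrite /Fdet; apply: det_cont => i j.
have c1 : {for (nu0, alpha0), continuous (fun t : C * C => t.1)} by exact: cvg_fst.
have c2 : {for (nu0, alpha0), continuous (fun t : C * C => t.2)} by exact: cvg_snd.
have comp (f : C -> C) : {for alpha0, continuous f} -> {for (nu0, alpha0), continuous (fun t : C * C => f t.2)}.
  by move=> cf; exact: (contcomp c2 cf).
have [i' ->|i' ->] := split_ordP i; have [j' ->|j' ->] := split_ordP j.
- have -> : (fun t : C * C => Fmx e1 e2 p t.1 t.2 (lshift 1 i') (lshift 1 j')) =
    (fun t => t.1 * (i' == j')%:R + Cmx e1 e2 p t.2 i' j').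
    by apply/funext => t; rewrite /Fmx block_mxEul !mxE mulr_natr.
  apply: contD; first by apply: contM; [exact: c1|exact: contcst].
  exact: (comp (fun a => Cmx e1 e2 p a i' j') (@Cmx_cont i' j' alpha0 aU)).
- have -> : (fun t : C * C => Fmx e1 e2 p t.1 t.2 (lshift 1 i') (rshift N j')) = (fun t => dsigma t.2).
    by apply/funext => t; rewrite /Fmx block_mxEur !mxE.
  by apply: comp; exact: (entire_cont (edsig e_gen)).
- have -> : (fun t : C * C => Fmx e1 e2 p t.1 t.2 (rshift N i') (lshift 1 j')) = (fun t => 1).
    by apply/funext => t; rewrite /Fmx block_mxEdl !mxE.
  exact: contcst.
have -> : (fun t : C * C => Fmx e1 e2 p t.1 t.2 (rshift N i') (rshift N j')) = (fun t => sigma t.2).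
  by apply/funext => t; rewrite /Fmx block_mxEdr !mxE.
by apply: comp; exact: (entire_cont (entire_sigma e_gen)).
Qed.

Lemma Fdet_cont2 nu alpha : ~ lattice alpha \/ alpha = 0 -> {for alpha, continuous (Fdet nu)}.
Proof.
move=> aU; have /cont2P h := @Fdet_cont nu alpha aU.
apply/contCP => e e0; have [d d0 hd] := h e e0; exists d => // w wd.
by apply: hd => //; rewrite subrr nm0.
Qed.

End SpectralRoots.

Lemma pred_double_succ (j : nat) : (1 < j)%N -> j.-1 = (j.-2).+1.
Proof. by case: j => [|[|]]. Qed.

Section RootBehaviour.
Variables (R : realType) (e1 e2 eta1 eta2 : R[i]) (N : nat) (p : 'I_N -> R[i]).
Hypothesis N_gt0 : (0 < N)%N.
Hypothesis e_gen : lattice_generators e1 e2.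
Hypothesis qp : quasi_periods e1 e2 eta1 eta2.
Hypothesis p_inj : injective (fun j => torus_pi e1 e2 (p j)).
Local Notation C := R[i].
Implicit Types (z w x nu mu alpha : C).
Local Notation lattice := (lattice e1 e2).
Local Notation sigma := (weierstrass_sigma e1 e2).
Local Notation zeta := (weierstrass_zeta e1 e2).
Local Notation dsigma := (dsigma e1 e2).
Local Notation Fdet := (Fdet e1 e2 p).
Local Notation Fpoly := (Fpoly e1 e2 p).
Local Notation nus := (nus e1 e2 p).

Lemma dsigma_near0 : exists2 d : R, 0 < d & forall a, nm a < d -> 3/4 < nm (dsigma a).
Proof.
have h : 3/4 < nm (dsigma 0) by rewrite (dsigma0 e_gen) nm1; lra.
have [d d0 hd] := cont_near_lower (entire_cont (edsig e_gen) (x := 0)) h.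
exists d; first exact: d0.
by move=> a ad; apply: hd; rewrite subr0.
Qed.

Lemma sigma_near0 (e : R) : 0 < e -> exists2 d : R, 0 < d & forall a, nm a < d -> nm (sigma a) < e.
Proof.
move=> e0; have [d d0 hd] := contC_eps (entire_cont (entire_sigma e_gen) (x := 0)) e0.
exists d => // a ad; have := hd a; rewrite subr0 sigma0 subr0; exact.
Qed.

Lemma zeta_large (M : R) : exists2 d : R, 0 < d & forall a, 0 < nm a < d -> M < nm (zeta a).
Proof.
pose M1 := `|M| + 1; have M10 : 0 < M1 by rewrite ltr_wpDl.
have [d1 d10 h1] := dsigma_near0.
have e0 : 0 < (3/4) / M1 by rewrite divr_gt0 //; lra.
have [d2 d20 h2] := sigma_near0 e0; have [d3 d30 h3] := nonlattice_punctured e_gen.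
exists (Num.min (Num.min d1 d2) d3); first by rewrite !lt_min d10 d20.
move=> a /andP[a0]; rewrite !lt_min => /andP[/andP[a1 a2] a3].
have al : ~ lattice a by apply: h3; rewrite a0.
have s0 : 0 < nm (sigma a) by rewrite nm_gt0 (sigma_neq0 e_gen).
have b1 := h1 a a1; have := h2 a a2; rewrite ltr_pdivlMr // => b2.
rewrite (zetaE e_gen) nm_div ltr_pdivlMr //; apply: le_lt_trans b1.
apply: le_trans (ltW b2); rewrite mulrC ler_wpM2l ?nm_ge0 // /M1.
by have := ler_norm M; lra.
Qed.

(** The roots nu sum to N zeta(alpha). *)
Lemma big_root alpha : exists2 x, x \in nus alpha & nm (zeta alpha) <= nm x.
Proof.
apply: contrapT => H.
have small x : x \in nus alpha -> nm x < nm (zeta alpha).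
  by move=> xn; rewrite ltNge; apply/negP => h; apply: H; exists x.
have := sum_nus e1 e2 p N_gt0 alpha => /(congr1 (@nm R)); rewrite nmM nm_nat => e.
have le (s : seq C) : (forall x, x \in s -> nm x < nm (zeta alpha)) -> (0 < size s)%N ->
    \sum_(x <- s) nm x < (size s)%:R * nm (zeta alpha).
  elim: s => [//|y s IH] hs _; rewrite big_cons.
  have -> : (size (y :: s))%:R * nm (zeta alpha) = nm (zeta alpha) + (size s)%:R * nm (zeta alpha).
    by rewrite /= -natr1; ring.
  have y1 : nm y < nm (zeta alpha) by apply: hs; rewrite mem_head.
  have hs' x : x \in s -> nm x < nm (zeta alpha) by move=> xs; apply: hs; rewrite in_cons xs orbT.
  case: s IH hs hs' => [|y' s] IH hs hs'; first by rewrite big_nil mul0r !addr0.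
  by apply: ltrD => //; apply: IH.
have := le _ small; rewrite size_nus => /(_ N_gt0); rewrite -e => h.
by have := lt_le_trans h (nm_sum _ _ _); rewrite ltxx.
Qed.

(** Roots persist, also at alpha0 = 0 where the degree of the equation drops.
    If all N roots stay away from nu0, then |F(nu0, alpha)| is bounded below:
    at alpha0 = 0 one of the roots is at least |zeta(alpha)|, and its distance
    to nu0 compensates the factor sigma(alpha). This contradicts F(nu0,
    alpha0) = 0 by continuity. *)
Lemma root_near alpha0 nu0 (r : R) : ~ lattice alpha0 \/ alpha0 = 0 -> Fdet nu0 alpha0 = 0 -> 0 < r ->
  exists2 d : R, 0 < d & forall alpha, ~ lattice alpha -> nm (alpha - alpha0) < d ->
    exists2 nu, nm (nu - nu0) < r & Fdet nu alpha = 0.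
Proof.
move=> aU F0 r0; pose K := Num.min r 1.
have K0 : 0 < K by rewrite lt_min r0 ltr01.
have K1 : K <= 1 by rewrite ge_min lexx orbT.
have Kr : K <= r by rewrite ge_min lexx.
clearbody K.
have KN : 0 < K ^+ N by exact: exprn_gt0.
(* c is half of |sigma(alpha0)| off the lattice, and 1/4 at the origin *)
suff [c c0 [d d0 hd]] : exists2 c : R, 0 < c & exists2 d : R, 0 < d & forall alpha, ~ lattice alpha ->
    nm (alpha - alpha0) < d -> (forall x, x \in nus alpha -> K <= nm (nu0 - x)) ->
    c * K ^+ N <= nm (Fdet nu0 alpha).
  have e0 : 0 < c * K ^+ N by exact: mulr_gt0.
  have [d' d'0 hd'] := contC_eps (@Fdet_cont2 R e1 e2 N p e_gen p_inj nu0 _ aU) e0.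
  exists (Num.min d d'); first by rewrite lt_min d0.
  move=> alpha al; rewrite lt_min => /andP[ad ad'].
  apply: contrapT => H; have := hd' alpha ad'; rewrite F0 subr0 => h1.
  have : c * K ^+ N <= nm (Fdet nu0 alpha).
    apply: hd => // x xn; rewrite leNgt; apply/negP => xK; apply: H; exists x.
      by rewrite nmB; exact: lt_le_trans xK Kr.
    exact/(Fdet_root p e_gen x al).
  lra.
have Fnm alpha : ~ lattice alpha -> nm (Fdet nu0 alpha) = nm (sigma alpha) * \prod_(x <- nus alpha) nm (nu0 - x).
  by move=> al; rewrite (Fdet_prod p e_gen nu0 al) nmM nm_prod.
case: aU => [al0|a0].
  have s0 : 0 < nm (sigma alpha0) by rewrite nm_gt0 (sigma_neq0 e_gen).
  have h : nm (sigma alpha0) / 2 < nm (sigma alpha0) by lra.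
  have [d d0 hd] := cont_near_lower (entire_cont (entire_sigma e_gen) (x := alpha0)) h.
  exists (nm (sigma alpha0) / 2); first lra.
  exists d => // alpha al ad far; rewrite Fnm //.
  apply: ler_pM; [lra|exact: ltW|exact: ltW (hd _ ad)|].
  have := prod_far K0 K1 far; rewrite size_nus; exact.
exists (1/4); first lra.
have [d1 d10 h1] := dsigma_near0.
have n1 : 0 < nm nu0 + 1 by rewrite ltr_wpDl // nm_ge0.
have e0 : 0 < (1/2) / (nm nu0 + 1) by apply: divr_gt0 => //; lra.
have [d2 d20 h2] := sigma_near0 e0.
exists (Num.min d1 d2); first by rewrite lt_min d10.
move=> alpha al; rewrite a0 subr0 lt_min => /andP[a1 a2] far; rewrite Fnm //.
have [y yn yz] := big_root alpha.
have := prod_far_mem K0 K1 yn far; rewrite size_nus => le.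
apply: (@le_trans _ _ (nm (sigma alpha) * (nm (nu0 - y) * K ^+ N))); last by rewrite ler_wpM2l ?nm_ge0.
rewrite mulrA ler_wpM2r ?(ltW KN) //.
have s0 : 0 < nm (sigma alpha) by rewrite nm_gt0 (sigma_neq0 e_gen).
have yb : nm (zeta alpha) - nm nu0 <= nm (nu0 - y).
  by have := nm_le_sub y nu0; rewrite (nmB y); lra.
have E : nm (sigma alpha) * nm (zeta alpha) = nm (dsigma alpha).
  by rewrite -nmM (zetaE e_gen) mulrC divfK // -nm_gt0.
have := h2 alpha a2; rewrite ltr_pdivlMr; last by rewrite ltr_wpDl // nm_ge0.
rewrite mulrDr mulr1 => b2; have b1 := h1 alpha a1.
have := ler_wpM2l (ltW s0) yb; rewrite mulrBr E; lra.
Qed.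

(** The leading coefficient sigma(alpha) is bounded away from zero. *)
Lemma roots_locally_bounded alpha0 : ~ lattice alpha0 -> exists d M : R, [/\ 0 < d, 0 < M &
  forall alpha, nm (alpha - alpha0) < d -> ~ lattice alpha /\ forall x, x \in nus alpha -> nm x <= M].
Proof.
move=> al0; have aU : ~ lattice alpha0 \/ alpha0 = 0 by left.
have [d1 [B [d10 B0 hB]]] := cont_near_bounds N (fun k => @Fpoly_cont R e1 e2 N p e_gen p_inj k _ aU).
have s0 : 0 < nm (sigma alpha0) by rewrite nm_gt0 (sigma_neq0 e_gen).
have h : nm (sigma alpha0) / 2 < nm (sigma alpha0) by lra.
have [d2 d20 h2] := cont_near_lower (entire_cont (entire_sigma e_gen) (x := alpha0)) h.
have [d3 d30 h3] := nonlattice_open e_gen al0.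
pose c := nm (sigma alpha0) / 2; have c0 : 0 < c by rewrite /c; lra.
have NB : 0 <= N%:R * B / c by rewrite divr_ge0 ?mulr_ge0 ?ler0n // ltW.
exists (Num.min (Num.min d1 d2) d3), (N%:R * B / c + 1); split.
- by rewrite !lt_min d10 d20.
- lra.
move=> alpha; rewrite !lt_min => /andP[/andP[a1 a2] a3]; have al := h3 _ a3; split=> // x xn.
have [x1|x1] := lerP (nm x) 1; first lra.
have Fx : (Fpoly alpha).[x] = 0 by rewrite Fpoly_horner; apply/(Fdet_root p e_gen x al).
have := horner_coef_wide x (eq_leq (size_Fpoly p e_gen al)); rewrite Fx big_ord_recr /=.
have -> : (Fpoly alpha)`_N = sigma alpha.
  have := lead_coefE (Fpoly alpha); rewrite (size_Fpoly p e_gen al) /= => <-.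
  rewrite (Fpoly_prod p e_gen al) lead_coefZ (monicP (monic_prod_XsubC _ _ _)) mulr1 //.
move/esym/eqP; rewrite addr_eq0 => /eqP/(congr1 (@nm R)); rewrite nmN nmM nmX => e.
have x0 : 0 < nm x by lra.
have bound : \sum_(i < N) nm ((Fpoly alpha)`_i * x ^+ i) <= N%:R * B * nm x ^+ N.-1.
  apply: (@le_trans _ _ (\sum_(i < N) B * nm x ^+ N.-1)).
    apply: ler_sum => i _; rewrite nmM nmX; apply: ler_pM; rewrite ?exprn_ge0 ?nm_ge0 //.
      by apply: hB.
    by apply: ler_weXn2l; [exact: ltW|rewrite -ltnS prednK].
  by rewrite sumr_const card_ord -[leLHS]mulr_natl mulrA.
have := le_trans (nm_sum _ _ _) bound; rewrite e.
have -> : nm x ^+ N = nm x * nm x ^+ N.-1 by rewrite -exprS prednK.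
rewrite mulrA ler_pM2r ?exprn_gt0 // => le.
have : c * nm x <= N%:R * B.
  by apply: le_trans le; rewrite ler_wpM2r ?ltW //; exact: h2.
by rewrite mulrC -ler_pdivlMr //; lra.
Qed.

(** The reversed polynomial, whose small roots are the inverses of large
    roots. *)
Definition Qpoly alpha : {poly C} := \poly_(j < N.+1) (Fpoly alpha)`_(N - j).

Lemma Qpoly_prod alpha : ~ lattice alpha ->
  Qpoly alpha = sigma alpha *: \prod_(x <- nus alpha) (1 - x *: 'X).
Proof.
move=> al; apply: poly_eq_horner => w w0.
have wN : w ^+ N != 0 by rewrite expf_neq0.
rewrite /Qpoly horner_poly hornerZ horner_prod.
transitivity (w ^+ N * (Fpoly alpha).[w^-1]).
  rewrite (horner_coef_wide _ (eq_leq (size_Fpoly p e_gen al))) mulr_sumr (reindex_inj rev_ord_inj) /=.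
  apply: eq_bigr => j _; rewrite subSS; have jN : (j <= N)%N by rewrite -ltnS.
  rewrite subKn // mulrCA; congr (_ * _).
  have E : w ^+ N = w ^+ (N - j) * w ^+ j by rewrite -exprD subnK.
  by rewrite E exprVn mulfK ?expf_neq0.
rewrite Fpoly_horner (Fdet_prod p e_gen w^-1 al) mulrCA; congr (_ * _).
have EN : w ^+ N = \prod_(x <- nus alpha) w by rewrite prodr_const_seqE size_nus.
rewrite EN -big_split /=; apply: eq_bigr => x _; rewrite !hornerE mulrBr mulfV //; ring.
Qed.

(** Near alpha = 0 only one sheet goes to infinity. Two large roots give two
    roots w, v of the reversed polynomial near 0; the divided difference at
    them vanishes, although it is close to the coefficient of degree one,
    which is - N sigma'(alpha). *)
Lemma one_large_root : exists d M : R, [/\ 0 < d, 0 < M &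
  forall alpha x y s, 0 < nm alpha < d -> perm_eq (nus alpha) (x :: y :: s) ->
    M < nm x -> M < nm y -> False].
Proof.
have aU : ~ lattice 0 \/ (0 : C) = 0 by right.
have [d1 [B [d10 B0 hB]]] := cont_near_bounds N.+1 (fun k => @Fpoly_cont R e1 e2 N p e_gen p_inj k _ aU).
have [d2 d20 h2] := dsigma_near0; have [d3 d30 h3] := nonlattice_punctured e_gen.
(* so large that the terms of degree at least two in the divided difference
   sum to at most 1/2, less than the 3/4 of the linear one *)
pose M := N.+1%:R * (N.+1%:R * B) * 2 + 1.
have NB0 : 0 <= N.+1%:R * (N.+1%:R * B) by rewrite !mulr_ge0 ?ler0n // ltW.
have M1 : 1 <= M by rewrite /M; lra.
exists (Num.min (Num.min d1 d2) d3), M; split; [by rewrite !lt_min d10 d20|lra|].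
move=> alpha x y s /andP[a0]; rewrite !lt_min => /andP[/andP[a1 a2] a3] ps xM yM.
have al : ~ lattice alpha by apply: h3; rewrite a0.
have x0 : x != 0 by rewrite -nm_gt0; lra.
have y0 : y != 0 by rewrite -nm_gt0; lra.
pose q := sigma alpha *: ((x * y) *: \prod_(z <- s) (1 - z *: 'X)).
have lin (u : C) : u != 0 -> 1 - u *: 'X = (- u) *: ('X - u^-1%:P).
  move=> u0; have E : u *: (u^-1)%:P = 1 :> {poly C} by rewrite -mul_polyC -polyCM mulfV.
  by rewrite scaleNr scalerBr opprB E.
have QE : Qpoly alpha = ('X - x^-1%:P) * (('X - y^-1%:P) * q).
  rewrite (Qpoly_prod al) (perm_big _ ps) /= !big_cons (lin x x0) (lin y y0) /q.
  by rewrite -!scalerAl -!scalerAr !scalerA; congr (_ *: _); ring.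
have := divided_difference QE; set w := x^-1; set v := y^-1 => D.
have szQ : (size (Qpoly alpha) <= N.+1)%N by exact: size_poly.
have D2 : \sum_(j < N.+1) (Qpoly alpha)`_j * (\sum_(i < j) v ^+ (j.-1 - i) * w ^+ i) = 0.
  rewrite -[RHS]D (big_ord_widen N.+1 (fun j => (Qpoly alpha)`_j * (\sum_(i < j) v ^+ (j.-1 - i) * w ^+ i)) szQ).
  rewrite [RHS]big_mkcond; apply: eq_bigr => j _; case: ltnP => // h.
  by rewrite nth_default ?mul0r.
pose r := M^-1; have M0 : 0 < M by lra.
have r1 : r <= 1 by rewrite invf_le1.
have r0 : 0 <= r by rewrite invr_ge0 ltW.
have wr : nm w <= r by rewrite /w nmV lef_pV2 ?posrE ?nm_gt0 // ltW.
have vr : nm v <= r by rewrite /v nmV lef_pV2 ?posrE ?nm_gt0 // ltW.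
have i1 : (1 < N.+1)%N by [].
rewrite (bigD1 (Ordinal i1)) //= big_ord1 subnn !expr0 !mulr1 in D2.
have c1 : (Qpoly alpha)`_1 = - (N%:R * dsigma alpha).
  by rewrite coef_poly i1 subn1 (Fpoly_coef1 p N_gt0 e_gen al).
have big : 3/4 <= nm ((Qpoly alpha)`_1).
  rewrite c1 nmN nmM nm_nat; have := h2 alpha a2 => b.
  have : 1 <= N%:R :> R by rewrite ler1n.
  have := nm_ge0 (dsigma alpha); nra.
have : nm ((Qpoly alpha)`_1) <= N.+1%:R * (N.+1%:R * B * r).
  move/eqP: D2; rewrite addr_eq0 => /eqP ->; rewrite nmN.
  apply: le_trans (nm_sum _ _ _) _.
  apply: (@le_trans _ _ (\sum_(j < N.+1 | j != Ordinal i1) N.+1%:R * B * r)); last first.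
    apply: (@le_trans _ _ (\sum_(j < N.+1) N.+1%:R * B * r)).
      rewrite [leLHS]big_mkcond; apply: ler_sum => j _; case: ifP => // _.
      by rewrite !mulr_ge0 ?ler0n // ltW.
    by rewrite sumr_const card_ord -[leLHS]mulr_natl.
  apply: ler_sum => j j1; rewrite nmM.
  have -> : N.+1%:R * B * r = B * (N.+1%:R * r) by ring.
  apply: ler_pM; rewrite ?nm_ge0 //.
    by rewrite coef_poly ltn_ord; apply: hB; rewrite ?subr0 // ltnS leq_subr.
  apply: le_trans (nm_sum _ _ _) _.
  apply: (@le_trans _ _ (\sum_(i < j) r)); last first.
    by rewrite sumr_const card_ord -[leLHS]mulr_natl; apply: ler_wpM2r => //; rewrite ler_nat ltnW.
  apply: ler_sum => i _; rewrite nmM !nmX.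
  have j2 : (1 < j)%N.
    rewrite ltn_neqAle (leq_ltn_trans (leq0n i) (ltn_ord i)) andbT eq_sym.
    by move: j1; rewrite -val_eqE.
  apply: (@le_trans _ _ (r ^+ (j.-1 - i) * r ^+ i)).
    by apply: ler_pM; rewrite ?exprn_ge0 ?nm_ge0 // lerXn2r // nnegrE ?nm_ge0.
  rewrite -exprD subnK; last by rewrite -ltnS prednK // ltnW.
  by rewrite (pred_double_succ j2) exprS ler_piMr // exprn_ile1.
have -> : N.+1%:R * (N.+1%:R * B * r) = N.+1%:R * (N.+1%:R * B) / M by rewrite /r; ring.
move=> le; have := le_trans big le; rewrite ler_pdivlMr // /M; lra.
Qed.

End RootBehaviour.

(** * The generic roots are distinct *)

Section Discriminant.
Variables (R : realType) (e1 e2 eta1 eta2 : R[i]) (N : nat) (p : 'I_N -> R[i]).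
Hypothesis N_gt0 : (0 < N)%N.
Hypothesis e_gen : lattice_generators e1 e2.
Hypothesis qp : quasi_periods e1 e2 eta1 eta2.
Hypothesis p_inj : injective (fun j => torus_pi e1 e2 (p j)).
Local Notation C := R[i].
Implicit Types (z w x nu mu alpha : C).
Local Notation lattice := (lattice e1 e2).
Local Notation latt := (latt e1 e2).
Local Notation sigma := (weierstrass_sigma e1 e2).
Local Notation zeta := (weierstrass_zeta e1 e2).
Local Notation dsigma := (dsigma e1 e2).
Local Notation scaled_mx := (scaled_mx e1 e2 p).
Local Notation xs := (xs e1 e2 p).
Local Notation mus := (mus e1 e2 p).
Local Notation nus := (nus e1 e2 p).
Local Notation eta := (eta eta1 eta2).

Lemma entire_sum (I : Type) (s : seq I) (F : I -> C -> C) : (forall i, entire (F i)) ->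
  entire (fun t => \sum_(i <- s) F i t).
Proof. by move=> h z; apply: dC_sum => i _; exact: h. Qed.

Lemma entire_prod (I : Type) (s : seq I) (F : I -> C -> C) : (forall i, entire (F i)) ->
  entire (fun t => \prod_(i <- s) F i t).
Proof. by move=> h z; apply: dC_prod => i _; exact: h. Qed.

Lemma entire_ext (f g : C -> C) : (forall z, f z = g z) -> entire g -> entire f.
Proof. by move=> E; have -> : f = g by apply/funext. Qed.

Lemma entire_cst (c : C) : entire (fun=> c).
Proof. by move=> z; exact: dC_cst. Qed.

Lemma entire_det (n : nat) (A : C -> 'M[C]_n) : (forall i j, entire (fun t => A t i j)) ->
  entire (fun t => \det (A t)).
Proof.
move=> h; apply: entire_sum => s; apply: entire_mul; first exact: entire_cst.
by apply: entire_prod => i; exact: h.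
Qed.

Lemma entire_mulmx (m n k : nat) (A : C -> 'M[C]_(m, n)) (B : C -> 'M[C]_(n, k)) :
  (forall i j, entire (fun t => A t i j)) -> (forall i j, entire (fun t => B t i j)) ->
  forall i j, entire (fun t => (A t *m B t) i j).
Proof.
move=> hA hB i j; apply: (@entire_ext _ (fun t => \sum_l A t i l * B t l j)).
  by move=> t; rewrite mxE.
by apply: entire_sum => l; exact: entire_mul.
Qed.

Lemma entire_trace (n : nat) (A : C -> 'M[C]_n) : (forall i j, entire (fun t => A t i j)) ->
  entire (fun t => \tr (A t)).
Proof. by move=> h; apply: entire_sum => i; exact: h. Qed.

Lemma entire_adj (n : nat) (A : C -> 'M[C]_n) : (forall i j, entire (fun t => A t i j)) ->
  forall i j, entire (fun t => \adj (A t) i j).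
Proof.
move=> h i j; apply: (@entire_ext _ (fun t => (-1) ^+ (j + i) * \det (row' j (col' i (A t))))).
  by move=> t; rewrite mxE.
apply: entire_mul; first exact: entire_cst.
apply: entire_det => k l; apply: (@entire_ext _ (fun t => A t (lift j k) (lift i l))).
  by move=> t; rewrite !mxE.
exact: h.
Qed.

Lemma entire_mxpow (n : nat) (A : C -> 'M[C]_n) k : (forall i j, entire (fun t => A t i j)) ->
  forall i j, entire (fun t => mxpow (A t) k i j).
Proof.
move=> h; elim: k => [|k IH] i j; first exact: entire_cst.
apply: (@entire_ext _ (fun t => (A t *m mxpow (A t) k) i j)); first by [].
by apply: entire_mulmx.
Qed.

Lemma entire_scaled_mx i j : entire (fun t => (- scaled_mx t) i j).
Proof.
have [->|ij] := eqVneq i j.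
  apply: (@entire_ext _ (fun=> 0)); last exact: entire_cst.
  by move=> t; rewrite !mxE eqxx oppr0.
apply: (@entire_ext _ (fun t => (- (sigma (p j - p i))^-1) * sigma (t - (p j - p i)))).
  by move=> t; rewrite !mxE (negbTE ij) mulNr mulrC.
apply: entire_mul; first exact: entire_cst.
exact: (entire_sub (entire_sigma e_gen)).
Qed.

(** Power sums of the scaled roots, as traces: in this form they are entire in
    alpha. *)
Definition tr k alpha : C := \tr (mxpow (- scaled_mx alpha) k).

Lemma trE k alpha : tr k alpha = psum (xs alpha) k.
Proof. exact: (trace_power k N_gt0 (char_poly_scaled_mx e1 e2 p alpha)). Qed.

Definition Hk e k alpha : 'M[C]_k := \matrix_(i < k, j < k) tr (i + j + e) alpha.

Lemma HkE e k alpha : Hk e k alpha = hankel e (psum (xs alpha)) k.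
Proof. by apply/matrixP => i j; rewrite !mxE trE. Qed.

Lemma entire_Hk e k i j : entire (fun t => Hk e k t i j).
Proof.
apply: (@entire_ext _ (tr (i + j + e))); first by move=> t; rewrite mxE.
by apply: entire_trace; apply: entire_mxpow; exact: entire_scaled_mx.
Qed.

(** The subdiscriminant of order k of the scaled roots, an entire function. *)
Definition subdisc k alpha : C := \det (Hk 0 k alpha).
(** Together with [subdisc] it expresses the sum of the distinct roots as a
    quotient of entire functions. *)
Definition subdisc_sum k alpha : C := \tr (Hk 1 k alpha *m \adj (Hk 0 k alpha)).

Lemma entire_subdisc k : entire (subdisc k).
Proof. by apply: entire_det; exact: entire_Hk. Qed.

Lemma entire_subdisc_sum k : entire (subdisc_sum k).
Proof. by apply: entire_trace; apply: entire_mulmx; [exact: entire_Hk|apply: entire_adj; exact: entire_Hk]. Qed.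

(** The number of distinct points of the curve above alpha. *)
Definition ndist alpha := size (undup (xs alpha)).

Lemma subdisc_eq0 k alpha : (ndist alpha < k)%N -> subdisc k alpha = 0.
Proof. by move=> h; rewrite /subdisc HkE hankel_det. Qed.

Lemma subdisc_neq0 alpha : subdisc (ndist alpha) alpha != 0.
Proof. by rewrite /subdisc HkE; have [] := hankel_top (xs alpha). Qed.

Lemma subdisc_sumE alpha : subdisc_sum (ndist alpha) alpha = subdisc (ndist alpha) alpha * \sum_(x <- undup (xs alpha)) x.
Proof. by rewrite /subdisc_sum /subdisc !HkE; have [] := hankel_top (xs alpha). Qed.

Lemma ndist_le alpha : (ndist alpha <= N)%N.
Proof. by rewrite -(size_xs e1 e2 p alpha) size_undup. Qed.

Lemma mus_periodic alpha l : lattice l -> ~ lattice alpha -> perm_eq (mus (alpha + l)) (mus alpha).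
Proof.
move=> ll al; have al' : ~ lattice (alpha + l) by move/(lattDr _ ll).
apply: prod_XsubC_eq; apply: poly_eq_horner => mu _; rewrite !horner_prod.
have E a : ~ lattice a -> \prod_(x <- mus a) ('X - x%:P).[mu] = \det (spectral_mx e1 e2 p mu a).
  move=> h; rewrite (det_spectral_mx p e_gen mu h); apply: eq_bigr => x _; by rewrite hornerXsubC.
rewrite !E //; congr (\det _); apply/matrixP => i j; rewrite !mxE; case: eqVneq => // _.
exact: (Phi_periodic e_gen qp).
Qed.

Lemma undup_mus alpha : ~ lattice alpha -> undup (mus alpha) = [seq x / sigma alpha | x <- undup (xs alpha)].
Proof.
move=> al; rewrite musE undup_map_inj //.
by apply: mulIf; rewrite invr_eq0 (sigma_neq0 e_gen).
Qed.

Lemma ndistE alpha : ~ lattice alpha -> ndist alpha = size (undup (mus alpha)).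
Proof. by move=> al; rewrite undup_mus // size_map. Qed.

Lemma ndist_periodic alpha l : lattice l -> ~ lattice alpha -> ndist (alpha + l) = ndist alpha.
Proof.
move=> ll al; have al' : ~ lattice (alpha + l) by move/(lattDr _ ll).
by rewrite !ndistE //; apply: perm_size; apply: perm_undup; apply: perm_mem; exact: mus_periodic.
Qed.

Definition Tsum alpha : C := \sum_(m <- undup (mus alpha)) m.

Lemma Tsum_periodic alpha l : lattice l -> ~ lattice alpha -> Tsum (alpha + l) = Tsum alpha.
Proof.
move=> ll al; apply: perm_big; apply: perm_undup; apply: perm_mem; exact: mus_periodic.
Qed.

(** At r = [ndist] this is the sum of (multiplicity - 1) nu over the distinct
    roots nu. *)
Definition excess (r : nat) alpha : C := (N - r)%:R * zeta alpha - Tsum alpha.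

Lemma excessE alpha : ~ lattice alpha ->
  excess (ndist alpha) alpha = \sum_(x <- nus alpha) x - \sum_(x <- undup (nus alpha)) x.
Proof.
move=> al; have -> : undup (nus alpha) = [seq m + zeta alpha | m <- undup (mus alpha)].
  by rewrite nusE undup_map_inj //; exact: addIr.
rewrite (sum_nus e1 e2 p N_gt0) big_map big_split /= -/(Tsum alpha) big_const_seq count_predT -ndistE // iter_addr_0.
rewrite /excess natrB ?ndist_le // mulrBl mulr_natl [_%:R * _]mulr_natl opprD.
rewrite -[zeta alpha *+ ndist alpha]mulr_natl; ring.
Qed.

(** A large root is simple by [one_large_root], so it does not contribute to
    the excess. *)
Lemma excess_bound0 : exists d B : R, [/\ 0 < d, 0 <= B & forall alpha, 0 < nm alpha < d ->
  nm (excess (ndist alpha) alpha) <= B].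
Proof.
have [d1 [M [d10 M0 h1]]] := one_large_root N_gt0 e_gen p_inj.
have [d2 d20 h2] := nonlattice_punctured e_gen.
exists (Num.min d1 d2), (N%:R * M); split; [by rewrite lt_min d10|by rewrite mulr_ge0 // ltW|].
move=> alpha /andP[a0]; rewrite lt_min => /andP[a1 a2].
have al : ~ lattice alpha by apply: h2; rewrite a0.
rewrite excessE //; have := @sum_undup_bound R (nus alpha) M (ltW M0); rewrite size_nus; apply.
move=> x xc; rewrite leNgt; apply/negP => xM.
have x1 : x \in nus alpha by rewrite -has_pred1 has_count; exact: leq_trans xc.
have x2 : x \in rem x (nus alpha).
  rewrite -has_pred1 has_count; have := permP (perm_to_rem x1) (pred1 x).
  by rewrite /= eqxx add1n => e; move: xc; rewrite e ltnS.
have ps : perm_eq (nus alpha) (x :: x :: rem x (rem x (nus alpha))).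
  by apply: perm_trans (perm_to_rem x1) _; rewrite perm_cons perm_to_rem.
by apply: (h1 _ _ _ _ _ ps xM xM); rewrite a0.
Qed.

(** Away from the lattice all roots are bounded. *)
Lemma excess_bound1 alpha0 : ~ lattice alpha0 -> exists d B : R, [/\ 0 < d, 0 <= B &
  forall alpha, nm (alpha - alpha0) < d -> ~ lattice alpha /\ nm (excess (ndist alpha) alpha) <= B].
Proof.
move=> al0; have [d [M [d0 M0 h]]] := roots_locally_bounded N_gt0 e_gen p_inj al0.
exists d, (N%:R * M); split=> //; first by rewrite mulr_ge0 // ltW.
move=> alpha /h[al xM]; split=> //; rewrite excessE //.
have := @sum_undup_bound R (nus alpha) M (ltW M0); rewrite size_nus; apply.
move=> x xc; apply: xM; rewrite -has_pred1 has_count; exact: leq_trans xc.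
Qed.

Lemma excess_cell : exists2 B : R, 0 < B & forall alpha, cell e1 e2 alpha -> ~ lattice alpha ->
  nm (excess (ndist alpha) alpha) <= B.
Proof.
apply: (@compact_local_bound R C (cell e1 e2) (~` lattice) (fun z => nm (excess (ndist z) z)) (cell_compact e_gen)).
move=> x cx; have [xl|xl] := pselect (lattice x).
  have x0 := cell_lattice e_gen cx xl; have [d [B [d0 B0 h]]] := excess_bound0.
  exists B; apply/nbhsCP; exists d => // w wd wl; apply: h; rewrite x0 subr0 in wd; rewrite wd andbT nm_gt0.
  by apply/eqP => w0; apply: wl; rewrite w0; exact: lattice0.
have [d [B [d0 B0 h]]] := excess_bound1 xl.
by exists B; apply/nbhsCP; exists d => // w /h[].
Qed.

(** The roots mu are periodic in alpha, and zeta is periodic up to eta. *)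
Lemma excess_shift r m n alpha : ~ lattice alpha ->
  excess r (alpha + latt m n) = excess r alpha + (N - r)%:R * eta m n.
Proof.
move=> al; have ll : lattice (latt m n) by exists m, n.
by rewrite /excess (zeta_shift e_gen qp m n al) Tsum_periodic // mulrDr; ring.
Qed.

Lemma eta_bound m n : nm (eta m n) <= (`|m%:~R| + `|n%:~R|) * (nm eta1 + nm eta2).
Proof.
have nmz (k : int) : nm (k%:~R : C) = `|k%:~R|.
  have E : k%:~R = (k%:~R : R)%:C :> C by rewrite rmorph_int.
  by rewrite E nm_real.
apply: le_trans (nmD _ _) _; rewrite !nmM !nmz.
have := nm_ge0 eta1; have := nm_ge0 eta2; have := normr_ge0 (m%:~R : R); have := normr_ge0 (n%:~R : R).
move: `|m%:~R| `|n%:~R| (nm eta1) (nm eta2) => a b c d b0 a0 d0 c0.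
nra.
Qed.

(** Bounded on the period parallelogram and additive under translations. *)
Lemma excess_growth r : exists2 A : R, 0 < A & forall alpha, ~ lattice alpha -> ndist alpha = r ->
  nm (excess r alpha) <= A * (1 + nm alpha).
Proof.
have [B B0 hB] := excess_cell.
pose L := 2 * lbound e1 e2; have L0 : 0 <= L by rewrite mulr_ge0 ?lbound_ge0.
pose K := N%:R * (nm eta1 + nm eta2); have K0 : 0 <= K by rewrite mulr_ge0 // addr_ge0 // nm_ge0.
exists (B + K * (2 * L + 2)); first by rewrite ltr_wpDr // mulr_ge0 // addr_ge0 // mulr_ge0.
move=> alpha al ar; have [m [n [cz [hm hn]]]] := cell_reduce e_gen alpha.
have ll : lattice (latt m n) by exists m, n.
pose b := alpha - latt m n; have ab : alpha = b + latt m n by rewrite /b subrK.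
have bl : ~ lattice b by move=> h; apply: al; rewrite ab; exact: latticeD.
have br : ndist b = r by rewrite -ar ab ndist_periodic.
have := hB b cz bl; rewrite br => hb.
rewrite {1}ab excess_shift //; apply: le_trans (nmD _ _) _; rewrite nmM nm_nat.
have [k1 k2] := crd_le e_gen alpha; rewrite -/L in k1 k2.
have e := eta_bound m n; have na := nm_ge0 alpha.
have q0 : 0 <= nm eta1 + nm eta2 by rewrite addr_ge0 // nm_ge0.
have e1' : (N - r)%:R * nm (eta m n) <= K * (2 * (L * nm alpha) + 2).
  apply: (@le_trans _ _ (N%:R * ((`|m%:~R| + `|n%:~R|) * (nm eta1 + nm eta2)))).
    by apply: ler_pM; rewrite ?nm_ge0 ?ler0n // ler_nat leq_subr.
  have -> : N%:R * ((`|m%:~R| + `|n%:~R|) * (nm eta1 + nm eta2)) = K * (`|m%:~R| + `|n%:~R|).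
    by rewrite /K; ring.
  by apply: ler_wpM2l => //; lra.
apply: le_trans (lerD hb e1') _.
have q1 : 0 <= K * L by exact: mulr_ge0.
have q2 : 0 <= B * nm alpha by rewrite mulr_ge0 // ltW.
have q3 : 0 <= K * nm alpha by exact: mulr_ge0.
clearbody K L b; nra.
Qed.

(** Let r be the generic number of distinct roots. The excess is a quotient of
    entire functions of linear growth, hence affine by [quotient_liouville],
    with additive periods (N - r) eta_j. So (N - r) eta_j = c e_j for some c,
    and Legendre's relation gives r = N. The geometric content is that a sheet
    going to infinity at alpha = 0 alone cannot lie on a multiple component. *)
Lemma discriminant_nonzero : exists alpha, subdisc N alpha != 0.
Proof.
pose P k := (k <= N)%N && `[< exists alpha, subdisc k alpha != 0 >].
have P0 : exists k, P k.
  by exists (ndist 0); rewrite /P ndist_le; apply/asboolP; exists 0; exact: subdisc_neq0.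
have Pb k : P k -> (k <= N)%N by case/andP.
case: (ex_maxnP P0 Pb) => r /andP[rN /asboolP[a0 ha0]] rmax.
have nd alpha : subdisc r alpha != 0 -> ndist alpha = r.
  move=> D0; apply/eqP; rewrite eqn_leq; apply/andP; split.
    by apply: rmax; rewrite /P ndist_le; apply/asboolP; exists alpha; exact: subdisc_neq0.
  by rewrite leqNgt; apply/negP => /subdisc_eq0 h; rewrite h eqxx in D0.
suff rN' : r = N by exists a0; rewrite -rN'.
pose u alpha := (N - r)%:R * (dsigma alpha * subdisc r alpha) - subdisc_sum r alpha.
pose v alpha := sigma alpha * subdisc r alpha.
have eu : entire u.
  move=> z; apply: dC_B; last exact: (@entire_subdisc_sum r z).
  have h1 := entire_mul (edsig e_gen) (@entire_subdisc r).
  have h2 : entire (fun=> (N - r)%:R : C) by exact: entire_cst.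
  exact: (entire_mul h2 h1).
have ev : entire v := entire_mul (entire_sigma e_gen) (@entire_subdisc r).
have [d d0 hd] := isolated_zeros (0 : C) (@entire_subdisc r) (ex_intro _ a0 ha0).
have [d' d'0 hd'] := nonlattice_punctured e_gen.
have dd : 0 < Num.min d d' by rewrite lt_min d0.
have [b] := point_near (0 : C) dd; rewrite subr0 lt_min => /andP[b0 /andP[bd bd']].
have bl : ~ lattice b by apply: hd'; rewrite b0.
have Db : subdisc r b != 0 by apply: hd; rewrite subr0 b0.
(* u / v extends the excess: sigma clears the pole of zeta, and the
   subdiscriminant the denominator of the sum of distinct roots *)
have uE alpha : ~ lattice alpha -> subdisc r alpha != 0 -> u alpha = excess r alpha * v alpha.
  move=> al D0; have nr := nd _ D0; have := subdisc_sumE alpha; rewrite nr => UE.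
  have s0 := sigma_neq0 e_gen al.
  rewrite /u /v UE /excess /Tsum undup_mus // big_map -mulr_suml (zetaE e_gen).
  move: (\sum_(x <- _) _) (sigma alpha) (dsigma alpha) (subdisc r alpha) s0 => S s ds D s0.
  by field.
have [A A0 hA] := excess_growth r.
have nz : exists z, v z != 0 by exists b; rewrite mulf_neq0 // (sigma_neq0 e_gen).
have grow z : v z != 0 -> nm (u z) <= A * (1 + nm z) * nm (v z).
  move=> vz; have Dz : subdisc r z != 0 by apply: contraNneq vz => h; rewrite /v h mulr0.
  have zl : ~ lattice z by move/(sigma_eq0 e_gen) => h; rewrite /v h mul0r eqxx in vz.
  rewrite uE // nmM; apply: ler_wpM2r; first exact: nm_ge0.
  by apply: hA => //; exact: nd.
have [c [e hce]] := quotient_liouville eu ev nz grow.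
have ex alpha : ~ lattice alpha -> subdisc r alpha != 0 -> excess r alpha = c + e * alpha.
  move=> al D0; have v0 : v alpha != 0 by rewrite mulf_neq0 // (sigma_neq0 e_gen).
  by apply: (mulIf v0); rewrite -uE.
have Dl m n : subdisc r (b + latt m n) != 0.
  have ll : lattice (latt m n) by exists m, n.
  by rewrite -(nd _ Db) -(ndist_periodic ll bl) subdisc_neq0.
have key m n : (N - r)%:R * eta m n = e * latt m n.
  have ll : lattice (latt m n) by exists m, n.
  have bl' : ~ lattice (b + latt m n) by move/(lattDr _ ll).
  have := excess_shift r m n bl; rewrite (ex _ bl' (Dl m n)) (ex _ bl Db) => h.
  have -> : e * latt m n = (c + e * (b + latt m n)) - (c + e * b) by ring.
  by rewrite h; ring.
have k1 := key 1 0; have k2 := key 0 1.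
rewrite eta10 latt10 in k1; rewrite eta01 latt01 in k2.
have k0 : (N - r)%:R = 0 :> C := legendre_solve qp k1 k2.
move/eqP: k0; rewrite pnatr_eq0 subn_eq0 => Nr.
by apply/eqP; rewrite eqn_leq rN.
Qed.

Lemma subdisc_uniq alpha : subdisc N alpha != 0 -> uniq (xs alpha).
Proof.
move=> D0; have : ndist alpha = N.
  by apply/eqP; rewrite eqn_leq ndist_le leqNgt; apply/negP => /subdisc_eq0 h; rewrite h eqxx in D0.
rewrite /ndist => h.
by rewrite -[uniq _]negbK -ltn_size_undup h size_xs ltnn.
Qed.

End Discriminant.

(** * The multiplier map and the torus *)

Section LocalLogarithm.
Variable R : realType.
Local Notation C := R[i].

(** The principal logarithm is continuous at 1. *)
Lemma cexp_local_inv (e : R) : 0 < e ->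
  exists2 d : R, 0 < d & forall w : C, nm (w - 1) < d -> exists2 l, nm l < e & cexp l = w.
Proof.
move=> e0; have e20 : 0 < e / 2 by lra.
have c1 : {for (1 : C), continuous (fun w : C => ln (nm w))}.
  have p : 0 < nm (1 : C) by rewrite nm1.
  exact: (continuous_comp (@nm_continuous R 1) (@continuous_ln R (nm 1) p)).
have c2 : {for (1 : C), continuous (fun w : C => atan (complex.Im w / complex.Re w))}.
  have r0 : complex.Re (1 : C) != 0 by exact: oner_neq0.
  have h : {for (1 : C), continuous (fun w : C => complex.Im w / complex.Re w)}.
    have i1 : {for (1 : C), continuous (@complex.Im R)} by move=> A; exact: (@Im_continuous R 1 A).
    have i2 : {for (1 : C), continuous (@complex.Re R)} by move=> A; exact: (@Re_continuous R 1 A).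
    exact: (cvgM i1 (cvgV r0 i2)).
  exact: (continuous_comp h (@continuous_atan R _)).
have c3 : {for (1 : C), continuous (@complex.Re R)} by exact: Re_continuous.
have ln1' : ln (nm (1 : C)) = 0 by rewrite nm1 ln1.
have at1 : atan (complex.Im (1 : C) / complex.Re (1 : C)) = 0 by rewrite /= mul0r atan0.
have n1 : nbhs (1 : C) (fun w => `|ln (nm w)| < e / 2).
  have /cvgrPdist_lt/(_ _ e20) := c1; rewrite ln1'; apply: filterS => w; by rewrite sub0r normrN.
have n2 : nbhs (1 : C) (fun w => `|atan (complex.Im w / complex.Re w)| < e / 2).
  have /cvgrPdist_lt/(_ _ e20) := c2; rewrite at1; apply: filterS => w; by rewrite sub0r normrN.
have n3 : nbhs (1 : C) (fun w => 0 < complex.Re w).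
  have h : 0 < 1 / 2 :> R by lra.
  have /cvgrPdist_lt/(_ _ h) := c3; apply: filterS => w; rewrite ltr_norml /= => /andP[a b].
  by lra.
have H : nbhs (1 : C) (fun w => (`|ln (nm w)| < e / 2 /\ `|atan (complex.Im w / complex.Re w)| < e / 2) /\
    0 < complex.Re w) by exact: filterI (filterI n1 n2) n3.
have [d d0 hd] := (nbhsCP _ _).1 H.
exists d => // w /hd[[w1 w2] w3]; exists (clog w); last exact: clogK.
by apply: le_lt_trans (nm_le_ReIm _) _; rewrite /clog /=; lra.
Qed.

End LocalLogarithm.

Section MultiplierMap.
Variables (R : realType) (e1 e2 eta1 eta2 : R[i]).
Hypothesis e_gen : lattice_generators e1 e2.
Hypothesis qp : quasi_periods e1 e2 eta1 eta2.
Local Notation C := R[i].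
Implicit Types (z w nu alpha : C) (b : C * C).
Local Notation lattice := (lattice e1 e2).
Local Notation latt := (latt e1 e2).
Local Notation Psi := (Psi e1 e2 eta1 eta2).
Local Notation eta := (eta eta1 eta2).

(** The norm of the inverse of the linear map (nu, alpha) -> (nu e_j - eta_j
    alpha), whose determinant is Legendre's. *)
Definition PsiK : R := (nm e1 + nm e2 + nm eta1 + nm eta2) / nm (eta1 * e2 - eta2 * e1).

Lemma log_solve (l1 l2 : C) : exists nu alpha, [/\ nu * e1 - eta1 * alpha = l1,
   nu * e2 - eta2 * alpha = l2, nm nu <= PsiK * (nm l1 + nm l2) & nm alpha <= PsiK * (nm l1 + nm l2)].
Proof.
have W0 := legendre_neq0 qp; pose W := eta1 * e2 - eta2 * e1.
have w0 : 0 < nm W by rewrite nm_gt0.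
exists ((eta1 * l2 - eta2 * l1) / W), ((e1 * l2 - e2 * l1) / W).
have bound (a c : C) : nm a + nm c <= nm e1 + nm e2 + nm eta1 + nm eta2 ->
   nm ((a * l2 - c * l1) / W) <= PsiK * (nm l1 + nm l2).
  move=> h; rewrite nm_div ler_pdivrMr // /PsiK -/W mulrAC divfK ?lt0r_neq0 //.
  apply: le_trans (nmBD _ _) _; rewrite !nmM.
  have h1 := nm_ge0 l1; have h2 := nm_ge0 l2; have h3 := nm_ge0 a; have h4 := nm_ge0 c.
  apply: (@le_trans _ _ ((nm a + nm c) * (nm l1 + nm l2))); last by rewrite ler_wpM2r // addr_ge0.
  by rewrite mulrDl !mulrDr; have := mulr_ge0 h3 h1; have := mulr_ge0 h4 h2; lra.
have n1 := nm_ge0 e1; have n2 := nm_ge0 e2; have n3 := nm_ge0 eta1; have n4 := nm_ge0 eta2.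
split; [| |apply: bound; lra|apply: bound; lra].
  by rewrite /W; field; exact: W0.
by rewrite /W; field; exact: W0.
Qed.

Lemma Psi_surj b : b.1 != 0 -> b.2 != 0 -> exists nu alpha, Psi nu alpha = b.
Proof.
move=> /cexp_surj[l1 h1] /cexp_surj[l2 h2].
have [nu [alpha [k1 k2 _ _]]] := log_solve l1 l2; exists nu, alpha.
by rewrite PsiE k1 k2 h1 h2 -surjective_pairing.
Qed.

Lemma PsiD nu alpha dnu dalpha : Psi (nu + dnu) (alpha + dalpha) =
  ((Psi nu alpha).1 * (Psi dnu dalpha).1, (Psi nu alpha).2 * (Psi dnu dalpha).2).
Proof. by rewrite !PsiE /= -!cexpD; congr (cexp _, cexp _); ring. Qed.

(** Legendre's relation makes the exponents of the two multipliers arbitrary,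
    with control on (nu, alpha); then the logarithm is taken near 1. *)
Lemma Psi_open nu0 alpha0 (e : R) : 0 < e -> exists2 d : R, 0 < d & forall b,
  nm (b.1 - (Psi nu0 alpha0).1) < d -> nm (b.2 - (Psi nu0 alpha0).2) < d ->
  exists nu alpha, [/\ nm (nu - nu0) < e, nm (alpha - alpha0) < e & Psi nu alpha = b].
Proof.
move=> e0; have K0 : 0 <= PsiK by rewrite divr_ge0 ?nm_ge0 // !addr_ge0 ?nm_ge0.
have e'0 : 0 < e / (2 * PsiK + 1) by rewrite divr_gt0 // ltr_wpDl // mulr_ge0.
have [d d0 hd] := cexp_local_inv e'0.
have p1 : (Psi nu0 alpha0).1 != 0 by exact: cexp_neq0.
have p2 : (Psi nu0 alpha0).2 != 0 by exact: cexp_neq0.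
have [m10 m20] : 0 < nm (Psi nu0 alpha0).1 /\ 0 < nm (Psi nu0 alpha0).2 by rewrite !nm_gt0.
pose m := Num.min (nm (Psi nu0 alpha0).1) (nm (Psi nu0 alpha0).2).
have m0 : 0 < m by rewrite lt_min m10.
have mm1 : m <= nm (Psi nu0 alpha0).1 by rewrite ge_min lexx.
have mm2 : m <= nm (Psi nu0 alpha0).2 by rewrite ge_min lexx orbT.
exists (d * m); first exact: mulr_gt0.
have near (u v : C) : u != 0 -> m <= nm u -> nm (v - u) < d * m -> nm (v / u - 1) < d.
  move=> u0 mu vu; have -> : v / u - 1 = (v - u) / u by rewrite mulrBl divff.
  rewrite nm_div ltr_pdivrMr ?nm_gt0 //; apply: lt_le_trans vu _.
  by apply: ler_wpM2l => //; exact: ltW.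
move=> b b1 b2; have [l1 l1e h1] := hd _ (near _ _ p1 mm1 b1); have [l2 l2e h2] := hd _ (near _ _ p2 mm2 b2).
have [dnu [dalpha [k1 k2 n1 n2]]] := log_solve l1 l2.
have small : PsiK * (nm l1 + nm l2) < e.
  apply: (@le_lt_trans _ _ (PsiK * (2 * (e / (2 * PsiK + 1))))); first by rewrite ler_wpM2l //; lra.
  have P1 : 0 < 2 * PsiK + 1 by rewrite ltr_wpDl // mulr_ge0.
  have -> : PsiK * (2 * (e / (2 * PsiK + 1))) = e * (2 * PsiK) / (2 * PsiK + 1) by ring.
  by rewrite ltr_pdivrMr // mulrDr mulr1 ltrDl.
exists (nu0 + dnu), (alpha0 + dalpha); split.
- rewrite (_ : nu0 + dnu - nu0 = dnu); last by ring.
  exact: le_lt_trans n1 small.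
- rewrite (_ : alpha0 + dalpha - alpha0 = dalpha); last by ring.
  exact: le_lt_trans n2 small.
rewrite PsiD [b]surjective_pairing (PsiE e1 e2 eta1 eta2 dnu dalpha) k1 k2 h1 h2 /=.
by congr (_, _); rewrite mulrC divfK.
Qed.

Lemma Psi_near nu0 alpha0 (e : R) : 0 < e -> exists2 d : R, 0 < d & forall nu alpha,
  nm (nu - nu0) < d -> nm (alpha - alpha0) < d ->
  nm ((Psi nu alpha).1 - (Psi nu0 alpha0).1) < e /\ nm ((Psi nu alpha).2 - (Psi nu0 alpha0).2) < e.
Proof.
move=> e0.
have c (u h : C) : {for (nu0, alpha0), continuous (fun t : C * C => cexp (t.1 * u - h * t.2))}.
  have c1 : {for (nu0, alpha0), continuous (fun t : C * C => t.1)} by exact: cvg_fst.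
  have c2 : {for (nu0, alpha0), continuous (fun t : C * C => t.2)} by exact: cvg_snd.
  have k1 : {for (nu0, alpha0), continuous (fun _ : C * C => u)} by exact: contcst.
  have k2 : {for (nu0, alpha0), continuous (fun _ : C * C => h)} by exact: contcst.
  have c3 := contB (contM c1 k1) (contM k2 c2).
  exact: (contcomp c3 (entire_cont (@entire_cexp R) (x := _))).
have [d1 d10 h1] := (cont2P _ _ _).1 (c e1 eta1) e e0.
have [d2 d20 h2] := (cont2P _ _ _).1 (c e2 eta2) e e0.
exists (Num.min d1 d2); first by rewrite lt_min d10.
move=> nu alpha; rewrite !lt_min => /andP[n1 n2] /andP[a1 a2].
by split; [exact: h1|exact: h2].
Qed.

Lemma Psi_period m n : Psi (eta m n) (latt m n) = (1, 1).
Proof.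
have [_ _ leg] := qp; rewrite PsiE !etaE /Defs.latt.
have -> : (m%:~R * eta1 + n%:~R * eta2) * e1 - eta1 * (m%:~R * e1 + n%:~R * e2) =
   - n%:~R * (eta1 * e2 - eta2 * e1) by ring.
have -> : (m%:~R * eta1 + n%:~R * eta2) * e2 - eta2 * (m%:~R * e1 + n%:~R * e2) =
   m%:~R * (eta1 * e2 - eta2 * e1) by ring.
have P (k : int) : cexp (k%:~R * twopii R) = 1 by exact: cexp_2pi.
by have [->|->] := leg; rewrite ?mulrN ?mulNr ?opprK -?mulNr -?mulrNz !P.
Qed.

Lemma Psi_shift nu alpha m n : Psi (nu + eta m n) (alpha + latt m n) = Psi nu alpha.
Proof. by rewrite PsiD Psi_period /= !mulr1. Qed.

(** The exponents differ by 2 pi i times integers. Since Legendre's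
    determinant is +- 2 pi i, the solutions are exactly the deck
    transformations (nu, alpha) -> (nu + eta_l, alpha + l) with l in the
    lattice. *)
Lemma Psi_fibre nu alpha nu' alpha' : Psi nu alpha = Psi nu' alpha' ->
  exists m n, nu' = nu + eta m n /\ alpha' = alpha + latt m n.
Proof.
move=> E; have [_ _ leg] := qp; have W0 := legendre_neq0 qp.
pose dn := nu' - nu; pose da := alpha' - alpha.
have D : Psi dn da = (1, 1).
  have := PsiD nu alpha dn da; have -> : nu + dn = nu' by rewrite /dn; ring.
  have -> : alpha + da = alpha' by rewrite /da; ring.
  rewrite -E => h; rewrite [Psi dn da]surjective_pairing.
  have p1 : (Psi nu alpha).1 != 0 by exact: cexp_neq0.
  have p2 : (Psi nu alpha).2 != 0 by exact: cexp_neq0.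
  congr (_, _).
    by apply: (mulfI p1); rewrite mulr1 {2}h.
  by apply: (mulfI p2); rewrite mulr1 {2}h.
have [/cexp_eq1[m hm] /cexp_eq1[n hn]] : cexp (dn * e1 - eta1 * da) = 1 /\ cexp (dn * e2 - eta2 * da) = 1.
  by split; [exact: (congr1 fst D)|exact: (congr1 snd D)].
rewrite -/(twopii R) in hm hn; have w0 := twopii_neq0 R.
have A1 : da * (eta1 * e2 - eta2 * e1) = (n%:~R * e1 - m%:~R * e2) * twopii R.
  have -> : (n%:~R * e1 - m%:~R * e2) * twopii R = (n%:~R * twopii R) * e1 - (m%:~R * twopii R) * e2 by ring.
  by rewrite -hm -hn; ring.
have A2 : dn * (eta1 * e2 - eta2 * e1) = (n%:~R * eta1 - m%:~R * eta2) * twopii R.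
  have -> : (n%:~R * eta1 - m%:~R * eta2) * twopii R = (n%:~R * twopii R) * eta1 - (m%:~R * twopii R) * eta2 by ring.
  by rewrite -hm -hn; ring.
have [L|L] := leg; rewrite L in A1 A2.
  exists n, (- m); rewrite !etaE /Defs.latt mulrNz !mulNr -(mulIf w0 A1) -(mulIf w0 A2).
  by rewrite /dn /da; split; ring.
rewrite !mulrN -!mulNr in A1 A2.
exists (- n), m; rewrite !etaE /Defs.latt mulrNz !mulNr.
have := mulIf w0 A1; have := mulIf w0 A2; rewrite /dn /da => B2 B1; split.
  have -> : nu' = nu - (- (nu' - nu)) by ring.
  by rewrite B2; ring.
have -> : alpha' = alpha - (- (alpha' - alpha)) by ring.
by rewrite B1; ring.
Qed.

(** Every pair of nonzero multipliers has a representative whose alpha is in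
    the period parallelogram, where 0 is the only lattice point. *)
Lemma Psi_rep b : b.1 != 0 -> b.2 != 0 -> exists nu alpha,
  [/\ Psi nu alpha = b, cell e1 e2 alpha & ~ lattice alpha \/ alpha = 0].
Proof.
move=> b1 b2; have [nu [alpha E]] := Psi_surj b1 b2.
have [m [n [c _]]] := cell_reduce e_gen alpha.
exists (nu + eta (- m) (- n)), (alpha + latt (- m) (- n)).
rewrite Psi_shift; rewrite lattN in c *; split=> //.
have [al|al] := pselect (lattice (alpha - latt m n)); last by left.
by right; exact: (cell_lattice e_gen c al).
Qed.

(** A deck transformation that moves alpha little is trivial. *)
Lemma Psi_inj_local : exists2 d : R, 0 < d & forall nu alpha nu' alpha',
  Psi nu alpha = Psi nu' alpha' -> nm (alpha - alpha') < d -> nu = nu' /\ alpha = alpha'.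
Proof.
have [d d0 hd] := lattice_discrete e_gen; exists d => // nu alpha nu' alpha' E ad.
have [m [n [h1 h2]]] := Psi_fibre E.
have l0 : latt m n = 0.
  apply: hd; first by exists m, n.
  by move: ad; rewrite h2 nmB; have -> : alpha + latt m n - alpha = latt m n by ring.
have := latt_eq0 e_gen m n; rewrite l0 eqxx => /esym/andP[/eqP m0 /eqP n0].
by rewrite h1 h2 l0 m0 n0 etaE !mul0r !addr0.
Qed.

End MultiplierMap.

Section TorusTopology.
Variables (R : realType) (e1 e2 : R[i]).
Hypothesis e_gen : lattice_generators e1 e2.
Local Notation C := R[i].
Implicit Types (z w alpha : C) (a : torus e1 e2).
Local Notation lattice := (lattice e1 e2).
Local Notation pi := (torus_pi e1 e2).

Lemma pi_repr a : pi (repr a) = a.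
Proof. exact: reprK. Qed.

Lemma pi_shift z l : lattice l -> pi (z + l) = pi z.
Proof. by move=> ll; apply/torus_piP; have -> : z + l - z = l by ring. Qed.

Lemma pi_latt z : pi z = pi 0 <-> lattice z.
Proof. by split=> [/torus_piP|h]; [rewrite subr0|apply/torus_piP; rewrite subr0]. Qed.

Lemma pi_cont : continuous pi.
Proof. exact: pi_continuous. Qed.

Lemma pi_near z (A : set (torus e1 e2)) : nbhs (pi z) A ->
  exists2 d : R, 0 < d & forall w, nm (w - z) < d -> A (pi w).
Proof. by move=> h; have /nbhsCP := @pi_cont z A h. Qed.

Lemma pi_open z (d : R) : 0 < d -> nbhs (pi z) (pi @` [set w | nm (w - z) < d]).
Proof.
move=> d0; apply: open_nbhs_nbhs; split; last by exists z => //=; rewrite subrr nm0.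
change (open (pi @^-1` (pi @` [set w | nm (w - z) < d]))).
rewrite openE => w [w' w'd /torus_piP ww']; apply/nbhsCP.
exists (d - nm (w' - z)); first by rewrite subr_gt0.
move=> v vw; exists (v + (w' - w)) => /=; last exact: pi_shift.
have -> : v + (w' - w) - z = (v - w) + (w' - z) by ring.
by apply: le_lt_trans (nmD _ _) _; move: vw; rewrite ltrBrDr.
Qed.

(** The lattice is discrete. *)
Lemma pi_inj_local : exists2 d : R, 0 < d & forall z w, pi z = pi w -> nm (z - w) < d -> z = w.
Proof.
have [d d0 hd] := lattice_discrete e_gen; exists d => // z w /torus_piP zw zwd.
by apply/eqP; rewrite -subr_eq0; apply/eqP; exact: hd.
Qed.

(** Points not congruent modulo the lattice are at positive distance from each
    other's translates. *)
Lemma torus_hausdorff : hausdorff_space (torus e1 e2).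
Proof.
move=> a b cl; apply: contrapT => ab.
rewrite -(pi_repr a) -(pi_repr b) in ab cl; set x := repr a in ab cl; set y := repr b in ab cl.
have xy : ~ lattice (x - y) by move=> h; apply: ab; apply/torus_piP.
have [d d0 hd] := nonlattice_open e_gen xy.
have d20 : 0 < d / 2 by lra.
have [c [[u ux <-] [v vy /torus_piP uv]]] := cl _ _ (pi_open x d20) (pi_open y d20).
have vu : lattice (u - v) by rewrite -opprB; exact: latticeN.
apply: (hd (u - v)) vu; have -> : u - v - (x - y) = (u - x) - (v - y) by ring.
by apply: le_lt_trans (nmBD _ _) _; move: ux vy => /=; lra.
Qed.

Lemma pi_cell a : exists2 alpha, cell e1 e2 alpha & pi alpha = a.
Proof.
have [m [n [c _]]] := cell_reduce e_gen (repr a); exists (repr a - latt e1 e2 m n) => //.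
rewrite -[RHS]pi_repr; apply: pi_shift; apply: latticeN; by exists m, n.
Qed.

End TorusTopology.

(** * The completed curve and its projection *)

Section GeneralTopology.

Lemma compact_relatively_closed (T : topologicalType) (K Z : set T) : compact K ->
  (forall x, K x -> ~ Z x -> nbhs x (~` Z)) -> compact (K `&` Z).
Proof.
move=> cK cZ F FF FKZ; have FK : F K by apply: filterS FKZ => x [].
have [x [Kx cl]] := cK F FF FK; exists x; split=> //; split=> //.
apply: contrapT => nZ; have [y [[_ Zy] /= nZy]] := cl _ _ FKZ (cZ x Kx nZ).
exact: nZy.
Qed.

Lemma continuous_within (S T : topologicalType) (A : set S) (f : S -> T) :
  {within A, continuous f} <-> forall x, A x -> forall V, nbhs (f x) V ->
     nbhs x (fun y => A y -> V (f y)).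
Proof.
split=> [/subspace_continuousP h x Ax V Vx|h].
  exact: (h x Ax V Vx).
by apply/subspace_continuousP => x Ax V Vx; exact: h.
Qed.

(** The inverse of an open injective map is continuous. All the homeomorphism
    claims about the projection reduce to this. *)
Lemma open_injective_homeo (S T : topologicalType) (f : S -> T) (V : set S) (x0 : S) : open V ->
  continuous f -> (forall x A, nbhs x A -> nbhs (f x) (f @` A)) ->
  (forall x y, V x -> V y -> f x = f y -> x = y) ->
  open (f @` V) /\ homeomorphism_on V (f @` V) f.
Proof.
move=> oV cf of_ inj; split.
  rewrite openE => _ [x Vx <-]; apply: of_; exact: open_nbhs_nbhs.
split; [split|exact: continuous_subspaceT|].
- by move=> x Vx; exists x.
- by move=> x y /set_mem Vx /set_mem Vy; exact: inj.
- by [].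
pose g y := xget x0 [set x | V x /\ f x = y].
have gK x : V x -> g (f x) = x.
  move=> Vx; have [gV gf] : [set x' | V x' /\ f x' = f x] (g (f x)) by apply: xgetPex; exists x.
  exact: inj.
exists g; split=> //; apply/continuous_within => _ [x Vx <-] A; rewrite gK // => Ax.
have AV : nbhs x (A `&` V) by apply: filterI => //; exact: open_nbhs_nbhs.
apply: filterS (of_ _ _ AV) => _ [x' [Ax' Vx'] <-] _; by rewrite gK.
Qed.

End GeneralTopology.

Section CompletedCurve.
Variables (R : realType) (e1 e2 eta1 eta2 : R[i]) (N : nat) (p : 'I_N -> R[i]).
Hypothesis N_gt0 : (0 < N)%N.
Hypothesis e_gen : lattice_generators e1 e2.
Hypothesis qp : quasi_periods e1 e2 eta1 eta2.
Hypothesis p_inj : injective (fun j => torus_pi e1 e2 (p j)).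
Local Notation C := R[i].
Implicit Types (z w x nu mu alpha : C) (b : C * C).
Local Notation lattice := (lattice e1 e2).
Local Notation latt := (latt e1 e2).
Local Notation zeta := (weierstrass_zeta e1 e2).
Local Notation Fdet := (Fdet e1 e2 p).
Local Notation nus := (nus e1 e2 p).
Local Notation Psi := (Psi e1 e2 eta1 eta2).
Local Notation eta := (eta eta1 eta2).
Local Notation S := (solution_factors e1 e2 p).
Local Notation pi := (torus_pi e1 e2).
Local Notation ST0 := {b : C * C | `[< S b >]}.
Local Notation ST := (initial_topology (fun s : ST0 => (val s : C * C))).
Local Notation G := (one_point_compactification ST).

(** The values of alpha at which F is defined and continuous. Every class
    modulo the lattice has such a representative. *)
Definition regular_point alpha := ~ lattice alpha \/ alpha = 0.

Lemma factors_neq0 b : S b -> b.1 != 0 /\ b.2 != 0.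
Proof. by move=> [psi /(solution_withP p e_gen)[]]. Qed.

Lemma S_Fdet nu alpha : regular_point alpha -> S (Psi nu alpha) <-> Fdet nu alpha = 0.
Proof. exact: solution_factorsP. Qed.

(** The point of the completed curve with given multipliers. *)
Definition toG b : G := (insub b : option ST0).
(** The value at the puncture is arbitrary. *)
Definition multG (x : G) : C * C := if x is Some s then val s else (0, 0).
Definition lift b : C * C := xget (0, 0) [set t | Psi t.1 t.2 = b].
(** The class of alpha does not depend on the choice of the lift, by
    [Psi_fibre]. The puncture lies above 0. *)
Definition prjG (x : G) : torus e1 e2 := if x is Some s then pi (lift (val s)).2 else pi 0.
(** Points of the curve in the coordinates (nu, alpha). *)
Definition PG nu alpha : G := toG (Psi nu alpha).

Lemma liftP b : b.1 != 0 -> b.2 != 0 -> Psi (lift b).1 (lift b).2 = b.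
Proof.
move=> b1 b2; have [nu [alpha E]] := Psi_surj qp b1 b2.
by apply: (@xgetPex _ (0, 0) [set t | Psi t.1 t.2 = b]); exists (nu, alpha).
Qed.

Lemma toG_some b : S b -> exists2 s : ST0, toG b = Some s & val s = b.
Proof. by move=> Sb; rewrite /toG; case: insubP => [s _ sb|/negP[]]; [exists s|exact/asboolP]. Qed.

Lemma multG_toG b : S b -> multG (toG b) = b.
Proof. by move=> /toG_some[s -> sb]. Qed.

Lemma toG_val (s : ST0) : toG (val s) = Some s.
Proof. by rewrite /toG valK. Qed.

Lemma S_val (s : ST0) : S (val s).
Proof. exact/asboolP/(valP s). Qed.

Lemma toG_neq b : S b -> toG b <> None.
Proof. by move=> /toG_some[s -> _]. Qed.

Lemma prjG_Psi nu alpha : S (Psi nu alpha) -> prjG (PG nu alpha) = pi alpha.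
Proof.
move=> Sb; have [s E sb] := toG_some Sb; rewrite /PG E /= sb.
have [b1 b2] := factors_neq0 Sb; have := liftP b1 b2.
move: (lift _) => t; move/(Psi_fibre qp) => [m [n [_ ->]]]; apply/esym; apply: pi_shift; by exists m, n.
Qed.

Lemma G_rep (x : G) : x = None \/ exists nu alpha, [/\ cell e1 e2 alpha, regular_point alpha,
  Fdet nu alpha = 0, S (Psi nu alpha) & x = PG nu alpha].
Proof.
case: x => [s|]; last by left.
right; have Sb := S_val s; have [b1 b2] := factors_neq0 Sb.
have [nu [alpha [E c U]]] := Psi_rep e_gen qp b1 b2; exists nu, alpha.
by split=> //; [apply/S_Fdet => //; rewrite E|rewrite E|rewrite /PG E toG_val].
Qed.

Lemma nbhsST (s : ST) (B : set ST) : nbhs s B <->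
  exists2 d : R, 0 < d & forall s' : ST0, nm ((val s').1 - (val s).1) < d -> nm ((val s').2 - (val s).2) < d -> B s'.
Proof.
split=> [|[d d0 h]].
  rewrite nbhsE => -[U [[B0 oB OU] Us] UB].
  have : nbhs (val s) B0 by apply: open_nbhs_nbhs; split=> //; move: Us; rewrite -OU.
  rewrite [val s]surjective_pairing => /nbhsC2P[d d0 hd]; exists d => // s' h1 h2.
  by apply: UB; rewrite -OU /=; have := hd (val s').1 (val s').2 h1 h2; rewrite -surjective_pairing.
have c := @initial_continuous _ _ (fun s : ST0 => (val s : C * C)) s.
pose O : set (C * C) := [set t | nm (t.1 - (val s).1) < d /\ nm (t.2 - (val s).2) < d].
have nO : nbhs (val s) O.
  rewrite [X in nbhs X]surjective_pairing; apply/nbhsC2P; exists d => // x y xd yd; by split.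
have cO : nbhs s ((fun s : ST => (val s : C * C)) @^-1` O) by exact: c.
by apply: filterS cO => s' [h1 h2]; exact: h.
Qed.

Lemma nbhsG_toG b (A : set G) : S b -> nbhs (toG b) A <->
  exists2 d : R, 0 < d & forall b', S b' -> nm (b'.1 - b.1) < d -> nm (b'.2 - b.2) < d -> A (toG b').
Proof.
move=> Sb; have [s E sb] := toG_some Sb; rewrite E.
have -> : nbhs (Some s : G) A = nbhs (s : ST) (fun s' => A (Some s')) by [].
split=> [/nbhsST[d d0 h]|[d d0 h]].
  exists d => // b' Sb' h1 h2; have [s' E' sb'] := toG_some Sb'; rewrite E'.
  by apply: h; rewrite sb' sb.
apply/nbhsST; exists d => // s' h1 h2; rewrite -toG_val; apply: h; rewrite -?sb //; exact: S_val.
Qed.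

(** Since [Psi] is continuous and open, the coordinates (nu, alpha) describe
    the topology of the curve. *)
Lemma nbhsG_PG nu0 alpha0 (A : set G) : S (Psi nu0 alpha0) -> nbhs (PG nu0 alpha0) A <->
  exists2 d : R, 0 < d & forall nu alpha, S (Psi nu alpha) -> nm (nu - nu0) < d ->
    nm (alpha - alpha0) < d -> A (PG nu alpha).
Proof.
move=> Sb; split=> [/(nbhsG_toG _ Sb)[d d0 h]|[d d0 h]].
  have [d' d'0 h'] := Psi_near e1 e2 eta1 eta2 nu0 alpha0 d0; exists d' => // nu alpha Sb' h1 h2.
  by have [k1 k2] := h' nu alpha h1 h2; exact: h.
apply/(nbhsG_toG _ Sb); have [d' d'0 h'] := Psi_open qp nu0 alpha0 d0; exists d' => // b' Sb' h1 h2.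
by have [nu [alpha [k1 k2 E]]] := h' b' h1 h2; rewrite -E; apply: h; rewrite // E.
Qed.

Lemma hausdorffST : hausdorff_space ST.
Proof.
move=> s t cl; apply: contrapT => st.
have vst : val s <> val t by move=> h; apply: st; exact: val_inj.
have [d d0 hd] : exists2 d : R, 0 < d & d <= nm ((val s).1 - (val t).1) \/ d <= nm ((val s).2 - (val t).2).
  have [h1|h1] := eqVneq (val s).1 (val t).1.
    have h2 : (val s).2 - (val t).2 != 0.
      rewrite subr_eq0; apply/eqP => h2; apply: vst.
      by rewrite [val s]surjective_pairing [val t]surjective_pairing h1 h2.
    by exists (nm ((val s).2 - (val t).2)); [rewrite nm_gt0|right].
  by exists (nm ((val s).1 - (val t).1)); [rewrite nm_gt0 subr_eq0|left].
have d20 : 0 < d / 2 by lra.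
pose B (u : ST) : set ST := [set v : ST | nm ((val v).1 - (val u).1) < d / 2 /\ nm ((val v).2 - (val u).2) < d / 2].
have nB u : nbhs u (B u) by apply/nbhsST; exists (d / 2).
have [v [[a1 a2] [b1 b2]]] := cl _ _ (nB s) (nB t).
have tri (x y z : C) : nm (z - x) < d / 2 -> nm (z - y) < d / 2 -> nm (x - y) < d.
  move=> h1 h2; have -> : x - y = (z - y) - (z - x) by ring.
  by apply: le_lt_trans (nmBD _ _) _; lra.
have := tri _ _ _ a1 b1; have := tri _ _ _ a2 b2; case: hd; lra.
Qed.

(** Compactness of a subset of the curve can be tested in the space of
    multipliers. *)
Lemma compactST (W : set (C * C)) : compact W -> W `<=` S -> compact [set s : ST | W (val s)].
Proof.
move=> cW WS F FF FW.
have FW' : fmap (fun s : ST => (val s : C * C)) F W by exact: FW.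
have [b [Wb cl]] := cW _ (fmap_proper_filter (fun s : ST => (val s : C * C)) FF) FW'.
have [s E sb] := toG_some (WS _ Wb); exists s; split; first by rewrite /= sb.
move=> A B FA /nbhsST[d d0 hd].
have FA' : fmap (fun s : ST => (val s : C * C)) F ((fun s : ST => (val s : C * C)) @` A).
  have sub : A `<=` (fun s : ST => (val s : C * C)) @^-1` ((fun s : ST => (val s : C * C)) @` A).
    by move=> t At; exists t.
  exact: filterS sub FA.
pose O : set (C * C) := [set t | nm (t.1 - b.1) < d /\ nm (t.2 - b.2) < d].
have nO : nbhs b O.
  rewrite [X in nbhs X]surjective_pairing; apply/nbhsC2P; exists d => // x y xd yd; by split.
have [_ [[t At <-] [h1 h2]]] := cl _ _ FA' nO.
by exists t; split=> //; apply: hd; rewrite sb.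
Qed.

Definition root_set (A : set C) (M : R) : set (C * C) :=
  (fun t : C * C => Psi t.1 t.2) @` [set t : C * C | [/\ nm t.1 <= M, A t.2 & Fdet t.1 t.2 = 0]].

Lemma root_set_compact A M : compact A -> (forall alpha, A alpha -> regular_point alpha) ->
  compact (root_set A M).
Proof.
move=> cA AU.
have c0 : compact [set t : C * C | [/\ nm t.1 <= M, A t.2 & Fdet t.1 t.2 = 0]].
  have cM : compact [set z : C | nm z <= M].
    by have := @cball_compact R 0 M; rewrite (_ : [set z : C | nm (z - 0) <= M] = [set z | nm z <= M]) //;
      apply/seteqP; split=> z /=; rewrite subr0.
  have -> : [set t : C * C | [/\ nm t.1 <= M, A t.2 & Fdet t.1 t.2 = 0]] =
    ([set z : C | nm z <= M] `*` A) `&` [set t | Fdet t.1 t.2 = 0].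
    by apply/seteqP; split=> t /=; [move=> [h1 h2 h3]|move=> [[h1 h2] h3]].
  apply: compact_relatively_closed; first exact: compact_setX.
  move=> [nu alpha] [_ Aa] /= /eqP F0; have F0' : 0 < nm (Fdet nu alpha) by rewrite nm_gt0.
  have [d d0 hd] := (cont2P _ _ _).1 (Fdet_cont e_gen p_inj (nu0 := nu) (AU _ Aa)) _ F0'.
  apply/nbhsC2P; exists d => // x y xd yd /= h; have := hd x y xd yd.
  by rewrite /= h sub0r nmN ltxx.
apply: continuous_compact c0; apply: continuous_subspaceT => -[nu alpha] B.
rewrite [X in nbhs X]surjective_pairing => /nbhsC2P[d d0 hd].
have [d' d'0 hd'] := Psi_near e1 e2 eta1 eta2 nu alpha d0.
apply/nbhsC2P; exists d' => // x y xd yd; have [k1 k2] := hd' x y xd yd.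
by have := hd _ _ k1 k2; rewrite -surjective_pairing.
Qed.

Lemma root_set_sub A M : (forall alpha, A alpha -> regular_point alpha) -> root_set A M `<=` S.
Proof. by move=> AU _ [[nu alpha] /= [_ Aa F0] <-]; apply/S_Fdet => //; exact: AU. Qed.

(** The complement of a compact subset of the curve is a neighbourhood of the
    puncture. *)
Lemma nbhsG_None (W : set (C * C)) (A : set G) : compact W -> W `<=` S -> A None ->
  (forall b, S b -> ~ W b -> A (toG b)) -> nbhs (None : G) A.
Proof.
move=> cW WS A0 h; have cW' := compactST cW WS.
exists [set s : ST | W (val s)]; first by split=> //; exact: compact_closed hausdorffST cW'.
move=> x [[s /= nW <-]|->] //; rewrite -toG_val; apply: h => //; exact: S_val.
Qed.

(** Conversely, a neighbourhood of the puncture contains all points none of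
    whose coordinates (nu, alpha) are bounded by some M: a compact set is
    covered by the images of finitely many bounded sets. *)
Lemma nbhsG_None_inv (A : set G) : nbhs (None : G) A -> A None /\ exists2 M : R, 0 < M &
  forall nu alpha, S (Psi nu alpha) ->
    (forall nu' alpha', Psi nu' alpha' = Psi nu alpha -> nm nu' <= M -> nm alpha' <= M -> False) ->
    A (PG nu alpha).
Proof.
move=> [W [cW _] WA]; split; first by apply: WA; right.
have : \forall M \near +oo, W `<=` (fun s : ST => exists nu alpha,
   [/\ nm nu <= M, nm alpha <= M & Psi nu alpha = val s]).
  move/compact_near_coveringP: cW; apply=> s Ws.
  have [b1 b2] := factors_neq0 (S_val s); have [nu [alpha E]] := Psi_surj qp b1 b2.
  have [d d0 hd] := Psi_open qp nu alpha (ltr01 (R:=R)); rewrite E in hd.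
  exists ([set s' : ST | nm ((val s').1 - (val s).1) < d /\ nm ((val s').2 - (val s).2) < d],
    [set M | nm nu + nm alpha + 1 <= M]) => /=.
    by split; [apply/nbhsST; exists d|exact: nbhs_pinfty_ge (num_real _)].
  move=> [s' M] /= [[h1 h2] MM]; have [nu' [alpha' [k1 k2 E']]] := hd _ h1 h2.
  have n1 := nm_ge0 nu; have n2 := nm_ge0 alpha.
  by exists nu', alpha'; split=> //; [have := nm_le_sub nu' nu|have := nm_le_sub alpha' alpha]; lra.
move=> H; have H0 : \forall M \near +oo, (0 : R) < M by exact: nbhs_pinfty_gt (num_real _).
have [M [h1 h2]] := filter_ex (filterI H H0).
exists M => // nu alpha Sb H1; have [s E sb] := toG_some Sb.
rewrite /PG E; apply: WA; left; exists s => // /h1[nu' [alpha' [k1 k2 E']]].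
by apply: (H1 nu' alpha') => //; rewrite E' sb.
Qed.

(** A closed ball of regular alpha together with bounded nu has a compact
    image, which is a neighbourhood by openness of [Psi]. *)
Lemma locally_compactST : locally_compact [set: ST].
Proof.
move=> s _; rewrite withinET.
have [[]|[nu [alpha [_ aU F0 Sb E]]]] := G_rep (Some s) => //.
have sE : val s = Psi nu alpha.
  by have := congr1 multG E; rewrite /= /PG multG_toG.
have [r r0 hr] : exists2 r : R, 0 < r & forall w, nm (w - alpha) <= r -> regular_point w.
  case: aU => [al|->].
    have [d d0 hd] := nonlattice_open e_gen al; exists (d / 2); first lra.
    by move=> w wd; left; apply: hd; lra.
  have [d d0 hd] := nonlattice_punctured e_gen; exists (d / 2); first lra.
  move=> w; rewrite subr0 => wd; have [->|w0] := eqVneq w 0; first by right.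
  by left; apply: hd; rewrite nm_gt0 w0; lra.
pose K := root_set [set w | nm (w - alpha) <= r] (nm nu + 1).
have cK : compact K by apply: root_set_compact => //; exact: cball_compact.
have KS : K `<=` S by exact: root_set_sub.
have cK' := compactST cK KS.
exists [set s : ST | K (val s)]; last by split=> //; exact: compact_closed hausdorffST cK'.
have e0 : 0 < Num.min 1 r by rewrite lt_min ltr01.
have [d d0 hd] := Psi_open qp nu alpha e0; apply/nbhsST; exists d => // s' h1 h2.
rewrite sE in h1 h2; have [nu' [alpha' [k1 k2 E']]] := hd _ h1 h2.
move: k1 k2; rewrite !lt_min => /andP[k1 _] /andP[_ k2].
exists (nu', alpha') => //=; split; [by have := nm_le_sub nu' nu; lra|exact: ltW|].
by apply/S_Fdet; [exact/hr/ltW|rewrite E'; exact: S_val].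
Qed.

Lemma G_compact : compact [set: G].
Proof. exact: one_point_compactification_compact. Qed.

Lemma G_hausdorff : hausdorff_space G.
Proof. exact: one_point_compactification_hausdorff locally_compactST hausdorffST. Qed.

Lemma roots_bounded (A : set C) : compact A -> (forall alpha, A alpha -> ~ lattice alpha) ->
  exists2 M : R, 0 < M & forall nu alpha, A alpha -> Fdet nu alpha = 0 -> nm nu <= M.
Proof.
move=> cA Al.
have : \forall M \near +oo, A `<=` (fun alpha => forall nu, Fdet nu alpha = 0 -> nm nu <= M).
  move/compact_near_coveringP: cA; apply=> alpha0 Aa0.
  have [d [M [d0 M0 h]]] := roots_locally_bounded N_gt0 e_gen p_inj (Al _ Aa0).
  exists ([set w | nm (w - alpha0) < d], [set M' | M <= M']) => /=.
    by split; [apply/nbhsCP; exists d|exact: nbhs_pinfty_ge (num_real _)].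
  move=> [w M'] /= [/h[wl hw] MM] nu /(Fdet_root p e_gen nu wl) nw.
  by apply: le_trans MM; exact: hw.
move=> H; have H0 : \forall M \near +oo, (0 : R) < M by exact: nbhs_pinfty_gt (num_real _).
have [M [h1 h2]] := filter_ex (filterI H H0).
by exists M => // nu alpha Aa; exact: h1.
Qed.

Lemma annulus_compact (e : R) : compact (cell e1 e2 `&` [set w | e <= nm w]).
Proof.
apply: compact_relatively_closed; first exact: cell_compact.
move=> x _ /negP; rewrite -ltNge => xe; apply/nbhsCP; exists (e - nm x); first by rewrite subr_gt0.
by move=> w wx /=; apply/negP; rewrite -ltNge; have := nm_le_sub w x; lra.
Qed.

Lemma annulus_nonlattice (e : R) alpha : 0 < e -> cell e1 e2 alpha -> e <= nm alpha -> ~ lattice alpha.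
Proof. by move=> e0 c h /(cell_lattice e_gen c) a0; rewrite a0 nm0 in h; lra. Qed.

(** At the puncture: the points above alpha with |alpha| at least e in the
    period parallelogram form a compact set, so outside it alpha is small. *)
Lemma prjG_cont : continuous prjG.
Proof.
move=> x A; have [->|[nu [alpha [_ _ _ Sb ->]]]] := G_rep x.
  move=> /pi_near[e e0 he].
  have [M M0 hM] := roots_bounded (@annulus_compact e) (fun alpha h => annulus_nonlattice e0 h.1 h.2).
  have AU alpha : (cell e1 e2 `&` [set w | e <= nm w]) alpha -> regular_point alpha.
    by move=> h; left; exact: annulus_nonlattice e0 h.1 h.2.
  apply: (nbhsG_None (W := root_set (cell e1 e2 `&` [set w | e <= nm w]) M)).
  - by apply: root_set_compact => //; exact: annulus_compact.
  - exact: root_set_sub.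
  - by rewrite /= /preimage /=; apply: he; rewrite subrr nm0.
  move=> b Sb nW; have [|[nu [alpha [c aU F0 Sb' E]]]] := G_rep (toG b); first by move/(toG_neq Sb).
  rewrite /preimage /= E prjG_Psi //; apply: he; rewrite subr0 ltNge; apply/negP => ea; apply: nW.
  exists (nu, alpha); last by rewrite /= -(multG_toG Sb') -/(PG nu alpha) -E multG_toG.
  by split=> //=; exact: (hM nu alpha (conj c ea) F0).
rewrite prjG_Psi // => /pi_near[e e0 he]; apply/(nbhsG_PG _ Sb); exists e => // nu' alpha' Sb' _ ad.
by rewrite /preimage /= prjG_Psi //; exact: he.
Qed.

Lemma eta_latt_bound (M : R) : 0 <= M -> exists2 B : R, 0 < B & forall m n, nm (latt m n) <= M -> nm (eta m n) <= B.
Proof.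
move=> M0; pose L := 2 * lbound e1 e2; have L0 : 0 <= L by rewrite mulr_ge0 ?lbound_ge0.
pose K := nm eta1 + nm eta2; have K0 : 0 <= K by rewrite addr_ge0 // nm_ge0.
exists ((L * M + L * M) * K + 1).
  by rewrite ltr_wpDl // mulr_ge0 // addr_ge0 // mulr_ge0.
move=> m n lM; have [k1 k2] := crd_le e_gen (latt m n); have [c1 c2] := crd_latt e_gen m n.
rewrite c1 -/L in k1; rewrite c2 -/L in k2.
apply: le_trans (eta_bound eta1 eta2 m n) _.
have LM : L * nm (latt m n) <= L * M by rewrite ler_wpM2l.
apply: (@le_trans _ _ ((L * M + L * M) * K)); last by rewrite lerDl.
by rewrite /K ler_wpM2r //; lra.
Qed.

(** At a finite point this is the persistence of roots. At the puncture it
    says that above every small alpha there is a point near the puncture,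
    which is the unbounded root. *)
Lemma prjG_open (x : G) (A : set G) : nbhs x A -> nbhs (prjG x) (prjG @` A).
Proof.
have [->|[nu0 [alpha0 [_ aU F0 Sb ->]]]] := G_rep x.
  move=> /nbhsG_None_inv[A0 [M M0 hM]]; rewrite /=.
  have M1 : 0 <= M + 1 by lra.
  have [B B0 hB] := eta_latt_bound M1.
  (* B bounds the quasi-periods of the deck transformations that keep alpha
     bounded, so a root beyond M + B has no representative with nu within M *)
  have [d1 d10 h1] := zeta_large e_gen (M + B); have [d2 d20 h2] := nonlattice_punctured e_gen.
  have d0 : 0 < Num.min (Num.min d1 d2) 1 by rewrite !lt_min d10 d20 ltr01.
  apply: filterS (@pi_open _ e1 e2 0 _ d0) => _ [alpha /= ad <-].
  rewrite subr0 !lt_min in ad; case/andP: ad => /andP[a1 a2] a3.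
  have [->|an] := eqVneq alpha 0; first by exists None.
  have a0 : 0 < nm alpha by rewrite nm_gt0.
  have al : ~ lattice alpha by apply: h2; rewrite a0.
  have [nu nun nuz] := big_root e1 e2 p N_gt0 alpha.
  have aU : regular_point alpha by left.
  have Sb : S (Psi nu alpha) by apply/(S_Fdet nu aU); exact/(Fdet_root p e_gen nu al).
  exists (PG nu alpha); last exact: prjG_Psi.
  apply: hM => // nu' alpha' /(Psi_fibre qp)[m [n [E1 E2]]] n1 n2.
  have zl := h1 alpha; rewrite a0 a1 in zl; have {}zl := zl isT.
  have lM : nm (latt m n) <= M + 1.
    have -> : latt m n = alpha - alpha' by rewrite E2; ring.
    by apply: le_trans (nmBD _ _) _; lra.
  have := hB m n lM; have := nmD nu' (eta m n); rewrite -E1; lra.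
move=> /(nbhsG_PG _ Sb)[d d0 hd]; rewrite prjG_Psi //.
have [d' d'0 hd'] := root_near N_gt0 e_gen p_inj aU F0 d0.
have dd : 0 < Num.min d d' by rewrite lt_min d0.
have loc : exists2 r : R, 0 < r & forall w, nm (w - alpha0) < r -> ~ lattice w \/ w = alpha0.
  case: aU => [al|->].
    by have [r r0 hr] := nonlattice_open e_gen al; exists r => // w /hr; left.
  have [r r0 hr] := nonlattice_punctured e_gen; exists r => // w; rewrite subr0 => wr.
  have [->|w0] := eqVneq w 0; first by right.
  by left; apply: hr; rewrite nm_gt0 w0.
have [r r0 hr] := loc.
have dr : 0 < Num.min (Num.min d d') r by rewrite lt_min dd.
apply: filterS (@pi_open _ e1 e2 alpha0 _ dr) => _ [alpha /= ad <-].
rewrite !lt_min in ad; case/andP: ad => /andP[a1 a2] a3.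
have [al|->] := hr _ a3; last first.
  exists (PG nu0 alpha0); last exact: prjG_Psi.
  by apply: hd => //; rewrite subrr nm0.
have [nu n1 F1] := hd' alpha al a2.
have Sb1 : S (Psi nu alpha) by apply/S_Fdet => //; left.
exists (PG nu alpha); last exact: prjG_Psi.
exact: hd.
Qed.

End CompletedCurve.

(** * The branched covering *)

Section Covering.
Variables (R : realType) (e1 e2 eta1 eta2 : R[i]) (N : nat) (p : 'I_N -> R[i]).
Hypothesis N_gt0 : (0 < N)%N.
Hypothesis e_gen : lattice_generators e1 e2.
Hypothesis qp : quasi_periods e1 e2 eta1 eta2.
Hypothesis p_inj : injective (fun j => torus_pi e1 e2 (p j)).
Local Notation C := R[i].
Implicit Types (z w nu mu alpha : C) (b : C * C).
Local Notation lattice := (lattice e1 e2).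
Local Notation latt := (latt e1 e2).
Local Notation sigma := (weierstrass_sigma e1 e2).
Local Notation zeta := (weierstrass_zeta e1 e2).
Local Notation Fdet := (Fdet e1 e2 p).
Local Notation nus := (nus e1 e2 p).
Local Notation Psi := (Psi e1 e2 eta1 eta2).
Local Notation S := (solution_factors e1 e2 p).
Local Notation pi := (torus_pi e1 e2).
Local Notation ST0 := {b : C * C | `[< S b >]}.
Local Notation ST := (initial_topology (fun s : ST0 => (val s : C * C))).
Local Notation G := (one_point_compactification ST).
Local Notation PG := (PG e1 e2 eta1 eta2 p).
Local Notation prj := (@prjG R e1 e2 eta1 eta2 N p).
Local Notation disc := (subdisc e1 e2 p N).

Let S_Fdet nu alpha : regular_point e1 e2 alpha -> S (Psi nu alpha) <-> Fdet nu alpha = 0.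
Proof. exact: S_Fdet. Qed.

Lemma perm_eq_head2 (T : eqType) (s : seq T) x y : x \in s -> y \in s -> y != x ->
  exists s', perm_eq s [:: x, y & s'].
Proof.
move=> xs ys yx; exists (rem y (rem x s)).
apply: (perm_trans (perm_to_rem xs)); rewrite perm_cons; exact: perm_to_rem (rem_mem yx ys).
Qed.

(** Were there a root at alpha = 0 beyond the bound of [one_large_root], its
    continuation and the unbounded root would be two large roots. *)
Lemma roots_bounded0 : exists2 M : R, 0 < M & forall nu, Fdet nu 0 = 0 -> nm nu <= M.
Proof.
have [d [M [d0 M0 h]]] := one_large_root N_gt0 e_gen p_inj.
exists M => // nu F0; rewrite leNgt; apply/negP => nuM.
(* with this radius the continued root stays beyond M and below the unbounded
   root *)
have r0 : 0 < nm nu - M by rewrite subr_gt0.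
have [d' d'0 h'] := root_near N_gt0 e_gen p_inj (or_intror erefl) F0 r0.
have [d1 d10 h1] := zeta_large e_gen (nm nu + (nm nu - M)).
have [d2 d20 h2] := nonlattice_punctured e_gen.
have dd : 0 < Num.min (Num.min d d') (Num.min d1 d2) by rewrite !lt_min d0 d'0 d10 d20.
have [alpha] := point_near 0 dd; rewrite subr0 !lt_min => /and3P[a0 /andP[a1 a2] /andP[a3 a4]].
have al : ~ lattice alpha by apply: h2; rewrite a0.
have [|nu' n1 F1] := h' alpha al; first by rewrite subr0.
have [x xn xz] := big_root e1 e2 p N_gt0 alpha.
have zl : nm nu + (nm nu - M) < nm (zeta alpha) by apply: h1; rewrite a0.
have t1 := nm_le_sub nu' nu; have t2 := nm_le_sub nu nu'; rewrite nmB in t2.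
have xnu : nu' != x by apply/eqP => E; move: xz; rewrite -E; lra.
have nun := (Fdet_root p e_gen nu' al).1 F1.
have [s ps] := perm_eq_head2 xn nun xnu.
by apply: (h alpha x nu' s); rewrite ?a0 //; lra.
Qed.

Lemma PG_inj nu alpha nu' alpha' : S (Psi nu alpha) -> S (Psi nu' alpha') ->
  PG nu alpha = PG nu' alpha' -> Psi nu alpha = Psi nu' alpha'.
Proof. by move=> S1 S2 E; rewrite -(multG_toG S1) -(multG_toG S2); congr multG. Qed.

Lemma root_PG nu alpha (A : set G) (d : R) : ~ lattice alpha -> Fdet nu alpha = 0 -> 0 < d ->
  (forall nu' alpha', ~ lattice alpha' -> Fdet nu' alpha' = 0 -> nm (nu' - nu) < d ->
     nm (alpha' - alpha) < d -> A (PG nu' alpha')) -> nbhs (PG nu alpha) A.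
Proof.
move=> al F0 d0 h; have aU : regular_point e1 e2 alpha by left.
apply/(nbhsG_PG qp _ ((S_Fdet nu aU).2 F0)).
have [r r0 hr] := nonlattice_open e_gen al.
exists (Num.min d r) => [|nu' alpha' Sb]; first by rewrite lt_min d0.
rewrite !lt_min => /andP[k1 _] /andP[k2 k3]; have al' := hr _ k3.
by apply: h => //; apply/S_Fdet => //; left.
Qed.

(** Above small alpha the only root beyond the bound is the unbounded one, so
    these points and the puncture form a neighbourhood on which the projection
    is injective. It is a neighbourhood because the remaining points make up a
    compact set. *)
Lemma puncture_chart : exists V : set G, [/\ open V, V None &
  forall x y, V x -> V y -> prj x = prj y -> x = y].
Proof.
have [d1 [M1 [d10 M10 h1]]] := one_large_root N_gt0 e_gen p_inj.
have [M2 M20 h2] := roots_bounded0.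
have [d3 d30 h3] := nonlattice_punctured e_gen; have [d4 d40 h4] := pi_inj_local e_gen.
pose M := M1 + M2; pose d := Num.min (Num.min d1 d3) (d4 / 2).
have d40' : 0 < d4 / 2 by lra.
have d0 : 0 < d by rewrite !lt_min d10 d30.
have dP alpha : 0 < nm alpha < d ->
    [/\ 0 < nm alpha < d1, ~ lattice alpha & nm alpha < d4 / 2].
  rewrite !lt_min => /and3P[a0 /andP[a1 a2] a3].
  by split=> //; [rewrite a0|apply: h3; rewrite a0].
have SV nu alpha : 0 < nm alpha < d -> Fdet nu alpha = 0 -> S (Psi nu alpha).
  by move=> /dP[_ al _] F0; apply/S_Fdet => //; left.
pose V : set G := [set x | x = None \/ exists nu alpha,
  [/\ 0 < nm alpha < d, M < nm nu, Fdet nu alpha = 0 & x = PG nu alpha]].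
have V0 : V None by left.
have nV (nu alpha : C) : 0 < nm alpha < d -> M < nm nu -> Fdet nu alpha = 0 -> nbhs (PG nu alpha) V.
  move=> ad nM F0; have [_ al _] := dP _ ad; case/andP: (ad) => a0 a1.
  apply: (root_PG al F0 (d := Num.min (Num.min (nm alpha) (d - nm alpha)) (nm nu - M))).
    by rewrite !lt_min a0 !subr_gt0 a1.
  move=> nu' alpha' al' F0'; rewrite !lt_min => /andP[_ k1] /andP[/andP[k2 k3] _]; right.
  exists nu', alpha'; split=> //.
    have := nm_le_sub alpha' alpha; have := nm_le_sub alpha alpha'; rewrite (nmB alpha).
    by move=> t1 t2; apply/andP; split; lra.
  by have := nm_le_sub nu nu'; rewrite nmB; lra.
have nV0 : nbhs (None : G) V.
  have d20 : 0 < d / 2 by lra.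
  have [M3 M30 h5] := roots_bounded N_gt0 e_gen p_inj (@annulus_compact _ _ _ e_gen (d / 2))
    (fun alpha h => annulus_nonlattice e_gen d20 h.1 h.2).
  pose A1 := cell e1 e2 `&` [set w | d / 2 <= nm w]; pose A2 := [set w : C | nm (w - 0) <= d / 2].
  have A1U alpha : A1 alpha -> regular_point e1 e2 alpha.
    by move=> [c h]; left; exact: (annulus_nonlattice e_gen d20 c h).
  have A2U alpha : A2 alpha -> regular_point e1 e2 alpha.
    rewrite /A2 /= subr0 => h; have [->|a0] := eqVneq alpha 0; [by right|left].
    have a1 : 0 < nm alpha < d by rewrite nm_gt0 a0; apply: le_lt_trans h _; lra.
    by have [_ al _] := dP _ a1.
  apply: (nbhsG_None (W := root_set e1 e2 eta1 eta2 p A1 M3 `|` root_set e1 e2 eta1 eta2 p A2 M)).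
  - apply: compactU.
      by apply: root_set_compact => //; exact: annulus_compact.
    by apply: root_set_compact => //; exact: cball_compact.
  - by move=> b [|]; [apply: root_set_sub|apply: root_set_sub].
  - exact: V0.
  move=> b Sb nW; have [|[nu [alpha [c aU F0 Sb' E]]]] := G_rep N_gt0 e_gen qp p_inj (toG e1 e2 p b).
    by move/(toG_neq Sb).
  have bE : b = Psi nu alpha by rewrite -(multG_toG Sb) E /PG multG_toG.
  have ad : nm alpha < d / 2.
    rewrite ltNge; apply/negP => h; apply: nW; left; exists (nu, alpha) => //=.
    by split=> //=; apply: h5 F0; split.
  have nM : M < nm nu.
    rewrite ltNge; apply/negP => h; apply: nW; right; exists (nu, alpha) => //=.
    by split=> //=; rewrite /A2 /= subr0 ltW.
  rewrite E; right; exists nu, alpha; split=> //.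
  apply/andP; split; last lra.
  rewrite nm_gt0; apply/eqP => a0; rewrite a0 in F0; have := h2 nu F0; rewrite /M in nM; lra.
exists V; split=> //.
  rewrite openE => x [->|[nu [alpha [ad nM F0 ->]]]]; first exact: nV0.
  exact: nV.
have far nu alpha : 0 < nm alpha < d -> Fdet nu alpha = 0 -> prj (PG nu alpha) <> pi 0.
  move=> ad F0; rewrite prjG_Psi //; last exact: SV.
  have [_ al a4] := dP _ ad => /h4 h; apply: al; rewrite h; first by exists 0, 0; rewrite /latt !mul0r addr0.
  by rewrite subr0; lra.
move=> _ _ [->|[nu [alpha [ad nM F0 ->]]]] [->|[nu' [alpha' [ad' nM' F0' ->]]]] //.
- by move=> h; case: (far _ _ ad' F0').
- by move=> h; case: (far _ _ ad F0).
rewrite !prjG_Psi //; try exact: SV.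
have [a1 al a4] := dP _ ad; have [a1' al' a4'] := dP _ ad'.
move=> /h4 h; have E : alpha = alpha'.
  by apply: h; apply: le_lt_trans (nmBD _ _) _; lra.
rewrite -E in F0' *; have [->//|nn] := eqVneq nu nu'.
have n1 := (Fdet_root p e_gen nu al).1 F0; have n2 := (Fdet_root p e_gen nu' al).1 F0'.
rewrite eq_sym in nn; have [s ps] := perm_eq_head2 n1 n2 nn.
rewrite /M in nM nM'; by case: (h1 alpha nu nu' s a1 ps); lra.
Qed.

(** At alpha = 0 the polynomial is not zero since its roots are bounded. *)
Lemma roots_finite alpha : regular_point e1 e2 alpha -> finite_set [set nu | Fdet nu alpha = 0].
Proof.
case=> [al|->].
  rewrite (_ : mkset _ = [set` nus alpha]); first exact: finite_seq.
  by apply/seteqP; split=> nu /(Fdet_root p e_gen nu al).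
have P0 : Fpoly e1 e2 p 0 != 0.
  apply/eqP => P0; have [M M0 h] := roots_bounded0.
  have /h : Fdet (M + 1)%:C 0 = 0 by rewrite -Fpoly_horner P0 horner0.
  by rewrite nm_real ger0_norm; lra.
have [r E] := closed_field_poly_normal (Fpoly e1 e2 p 0).
rewrite (_ : mkset _ = [set` r]); first exact: finite_seq.
have lc : lead_coef (Fpoly e1 e2 p 0) != 0 by rewrite lead_coef_eq0.
apply/seteqP; split=> nu /=; rewrite -Fpoly_horner => /eqP.
  by rewrite -/(root _ _) E rootZ // root_prod_XsubC.
by move=> h; apply/eqP; rewrite -/(root _ _) E rootZ // root_prod_XsubC; apply/eqP.
Qed.

(** A deck transformation moves any point above the class of alpha to the
    given representative. *)
Lemma PG_over (x : G) alpha : regular_point e1 e2 alpha -> prj x = pi alpha -> x <> None ->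
  exists nu, [/\ Fdet nu alpha = 0, S (Psi nu alpha) & x = PG nu alpha].
Proof.
move=> aU; have [->//|[nu [alpha' [_ _ F0 Sb ->]]]] := G_rep N_gt0 e_gen qp p_inj x.
rewrite prjG_Psi // => /torus_piP[m [n E]] _; have aE : alpha' = alpha + latt m n by rewrite -E; ring.
exists (nu - eta eta1 eta2 m n).
have PE : Psi (nu - eta eta1 eta2 m n) alpha = Psi nu alpha'.
  by rewrite -(Psi_shift qp _ _ m n) -aE subrK.
have S' : S (Psi (nu - eta eta1 eta2 m n) alpha) by rewrite PE.
by split=> //; [exact/S_Fdet|rewrite /PG PE].
Qed.

Lemma prj_fibre_finite (a : torus e1 e2) : finite_set (prj @^-1` [set a]).
Proof.
have [alpha c E] := pi_cell e_gen a.
have aU : regular_point e1 e2 alpha.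
  have [l|nl] := EM (lattice alpha); last by left.
  by right; exact: (cell_lattice e_gen c l).
apply: (@sub_finite_set _ _ ([set None] `|` (PG^~ alpha @` [set nu | Fdet nu alpha = 0]))).
  move=> x /= xa; have [->|xn] := EM (x = None); first by left.
  rewrite -E in xa; have [nu [F0 _ ->]] := PG_over aU xa xn.
  by right; exists nu.
rewrite finite_setU; split; first exact: finite_set1.
exact/finite_image/roots_finite.
Qed.

Lemma ndist_disc alpha : disc alpha != 0 <-> ndist e1 e2 p alpha = N.
Proof.
split=> [h|E]; last by have := subdisc_neq0 e1 e2 p N_gt0 alpha; rewrite E.
apply/eqP; rewrite eqn_leq ndist_le leqNgt; apply/negP => l.
by rewrite (subdisc_eq0 N_gt0 l) eqxx in h.
Qed.

(** Zero is counted in because its fibre contains the puncture. *)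
Definition branch_points : set (torus e1 e2) :=
  pi @` [set alpha | cell e1 e2 alpha /\ (lattice alpha \/ disc alpha = 0)].

(** Zeros of nonzero entire functions are isolated. *)
Lemma discriminant_isolated alpha0 : exists2 d : R, 0 < d & forall alpha,
  0 < nm (alpha - alpha0) < d -> ~ lattice alpha /\ disc alpha != 0.
Proof.
have [|d1 d10 h1] := @isolated_zeros _ sigma alpha0 (entire_sigma e_gen).
  have [d d0 h] := nonlattice_punctured e_gen; have [z] := point_near 0 d0; rewrite subr0 => zd.
  by exists z; apply: sigma_neq0 => //; exact: h.
have [d2 d20 h2] := @isolated_zeros _ disc alpha0 (@entire_subdisc _ _ _ _ _ e_gen _) (discriminant_nonzero N_gt0 e_gen qp p_inj).
exists (Num.min d1 d2); first by rewrite lt_min d10.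
move=> alpha; rewrite lt_min => /and3P[a0 a1 a2]; split; last by apply: h2; rewrite a0.
by move/(sigma_eq0 e_gen) => h; have := h1 alpha; rewrite a0 a1 h eqxx => /(_ isT).
Qed.

(** Isolated points in a compact parallelogram. *)
Lemma branch_points_finite : finite_set branch_points.
Proof.
apply: finite_image.
pose Z : set C := [set alpha | cell e1 e2 alpha /\ (lattice alpha \/ disc alpha = 0)].
have /choice[d hd] : forall a : C, exists d : R, 0 < d /\ forall alpha,
    0 < nm (alpha - a) < d -> ~ lattice alpha /\ disc alpha != 0.
  by move=> a; have [d d0 h] := discriminant_isolated a; exists d.
have := @cell_compact _ _ _ e_gen; rewrite compact_cover.
move=> /(_ C setT (fun a => [set w | nm (w - a) < d a])) [a _||D _ cov].
- rewrite openE => w /= wa; apply/nbhsCP; exists (d a - nm (w - a)); first by rewrite subr_gt0.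
  by move=> z zw /=; rewrite (_ : z - a = (z - w) + (w - a)); [have := nmD (z - w) (w - a); lra|ring].
- by move=> a _; exists a => //=; rewrite subrr nm0; exact: (hd a).1.
apply: (sub_finite_set _ (finite_fset D)) => alpha [c Za]; have [a aD /= aa] := cov alpha c; rewrite /=.
have [->//|na] := eqVneq alpha a.
have [|al ad] := (hd a).2 alpha; first by rewrite nm_gt0 subr_eq0 na.
by case: Za => // /eqP; rewrite (negPf ad).
Qed.

Lemma branch_points_disc alpha : branch_points (pi alpha) -> lattice alpha \/ disc alpha = 0.
Proof.
move=> [w [_ h] /torus_piP wa]; have [al|al] := EM (lattice alpha); [by left|right].
apply: contrapT => /eqP/ndist_disc dN.
have [wl|wl] := EM (lattice w).
  by apply: al; rewrite (_ : alpha = w - (w - alpha)); [exact: latticeB|ring].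
case: h => // /eqP; apply/negP; rewrite -/(is_true _); apply/ndist_disc.
have := ndist_periodic p e_gen qp wa al.
by rewrite dN (_ : alpha + (w - alpha) = w); last ring.
Qed.

(** The projection is open, and every open set of the torus contains a point
    that is not a branch point. *)
Lemma unbranched_dense : closure (prj @^-1` (~` branch_points)) = [set: G].
Proof.
apply/seteqP; split=> // x _ A Ax.
have := prjG_open N_gt0 e_gen qp p_inj Ax; rewrite -(pi_repr (prj x)) => /pi_near[d d0 h].
have [d' d'0 h'] := discriminant_isolated (repr (prj x)).
have dd : 0 < Num.min d d' by rewrite lt_min d0.
have [w] := point_near (repr (prj x)) dd; rewrite lt_min => /and3P[w0 w1 w2].
have [y Ay yw] := h w w1; exists y; split=> //= /[!yw] /branch_points_disc.
have [|wl wd] := h' w; first by rewrite w0.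
by case=> // /eqP; apply/negP.
Qed.

Lemma common_gap (T : eqType) (f : T -> R) (s : seq T) : exists2 r : R, 0 < r &
  forall x, x \in s -> 0 < f x -> r <= f x.
Proof.
elim: s => [|x s [r r0 h]]; first by exists 1.
have [fx|fx] := ltP 0 (f x); last first.
  by exists r => // y; rewrite inE => /orP[/eqP-> h'|]; [lra|exact: h].
exists (Num.min r (f x)); first by rewrite lt_min r0.
move=> y; rewrite inE => /orP[/eqP-> _|ys fy]; first by rewrite ge_min lexx orbT.
by rewrite ge_min h.
Qed.

Lemma roots_separated (s : seq C) : exists2 r : R, 0 < r &
  forall x y, x \in s -> y \in s -> nm (x - y) < r -> x = y.
Proof.
have [r r0 h] := common_gap (@nm R) [seq x - y | x <- s, y <- s].
exists r => // x y xs ys xy; apply: contrapT => /eqP; rewrite -subr_eq0 -nm_gt0 => n.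
have := h (x - y) (allpairs_f _ xs ys) n; lra.
Qed.

(** Continuity of simple roots: N disjoint discs about the distinct roots at
    alpha0 contain a root each above a nearby alpha, hence exactly one each,
    and there are no others. *)
Lemma roots_nearby alpha0 : ~ lattice alpha0 -> uniq (nus alpha0) ->
  exists r d : R, [/\ 0 < r, 0 < d,
   forall i j : 'I_N, nm ((nus alpha0)`_i - (nus alpha0)`_j) < 2 * r -> i = j &
   forall alpha, nm (alpha - alpha0) < d -> ~ lattice alpha /\
    exists g : 'I_N -> C, (forall i, nm (g i - (nus alpha0)`_i) < r /\ Fdet (g i) alpha = 0) /\
      forall nu, Fdet nu alpha = 0 -> exists i, nu = g i].
Proof.
move=> al0 un; have sz := size_nus e1 e2 p alpha0.
have mem (i : 'I_N) : (nus alpha0)`_i \in nus alpha0 by apply: mem_nth; rewrite sz.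
have [r2 r20 sep] := roots_separated (nus alpha0).
have r0 : 0 < r2 / 2 by lra.
have sep' (i j : 'I_N) : nm ((nus alpha0)`_i - (nus alpha0)`_j) < 2 * (r2 / 2) -> i = j.
  rewrite mulrCA divff ?mulr1 // => /(sep _ _ (mem i) (mem j)) /eqP.
  by rewrite nth_uniq ?sz // => /eqP/val_inj.
pose near_root (i : 'I_N) : set C := [set alpha | ~ lattice alpha /\
    exists nu, nm (nu - (nus alpha0)`_i) < r2 / 2 /\ Fdet nu alpha = 0].
have near_i (i : 'I_N) : nbhs alpha0 (near_root i).
  have F0 := (Fdet_root p e_gen _ al0).2 (mem i).
  have [d d0 h] := root_near N_gt0 e_gen p_inj (or_introl al0) F0 r0.
  have [d' d'0 h'] := nonlattice_open e_gen al0.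
  apply/nbhsCP; exists (Num.min d d'); first by rewrite lt_min d0.
  move=> w; rewrite lt_min => /andP[w1 w2]; have wl := h' w w2; split=> //.
  by have [nu n1 n2] := h w wl w1; exists nu.
have H : nbhs alpha0 [set alpha | forall i : 'I_N, near_root i alpha].
  exact: (@filter_forall _ _ near_root (nbhs alpha0) _ near_i).
have [d d0 hd] := (nbhsCP _ _).1 H; exists (r2 / 2), d; split=> // alpha ad.
have al : ~ lattice alpha by have [] := hd alpha ad (Ordinal N_gt0).
split=> //; have [g hg] := choice (fun i => (hd alpha ad i).2); exists g; split=> // nu F0.
have g_inj : injective g.
  move=> i j gij; apply: sep'; have [a1 _] := hg i; have [a2 _] := hg j; rewrite -gij in a2.
  rewrite (_ : _ - _ = (g i - (nus alpha0)`_j) - (g i - (nus alpha0)`_i)); last by ring.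
  by apply: le_lt_trans (nmBD _ _) _; lra.
have sub : {subset codom g <= nus alpha}.
  by move=> _ /codomP[i ->]; apply/(Fdet_root p e_gen _ al); have [] := hg i.
have uc : uniq (codom g) by rewrite map_inj_uniq ?enum_uniq.
have [|_ E] := uniq_min_size uc sub; first by rewrite size_nus size_codom card_ord.
by move: ((Fdet_root p e_gen nu al).1 F0); rewrite -E => /codomP.
Qed.

(** The sheets are the points whose nu is close to one of the N distinct
    roots. *)
Lemma unbranched_even (a : torus e1 e2) : ~ branch_points a ->
  exists2 U, open_nbhs a U & evenly_covered N prj U.
Proof.
have [alpha0 c <-] := pi_cell e_gen a => nD.
have al0 : ~ lattice alpha0 by move=> h; apply: nD; exists alpha0 => //; split=> //; left.
have D0 : disc alpha0 != 0.
  by apply/eqP => h; apply: nD; exists alpha0 => //; split=> //; right.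
have un : uniq (nus alpha0).
  by rewrite map_inj_uniq ?(subdisc_uniq N_gt0 D0) // => x y /addIr /mulIf -> //; rewrite invr_eq0 sigma_neq0.
have [r [d1 [r0 d10 sep roots]]] := roots_nearby al0 un.
have [d2 d20 inj] := Psi_inj_local e_gen qp; have [d3 d30 pinj] := pi_inj_local e_gen.
pose d := Num.min d1 (Num.min (d2 / 2) (d3 / 2)).
have d0 : 0 < d by rewrite !lt_min d10; apply/andP; split; lra.
have dP alpha alpha' : nm (alpha - alpha0) < d -> nm (alpha' - alpha0) < d ->
    [/\ nm (alpha - alpha0) < d1, nm (alpha - alpha') < d2 & nm (alpha - alpha') < d3].
  rewrite !lt_min => /and3P[a1 a2 a3] /and3P[_ b2 b3].
  have : nm (alpha - alpha') <= nm (alpha - alpha0) + nm (alpha' - alpha0).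
    by rewrite (_ : alpha - alpha' = (alpha - alpha0) - (alpha' - alpha0)); [exact: nmBD|ring].
  by split=> //; lra.
have nl alpha : nm (alpha - alpha0) < d -> ~ lattice alpha.
  by move=> h; have [/roots[]] := dP _ _ h h.
have SF nu alpha : nm (alpha - alpha0) < d -> Fdet nu alpha = 0 -> S (Psi nu alpha).
  by move=> h F0; apply/S_Fdet => //; left; exact: nl.
pose U := pi @` [set w | nm (w - alpha0) < d].
pose V (i : 'I_N) : set G := [set x | exists nu alpha, [/\ nm (alpha - alpha0) < d,
  nm (nu - (nus alpha0)`_i) < r, Fdet nu alpha = 0 & x = PG nu alpha]].
have root_in nu alpha : nm (alpha - alpha0) < d -> Fdet nu alpha = 0 ->
    exists i : 'I_N, nm (nu - (nus alpha0)`_i) < r.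
  move=> ad F0; have [a1 _ _] := dP _ _ ad ad; have [_ [g [hg gE]]] := roots alpha a1.
  by have [i ->] := gE nu F0; exists i; have [] := hg i.
have root_inj nu nu' alpha (i : 'I_N) : nm (alpha - alpha0) < d -> Fdet nu alpha = 0 -> Fdet nu' alpha = 0 ->
    nm (nu - (nus alpha0)`_i) < r -> nm (nu' - (nus alpha0)`_i) < r -> nu = nu'.
  move=> ad F0 F0'; have [a1 _ _] := dP _ _ ad ad; have [_ [g [hg gE]]] := roots alpha a1.
  have [j ->] := gE nu F0; have [k ->] := gE nu' F0'.
  have same l : nm (g l - (nus alpha0)`_i) < r -> l = i.
    move=> h; apply: sep; have [h' _] := hg l.
    rewrite (_ : _ - _ = (g l - (nus alpha0)`_i) - (g l - (nus alpha0)`_l)); last by ring.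
    by apply: le_lt_trans (nmBD _ _) _; lra.
  by move=> /same -> /same ->.
have oV i : open (V i).
  rewrite openE => _ [nu [alpha [ad nn F0 ->]]].
  apply: (root_PG (nl _ ad) F0 (d := Num.min (d - nm (alpha - alpha0)) (r - nm (nu - (nus alpha0)`_i)))).
    by rewrite lt_min !subr_gt0 ad.
  move=> nu' alpha' _ F0'; rewrite !lt_min => /andP[_ k1] /andP[k2 _]; exists nu', alpha'.
  split=> //.
    by rewrite (_ : alpha' - alpha0 = (alpha' - alpha) + (alpha - alpha0));
      [have := nmD (alpha' - alpha) (alpha - alpha0); lra|ring].
  by rewrite (_ : nu' - (nus alpha0)`_i = (nu' - nu) + (nu - (nus alpha0)`_i));
    [have := nmD (nu' - nu) (nu - (nus alpha0)`_i); lra|ring].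
have prjV i : prj @` V i = U.
  apply/seteqP; split=> [_ [_ [nu [alpha [ad nn F0 ->]]] <-]|_ [alpha ad <-]].
    by exists alpha => //; rewrite prjG_Psi //; exact: SF.
  have [a1 _ _] := dP _ _ ad ad; have [_ [g [hg gE]]] := roots alpha a1.
  have [h1 F0] := hg i; exists (PG (g i) alpha); last by rewrite prjG_Psi //; exact: SF.
  by exists (g i), alpha.
have V_inj i x y : V i x -> V i y -> prj x = prj y -> x = y.
  move=> [nu [alpha [ad nn F0 ->]]] [nu' [alpha' [ad' nn' F0' ->]]].
  rewrite !prjG_Psi //; try exact: SF.
  move=> /pinj h; have [_ _ h'] := dP _ _ ad ad'; have E' := h h'.
  by rewrite -E' in F0' *; rewrite (root_inj nu nu' alpha i).
have hom i := open_injective_homeo (None : G) (oV i) (@prjG_cont _ _ _ _ _ _ _ N_gt0 e_gen qp p_inj)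
  (@prjG_open _ _ _ _ _ _ _ N_gt0 e_gen qp p_inj) (V_inj i).
exists U.
  split; first by rewrite -(prjV (Ordinal N_gt0)); exact: (hom _).1.
  by exists alpha0 => //=; rewrite subrr nm0.
exists V; split=> //.
- apply/trivIsetP => i j _ _ ij; apply/seteqP; split=> // x.
  move=> [[nu [alpha [ad nn F0 ->]]] [nu' [alpha' [ad' nn' F0' EE]]]].
  have [_ h' _] := dP _ _ ad ad'.
  have [E1 _] := inj _ _ _ _ (PG_inj (SF _ _ ad F0) (SF _ _ ad' F0') EE) h'.
  rewrite -E1 in nn'; case/eqP: ij; apply: sep.
  rewrite (_ : _ - _ = (nu - (nus alpha0)`_j) - (nu - (nus alpha0)`_i)); last by ring.
  by apply: le_lt_trans (nmBD _ _) _; lra.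
- apply/seteqP; split=> [x [alpha ad xa]|x [i _ Vx]]; last by rewrite /= -(prjV i); exists x.
  have xn : x <> None.
    move=> xn; rewrite xn in xa; apply: (nl _ ad).
    by have /torus_piP := xa; rewrite subr0.
  have [|nu [F0 Sb ->]] := PG_over _ (esym xa) xn; first by left; exact: nl.
  have [i ni] := root_in _ _ ad F0; exists i => //; by exists nu, alpha.
- by move=> i; rewrite -(prjV i); exact: (hom i).2.
Qed.

Lemma prj_branched : branched_covering N prj.
Proof.
have cont := @prjG_cont _ _ _ _ _ _ _ N_gt0 e_gen qp p_inj.
split=> //.
- move=> K cK; apply: (@subclosed_compact _ _ [set: G]) => //; last exact: G_compact.
  by apply: (continuous_closedP _).1 => //; exact: compact_closed (torus_hausdorff e_gen) cK.
- exact: prj_fibre_finite.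
exists branch_points; split; [exact: branch_points_finite|exact: unbranched_dense|exact: unbranched_even].
Qed.

End Covering.

(** * The equation of the curve and the multipliers *)

Section Equation.
Variables (R : realType) (e1 e2 eta1 eta2 : R[i]) (N : nat) (p : 'I_N -> R[i]).
Hypothesis N_gt0 : (0 < N)%N.
Hypothesis e_gen : lattice_generators e1 e2.
Hypothesis qp : quasi_periods e1 e2 eta1 eta2.
Hypothesis p_inj : injective (fun j => torus_pi e1 e2 (p j)).
Local Notation C := R[i].
Implicit Types (z w nu mu alpha : C) (b : C * C).
Local Notation lattice := (lattice e1 e2).
Local Notation latt := (latt e1 e2).
Local Notation sigma := (weierstrass_sigma e1 e2).
Local Notation zeta := (weierstrass_zeta e1 e2).
Local Notation Phi := (Phi e1 e2).
Local Notation Fdet := (Fdet e1 e2 p).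
Local Notation Psi := (Psi e1 e2 eta1 eta2).
Local Notation S := (solution_factors e1 e2 p).
Local Notation pi := (torus_pi e1 e2).
Local Notation spmx := (spectral_mx e1 e2 p).
Local Notation ST0 := {b : C * C | `[< S b >]}.
Local Notation ST := (initial_topology (fun s : ST0 => (val s : C * C))).
Local Notation G := (one_point_compactification ST).
Local Notation PG := (PG e1 e2 eta1 eta2 p).
Local Notation prj := (@prjG R e1 e2 eta1 eta2 N p).
Local Notation mult := (@multG R e1 e2 N p).
Local Notation lift := (lift e1 e2 eta1 eta2).
Local Notation curve := (spectral_curve e1 e2 p).

Lemma S_root nu alpha : ~ lattice alpha -> S (Psi nu alpha) <-> Fdet nu alpha = 0.
Proof. by move=> al; apply: S_Fdet => //; left. Qed.

Lemma repr_nonlattice (a : torus e1 e2) : a <> pi 0 -> ~ lattice (repr a).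
Proof. by move=> a0 /pi_latt; rewrite pi_repr. Qed.

Lemma repr_pi alpha : exists m n, repr (pi alpha) = alpha + latt m n.
Proof.
have /torus_piP[m [n E]] := pi_repr (pi alpha); exists m, n.
by rewrite -E; ring.
Qed.

Lemma nonlattice_shift alpha m n : ~ lattice alpha -> ~ lattice (alpha + latt m n).
Proof. have ll : lattice (latt m n) by exists m, n.
by move=> al /(lattDr alpha ll). Qed.

(** The equation of the curve and F differ by the factor sigma(alpha), and by
    the substitution nu = mu + zeta(alpha). *)
Lemma curve_root mu (a : torus e1 e2) : curve (mu, a) <->
  a <> pi 0 /\ Fdet (mu + zeta (repr a)) (repr a) = 0.
Proof.
rewrite /spectral_curve /=; split=> -[a0 h]; split=> //; have al := repr_nonlattice a0.
  by rewrite (Fdet_gen p e_gen _ al) addrK -spectral_eqE h mulr0.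
move: h; rewrite (Fdet_gen p e_gen _ al) addrK spectral_eqE => /eqP.
by rewrite mulf_eq0 (negPf (sigma_neq0 e_gen al)) => /eqP.
Qed.

(** The inclusion of the curve, through the chosen representative of the class
    of alpha. *)
Definition iota (x : C * torus e1 e2) : G := PG (x.1 + zeta (repr x.2)) (repr x.2).

(** The choice of the representative does not matter: the quasi-period of zeta
    is absorbed by a deck transformation. *)
Lemma iota_pi mu alpha : ~ lattice alpha -> iota (mu, pi alpha) = PG (mu + zeta alpha) alpha.
Proof.
move=> al; have [m [n E]] := repr_pi alpha; rewrite /iota /= E (zeta_shift e_gen qp m n al) addrA.
by rewrite /PG (Psi_shift qp).
Qed.

Lemma iota_S x : curve x -> S (Psi (x.1 + zeta (repr x.2)) (repr x.2)).
Proof. by case: x => mu a /curve_root[a0 F0]; apply/S_root => //; exact: repr_nonlattice. Qed.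

Lemma prj_iota x : curve x -> prj (iota x) = x.2.
Proof. by move=> /iota_S Sx; rewrite /iota prjG_Psi // pi_repr. Qed.

Lemma PG_over_regular (x : G) : prj x <> pi 0 -> exists nu alpha,
  [/\ ~ lattice alpha, Fdet nu alpha = 0, S (Psi nu alpha) & x = PG nu alpha].
Proof.
have [->//|[nu [alpha [_ aU F0 Sb ->]]]] := G_rep N_gt0 e_gen qp p_inj x.
rewrite prjG_Psi // => a0; exists nu, alpha; split=> //.
by move=> h; apply: a0; apply/pi_latt.
Qed.

Lemma curve_pi mu alpha : ~ lattice alpha -> curve (mu, pi alpha) <-> Fdet (mu + zeta alpha) alpha = 0.
Proof.
move=> al; have [m [n E]] := repr_pi alpha.
have al' : ~ lattice (repr (pi alpha)) by rewrite E; exact: nonlattice_shift.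
have PE : Psi (mu + zeta (repr (pi alpha))) (repr (pi alpha)) = Psi (mu + zeta alpha) alpha.
  by rewrite E (zeta_shift e_gen qp m n al) addrA (Psi_shift qp).
split=> [/curve_root[_ /(S_root _ al')]|/(S_root _ al)]; first by rewrite PE => /S_root; exact.
by rewrite -PE => /(S_root _ al') F0; apply/curve_root; split=> // /pi_latt.
Qed.

(** The inverse of [iota], through a chosen lift. *)
Definition coiota (x : G) : C * torus e1 e2 :=
  let t := lift (mult x) in (t.1 - zeta t.2, pi t.2).

Lemma coiota_PG nu alpha : ~ lattice alpha -> S (Psi nu alpha) ->
  coiota (PG nu alpha) = (nu - zeta alpha, pi alpha).
Proof.
move=> al Sb; rewrite /coiota multG_toG //; have [b1 b2] := factors_neq0 e_gen Sb.
have := liftP qp b1 b2; move: (lift _) => t /esym/(Psi_fibre qp)[m [n [E1 E2]]].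
rewrite E1 E2 (zeta_shift e_gen qp m n al) pi_shift; last by exists m, n.
by congr pair; ring.
Qed.

Lemma zeta_near alpha (d : R) : ~ lattice alpha -> 0 < d -> exists2 d', 0 < d' & forall w,
  nm (w - alpha) < d' -> ~ lattice w /\ nm (zeta w - zeta alpha) < d.
Proof.
move=> al d0; have c := dC_cont (dC_zeta e_gen al).
have [d1 d10 h1] := (contCP _ _).1 c d d0; have [d2 d20 h2] := nonlattice_open e_gen al.
exists (Num.min d1 d2); first by rewrite lt_min d10.
by move=> w; rewrite lt_min => /andP[w1 w2]; split; [exact: h2|exact: h1].
Qed.

(** Both directions are continuous because zeta is continuous off the lattice,
    and because the coordinates (nu, alpha) describe the topology of the
    curve. *)
Lemma iota_homeomorphism :
  homeomorphism_on curve (prj @^-1` [set a | a <> pi 0]) iota.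
Proof.
split.
- split.
  + by move=> [mu a] cx; rewrite /= prj_iota //; case/curve_root: cx.
  + move=> [mu a] [mu' a'] /set_mem cx /set_mem cx' E.
    have aa : a = a' by rewrite -[a](prj_iota cx) E prj_iota.
    rewrite -aa in cx' E *; have := PG_inj (iota_S cx) (iota_S cx') E; move: (repr a) => r /= EE.
    have [d d0 inj] := Psi_inj_local e_gen qp.
    have [|/addIr -> //] := inj _ _ _ _ EE; by rewrite subrr nm0.
  + move=> x /= /PG_over_regular[nu [alpha [al F0 Sb ->]]].
    exists (nu - zeta alpha, pi alpha); last by rewrite iota_pi // subrK.
    by apply/curve_pi => //; rewrite subrK.
- apply/continuous_within => -[mu a] cx V /=.
  have [a0 F0] := (curve_root mu a).1 cx; have al := repr_nonlattice a0.
  move=> /(nbhsG_PG qp _ (iota_S cx))[d d0 hd]; rewrite /= in hd.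
  have d20 : 0 < d / 2 by lra.
  have [d' d'0 hz] := zeta_near al d20.
  have dd : 0 < Num.min d d' by rewrite lt_min d0.
  exists ([set w | nm (w - mu) < d / 2], pi @` [set w | nm (w - repr a) < Num.min d d']).
    split=> /=; first by apply/nbhsCP; exists (d / 2).
    by rewrite -{1}(pi_repr a); exact: pi_open.
  move=> [mu' a'] /= [mm [alpha ad <-]] cx'.
  rewrite /= lt_min in ad; case/andP: ad => ad1 ad2; have [al' zz] := hz _ ad2.
  rewrite iota_pi //; apply: hd => //; first by apply/S_root => //; exact/curve_pi.
  rewrite (_ : _ - _ = (mu' - mu) + (zeta alpha - zeta (repr a))); last by ring.
  by apply: le_lt_trans (nmD _ _) _; lra.
exists coiota; split; last first.
  move=> [mu a] cx; rewrite /iota /= coiota_PG ?addrK ?pi_repr //.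
    by apply: repr_nonlattice; case/curve_root: cx.
  exact: (iota_S cx).
apply/continuous_within => x /PG_over_regular[nu [alpha [al F0 Sb ->]]] V.
rewrite coiota_PG // => -[[A B] /= [/nbhsCP[d d0 hA] /pi_near[d' d'0 hB]] AB].
have d20 : 0 < d / 2 by lra.
have [d2 d2_gt0 hz] := zeta_near al d20.
apply/(nbhsG_PG qp _ Sb); exists (Num.min (d / 2) (Num.min d' d2)); first by rewrite !lt_min d20 d'0.
move=> nu' alpha' Sb'; rewrite !lt_min => /andP[n1 _] /and3P[_ a1 a2] _.
have [al' zz] := hz _ a2; rewrite coiota_PG //; apply: AB; split=> /=; last exact: hB.
apply: hA; rewrite (_ : _ - _ = (nu' - nu) - (zeta alpha' - zeta alpha)); last by ring.
by apply: le_lt_trans (nmBD _ _) _; lra.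
Qed.

Lemma mult_homeomorphism : homeomorphism_on (~` [set None : G]) S mult.
Proof.
have rep (x : G) : x <> None -> exists2 b, S b & x = toG e1 e2 p b.
  by case: x => [s|//] _; exists (val s); [exact: S_val|rewrite toG_val].
split.
- split.
  + by move=> x /rep[b Sb ->]; rewrite multG_toG.
  + by move=> x y /set_mem/rep[b Sb ->] /set_mem/rep[b' Sb' ->]; rewrite !multG_toG // => ->.
  + by move=> b Sb; exists (toG e1 e2 p b); [exact: toG_neq|exact: multG_toG].
- apply/continuous_within => x /rep[b Sb ->] V; rewrite multG_toG // [X in nbhs X]surjective_pairing.
  move=> /nbhsC2P[d d0 hd]; apply/(nbhsG_toG _ Sb); exists d => // b' Sb' h1 h2 _.
  by rewrite multG_toG // [b']surjective_pairing; exact: hd.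
exists (toG e1 e2 p); split; last by move=> x /rep[b Sb ->]; rewrite multG_toG.
apply/continuous_within => b Sb V /(nbhsG_toG _ Sb)[d d0 hd].
rewrite [X in nbhs X]surjective_pairing; apply/nbhsC2P; exists d => // x y xd yd Sxy.
exact: hd.
Qed.

Lemma Phi_nonzero alpha : ~ lattice alpha -> exists2 z, ~ lattice z & Phi z alpha != 0.
Proof.
move=> al; have [d d0 hd] := nonlattice_open e_gen al; have [d' d'0 hd'] := nonlattice_punctured e_gen.
have dd : 0 < Num.min d d' by rewrite lt_min d0.
have [z] := point_near 0 dd; rewrite subr0 lt_min => /and3P[z0 z1 z2].
have zl : ~ lattice z by apply: hd'; rewrite z0.
have az : ~ lattice (alpha - z).
  by apply: hd; rewrite (_ : _ - _ = - z); [rewrite nmN|ring].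
have s0 := mulf_neq0 (sigma_neq0 e_gen al) (sigma_neq0 e_gen zl); rewrite -invr_eq0 in s0.
exists z => //; exact: mulf_neq0 (mulf_neq0 (sigma_neq0 e_gen az) s0) (cexp_neq0 _).
Qed.

(** The function exp(mu z) Phi(z, alpha) has the multipliers of [Psi], and it
    does not vanish identically. *)
Lemma mult_iota mu (a : torus e1 e2) (k : C * C) : curve (mu, a) ->
  mult (iota (mu, a)) = bloch_factors e1 e2 k <->
  quasi_periodic e1 e2 lattice k (fun z => cexp (mu * z) * Phi z (repr a)).
Proof.
move=> cx; rewrite /iota multG_toG; last exact: (iota_S cx).
have [a0 _] := (curve_root mu a).1 cx; have al := repr_nonlattice a0.
rewrite /=; move: (repr a) al => r al.
pose f z := cexp (mu * z) * Phi z r.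
have f1 z : ~ lattice z -> f (z + e1) = (Psi (mu + zeta r) r).1 * f z.
  move=> zl; rewrite /f (Phi_e1 e_gen qp zl al) mulrDr cexpD /=.
  rewrite (_ : (mu + zeta r) * e1 - eta1 * r = mu * e1 + (zeta r * e1 - eta1 * r)); last by ring.
  by rewrite [cexp (mu * e1 + _)]cexpD; move: (cexp _) (cexp _) (cexp _) (Phi z r) => *; ring.
have f2 z : ~ lattice z -> f (z + e2) = (Psi (mu + zeta r) r).2 * f z.
  move=> zl; rewrite /f (Phi_e2 e_gen qp zl al) mulrDr cexpD /=.
  rewrite (_ : (mu + zeta r) * e2 - eta2 * r = mu * e2 + (zeta r * e2 - eta2 * r)); last by ring.
  by rewrite [cexp (mu * e2 + _)]cexpD; move: (cexp _) (cexp _) (cexp _) (Phi z r) => *; ring.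
split=> [E z zl|h].
  by split; [have := f1 z zl|have := f2 z zl]; rewrite E.
have [z zl Pz] := Phi_nonzero al; have fz : f z != 0 by exact: mulf_neq0 (cexp_neq0 _) Pz.
have [h1 h2] : f (z + e1) = bloch_factor k e1 * f z /\ f (z + e2) = bloch_factor k e2 * f z.
  exact: h z zl.
rewrite [LHS]surjective_pairing; congr pair; apply: (mulIf fz).
  by rewrite -f1.
by rewrite -f2.
Qed.

(** Where the N roots are distinct the spectral matrix has a one-dimensional
    kernel. *)
Lemma unique_unbranched nu alpha : ~ lattice alpha -> subdisc e1 e2 p N alpha != 0 ->
  unique_up_to_scale e1 e2 p (Psi nu alpha).
Proof.
move=> al D0; apply: (unique_gen e_gen qp p_inj al) => v w.
set mu := nu - _.
have eig (u : 'rV_N) : u *m spmx mu alpha = 0 -> u *m (- spmx 0 alpha) = mu *: u.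
  have -> : spmx mu alpha = mu%:M + spmx 0 alpha.
    by apply/matrixP => i j; rewrite !mxE; case: eqVneq => _; rewrite ?mulr1n ?mulr0n ?addr0 ?add0r.
  rewrite mulmxDr mul_mx_scalar mulmxN => /eqP; rewrite addr_eq0 => /eqP E.
  by rewrite E.
move=> /eig vE /eig wE v0.
have ch : char_poly (- spmx 0 alpha) = \prod_(z <- mus e1 e2 p alpha) ('X - z%:P).
  apply: poly_eq_horner => x _; rewrite horner_char_poly horner_prod.
  rewrite (eq_bigr (fun z => x - z)); last by move=> z _; rewrite !hornerE.
  rewrite -det_spectral_mx //; congr (\det _); apply/matrixP => i j; rewrite !mxE.
  by case: eqVneq => _; rewrite ?mulr1n ?mulr0n ?opprK ?addr0 ?add0r.
have un : uniq (mus e1 e2 p alpha).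
  by rewrite map_inj_uniq ?(subdisc_uniq N_gt0 D0) // => x y /mulIf -> //; rewrite invr_eq0 sigma_neq0.
exact: simple_eigenspace ch un vE wE v0.
Qed.

(** Non-uniqueness happens only above branch points. *)
Lemma nonunique_finite :
  finite_set [set x : G | x <> None /\ ~ unique_up_to_scale e1 e2 p (mult x)].
Proof.
have fin : finite_set (\bigcup_(a in branch_points p) (prj @^-1` [set a])).
  apply: bigcup_finite; first exact: (branch_points_finite N_gt0 e_gen qp p_inj).
  by move=> a _; exact: prj_fibre_finite.
apply: sub_finite_set fin; move=> x [xn nu_x]; exists (prj x) => //.
have [//|[nu [alpha [c _ F0 Sb xE]]]] := G_rep N_gt0 e_gen qp p_inj x.
rewrite xE prjG_Psi //; exists alpha => //; split=> //; apply: contrapT => h; apply: nu_x.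
rewrite xE multG_toG //; apply: unique_unbranched; first by move=> l; apply: h; left.
by apply/eqP => D0; apply: h; right.
Qed.

Lemma puncture_homeomorphism : exists2 V : set G, open_nbhs (None : G) V &
  open (prj @` V) /\ homeomorphism_on V (prj @` V) prj.
Proof.
have [V [oV V0 V_inj]] := puncture_chart N_gt0 e_gen qp p_inj.
exists V; first by split.
exact: (open_injective_homeo (None : G) oV (@prjG_cont _ _ _ _ _ _ _ N_gt0 e_gen qp p_inj)
  (@prjG_open _ _ _ _ _ _ _ N_gt0 e_gen qp p_inj) V_inj).
Qed.

End Equation.

Theorem theorem1 (R : realType) (e1 e2 : R[i]) (N : nat) (p : 'I_N -> R[i])
  (N_gt0 : (0 < N)%N)
  (e_gen : lattice_generators e1 e2)
  (p_inj : injective (fun j => torus_pi e1 e2 (p j))) :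
  (* q_1, ..., q_N are holomorphic functions on X minus 0 *)
  (forall i alpha, (1 <= i <= N)%N -> ~ lattice e1 e2 alpha ->
     derivable (q_coef e1 e2 p i) alpha 1 /\
     forall l, lattice e1 e2 l ->
       q_coef e1 e2 p i (alpha + l) = q_coef e1 e2 p i alpha) /\
  (* G is the completed curve, oo its puncture, prj its projection to X,
     iota the inclusion of the curve over X minus 0, and mult the pair of
     multipliers of the solutions attached to a point of the curve *)
  exists (G : topologicalType) (oo : G) (prj : G -> torus e1 e2)
         (iota : R[i] * torus e1 e2 -> G) (mult : G -> R[i] * R[i]),
    (* up to the puncture oo, the curve is an N-sheeted covering of X *)
    [/\ compact [set: G], hausdorff_space G & branched_covering N prj] /\
    (prj oo = torus_pi e1 e2 0 /\
     exists2 V, open_nbhs oo V &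
       open (prj @` V) /\ homeomorphism_on V (prj @` V) prj) /\
    (* over X minus 0 it is given by the equation, with (mu, alpha) |-> alpha *)
    (homeomorphism_on (spectral_curve e1 e2 p)
       (prj @^-1` [set a | a <> torus_pi e1 e2 0]) iota /\
     forall x, spectral_curve e1 e2 p x -> prj (iota x) = x.2) /\
    (forall mu alpha k, spectral_curve e1 e2 p (mu, alpha) ->
       mult (iota (mu, alpha)) = bloch_factors e1 e2 k <->
       quasi_periodic e1 e2 (lattice e1 e2) k
         (fun z => cexp (mu * z) * Phi e1 e2 z (repr alpha))) /\
    (* it parametrizes the solutions up to scale *)
    homeomorphism_on (~` [set oo]) (solution_factors e1 e2 p) mult /\
    finite_set
      [set x | x <> oo /\ ~ unique_up_to_scale e1 e2 p (mult x)].
Proof.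
have [eta1 [eta2 qp]] := quasi_periods_exist e_gen.
split=> [i alpha _ al|].
  split=> [|l ll]; first exact: (@q_coef_dC _ _ _ _ _ e_gen p_inj).
  exact: (q_coef_periodic p e_gen qp).
exists (one_point_compactification (initial_topology
  (fun s : {b : R[i] * R[i] | `[< solution_factors e1 e2 p b >]} => (val s : R[i] * R[i])))), None,
  (@prjG R e1 e2 eta1 eta2 N p), (@iota R e1 e2 eta1 eta2 N p), (@multG R e1 e2 N p).
split; first split.
- exact: G_compact.
- exact: (G_hausdorff N_gt0 e_gen qp p_inj).
- exact: (prj_branched N_gt0 e_gen qp p_inj).
split; first by split; [|exact: (puncture_homeomorphism N_gt0 e_gen qp p_inj)].
split; first by split; [exact: (iota_homeomorphism N_gt0 e_gen qp p_inj)|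
  exact: (prj_iota N_gt0 e_gen qp p_inj)].
split; first by move=> mu alpha k; exact: (mult_iota N_gt0 e_gen qp p_inj).
by split; [exact: mult_homeomorphism|exact: (nonunique_finite N_gt0 e_gen qp p_inj)].
Qed.
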